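(* Suppose that the standing assumptions (1)-(3) of the context hold, that $\bar a_2,\bar b_2\neq0$ and $\partial_\omega\|U_0\|_{L^2}^2>0$, that $\lambda_0=i\min\{\omega,s\}$ (resp. $\lambda_0=-i\min\{\omega,s\}$) is a zero of $E(\lambda,0)$, and that $\gamma=0$ is a simple zero of the extended Evans function $\widetilde E(\gamma,0)$ with $\lambda_{\mathrm{br}}=\lambda_0$. Then for $\epsilon>0$ sufficiently small, one of the following three cases occurs: (1) $\mathcal L_\epsilon$ has a unique simple eigenvalue in $\lambda_0+i(-\infty,0)$ (resp. $\lambda_0+i(0,\infty)$) and no resonance pole near $\lambda=\lambda_0$; (2) $\mathcal L_\epsilon$ has a unique resonance pole in $\lambda_0+i(-\infty,0)$ (resp. $\lambda_0+i(0,\infty)$) and no eigenvalue near $\lambda=\lambda_0$; (3) $\lambda=\lambda_0$ remains as an eigenvalue or a resonance pole of $\mathcal L_\epsilon$.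
   Context: Setting. Fix real constants $\omega,s>0$ and a function $F:\mathbb R\times\mathbb R\times\mathbb R\to\mathbb R$, $(\zeta_1,\zeta_2,\mu)\mapsto F(\zeta_1,\zeta_2;\mu)$, with real parameter $\mu$; $\partial_jF$ ($j=1,2$) is the derivative in the $j$-th argument. The coupled nonlinear Schrödinger equations are $$i\partial_tu+\partial_x^2u+\partial_1F(|u|^2,|v|^2;\mu)u=0,\quad i\partial_tv+\partial_x^2v+\partial_2F(|u|^2,|v|^2;\mu)v=0.$$ A real-valued solution $(U,V)$, with $U(x),V(x)\to0$ as $x\to\pm\infty$ (a homoclinic solution), of the stationary system $$-U''+\omega U-\partial_1F(U^2,V^2;\mu)U=0,\quad -V''+sV-\partial_2F(U^2,V^2;\mu)V=0$$ gives the solitary wave $(e^{i\omega t}U(x),e^{ist}V(x))$. Standing assumptions. (1) $F$ is $C^3$ and $F(0,0;\mu)=\partial_1F(0,0;\mu)=\partial_2F(0,0;\mu)=0$, $\partial_\mu F(\zeta,0;\mu)=0$ for all $\zeta,\mu\in\mathbb R$. One writes $\partial_1^jF(\zeta,0)$ for $\partial_1^jF(\zeta,0;\mu)$. (2) $-U''+\omega U-\partial_1F(U^2,0)U=0$ has a homoclinic solution $U_0\not\equiv0$ with $\lim_{x\to\pm\infty}U_0(x)=0$ and $U_0'(0)=0$; it is taken positive, even, with $U_0'(x)<0$ for $x>0$. It depends on $\omega$, and $\partial_\omega\|U_0\|_{L^2}^2$ is the derivative of $\|U_0\|_{L^2(\mathbb R)}^2$ in $\omega$ along this family. (3) At $\mu=0$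 the equation $-\delta V''+s\,\delta V-\partial_2F(U_0(x)^2,0;0)\delta V=0$ has a nonzero bounded solution $V_1(x)$ with $\lim_{x\to\pm\infty}V_1(x)=0$. Bifurcated waves. Let $\phi_{11},\phi_{12}$ solve $-\phi''+\omega\phi-\bigl(2\partial_1^2F(U_0^2,0)U_0^2+\partial_1F(U_0^2,0)\bigr)\phi=0$ with $\phi_{11}(0)=1,\phi_{11}'(0)=0$, $\phi_{12}(0)=0,\phi_{12}'(0)=1$; let $g=\partial_1\partial_2F(U_0^2,0;0)U_0V_1^2$, $U_2(x)=-\phi_{11}(x)\int_x^\infty\phi_{12}g\,dy-\phi_{12}(x)\int_0^x\phi_{11}g\,dy$, and $$\bar a_2=-\int_{\mathbb R}\partial_2\partial_\mu F(U_0^2,0;0)V_1^2\,dx,\quad \bar b_2=-2\int_{\mathbb R}\partial_1\partial_2F(U_0^2,0;0)U_0U_2V_1^2\,dx-\int_{\mathbb R}\partial_2^2F(U_0^2,0;0)V_1^4\,dx.$$ If $\bar a_2,\bar b_2\ne0$, a pitchfork bifurcation of $(U_0,0)$ occurs at $\mu=0$: for small $\epsilon>0$ and $\mu=\bar\mu\epsilon^2$, $\bar\mu=-\bar b_2/\bar a_2$, there are homoclinic solutions $(U_\epsilon,V_\epsilon)$ with $U_\epsilon=U_0+\epsilon^2U_2+O(\epsilon^4)$, $V_\epsilon=\pm(\epsilon V_1+O(\epsilon^3))$, giving the bifurcated solitary waves $(e^{i\omega t}U_\epsilon,e^{ist}V_\epsilon)$. Linearized operator. The linearized operator $\mathcal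 L:H^2(\mathbb R,\mathbb C^4)\subset L^2(\mathbb R,\mathbb C^4)\to L^2(\mathbb R,\mathbb C^4)$ around $(e^{i\omega t}U,e^{ist}V)$ is $$\mathcal L=-i\Sigma_3\left[-\partial_x^2I_4+\begin{pmatrix}\omega I_2&O_2\\O_2&sI_2\end{pmatrix}-\begin{pmatrix}B_{11}&B_{12}\\ B_{21}&B_{22}\end{pmatrix}\right],$$ with $\sigma_1=\begin{pmatrix}0&1\\1&0\end{pmatrix}$, $\sigma_3=\mathrm{diag}(1,-1)$, $\Sigma_3=\mathrm{diag}(\sigma_3,\sigma_3)$, and, all derivatives of $F$ being evaluated at $(U(x)^2,V(x)^2;\mu)$, $B_{11}=\partial_1^2F\,U^2(I_2+\sigma_1)+\partial_1F\,I_2$, $B_{12}=B_{21}=\partial_1\partial_2F\,UV(I_2+\sigma_1)$, $B_{22}=\partial_2^2F\,V^2(I_2+\sigma_1)+\partial_2F\,I_2$. $\mathcal L_\epsilon$ is the linearized operator around the bifurcated wave (with $\mu=\bar\mu\epsilon^2$), and $\mathcal L_0$ the one around the fundamental wave $(e^{i\omega t}U_0,0)$ at $\mu=0$. Its essential spectrum is $i(-\infty,-\min\{\omega,s\}]\cup i[\min\{\omega,s\},\infty)$. Evans function. Let $\nu_1=\sqrt{\omega-i\lambda}$, $\nu_2=\sqrt{\omega+i\lambda}$, $\nu_3=\sqrt{s-i\lambda}$, $\nu_4=\sqrt{s+i\lambda}$ with $-3\pi/4<\arg\nu_1,\arg\nu_3<\pi/4$ and $-\pi/4<\arg\nu_2,\arg\nu_4<3\pi/4$;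 $\lambda=\pm i\omega,\pm is$ are the branch points. Write $\mathcal L_\epsilon\psi=\lambda\psi$ as a first-order system $Y'=A(x,\lambda,\epsilon)Y$ for $Y=(\psi,\psi')^{\mathsf T}\in\mathbb C^8$. With $e_j$ the standard basis of $\mathbb C^4$, let $Y_j^-$ and $Y_{j+4}^+$ ($j=1,\dots,4$) be Jost solutions, i.e. solutions with $e^{-\nu_jx}Y_j^-\to(e_j,\nu_je_j)^{\mathsf T}$ as $x\to-\infty$ and $e^{\nu_jx}Y_{j+4}^+\to(e_j,-\nu_je_j)^{\mathsf T}$ as $x\to+\infty$ (exponentially fast), chosen analytic in $\lambda$ away from the cuts $\{\mathrm{Re}\,\lambda\le0,\ \mathrm{Im}\,\lambda\in\{\pm\omega,\pm s\}\}$ and continuous at the branch points, for $\lambda$ with $\min_j\mathrm{Re}\,\nu_j(\lambda)>-\rho/2$ where $\rho>0$ is an exponential decay rate of the wave profile. The Evans function is $E(\lambda,\epsilon)=\det(Y_1^-\,Y_2^-\,Y_3^-\,Y_4^-\,Y_5^+\,Y_6^+\,Y_7^+\,Y_8^+)$, independent of $x$; its zeros do not depend on the choice of Jost solutions. Near $\lambda_{\mathrm{br}}\in\{i\omega,is\}$ substitute $\lambda=\lambda_{\mathrm{br}}-i\gamma^2$, and near $\lambda_{\mathrm{br}}\in\{-i\omega,-is\}$ substitute $\lambda=\lambda_{\mathrm{br}}+i\gamma^2$; using $\gamma\approx0$ as spectral parameter (the square roots $\nu_j$ vanishing at $\lambda_{\mathrm{br}}$ being replaced by $\gamma$), the Jost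 solutions are analytic in $\gamma$ and the same determinant is the extended Evans function $\widetilde E(\gamma,\epsilon)$, analytic near $\gamma=0$. Resonance pole. A zero of the Evans function (near a branch point: a point $\lambda=\lambda_{\mathrm{br}}\mp i\gamma^2$ with $\widetilde E(\gamma,\epsilon)=0$) that is not an eigenvalue of $\mathcal L_\epsilon$ is called a resonance pole of $\mathcal L_\epsilon$.
   Formalization: Uniqueness of the eigenvalue or resonance pole on the half-line is claimed only near λ₀; on the whole half-line it fails, since the spectrum is symmetric under λ → −λ and 0 is always an eigenvalue. *)

(* Defs.v *)
From HB Require Import structures.
From mathcomp Require Import all_boot all_order all_algebra.
From mathcomp Require Import complex.
From mathcomp Require Import all_classical all_reals all_analysis.

Set Implicit Arguments.
Unset Strict Implicit.
Unset Printing Implicit Defensive.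

Import Order.TTheory GRing.Theory Num.Theory numFieldNormedType.Exports.

Local Open Scope classical_set_scope.
Local Open Scope complex_scope.
Local Open Scope ring_scope.

Section Nonlinearity.
Context {R : realType}.
Implicit Types F : R -> R -> R -> R.

(* F z1 z2 m stands for F(zeta_1, zeta_2; mu). *)
Definition d1 F : R -> R -> R -> R := fun z1 z2 m => derive1 (fun z => F z z2 m) z1.
Definition d2 F : R -> R -> R -> R := fun z1 z2 m => derive1 (fun z => F z1 z m) z2.
Definition dmu F : R -> R -> R -> R := fun z1 z2 m => derive1 (fun z => F z1 z2 z) m.

Fixpoint Ck (k : nat) F : Prop :=
  continuous (fun p : R * R * R => F p.1.1 p.1.2 p.2) /\
  if k is k'.+1 then
    [/\ forall z1 z2 m, [/\ derivable (fun z => F z z2 m) z1 1,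
                            derivable (fun z => F z1 z m) z2 1 &
                            derivable (fun z => F z1 z2 z) m 1],
        Ck k' (d1 F), Ck k' (d2 F) & Ck k' (dmu F)]
  else True.

Definition nonlinearity F : Prop :=
  [/\ Ck 3 F,
      forall m, [/\ F 0 0 m = 0, d1 F 0 0 m = 0 & d2 F 0 0 m = 0] &
      forall z m, dmu F z 0 m = 0].

End Nonlinearity.

Section Waves.
Context {R : realType}.
Implicit Types (F : R -> R -> R -> R) (omega s : R) (f : R -> R).

Local Notation leb := (@lebesgue_measure R).

Definition twice_derivable f : Prop :=
  (forall x, derivable f x 1) /\ (forall x, derivable (derive1 f) x 1).

Definition vanishes_at_infty f : Prop :=
  f x @[x --> +oo] --> 0 /\ f x @[x --> -oo] --> 0.

(* Since dF/dmu(zeta, 0; mu) = 0, the derivatives d1^j F(zeta, 0; mu) do not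
   depend on mu; mu = 0 is used wherever they occur. *)
Definition fundamental_wave F omega (U0 : R -> R) : Prop :=
  [/\ twice_derivable U0,
      forall x, - derive1n 2 U0 x + omega * U0 x - d1 F (U0 x ^+ 2) 0 0 * U0 x = 0,
      vanishes_at_infty U0,
      (forall x, 0 < U0 x) /\ (forall x, U0 (- x) = U0 x) &
      derive1 U0 0 = 0 /\ (forall x, 0 < x -> derive1 U0 x < 0)].

Definition transverse_mode F s (U0 V1 : R -> R) : Prop :=
  [/\ twice_derivable V1,
      forall x, - derive1n 2 V1 x + s * V1 x - d2 F (U0 x ^+ 2) 0 0 * V1 x = 0,
      exists x, V1 x != 0,
      exists M, forall x, `|V1 x| <= M &
      vanishes_at_infty V1].

Definition sqnorm (U : R -> R) : R := \int[leb]_x (U x ^+ 2).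

Definition homoclinic_wave F omega s m (U V : R -> R) : Prop :=
  [/\ twice_derivable U /\ twice_derivable V,
      forall x, - derive1n 2 U x + omega * U x
                - d1 F (U x ^+ 2) (V x ^+ 2) m * U x = 0,
      forall x, - derive1n 2 V x + s * V x
                - d2 F (U x ^+ 2) (V x ^+ 2) m * V x = 0,
      vanishes_at_infty U & vanishes_at_infty V].

Definition variational_solution F omega (U0 phi : R -> R) : Prop :=
  twice_derivable phi /\
  forall x, - derive1n 2 phi x + omega * phi x
    - (2 * d1 (d1 F) (U0 x ^+ 2) 0 0 * U0 x ^+ 2 + d1 F (U0 x ^+ 2) 0 0)
      * phi x = 0.

Definition fundamental_pair F omega (U0 phi11 phi12 : R -> R) : Prop :=
  [/\ variational_solution F omega U0 phi11,
      variational_solution F omega U0 phi12,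
      phi11 0 = 1 /\ derive1 phi11 0 = 0 &
      phi12 0 = 0 /\ derive1 phi12 0 = 1].

Definition oriented_integral (a b : R) f : R :=
  if a <= b then \int[leb]_(y in `[a, b]) f y
  else - \int[leb]_(y in `[b, a]) f y.

Definition source F (U0 V1 : R -> R) (x : R) : R :=
  d1 (d2 F) (U0 x ^+ 2) 0 0 * U0 x * V1 x ^+ 2.

Definition U2 F (U0 V1 phi11 phi12 : R -> R) (x : R) : R :=
  - phi11 x * \int[leb]_(y in `[x, +oo[) (phi12 y * source F U0 V1 y)
  - phi12 x * oriented_integral 0 x (fun y => phi11 y * source F U0 V1 y).

Definition abar2 F (U0 V1 : R -> R) : R :=
  - \int[leb]_x (d2 (dmu F) (U0 x ^+ 2) 0 0 * V1 x ^+ 2).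

Definition bbar2 F (U0 V1 phi11 phi12 : R -> R) : R :=
  - 2 * \int[leb]_x (d1 (d2 F) (U0 x ^+ 2) 0 0 * U0 x
                      * U2 F U0 V1 phi11 phi12 x * V1 x ^+ 2)
  - \int[leb]_x (d2 (d2 F) (U0 x ^+ 2) 0 0 * V1 x ^+ 4).

Definition mubar F (U0 V1 phi11 phi12 : R -> R) : R :=
  - bbar2 F U0 V1 phi11 phi12 / abar2 F U0 V1.

(* The branch (U e, V e), 0 < e < eps0, of bifurcated waves, with sign (-1)^c
   in front of V1; the remainders are uniform in x, and the value at e = 0 is
   the fundamental wave itself. *)
Definition bifurcated_branch F omega s (U0 V1 phi11 phi12 : R -> R)
    (c : bool) (eps0 : R) (U V : R -> R -> R) : Prop :=
  [/\ U 0 = U0, V 0 = (fun=> 0),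
      forall e, 0 < e < eps0 ->
        homoclinic_wave F omega s (mubar F U0 V1 phi11 phi12 * e ^+ 2)
          (U e) (V e) &
      exists K : R, forall e, 0 < e < eps0 -> forall x,
        `|U e x - (U0 x + e ^+ 2 * U2 F U0 V1 phi11 phi12 x)| <= K * e ^+ 4 /\
        `|V e x - (-1) ^+ c * (e * V1 x)| <= K * e ^+ 3].

End Waves.

Section LinearizedOperator.
Context {R : realType}.
Local Notation C := R[i].
Local Notation leb := (@lebesgue_measure R).

Definition sigma1 : 'M[R]_2 := \matrix_(i, j) (i != j)%:R.
Definition sigma3 : 'M[R]_2 := \matrix_(i, j) ((-1) ^+ i *+ (i == j)).

Definition Sigma3 : 'M[C]_(2 + 2) :=
  map_mx (real_complex R) (block_mx sigma3 0 0 sigma3).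

Definition freq (omega s : R) : 'M[C]_(2 + 2) :=
  map_mx (real_complex R) (block_mx omega%:M 0 0 s%:M).

Definition potential (F : R -> R -> R -> R) (U V : R -> R) (m : R) (x : R) :
    'M[C]_(2 + 2) :=
  let z1 := U x ^+ 2 in
  let z2 := V x ^+ 2 in
  let B11 := (d1 (d1 F) z1 z2 m * U x ^+ 2) *: (1%:M + sigma1)
             + d1 F z1 z2 m *: 1%:M in
  let B12 := (d1 (d2 F) z1 z2 m * (U x * V x)) *: (1%:M + sigma1) in
  let B22 := (d2 (d2 F) z1 z2 m * V x ^+ 2) *: (1%:M + sigma1)
             + d2 F z1 z2 m *: 1%:M in
  map_mx (real_complex R) (block_mx B11 B12 B12 B22).

(* An element of H^2(R) is represented by its C^1 representative u, with
   derivative u1; u1 is locally absolutely continuous with derivative u2. *)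
Definition H2_real (u u1 u2 : R -> R) : Prop :=
  [/\ u \in Lfun leb 2%:E, u1 \in Lfun leb 2%:E, u2 \in Lfun leb 2%:E,
      forall x : R, is_derive x (1 : R) u (u1 x) &
      forall a b, a <= b -> u1 b - u1 a = \int[leb]_(t in `[a, b]) u2 t].

Definition H2 (psi psi1 psi2 : R -> 'cV[C]_(2 + 2)) : Prop :=
  forall j,
    H2_real (fun x => complex.Re (psi x j 0)) (fun x => complex.Re (psi1 x j 0))
            (fun x => complex.Re (psi2 x j 0)) /\
    H2_real (fun x => complex.Im (psi x j 0)) (fun x => complex.Im (psi1 x j 0))
            (fun x => complex.Im (psi2 x j 0)).

(* Graph of the operator L: psi is in the domain H^2(R, C^4) and
   L psi = chi almost everywhere. *)
Definition lin_op (omega s : R) (B : R -> 'M[C]_(2 + 2))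
    (psi chi : R -> 'cV[C]_(2 + 2)) : Prop :=
  exists psi1 psi2, H2 psi psi1 psi2 /\
    {ae leb, forall x,
      (- 'i%C) *: (Sigma3 *m (- psi2 x + freq omega s *m psi x - B x *m psi x))
      = chi x}.

Definition L_eigenvector (omega s : R) B (lambda : C) psi : Prop :=
  (exists x, psi x != 0) /\
  lin_op omega s B psi (fun x => lambda *: psi x).

Definition L_eigenvalue (omega s : R) B (lambda : C) : Prop :=
  exists psi, L_eigenvector omega s B lambda psi.

(* psi lies in the kernel of (L - lambda)^n. *)
Fixpoint root_vector (omega s : R) B (lambda : C) (n : nat)
    (psi : R -> 'cV[C]_(2 + 2)) : Prop :=
  if n is n'.+1 then
    exists2 chi, lin_op omega s B psi (fun x => lambda *: psi x + chi x) &
                 root_vector omega s B lambda n' chi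
  else forall x, psi x = 0.

(* Algebraic simplicity: the root space is one-dimensional. *)
Definition simple_L_eigenvalue (omega s : R) B (lambda : C) : Prop :=
  exists2 psi, L_eigenvector omega s B lambda psi &
    forall n chi, root_vector omega s B lambda n chi ->
      exists k : C, forall x, chi x = k *: psi x.

End LinearizedOperator.

Section EvansFunction.
Context {R : realType}.
Local Notation C := R[i].

Definition cexp (z : C) : C :=
  (expR (complex.Re z))%:C * (cos (complex.Im z) +i* sin (complex.Im z)).

(* Square root with argument in ]-pi/4, 3pi/4[, i.e. in the half-plane
   Re w + Im w > 0. *)
Definition sqrt_up (z : C) : C :=
  let w := sqrtC z in if 0 < complex.Re w + complex.Im w then w else - w.

(* Square root with argument in ]-3pi/4, pi/4[, i.e. in the half-plane
   Re w - Im w > 0. *)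
Definition sqrt_down (z : C) : C :=
  let w := sqrtC z in if 0 < complex.Re w - complex.Im w then w else - w.

(* Indices are shifted by one: nu_{j+1}^2 = nusq j. *)
Definition nusq (omega s : R) (lambda : C) (j : 'I_(2 + 2)) : C :=
  nth 0 [:: omega%:C - 'i%C * lambda; omega%:C + 'i%C * lambda;
            s%:C - 'i%C * lambda; s%:C + 'i%C * lambda] j.

Definition nu (omega s : R) (lambda : C) (j : 'I_(2 + 2)) : C :=
  if odd j then sqrt_up (nusq omega s lambda j)
  else sqrt_down (nusq omega s lambda j).

(* L psi = lambda psi reads psi'' = (freq - B - i lambda Sigma3) psi. *)
Definition coefA (omega s : R) (B : R -> 'M[C]_(2 + 2)) (lambda : C) (x : R) :
    'M[C]_((2 + 2) + (2 + 2)) :=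
  block_mx 0 1%:M (freq omega s - B x - ('i%C * lambda) *: Sigma3) 0.

Definition asym (n : C) (j : 'I_(2 + 2)) : 'cV[C]_((2 + 2) + (2 + 2)) :=
  col_mx (delta_mx j 0) (n *: delta_mx j 0).

(* The columns of Y are Y_1^-, ..., Y_4^-, Y_5^+, ..., Y_8^+, for the
   exponents nu_1, ..., nu_4 given by n. *)
Definition jost (omega s : R) B (lambda : C) (n : 'I_(2 + 2) -> C)
    (Y : R -> 'M[C]_((2 + 2) + (2 + 2))) : Prop :=
  [/\ forall x i j, let dY := (coefA omega s B lambda x *m Y x) i j in
        is_derive x (1 : R) (fun t => complex.Re (Y t i j)) (complex.Re dY) /\
        is_derive x (1 : R) (fun t => complex.Im (Y t i j)) (complex.Im dY),
      forall j, exists K k : R, 0 < k /\ forall x i, x <= 0 ->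
        `|cexp (- n j * x%:C) * Y x i (lshift _ j) - asym (n j) j i 0|
        <= (K * expR (k * x))%:C &
      forall j, exists K k : R, 0 < k /\ forall x i, 0 <= x ->
        `|cexp (n j * x%:C) * Y x i (rshift _ j) - asym (- n j) j i 0|
        <= (K * expR (- k * x))%:C].

Definition analytic_at (f : C -> C) (z0 : C) : Prop :=
  exists r : R, exists a : nat -> C, 0 < r /\
    forall z, `|z - z0| < r%:C ->
      series (fun k => a k * (z - z0) ^+ k : C^o) @ \oo --> (f z : C^o).

Definition branch_points (omega s : R) : set C :=
  [set z | complex.Re z = 0 /\ (`|complex.Im z| = omega \/ `|complex.Im z| = s)].

Definition cuts (omega s : R) : set C :=
  [set z | complex.Re z <= 0 /\ (`|complex.Im z| = omega \/ `|complex.Im z| = s)].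

Definition jost_domain (omega s rho : R) : set C :=
  [set z | forall j, - rho / 2 < complex.Re (nu omega s z j)].

(* Jost solutions for lambda in the open set N: N = setT gives a global
   choice, and smaller N are allowed since the zeros of the Evans function do
   not depend on the choice. *)
Definition jost_family (omega s rho : R) B (N : set C)
    (J : C -> R -> 'M[C]_((2 + 2) + (2 + 2))) : Prop :=
  let D := N `&` jost_domain omega s rho in
  let Dreg := D `\` cuts omega s in
  [/\ forall lambda, (Dreg `|` (D `&` branch_points omega s)) lambda ->
        jost omega s B lambda (nu omega s lambda) (J lambda),
      forall lambda x i j, Dreg lambda ->
        analytic_at (fun z => J z x i j) lambda &
      forall lambda x i j, (D `&` branch_points omega s) lambda ->
        (J z x i j : C^o) @[z --> within Dreg (nbhs (lambda : C^o))]
          --> (J lambda x i j : C^o)].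

(* Evaluated at x = 0; the determinant does not depend on x as \tr A = 0. *)
Definition evans (J : C -> R -> 'M[C]_((2 + 2) + (2 + 2))) (z : C) : C :=
  \det (J z 0).

(* b = false is the branch point i min{omega, s}, b = true its conjugate. *)
Definition lambda0 (omega s : R) (b : bool) : C :=
  (-1) ^+ b * ('i%C * (Num.min omega s)%:C).

Definition lambda_of (omega s : R) (b : bool) (gamma : C) : C :=
  lambda0 omega s b - (-1) ^+ b * ('i%C * gamma ^+ 2).

(* Each square root vanishing at the branch point is replaced by gamma. *)
Definition nu_ext (omega s : R) (b : bool) (gamma : C) (j : 'I_(2 + 2)) : C :=
  if nusq omega s (lambda0 omega s b) j == 0 then gamma
  else nu omega s (lambda_of omega s b gamma) j.

Definition extended_jost_family (omega s : R) B (b : bool) (r0 : R)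
    (Y : C -> R -> 'M[C]_((2 + 2) + (2 + 2))) : Prop :=
  forall gamma, `|gamma| < r0%:C ->
    jost omega s B (lambda_of omega s b gamma) (nu_ext omega s b gamma)
      (Y gamma) /\
    forall x i j, analytic_at (fun z => Y z x i j) gamma.

Definition simple_zero (f : C -> C) (z : C) : Prop :=
  f z = 0 /\ derive1 (f : C^o -> C^o) z != 0.

Definition resonance_pole (omega s : R) B (b : bool) (r0 : R)
    (Y : C -> R -> 'M[C]_((2 + 2) + (2 + 2))) (lambda : C) : Prop :=
  (exists gamma, [/\ `|gamma| < r0%:C, lambda = lambda_of omega s b gamma &
                     evans Y gamma = 0]) /\
  ~ L_eigenvalue omega s B lambda.

(* lambda0 + i]-oo, 0[ if b = false, lambda0 + i]0, +oo[ if b = true. *)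
Definition half_line (omega s : R) (b : bool) : set C :=
  [set lambda0 omega s b - (-1) ^+ b * ('i%C * t%:C) | t in [set t : R | 0 < t]].

Definition near_lambda0 (omega s : R) (b : bool) (r : R) : set C :=
  [set z | `|z - lambda0 omega s b| < r%:C].

End EvansFunction.

(* Main.v *)
Require Import Defs.
From HB Require Import structures.
From mathcomp Require Import all_boot all_order all_algebra.
From mathcomp Require Import perm complex ring lra.
From mathcomp Require Import all_classical all_reals all_analysis measurable_realfun.

(** In the variable gamma the eigenvalue equation is psi'' = (N + S gamma^2) psi - B psi with N
    >= 0 and S real diagonal and B real symmetric. A contraction in an exponentially weighted
    space, after dividing by e^{-gamma x} and splitting off the modes of N, gives four solutions
    that decay at +oo when Re gamma > 0, depend analytically on gamma near 0, are real for real
    gamma, and are strictly differentiable at (gamma, epsilon) = (0, 0) in the sense of divided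
    differences; only continuity of the potential at epsilon = 0 is used. Reflection gives the
    solutions at -oo, and the determinant D of the eight Cauchy data is an Evans function that
    is real on the real axis. Wronskians of two decaying solutions vanish, decaying solutions
    form a Lagrangian subspace, and analyticity carries this from Re gamma > 0 to a full disc,
    so the given extended Evans function is D times a nonvanishing factor. Hence D has a simple
    zero at gamma = 0 for epsilon = 0 and, by strict differentiability, exactly one zero
    gamma_epsilon near 0 for small epsilon; it is real by the intermediate value theorem. For Re
    gamma >= 0 an L^2 eigenfunction has vanishing Wronskians with the bounded solutions, so
    D(gamma) = 0; conversely a zero gamma > 0 produces an exponentially decaying eigenfunction.
    A second eigenfunction or a generalized eigenfunction would make D vanish to second order.
    The three cases are gamma_epsilon > 0, gamma_epsilon < 0 and gamma_epsilon = 0. *)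

Set Implicit Arguments.
Unset Strict Implicit.
Unset Printing Implicit Defensive.

Import Order.TTheory GRing.Theory Num.Theory numFieldNormedType.Exports.

Local Open Scope classical_set_scope.
Local Open Scope complex_scope.
Local Open Scope ring_scope.

(** * Real functions *)

(** The given families [Y e] are chosen separately for each [e], so nothing is known about how they
    depend on [e]; hence a second Evans function, [Ehat], is built from scratch. Two facts link
    them: the zero sets agree for every small [e], and at [e = 0] the given function is at most a
    constant times [Ehat], which excludes a multiple zero of [Ehat]. At the branch point some limit
    exponents are 0, so growth and decay are not separated. Once e^{-gamma x} is removed, such a
    mode is a constant plus a term O(e^{-kx}), where k lies below the decay rate of the potential
    and is at most half of every nonzero exponent; 8|gamma| <= k guarantees that e^{2|gamma|x} never
    beats e^{-kx}, whatever the sign of Re gamma. The map from gamma to lambda is two-to-one.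
    Eigenvalues are studied through the preimage with Re gamma >= 0, resonance poles through either
    one; since the zero is unique, both are governed by the same real number, whose sign decides the
    case. *)

Section RealCalculus.
Context {R : realType}.
Implicit Types (f g u v : R -> R) (x y a b l : R).

Definition der f x l := is_derive x (1 : R) f l.

Lemma derE f x l : der f x l -> derivable f x 1 /\ derive1 f x = l.
Proof.
by case=> h1 h2; rewrite derive1E.
Qed.

Lemma derI f x : derivable f x 1 -> der f x (derive1 f x).
Proof. by move=> h; split => //; rewrite derive1E. Qed.

Lemma der_eq f x l l' : der f x l -> l = l' -> der f x l'.
Proof. by move=> h <-. Qed.

Lemma der_ext f g x l : (forall t, f t = g t) -> der f x l -> der g x l.
Proof. by move=> /funext ->. Qed.

Lemma derD f g x a b : der f x a -> der g x b -> der (fun t => f t + g t) x (a + b).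
Proof. by move=> h1 h2; apply: is_deriveD. Qed.

Lemma derN f x a : der f x a -> der (fun t => - f t) x (- a).
Proof. by move=> h1; apply: is_deriveN. Qed.

Lemma derB f g x a b : der f x a -> der g x b -> der (fun t => f t - g t) x (a - b).
Proof. by move=> h1 h2; apply: is_deriveB. Qed.

Lemma derM f g x a b : der f x a -> der g x b ->
  der (fun t => f t * g t) x (a * g x + f x * b).
Proof.
move=> h1 h2; apply: (@der_eq (f * g) x _ _ (is_deriveM h1 h2)).
by rewrite /GRing.scale /= addrC (mulrC (g x)).
Qed.

Lemma der_cst c x : der (fun=> c : R) x 0.
Proof. exact: is_derive_cst. Qed.

Lemma der_id x : der (fun t => t) x 1.
Proof. exact: is_derive_id. Qed.

Lemma derZ c f x a : der f x a -> der (fun t => c * f t) x (c * a).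
Proof. by move=> h; apply: der_eq (derM (der_cst c x) h) _; rewrite mul0r add0r. Qed.

Lemma der_comp f g x a b : der f (g x) a -> der g x b ->
  der (fun t => f (g t)) x (a * b).
Proof. by move=> h1 h2; apply: (is_derive1_comp h1 h2). Qed.

Lemma der_exp f x a : der f x a -> der (fun t => expR (f t)) x (a * expR (f x)).
Proof.
move=> h; apply: der_eq (der_comp (is_derive_expR (f x)) h) _.
by rewrite mulrC.
Qed.

Lemma der_opp f x l : der f (- x) l -> der (fun t => f (- t)) x (- l).
Proof.
move=> h; apply: der_eq (der_comp h (derN (der_id x))) _.
by rewrite mulrN1.
Qed.

Lemma der_cts f x l : der f x l -> {for x, continuous f}.
Proof. by case/derE => h _; apply: differentiable_continuous; apply/derivable1_diffP. Qed.

Lemma der_within f (df : R -> R) a b :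
  (forall x, a <= x <= b -> der f x (df x)) -> {within `[a, b], continuous f}.
Proof.
move=> h; apply: derivable_within_continuous => x; rewrite in_itv /= => xab.
by case: (derE (h x xab)).
Qed.

Lemma der_incr f (df : R -> R) a b : a <= b ->
  (forall x, a <= x <= b -> der f x (df x)) ->
  (forall x, a <= x <= b -> 0 <= df x) -> f a <= f b.
Proof.
move=> ab h h0.
have hab x : x \in `]a, b[ -> a <= x <= b.
  by rewrite in_itv /= => /andP[/ltW -> /ltW ->].
apply: (@ger0_derive1_ndecr _ f a b) => //.
- by move=> x /hab /h /derE [].
- by move=> x /hab hx; case: (derE (h x hx)) => _ ->; exact: h0.
- exact: der_within h.
Qed.

(** Mean value inequality by monotonicity: [v + u] and [v - u] are both nondecreasing. The integral
    estimates below use it with an explicit primitive [v] of the majorant. *)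
Lemma der_cmp u v (du dv : R -> R) a b : a <= b ->
  (forall x, a <= x <= b -> der u x (du x)) ->
  (forall x, a <= x <= b -> der v x (dv x)) ->
  (forall x, a <= x <= b -> `|du x| <= dv x) ->
  `|u b - u a| <= v b - v a.
Proof.
move=> ab hu hv hle; rewrite ler_norml; apply/andP; split.
  have := @der_incr (fun x => v x + u x) (fun x => dv x + du x) a b ab _ _.
  have H1 : forall x, a <= x <= b -> der (fun x => v x + u x) x (dv x + du x).
    by move=> x hx; apply: derD; auto.
  have H2 : forall x, a <= x <= b -> 0 <= dv x + du x.
    by move=> x hx; have := hle x hx; rewrite ler_norml => /andP[]; lra.
  move=> /(_ H1 H2); lra.
have := @der_incr (fun x => v x - u x) (fun x => dv x - du x) a b ab _ _.
have H1 : forall x, a <= x <= b -> der (fun x => v x - u x) x (dv x - du x).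
  by move=> x hx; apply: derB; auto.
have H2 : forall x, a <= x <= b -> 0 <= dv x - du x.
  by move=> x hx; have := hle x hx; rewrite ler_norml => /andP[]; lra.
move=> /(_ H1 H2); lra.
Qed.

Lemma der_const f a b : (forall x, der f x 0) -> f a = f b.
Proof.
move=> h.
wlog ab : a b / a <= b.
  by move=> H; case: (leP a b) => [|/ltW] /H.
have := @der_cmp f (fun=> 0) (fun=> 0) (fun=> 0) a b ab
   (fun x _ => h x) (fun x _ => der_cst 0 x) _.
move=> H; have : `|f b - f a| <= 0.
  by rewrite -(subrr (0:R)); apply: H => x _; rewrite normr0.
by rewrite normr_le0 subr_eq0 eq_sym => /eqP.
Qed.

(** The multiplied-out difference quotient needs no exception at [h = 0]; limits of derivatives and
    local changes of a function are handled in this form. *)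
Lemma der_eps f x l : der f x l <->
  forall e : R, 0 < e -> exists2 d : R, 0 < d &
    forall h, `|h| < d -> `|f (x + h) - f x - l * h| <= e * `|h|.
Proof.
split=> [h e e0|h].
  have [hd hv] := derE h.
  move: hd; rewrite /derivable => /cvg_ex [l' hl'].
  have El : l' = l by rewrite -hv derive1E /derive; apply/esym/cvg_lim.
  rewrite {}El in hl'.
  have /cvgrPdist_le /(_ e e0) := hl'.
  rewrite /prop_near1 /= /dnbhs /within /= => /nbhs_ballP [d /= d0 H].
  exists d => // k kd.
  have [->|k0] := eqVneq k 0; first by rewrite addr0 subrr mulr0 subrr normr0 mulr0.
  have := H k; rewrite /ball /= sub0r normrN => /(_ kd k0).
  have -> : l - k^-1 *: (f (k *: (1:R) + x) - f x) = - (k^-1 * (f (x + k) - f x - l * k)).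
    rewrite /GRing.scale /= mulr1 (addrC k) (mulrBr k^-1 _ (l * k)) (mulrCA _ l) mulVf //; lra.
  rewrite normrN normrM normfV. rewrite ler_pdivrMl ?normr_gt0 //. rewrite [e * _]mulrC.
  exact: id.
suff H : (h : R)^-1 *: (f (h *: (1:R) + x) - f x) @[h --> 0^'] --> l.
  split; first by apply/cvg_ex; exists l.
  by rewrite /derive; apply: cvg_lim.
apply/cvgrPdist_le => e e0; have [d d0 H] := h e e0.
rewrite /prop_near1 /= /dnbhs /within /=; apply/nbhs_ballP; exists d => //= k.
rewrite /ball /= sub0r normrN => kd k0.
have -> : l - k^-1 *: (f (k *: (1:R) + x) - f x) = - (k^-1 * (f (x + k) - f x - l * k)).
  rewrite /GRing.scale /= mulr1 (addrC k) (mulrBr k^-1 _ (l * k)) (mulrCA _ l) mulVf //; lra.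
rewrite normrN normrM normfV ler_pdivrMl ?normr_gt0 // [_ * e]mulrC.
exact: H.
Qed.

(** The mean value inequality for [un n - un N] compares the increments over [h] up to
    [e / 2 * |h|], uniformly in [n]. Letting [n] tend to infinity leaves one fixed [N], whose own
    differentiability finishes the estimate. *)
Lemma der_lim (un dn : nat -> R -> R) u d x (r : R) : 0 < r ->
  (forall n y, der (un n) y (dn n y)) ->
  (forall y, un n y @[n --> \oo] --> u y) ->
  (forall e : R, 0 < e -> exists N, forall n y, (N <= n)%N -> `|y - x| <= r ->
     `|dn n y - d y| <= e) ->
  der u x (d x).
Proof.
move=> r0 hun hu hd; apply/der_eps => e e0.
have e8 : 0 < e / 8 by rewrite divr_gt0.
have [N HN] := hd _ e8.
have /der_eps /(_ _ e8) [d1 d10 H1] := hun N x.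
exists (Num.min d1 r) => [|h]; first by rewrite lt_min d10.
rewrite lt_min => /andP[hd1 hr].
suff H : `|u (x + h) - u x - (un N (x + h) - un N x)| <= e / 2 * `|h|.
  have := H1 h hd1; have := HN N x (leqnn _); rewrite subrr normr0 => /(_ (ltW r0)).
  set A := dn N x - d x => HA HB.
  have -> : u (x + h) - u x - d x * h =
    (u (x + h) - u x - (un N (x + h) - un N x)) +
    (un N (x + h) - un N x - dn N x * h) + A * h by rewrite /A; ring.
  apply: le_trans (ler_normD _ _) _; apply: le_trans (lerD (ler_normD _ _) (lexx _)) _.
  rewrite (normrM A); have H3 := ler_wpM2r (normr_ge0 h) HA.
  have H4 := mulr_ge0 (ltW e0) (normr_ge0 h); lra.
have Hn n : (N <= n)%N ->
    `|(un n (x + h) - un n x) - (un N (x + h) - un N x)| <= e / 2 * `|h|.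
  move=> Nn.
  have key a b : a <= b -> `|a - x| <= r -> `|b - x| <= r ->
     `|(un n b - un N b) - (un n a - un N a)| <= (e / 2) * b - (e / 2) * a.
    move=> ab ar br.
    apply: (@der_cmp (fun t => un n t - un N t) (fun t => e / 2 * t)
       (fun t => dn n t - dn N t) (fun=> e / 2)) => // t /andP[at1 tb].
    - exact: derB.
    - by apply: der_eq (derZ _ (der_id t)) _; rewrite mulr1.
    - have tr : `|t - x| <= r.
        by move: ar br; rewrite !ler_norml => /andP[? ?] /andP[? ?]; apply/andP; lra.
      have := HN n t Nn tr; have := HN N t (leqnn _) tr => h1 h2.
      have -> : dn n t - dn N t = (dn n t - d t) - (dn N t - d t) by ring.
      apply: le_trans (ler_normB _ _) _; lra.
  have hxr : `|x + h - x| <= r by rewrite addrC addKr ltW.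
  have x0r : `|x - x| <= r by rewrite subrr normr0 ltW.
  have [h0|h0] := leP 0 h.
    have := key x (x + h); rewrite lerDl h0 (ger0_norm h0) => /(_ isT x0r hxr).
    have -> : e / 2 * (x + h) - e / 2 * x = e / 2 * h by ring.
    by congr (`|_| <= _); ring.
  have := key (x + h) x; rewrite gerDl (ltW h0) (ltr0_norm h0) => /(_ isT hxr x0r).
  rewrite distrC; have -> : e / 2 * x - e / 2 * (x + h) = e / 2 * - h by ring.
  by congr (`|_| <= _); ring.
have C1 : (un n (x + h) - un n x) - (un N (x + h) - un N x) @[n --> \oo]
    --> (u (x + h) - u x) - (un N (x + h) - un N x).
  by apply: cvgB; [apply: cvgB; exact: hu | exact: cvg_cst].
apply: (cvgr_to_le (cvg_norm C1)).
by near=> n; apply: Hn; near: n; exact: nbhs_infty_ge.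
Unshelve. all: end_near.
Qed.

Lemma der_local f g x l (r : R) : 0 < r ->
  (forall h : R, `|h| < r -> f (x + h) = g (x + h)) -> der f x l -> der g x l.
Proof.
move=> r0 fg /der_eps H; apply/der_eps => e e0; have [d d0 Hd] := H e e0.
exists (Num.min d r) => [|h]; first by rewrite lt_min d0.
rewrite lt_min => /andP[hd hr]; rewrite -fg // -[in g x](addr0 x) -fg ?normr0 //.
by rewrite addr0; exact: Hd.
Qed.

(** The base point -1, rather than 0, leaves an overlap ]-1, 1[ with the mirror image of this
    primitive; [antider] glues the two there. *)
Lemma antider_right f : continuous f ->
  exists G : R -> R, forall x, -1 < x -> der G x (f x).
Proof.
move=> cf.
exists (fun x => \int[lebesgue_measure]_(t in `[-1, x]) f t) => x x1.
have xx : x < x + 1 by lra.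
have := @continuous_FTC1 R f (BLeft (-1)) x (x + 1) xx.
move=> /(_ _ _ (cf x)) [].
- apply: continuous_compact_integrable; first exact: segment_compact.
  by move=> y; apply: continuous_subspaceT.
- by rewrite /= lte_fin.
by move=> h1 h2; split; [exact: h1 | rewrite -derive1E; exact: h2].
Qed.

Lemma antider f : continuous f -> exists G : R -> R, forall x, der G x (f x).
Proof.
move=> cf; have [P HP] := antider_right cf.
have [|M HM] := @antider_right (fun x => f (- x)).
  move=> x; apply: continuous_comp; [exact: opp_continuous | exact: cf].
pose Q x := - M (- x).
have HQ x : x < 1 -> der Q x (f x).
  move=> x1; have /HM : -1 < - x by lra.
  by rewrite opprK => /der_opp /derN; rewrite opprK.
have E x : -1 < x < 1 -> Q x - Q 0 = P x - P 0.
  move=> /andP[xm xp].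
  have key a b : -1 < a -> a <= b -> b < 1 -> Q b - P b = Q a - P a.
    move=> am ab bp.
    have := @der_cmp (fun t => Q t - P t) (fun=> 0) (fun t => f t - f t) (fun=> 0) a b ab.
    move=> H; apply/eqP; rewrite -subr_eq0 -normr_le0 -(subrr (0:R)); apply: H => t /andP[ta tb].
    - by apply: derB; [apply: HQ; lra | apply: HP; lra].
    - exact: der_cst.
    - by rewrite subrr normr0.
  have [x0|/ltW x0] := leP 0 x.
    by have := key 0 x; move=> H; have := H ltac:(lra) x0 xp; lra.
  by have := key x 0; move=> H; have := H xm x0 ltac:(lra); lra.
exists (fun x => if x < 0 then Q x - Q 0 else P x - P 0) => x.
have [x0|x0] := ltP x 0.
  apply: (@der_local (fun t => Q t - Q 0) _ x _ (- x)); first by rewrite oppr_gt0.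
    by move=> h; rewrite ltr_norml => /andP[_ h2]; rewrite ifT //; lra.
  by apply: der_eq (derB (HQ x _) (der_cst _ x)) _; rewrite ?subr0 //; lra.
apply: (@der_local (fun t => P t - P 0) _ x _ 1) => //.
  move=> h; rewrite ltr_norml => /andP[h1 h2]; case: ltP => // h3.
  by rewrite E //; apply/andP; split; lra.
by apply: der_eq (derB (HP x _) (der_cst _ x)) _; rewrite ?subr0 //; lra.
Qed.

(** The limit of a primitive at infinity is produced as the supremum of [G + D], where [D] is minus
    the tail of the majorant: [G + D] lies below the limit and [G - D] above it, so no improper
    integral occurs. *)
Lemma antider_tail f (C q X : R) : continuous f -> 0 < q ->
  (forall x, X <= x -> `|f x| <= C * expR (- q * x)) ->
  exists G : R -> R, (forall x, der G x (f x)) /\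
    forall x, X <= x -> `|G x| <= C / q * expR (- q * x).
Proof.
move=> cf q0 hf; have [G HG] := antider cf.
pose D (x : R) := - (C / q * expR (- q * x)).
have HD x : der D x (C * expR (- q * x)).
  apply: der_eq (derN (derZ _ (der_exp (derZ (- q) (der_id x))))) _.
  by field; rewrite gt_eqF.
have cmp x y : X <= x -> x <= y -> `|G y - G x| <= D y - D x.
  move=> Xx xy; apply: (der_cmp xy) => [t _|t _|t /andP[xt _]]; [exact: HG|exact: HD|].
  by apply: hf; lra.
have C0 : 0 <= C.
  have := hf X (lexx X); move/(le_trans (normr_ge0 _)).
  by rewrite pmulr_lge0 // expR_gt0.
have Dneg x : D x <= 0.
  by rewrite oppr_le0 mulr_ge0 ?expR_ge0 // divr_ge0 // ltW.
pose S := [set G x + D x | x in [set x | X <= x]].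
have ub x y : X <= x -> X <= y -> G x + D x <= G y - D y.
  move=> Xx Xy; have [xy|/ltW xy] := leP x y.
    by have := cmp x y Xx xy; rewrite ler_norml => /andP[]; have := Dneg x; have := Dneg y; lra.
  by have := cmp y x Xy xy; rewrite ler_norml => /andP[]; have := Dneg x; have := Dneg y; lra.
have S0 : S !=set0 by exists (G X + D X); exists X => //=.
pose l := sup S.
exists (fun x => G x - l); split=> [x|x Xx].
  by apply: der_eq (derB (HG x) (der_cst l x)) _; rewrite subr0.
have h1 : G x + D x <= l.
  apply: ub_le_sup; last by exists x.
  by exists (G X - D X) => _ [y Xy <-]; apply: ub.
have h2 : l <= G x - D x.
  by apply: ge_sup => // _ [y Xy <-]; apply: ub.
rewrite ler_norml -[C / q * _]opprK -/(D x); apply/andP; split; lra.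
Qed.

(** The limit is the supremum of the lower bounds [u n - 2 * C * 2^-1 ^+ n], which gives the
    explicit rate for every [n] at once. *)
Lemma geom_cauchy (u : nat -> R) (C : R) :
  (forall n, `|u n.+1 - u n| <= C * 2^-1 ^+ n) ->
  exists l, u n @[n --> \oo] --> l /\ forall n, `|u n - l| <= 2 * C * 2^-1 ^+ n.
Proof.
move=> hu.
have C0 : 0 <= C by have := hu 0; rewrite expr0 mulr1; apply: le_trans.
have hq n : 0 <= (2^-1 : R) ^+ n by apply: exprn_ge0; rewrite invr_ge0.
have hnm n k : `|u (n + k)%N - u n| <= 2 * C * 2^-1 ^+ n - 2 * C * 2^-1 ^+ (n + k).
  elim: k => [|k IH]; first by rewrite addn0 !subrr normr0.
  have := hu (n + k)%N; rewrite addnS exprS.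
  have -> : u (n + k).+1 - u n = (u (n + k).+1 - u (n + k)%N) + (u (n + k)%N - u n) by ring.
  move=> H; apply: le_trans (ler_normD _ _) _.
  by have := lerD H IH; move/le_trans; apply; rewrite le_eqVlt; apply/orP; left; apply/eqP; field.
pose S := [set u n - 2 * C * 2^-1 ^+ n | n in [set: nat]].
have ub n m : u n - 2 * C * 2^-1 ^+ n <= u m + 2 * C * 2^-1 ^+ m.
  have P k : 0 <= 2 * C * 2^-1 ^+ k by rewrite !mulr_ge0.
  have [/subnKC <-|/ltnW /subnKC <-] := leqP n m.
    by have := hnm n (m - n)%N; rewrite ler_norml => /andP[]; have := P n; have := P (n + (m - n))%N; lra.
  by have := hnm m (n - m)%N; rewrite ler_norml => /andP[]; have := P m; have := P (m + (n - m))%N; lra.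
have H n : `|u n - sup S| <= 2 * C * 2^-1 ^+ n.
  have h1 : u n - 2 * C * 2^-1 ^+ n <= sup S.
    apply: ub_le_sup; last by exists n.
    by exists (u 0%N + 2 * C * 2^-1 ^+ 0) => _ [y _ <-]; apply: ub.
  have h2 : sup S <= u n + 2 * C * 2^-1 ^+ n.
    by apply: ge_sup => [|_ [y _ <-]]; [exists (u 0%N - 2 * C * 2^-1 ^+ 0); exists 0%N | apply: ub].
  rewrite ler_norml; apply/andP; split; lra.
exists (sup S); split => //.
apply/cvgrPdist_le => e e0.
have G : 2 * C * 2^-1 ^+ n @[n --> \oo] --> 2 * C * 0.
  by apply: cvgM; [exact: cvg_cst|apply: cvg_expr; rewrite ger0_norm ?invf_lt1 ?invr_ge0 // ltr1n].
rewrite mulr0 in G; have /cvgrPdist_le /(_ e e0) := G.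
apply: filterS => n; rewrite sub0r normrN distrC => h.
by apply: le_trans (H n) _; apply: le_trans (ler_norm _) h.
Qed.

Lemma expR_small (c : R) (e : R) : 0 < c -> 0 < e ->
  exists X : R, 0 <= X /\ forall x, X <= x -> expR (- c * x) <= e.
Proof.
move=> c0 e0; exists (`|ln e| / c); split=> [|x hx].
  by rewrite divr_ge0 // ltW.
rewrite -[e in _ <= e]lnK ?posrE // ler_expR.
have : `|ln e| <= c * x by rewrite mulrC -ler_pdivrMr.
rewrite ler_norml mulNr => /andP[]; lra.
Qed.

(** Standard passage to the limit in this file: a quantity independent of a far point or of an
    iteration index is bounded by [c * e] for every positive [e]. *)
Lemma small_le0 (x c : R) : 0 < c -> (forall e : R, 0 < e -> x <= c * e) -> x <= 0.
Proof.
move=> c0 h; rewrite leNgt; apply/negP => x0.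
have := h (x / (2 * c)); rewrite divr_gt0 ?mulr_gt0 // => /(_ isT).
have -> : c * (x / (2 * c)) = x / 2 by field; rewrite gt_eqF.
lra.
Qed.

End RealCalculus.

(** * Complex-valued functions of a real variable *)

Section ComplexModulus.
Context {R : realType}.
Local Notation C := R[i].
Implicit Types (z w : C).

(** The norm of [R[i]] takes its values in [R[i]]; a modulus in [R] can be compared with real
    functions and handled by [lra]. *)
Definition cn z : R := Num.sqrt (complex.Re z ^+ 2 + complex.Im z ^+ 2).

Lemma cnE z : `|z| = (cn z)%:C.
Proof. by rewrite normc_def. Qed.

Lemma cn_ge0 z : 0 <= cn z.
Proof. exact: sqrtr_ge0. Qed.

Lemma cnD z w : cn (z + w) <= cn z + cn w.
Proof. by rewrite -lecR rmorphD /= -!cnE ler_normD. Qed.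

Lemma cnM z w : cn (z * w) = cn z * cn w.
Proof. by apply: complexI; rewrite rmorphM /= -!cnE normrM. Qed.

Lemma cnN z : cn (- z) = cn z.
Proof. by apply: complexI; rewrite -!cnE normrN. Qed.

Lemma cnB z w : cn (z - w) <= cn z + cn w.
Proof. by rewrite -(cnN w) cnD. Qed.

Lemma cnC z w : cn (z - w) = cn (w - z).
Proof. by rewrite -cnN opprB. Qed.

Lemma cn0 : cn 0 = 0.
Proof. by apply: complexI; rewrite -!cnE normr0. Qed.

Lemma cn1 : cn 1 = 1.
Proof. by apply: complexI; rewrite -!cnE normr1. Qed.

Lemma cn_eq0 z : (cn z == 0) = (z == 0).
Proof. by rewrite -(inj_eq (@complexI R)) -cnE normr_eq0. Qed.

Lemma cn_gt0 z : (0 < cn z) = (z != 0).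
Proof. by rewrite lt_neqAle cn_ge0 andbT eq_sym cn_eq0. Qed.

Lemma cn_le0 z : (cn z <= 0) = (z == 0).
Proof. by rewrite -cn_eq0 eq_le cn_ge0 andbT. Qed.

Lemma cnV z : cn z^-1 = (cn z)^-1.
Proof. by apply: complexI; rewrite fmorphV /= -!cnE normfV. Qed.

Lemma cnX z n : cn (z ^+ n) = cn z ^+ n.
Proof. by apply: complexI; rewrite rmorphXn /= -!cnE normrX. Qed.

Lemma cnR (r : R) : cn r%:C = `|r|.
Proof. by rewrite /cn /= expr0n addr0 sqrtr_sqr. Qed.

Lemma cn_sum (I : Type) (r : seq I) (P : pred I) (F : I -> C) :
  cn (\sum_(i <- r | P i) F i) <= \sum_(i <- r | P i) cn (F i).
Proof.
elim/big_ind2 : _ => [|a b c d h1 h2|//]; first by rewrite cn0.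
by apply: le_trans (cnD _ _) _; exact: lerD.
Qed.

Lemma Re_le z : `|complex.Re z| <= cn z.
Proof. by rewrite -sqrtr_sqr ler_wsqrtr // lerDl sqr_ge0. Qed.

Lemma Im_le z : `|complex.Im z| <= cn z.
Proof. by rewrite -sqrtr_sqr ler_wsqrtr // lerDr sqr_ge0. Qed.

Lemma cn_le2 z : cn z <= `|complex.Re z| + `|complex.Im z|.
Proof.
rewrite /cn -[leRHS]ger0_norm ?addr_ge0 // -sqrtr_sqr ler_wsqrtr //.
rewrite -(real_normK (num_real (complex.Re z))) -(real_normK (num_real (complex.Im z))).
by have := mulr_ge0 (normr_ge0 (complex.Re z)) (normr_ge0 (complex.Im z)); nra.
Qed.

Lemma cn_sqr z : cn z ^+ 2 = complex.Re z ^+ 2 + complex.Im z ^+ 2.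
Proof. by rewrite sqr_sqrtr // addr_ge0 ?sqr_ge0. Qed.

Lemma cReD z w : complex.Re (z + w) = complex.Re z + complex.Re w.
Proof. by case: z; case: w. Qed.
Lemma cImD z w : complex.Im (z + w) = complex.Im z + complex.Im w.
Proof. by case: z; case: w. Qed.
Lemma cReN z : complex.Re (- z) = - complex.Re z.
Proof. by case: z. Qed.
Lemma cImN z : complex.Im (- z) = - complex.Im z.
Proof. by case: z. Qed.
Lemma cReM z w : complex.Re (z * w) =
  complex.Re z * complex.Re w - complex.Im z * complex.Im w.
Proof. by case: z; case: w. Qed.
Lemma cImM z w : complex.Im (z * w) =
  complex.Re z * complex.Im w + complex.Im z * complex.Re w.
Proof. by case: z; case: w. Qed.

Lemma complex_eq z w : complex.Re z = complex.Re w ->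
  complex.Im z = complex.Im w -> z = w.
Proof. by case: z; case: w => a b c d /= -> ->. Qed.

Lemma cn_cexp z : cn (cexp z) = expR (complex.Re z).
Proof.
rewrite /cexp cnM cnR ger0_norm ?expR_ge0 // /cn /= cos2Dsin2 sqrtr1 mulr1 //.
Qed.

Lemma cexpD z w : cexp (z + w) = cexp z * cexp w.
Proof.
rewrite /cexp cReD cImD expRD cosD sinD.
by apply: complex_eq; rewrite !(cReM, cImM) /=; ring.
Qed.

Lemma cexp0 : cexp (0 : C) = 1.
Proof. by apply: complex_eq; rewrite /cexp !(cReM, cImM) /= expR0 cos0 sin0; ring. Qed.

Lemma cexpNK z : cexp (- z) * cexp z = 1.
Proof. by rewrite -cexpD addNr cexp0. Qed.

Lemma cexp_neq0 z : cexp z != 0.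
Proof. by rewrite -cn_gt0 cn_cexp expR_gt0. Qed.

End ComplexModulus.

Section ComplexDerivative.
Context {R : realType}.
Local Notation C := R[i].
Implicit Types (f g : R -> C) (x : R) (l a b : C).

(** Componentwise, to match the way derivatives are expressed in [jost]. *)
Definition cder f x l :=
  der (fun t => complex.Re (f t)) x (complex.Re l) /\
  der (fun t => complex.Im (f t)) x (complex.Im l).

Definition ccts f := continuous (fun t => complex.Re (f t)) /\
  continuous (fun t => complex.Im (f t)).

Lemma cder_eq f x l l' : cder f x l -> l = l' -> cder f x l'.
Proof. by move=> h <-. Qed.

Lemma cder_ext f g x l : (forall t, f t = g t) -> cder f x l -> cder g x l.
Proof. by move=> /funext ->. Qed.

Lemma cder_ccts f (df : R -> C) : (forall x, cder f x (df x)) -> ccts f.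
Proof. by move=> h; split=> x; have [h1 h2] := h x; [exact: der_cts h1 | exact: der_cts h2]. Qed.

Lemma cderD f g x a b : cder f x a -> cder g x b ->
  cder (fun t => f t + g t) x (a + b).
Proof.
move=> [h1 h2] [h3 h4]; split.
  by apply: der_ext (der_eq (derD h1 h3) _) => *; rewrite cReD.
by apply: der_ext (der_eq (derD h2 h4) _) => *; rewrite cImD.
Qed.

Lemma cderN f x a : cder f x a -> cder (fun t => - f t) x (- a).
Proof.
move=> [h1 h2]; split.
  by apply: der_ext (der_eq (derN h1) _) => *; rewrite cReN.
by apply: der_ext (der_eq (derN h2) _) => *; rewrite cImN.
Qed.

Lemma cderB f g x a b : cder f x a -> cder g x b ->
  cder (fun t => f t - g t) x (a - b).
Proof. by move=> h1 h2; apply: cderD => //; exact: cderN. Qed.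

Lemma cderM f g x a b : cder f x a -> cder g x b ->
  cder (fun t => f t * g t) x (a * g x + f x * b).
Proof.
move=> [h1 h2] [h3 h4]; split.
  apply: der_ext (der_eq (derB (derM h1 h3) (derM h2 h4)) _) => [t|];
    by rewrite !(cReM, cReD) //; ring.
apply: der_ext (der_eq (derD (derM h1 h4) (derM h2 h3)) _) => [t|];
  by rewrite !(cImM, cImD) //; ring.
Qed.

Lemma cder_cst (c : C) x : cder (fun=> c) x 0.
Proof. by split; exact: der_cst. Qed.

Lemma cderZ (c : C) f x a : cder f x a -> cder (fun t => c * f t) x (c * a).
Proof. by move=> h; apply: cder_eq (cderM (cder_cst c x) h) _; rewrite mul0r add0r. Qed.

Lemma cderR (f : R -> R) x (l : R) : der f x l -> cder (fun t => (f t)%:C) x l%:C.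
Proof. by move=> h; split => //=; exact: der_cst. Qed.

Lemma cder_opp f x l : cder f (- x) l -> cder (fun t => f (- t)) x (- l).
Proof.
move=> [h1 h2]; split.
  by rewrite cReN; exact: (der_opp h1).
by rewrite cImN; exact: (der_opp h2).
Qed.

Lemma cder_sum (I : Type) (r : seq I) (F : I -> R -> C) (D : I -> C) x :
  (forall i, cder (F i) x (D i)) ->
  cder (fun t => \sum_(i <- r) F i t) x (\sum_(i <- r) D i).
Proof.
move=> h; elim: r => [|i r IH].
  by rewrite big_nil; apply: cder_ext (cder_cst 0 x) => t; rewrite big_nil.
rewrite big_cons; apply: cder_ext (cderD (h i) IH) => t; by rewrite big_cons.
Qed.

Lemma cder_cexp (c : C) x :
  cder (fun t => cexp (c * t%:C)) x (c * cexp (c * x%:C)).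
Proof.
have E (t : R) : cexp (c * t%:C) =
   (expR (complex.Re c * t))%:C * (cos (complex.Im c * t) +i* sin (complex.Im c * t)).
  by rewrite /cexp cReM cImM /= !mulr0 subr0 add0r.
have H : cder (fun t => cos (complex.Im c * t) +i* sin (complex.Im c * t)) x
   ((complex.Im c * - sin (complex.Im c * x)) +i* (complex.Im c * cos (complex.Im c * x))).
  have hd : der (fun t => complex.Im c * t) x (complex.Im c).
    by apply: der_eq (derZ _ (der_id x)) _; rewrite mulr1.
  split => /=.
    by apply: der_eq (der_comp (is_derive_cos _) hd) _; rewrite mulrC.
  by apply: der_eq (der_comp (is_derive_sin _) hd) _; rewrite mulrC.
have H2 := cderR (der_exp (derZ (complex.Re c) (der_id x))).
apply: cder_ext (cder_eq (cderM H2 H) _) => [t|]; first by rewrite E.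
rewrite E; apply: complex_eq; rewrite !(cReD, cImD, cReM, cImM) /=; ring.
Qed.

Lemma cder_const f (a b : R) : (forall x, cder f x 0) -> f a = f b.
Proof.
by move=> h; apply: complex_eq; apply: (@der_const _ (fun t => _ (f t))) => x; case: (h x).
Qed.

(** The factor 2 comes from treating real and imaginary parts separately; it is the origin of the
    factor 2 in the solver estimates below. *)
Lemma cder_cmp f (df : R -> C) (v dv : R -> R) (a b : R) : a <= b ->
  (forall x, a <= x <= b -> cder f x (df x)) ->
  (forall x, a <= x <= b -> der v x (dv x)) ->
  (forall x, a <= x <= b -> cn (df x) <= dv x) ->
  cn (f b - f a) <= 2 * (v b - v a).
Proof.
move=> ab hf hv hle; apply: le_trans (cn_le2 _) _.
have h1 : `|complex.Re (f b) - complex.Re (f a)| <= v b - v a.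
  apply: (der_cmp (u := fun t => complex.Re (f t)) ab _ hv (du := fun x => complex.Re (df x))).
    by move=> x /hf [].
  by move=> x /hle; apply: le_trans (Re_le _).
have h2 : `|complex.Im (f b) - complex.Im (f a)| <= v b - v a.
  apply: (der_cmp (u := fun t => complex.Im (f t)) ab _ hv (du := fun x => complex.Im (df x))).
    by move=> x /hf [].
  by move=> x /hle; apply: le_trans (Im_le _).
rewrite cReD cImD cReN cImN; lra.
Qed.

Lemma cctsD f g : ccts f -> ccts g -> ccts (fun t => f t + g t).
Proof.
move=> [h1 h2] [h3 h4]; split.
  have -> : (fun t => complex.Re (f t + g t)) = (fun t => complex.Re (f t) + complex.Re (g t)).
    by apply/funext => t; rewrite cReD.
  by move=> x; apply: cvgD; [exact: h1 | exact: h3].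
have -> : (fun t => complex.Im (f t + g t)) = (fun t => complex.Im (f t) + complex.Im (g t)).
  by apply/funext => t; rewrite cImD.
by move=> x; apply: cvgD; [exact: h2 | exact: h4].
Qed.

Lemma cctsM f g : ccts f -> ccts g -> ccts (fun t => f t * g t).
Proof.
move=> [h1 h2] [h3 h4]; split.
  have -> : (fun t => complex.Re (f t * g t)) =
     (fun t => complex.Re (f t) * complex.Re (g t) - complex.Im (f t) * complex.Im (g t)).
    by apply/funext => t; rewrite cReM.
  by move=> x; apply: cvgB; apply: cvgM; [exact: h1|exact: h3|exact: h2|exact: h4].
have -> : (fun t => complex.Im (f t * g t)) =
   (fun t => complex.Re (f t) * complex.Im (g t) + complex.Im (f t) * complex.Re (g t)).
  by apply/funext => t; rewrite cImM.
by move=> x; apply: cvgD; apply: cvgM; [exact: h1|exact: h4|exact: h2|exact: h3].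
Qed.

Lemma ccts_cst (c : C) : ccts (fun=> c).
Proof. by split=> x; exact: cvg_cst. Qed.

Lemma cctsZ c f : ccts f -> ccts (fun t => c * f t).
Proof. by apply: cctsM; exact: ccts_cst. Qed.

Lemma cctsN f : ccts f -> ccts (fun t => - f t).
Proof.
by move=> h; have := cctsZ (-1) h; congr ccts; apply/funext => t; rewrite mulN1r.
Qed.

Lemma cctsB f g : ccts f -> ccts g -> ccts (fun t => f t - g t).
Proof. by move=> h1 h2; apply: cctsD => //; exact: cctsN. Qed.

Lemma cctsR (f : R -> R) : continuous f -> ccts (fun t => (f t)%:C).
Proof. by move=> h; split => //= x; exact: cvg_cst. Qed.

Lemma ccts_sum (I : Type) (r : seq I) (F : I -> R -> C) :
  (forall i, ccts (F i)) -> ccts (fun t => \sum_(i <- r) F i t).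
Proof.
move=> h; elim: r => [|i r IH].
  have -> : (fun t => \sum_(i <- [::]) F i t) = fun=> 0.
    by apply/funext => t; rewrite big_nil.
  exact: ccts_cst.
have -> : (fun t => \sum_(j <- i :: r) F j t) = fun t => F i t + \sum_(j <- r) F j t.
  by apply/funext => t; rewrite big_cons.
exact: cctsD.
Qed.

Lemma cantider f : ccts f -> exists G : R -> C, forall x, cder G x (f x).
Proof.
move=> [/antider[G1 h1] /antider[G2 h2]]; exists (fun x => G1 x +i* G2 x) => x.
by split.
Qed.

Lemma cgeom_cauchy (u : nat -> C) (K : R) :
  (forall n, cn (u n.+1 - u n) <= K * 2^-1 ^+ n) ->
  exists l : C, [/\ complex.Re (u n) @[n --> \oo] --> complex.Re l,
    complex.Im (u n) @[n --> \oo] --> complex.Im l &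
    forall n, cn (u n - l) <= 4 * K * 2^-1 ^+ n].
Proof.
move=> hu.
have [|l1 [c1 h1]] := @geom_cauchy R (fun n => complex.Re (u n)) K.
  by move=> n; rewrite -cReN -cReD; apply: le_trans (Re_le _) (hu n).
have [|l2 [c2 h2]] := @geom_cauchy R (fun n => complex.Im (u n)) K.
  by move=> n; rewrite -cImN -cImD; apply: le_trans (Im_le _) (hu n).
exists (l1 +i* l2); split => // n; apply: le_trans (cn_le2 _) _.
by rewrite cReD cImD cReN cImN /=; have := h1 n; have := h2 n; lra.
Qed.

Lemma cder_lim (un dn : nat -> R -> C) u d x (r : R) : 0 < r ->
  (forall n y, cder (un n) y (dn n y)) ->
  (forall y, complex.Re (un n y) @[n --> \oo] --> complex.Re (u y)) ->
  (forall y, complex.Im (un n y) @[n --> \oo] --> complex.Im (u y)) ->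
  (forall e : R, 0 < e -> exists N, forall n y, (N <= n)%N -> `|y - x| <= r ->
     cn (dn n y - d y) <= e) ->
  cder u x (d x).
Proof.
move=> r0 hd h1 h2 hu; split.
  apply: (der_lim (un := fun n t => complex.Re (un n t)) (u := fun t => complex.Re (u t))
    (d := fun t => complex.Re (d t)) (dn := fun n t => complex.Re (dn n t)) r0) => //.
    by move=> n y; case: (hd n y).
  move=> e /hu [N HN]; exists N => n y Nn yx; rewrite -cReN -cReD.
  by apply: le_trans (Re_le _) (HN n y Nn yx).
apply: (der_lim (un := fun n t => complex.Im (un n t)) (u := fun t => complex.Im (u t))
  (d := fun t => complex.Im (d t)) (dn := fun n t => complex.Im (dn n t)) r0) => //.
  by move=> n y; case: (hd n y).
move=> e /hu [N HN]; exists N => n y Nn yx; rewrite -cImN -cImD.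
by apply: le_trans (Im_le _) (HN n y Nn yx).
Qed.

End ComplexDerivative.

(** * Weighted bounds for scalar equations *)

Section ScalarSolvers.
Context {R : realType}.
Local Notation C := R[i].
Variables (k L X : R).
Hypothesis (k0 : 0 < k) (L0 : 0 < L).
Local Ltac slra := move: k0 L0 => ? ?; lra.
Implicit Types (f u : R -> C) (kap A x : R).

(* The steep growth to the left of X makes the half-line where the potential is not small
   contribute little to the weighted norm, so that the contraction works on the whole line. *)
Definition wt (x : R) : R := expR (- k * x + L * Num.max 0 (X - x)).

Lemma wt_gt0 x : 0 < wt x. Proof. exact: expR_gt0. Qed.

Lemma wt_ge x : X <= x -> wt x = expR (- k * x).
Proof. by move=> h; rewrite /wt (max_idPl _) ?mulr0 ?addr0 // subr_le0. Qed.

Lemma wt_le x : x <= X -> wt x = expR (- k * x + L * (X - x)).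
Proof. by move=> h; rewrite /wt (max_idPr _) // subr_ge0. Qed.

(** Two constants, because the source contains the potential, which is small only to the right of
    [X]; on the left the larger constant gets divided by the slope [L]. *)
Definition bdd2 A A' f := (forall x, X <= x -> cn (f x) <= A * wt x) /\
  (forall x, x <= X -> cn (f x) <= A' * wt x).

Definition bdd A f := forall x, cn (f x) <= A * wt x.

Lemma bdd_bdd2 A f : bdd A f -> bdd2 A A f.
Proof. by move=> h; split=> x _. Qed.

Lemma bdd2_ge0 A A' f : bdd2 A A' f -> 0 <= A /\ 0 <= A'.
Proof.
move=> [h1 h2]; have := h1 X (lexx _); have := h2 X (lexx _).
by move/(le_trans (cn_ge0 _)); rewrite pmulr_lge0 ?wt_gt0 // => ? ;
  move/(le_trans (cn_ge0 _)); rewrite pmulr_lge0 ?wt_gt0.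
Qed.

Lemma bdd_ge0 A f : bdd A f -> 0 <= A.
Proof. by move/bdd_bdd2/bdd2_ge0 => []. Qed.

Lemma der_expl (c x : R) : der (fun t => expR (c * t)) x (c * expR (c * x)).
Proof. by apply: der_eq (der_exp (derZ c (der_id x))) _; rewrite mulr1. Qed.

Lemma der_expl2 (c d x : R) : der (fun t => expR (c * t + d)) x (c * expR (c * x + d)).
Proof.
by apply: der_eq (der_exp (derD (derZ c (der_id x)) (der_cst d x))) _; rewrite mulr1 addr0.
Qed.

Lemma cder_gauge (c : R) f x l : cder f x l ->
  cder (fun t => (expR (c * t))%:C * f t) x ((expR (c * x))%:C * (c%:C * f x + l)).
Proof.
by move=> h; apply: cder_eq (cderM (cderR (der_expl c x)) h) _; rewrite rmorphM /=; ring.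
Qed.

(** The homogeneous solution e^{kap x} is ruled out by any weighted bound on the right, so the
    unspecified [C0] merely selects the solution and disappears from the conclusion. The factor
    e^{-kap x} turns the equation into the computation of a primitive. *)
Lemma tail_est kap A A' (C0 : R) f u : 0 <= kap -> bdd2 A A' f ->
  (forall x, cder u x (kap%:C * u x + f x)) ->
  (forall x, X <= x -> cn (u x) <= C0 * wt x) ->
  bdd (2 * (A / k + A' / L)) u.
Proof.
move=> kap0 hf hu hC; have [A0 A'0] := bdd2_ge0 hf; have [f1 f2] := hf.
pose v (x : R) := (expR (- kap * x))%:C * u x.
have hv x : cder v x ((expR (- kap * x))%:C * f x).
  by apply: cder_eq (cder_gauge (- kap) (hu x)) _; rewrite rmorphN /=; ring.
pose q := k + kap.
have q0 : 0 < q by rewrite /q; slra.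
have cnv x : cn (v x) = expR (- kap * x) * cn (u x).
  by rewrite cnM cnR ger0_norm ?expR_ge0.
have cnvf x : cn ((expR (- kap * x))%:C * f x) = expR (- kap * x) * cn (f x).
  by rewrite cnM cnR ger0_norm ?expR_ge0.
pose D (x : R) := - (A / q * expR (- q * x)).
have HD x : der D x (A * expR (- q * x)).
  by apply: der_eq (derN (derZ _ (der_expl (- q) x))) _; field; rewrite gt_eqF.
have C00 : 0 <= C0.
  by have := hC X (lexx _); move/(le_trans (cn_ge0 _)); rewrite pmulr_lge0 ?wt_gt0.
(* [v x] is compared with [v y] at a far point [y], where the a priori bound makes [v y] at most
   [C0 * e]. *)
have far x : X <= x -> cn (v x) <= 2 * (A / q * expR (- q * x)).
  move=> Xx; rewrite -subr_le0; apply: (@small_le0 R _ (C0 + 1)) => [|e e0]; first by slra.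
  have [Y [_ hY]] := expR_small q0 e0; pose y := Num.max x Y.
  have xy : x <= y by rewrite le_max lexx.
  have Xy : X <= y by exact: le_trans xy.
  have := cder_cmp xy (fun t _ => hv t) (fun t _ => HD t) _.
  move=> /(_ _)/wrap[].
    move=> t /andP[xt _]; rewrite cnvf.
    have Xt : X <= t by exact: le_trans xt.
    have := ler_wpM2l (expR_ge0 (- kap * t)) (f1 t Xt); rewrite wt_ge // mulrCA -expRD.
    by congr (_ <= _ * expR _); rewrite /q; ring.
  have hy : cn (v y) <= C0 * e.
    rewrite cnv; have := ler_wpM2l (expR_ge0 (- kap * y)) (hC y Xy).
    rewrite wt_ge // mulrCA -expRD => /le_trans; apply; apply: ler_wpM2l => //.
    apply: le_trans (hY y _); last by rewrite le_max lexx orbT.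
    by rewrite ler_expR /q; slra.
  have hxy : cn (v x) <= cn (v y) + cn (v y - v x).
    by rewrite cnC; apply: le_trans (cnD _ _); rewrite addrC subrK.
  have : 0 <= A / q * expR (- q * y) by rewrite mulr_ge0 ?expR_ge0 // divr_ge0 // ltW.
  rewrite /D; move: hxy hy; slra.
have Aq : A / q <= A / k.
  by rewrite ler_wpM2l // lef_pV2 ?posrE // /q; slra.
have A'L : 0 <= A' / L by rewrite divr_ge0 // ltW.
have Ak : 0 <= A / k by rewrite divr_ge0 // ltW.
have Eu x : cn (u x) = expR (kap * x) * cn (v x).
  by rewrite cnv mulrA -expRD mulNr subrr expR0 mul1r.
move=> x; have [Xx|/ltW xX] := leP X x.
  rewrite Eu wt_ge //.
  have := ler_wpM2l (expR_ge0 (kap * x)) (far x Xx).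
  have -> : expR (kap * x) * (2 * (A / q * expR (- q * x))) =
     2 * (A / q) * (expR (kap * x) * expR (- q * x)) by ring.
  rewrite -expRD => /le_trans; apply.
  have -> : kap * x + - q * x = - k * x by rewrite /q; ring.
  by apply: ler_wpM2r; [exact: expR_ge0 | slra].
(* Left of [X] the integrand carries the extra factor e^{-Lt}; integrating it from [x] to [X] gains
   1 / L. *)
pose q' := q + L.
have q'0 : 0 < q' by rewrite /q'; slra.
pose D' (t : R) := - (A' / q' * expR (- q' * t + L * X)).
have HD' t : der D' t (A' * expR (- q' * t + L * X)).
  by apply: der_eq (derN (derZ _ (der_expl2 (- q') _ t))) _; field; rewrite gt_eqF.
have := cder_cmp xX (fun t _ => hv t) (fun t _ => HD' t) _.
move=> /(_ _)/wrap[].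
  move=> t /andP[_ tX]; rewrite cnvf.
  have := ler_wpM2l (expR_ge0 (- kap * t)) (f2 t tX); rewrite wt_le // mulrCA -expRD.
  by congr (_ <= _ * expR _); rewrite /q' /q; ring.
move=> H.
have hxy : cn (v x) <= cn (v X) + cn (v X - v x).
  by rewrite cnC; apply: le_trans (cnD _ _); rewrite addrC subrK.
have H1 := far X (lexx _).
have H2 : 0 <= A' / q' * expR (- q' * X + L * X) by rewrite mulr_ge0 ?expR_ge0 // divr_ge0 // ltW.
have A'q : A' / q' <= A' / L.
  by rewrite ler_wpM2l // lef_pV2 ?posrE // /q' /q; slra.
have H3 : cn (v x) <= 2 * (A / k * expR (- q * X)) + 2 * (A' / L * expR (- q' * x + L * X)).
  have := ler_wpM2r (expR_ge0 (- q * X)) Aq; have := ler_wpM2r (expR_ge0 (- q' * x + L * X)) A'q.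
  move: H H2; rewrite /D'; slra.
rewrite Eu wt_le //; have := ler_wpM2l (expR_ge0 (kap * x)) H3; move/le_trans; apply.
have H4 : expR (kap * x) * expR (- q * X) <= expR (- k * x + L * (X - x)).
  rewrite -expRD ler_expR /q.
  have := mulr_ge0 kap0 (_ : 0 <= X - x); have := mulr_ge0 (ltW k0) (_ : 0 <= X - x).
  have := mulr_ge0 (ltW L0) (_ : 0 <= X - x).
  by rewrite subr_ge0 => /(_ xX) ? /(_ xX) ? /(_ xX) ?; slra.
have H5 : expR (kap * x) * expR (- q' * x + L * X) = expR (- k * x + L * (X - x)).
  by rewrite -expRD; congr expR; rewrite /q' /q; ring.
have H6 := ler_wpM2l Ak H4.
rewrite mulrDr [X in _ + X](_ : _ = 2 * (A' / L * (expR (kap * x) * expR (- q' * x + L * X)))); last by ring.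
rewrite H5; slra.
Qed.

(** Variation of constants from +oo: the primitive of e^{-kap x} f that vanishes at infinity
    supplies the a priori bound, which [tail_est] then sharpens. *)
Lemma tail_solve kap A A' f : 0 <= kap -> ccts f -> bdd2 A A' f ->
  exists u, (forall x, cder u x (kap%:C * u x + f x)) /\
    bdd (2 * (A / k + A' / L)) u.
Proof.
move=> kap0 cf hf; have [f1 f2] := hf.
pose F x := (expR (- kap * x))%:C * f x.
have cF : ccts F.
  apply: cctsM cf; apply: cctsR => x.
  by apply: der_cts; exact: der_expl.
have [cF1 cF2] := cF.
have q0 : 0 < k + kap by slra.
have hF x : X <= x -> cn (F x) <= A * expR (- (k + kap) * x).
  move=> Xx; rewrite cnM cnR ger0_norm ?expR_ge0 //.
  have := ler_wpM2l (expR_ge0 (- kap * x)) (f1 x Xx); rewrite wt_ge // mulrCA -expRD.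
  by congr (_ <= _ * expR _); ring.
have [|G1 [h1 b1]] := @antider_tail R _ A _ X cF1 q0.
  by move=> x Xx; apply: le_trans (Re_le _) (hF x Xx).
have [|G2 [h2 b2]] := @antider_tail R _ A _ X cF2 q0.
  by move=> x Xx; apply: le_trans (Im_le _) (hF x Xx).
pose u (x : R) := (expR (kap * x))%:C * (G1 x +i* G2 x).
have hu x : cder u x (kap%:C * u x + f x).
  have hG : cder (fun x => G1 x +i* G2 x) x (F x) by split.
  apply: cder_eq (cder_gauge kap hG) _.
  rewrite mulrDr /F mulrA (mulrC _%:C (kap%:C)) -mulrA; congr (_ + _).
  by rewrite mulrA -rmorphM /= -expRD mulNr subrr expR0 mul1r.
exists u; split => //.
apply: (tail_est (C0 := 2 * (A / (k + kap))) kap0 hf hu) => x Xx.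
rewrite cnM cnR ger0_norm ?expR_ge0 //.
have hG : cn (G1 x +i* G2 x) <= 2 * (A / (k + kap) * expR (- (k + kap) * x)).
  by apply: le_trans (cn_le2 _) _; have := b1 x Xx; have := b2 x Xx => /=; slra.
have := ler_wpM2l (expR_ge0 (kap * x)) hG; rewrite wt_ge // => /le_trans; apply.
rewrite mulrCA (mulrCA (expR _)) -expRD.
have -> : kap * x + - (k + kap) * x = - k * x by ring.
by rewrite [leLHS]mulrA.
Qed.

(** The homogeneous solution e^{-kap x} is compatible with the weight, so decay selects nothing and
    [u X = 0] does. [2 * k <= kap] gives the gap kap - k >= k on the right; [2 * kap <= L] gives the
    gap L + k - kap >= L / 2 on the left, whence the factor 2 before [A' / L]. *)
Lemma head_est kap A A' f u : 2 * k <= kap -> 2 * kap <= L -> bdd2 A A' f ->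
  (forall x, cder u x (- kap%:C * u x + f x)) -> u X = 0 ->
  bdd (2 * (A / k + 2 * (A' / L))) u.
Proof.
move=> kap0 kapL hf hu uX; have [A0 A'0] := bdd2_ge0 hf; have [f1 f2] := hf.
pose v (x : R) := (expR (kap * x))%:C * u x.
have hv x : cder v x ((expR (kap * x))%:C * f x).
  by apply: cder_eq (cder_gauge kap (hu x)) _; ring.
have vX : v X = 0 by rewrite /v uX mulr0.
have cnv x : cn (v x) = expR (kap * x) * cn (u x).
  by rewrite cnM cnR ger0_norm ?expR_ge0.
have cnvf x : cn ((expR (kap * x))%:C * f x) = expR (kap * x) * cn (f x).
  by rewrite cnM cnR ger0_norm ?expR_ge0.
have Eu x : cn (u x) = expR (- kap * x) * cn (v x).
  by rewrite cnv mulrA -expRD mulNr addNr expR0 mul1r.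
have A'L : 0 <= A' / L by rewrite divr_ge0 // ltW.
have Ak : 0 <= A / k by rewrite divr_ge0 // ltW.
move=> x; have [Xx|/ltW xX] := leP X x.
  pose q := kap - k.
  have q0 : 0 < q by rewrite /q; slra.
  pose D (x : R) := A / q * expR (q * x).
  have HD t : der D t (A * expR (q * t)).
    by apply: der_eq (derZ _ (der_expl q t)) _; field; rewrite gt_eqF.
  have := cder_cmp Xx (fun t _ => hv t) (fun t _ => HD t) _.
  move=> /(_ _)/wrap[].
    move=> t /andP[Xt _]; rewrite cnvf.
    have := ler_wpM2l (expR_ge0 (kap * t)) (f1 t Xt); rewrite wt_ge // mulrCA -expRD.
    by congr (_ <= _ * expR _); rewrite /q; ring.
  rewrite vX subr0 => H.
  have DX : 0 <= D X by rewrite /D mulr_ge0 ?expR_ge0 // divr_ge0 // ltW.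
  have Aq : A / q <= A / k.
    by rewrite ler_wpM2l // lef_pV2 ?posrE // /q; slra.
  have {}H : cn (v x) <= 2 * (A / k * expR (q * x)).
    by have := ler_wpM2r (expR_ge0 (q * x)) Aq; move: H DX; rewrite /D; slra.
  rewrite Eu wt_ge //; have := ler_wpM2l (expR_ge0 (- kap * x)) H.
  rewrite mulrCA (mulrCA (expR _)) -expRD => /le_trans; apply.
  have -> : - kap * x + q * x = - k * x by rewrite /q; ring.
  have := expR_ge0 (- k * x) => h.
  have := mulr_ge0 A'L h; slra.
pose q := L + k - kap.
have q0 : 0 < q by rewrite /q; slra.
pose D (t : R) := - (A' / q * expR (- q * t + L * X)).
have HD t : der D t (A' * expR (- q * t + L * X)).
  by apply: der_eq (derN (derZ _ (der_expl2 (- q) _ t))) _; field; rewrite gt_eqF.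
have := cder_cmp xX (fun t _ => hv t) (fun t _ => HD t) _.
move=> /(_ _)/wrap[].
  move=> t /andP[_ tX]; rewrite cnvf.
  have := ler_wpM2l (expR_ge0 (kap * t)) (f2 t tX); rewrite wt_le // mulrCA -expRD.
  by congr (_ <= _ * expR _); rewrite /q; ring.
rewrite vX sub0r cnN => H.
have DX : D X <= 0 by rewrite /D oppr_le0 mulr_ge0 ?expR_ge0 // divr_ge0 // ltW.
have A'q : A' / q <= 2 * (A' / L).
  have -> : 2 * (A' / L) = A' / (L / 2) by field; rewrite gt_eqF.
  by rewrite ler_wpM2l // lef_pV2 ?posrE // /q; slra.
have {}H : cn (v x) <= 2 * (2 * (A' / L) * expR (- q * x + L * X)).
  by have := ler_wpM2r (expR_ge0 (- q * x + L * X)) A'q; move: H DX; rewrite /D; slra.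
rewrite Eu wt_le //; have := ler_wpM2l (expR_ge0 (- kap * x)) H.
rewrite mulrCA (mulrCA (expR _)) -expRD => /le_trans; apply.
have -> : - kap * x + (- q * x + L * X) = - k * x + L * (X - x) by rewrite /q; ring.
have h := expR_ge0 (- k * x + L * (X - x)).
have := mulr_ge0 Ak h; slra.
Qed.

Lemma head_solve kap f : ccts f ->
  exists u, (forall x, cder u x (- kap%:C * u x + f x)) /\ u X = 0.
Proof.
move=> cf.
have [|G HG] := @cantider R (fun x => (expR (kap * x))%:C * f x).
  by apply: cctsM cf; apply: cctsR => x; apply: der_cts; exact: der_expl.
exists (fun x => (expR (- kap * x))%:C * (G x - G X)); split=> [x|]; last first.
  by rewrite subrr mulr0.
have hG : cder (fun x => G x - G X) x ((expR (kap * x))%:C * f x).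
  by apply: cder_eq (cderB (HG x) (cder_cst _ x)) _; rewrite subr0.
apply: cder_eq (cder_gauge (- kap) hG) _.
rewrite mulrDr rmorphN /= mulrA (mulrC _%:C (- kap%:C)) -mulrA; congr (_ + _).
by rewrite mulrA -rmorphM /= -expRD mulNr addNr expR0 mul1r.
Qed.

End ScalarSolvers.

(** * Solutions decaying at infinity *)

Notation idx := 'I_(2 + 2)%N.

Lemma geom_small (R : realType) (e : R) : 0 < e -> exists n, (2 ^+ n : R)^-1 <= e.
Proof.
move=> e0; exists (Num.bound e^-1); rewrite -[leRHS]invrK lef_pV2 ?posrE ?invr_gt0 ?exprn_gt0 //.
have e1 : 0 <= e^-1 by rewrite invr_ge0 ltW.
have /ltW/le_trans := archi_boundP e1; apply.
by rewrite -natrX ler_nat ltnW // ltn_expl.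
Qed.

Section System.
Context {R : realType}.
Local Notation C := R[i].

(* ck is a decay rate of the potential and cKb a bound for it, cL the slope of the weight to the
   left of cX, cth the size of the second component relative to the first, ca the radius allowed
   for the spectral parameter g; the squared exponents are ckap j ^+ 2 + csg j * g ^+ 2. *)
Record consts := Consts {
  ck : R; cL : R; cX : R; cth : R; ca : R; cKb : R; cKM : R;
  ckap : idx -> R; csg : idx -> R }.

(** Operator bound for the terms of [Qop] that contain [g], when [cn g <= ca] and [w] is measured in
    units of [th] times the norm of [eta]. *)
Definition caf (c : consts) := 2 * ca c * (cth c + cKM c) + 2 * ca c ^+ 2.

(** The last two inequalities are the contraction conditions: passing from [w] to [eta] costs a
    factor 1/2, passing from the pair to [w] a factor th/2. A zero exponent comes with [sg = 1],
    which removes the [g ^+ 2] term of that mode; the other exponents satisfy the gap conditions of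
    [head_est]. *)
Definition good_consts (c : consts) : Prop :=
  [/\ [/\ 0 < ck c, 0 < cL c, 0 < cth c, cth c <= 1 & 0 < ca c],
      [/\ 0 <= cX c, 0 <= cKb c & 0 <= cKM c],
      forall j, [/\ 0 <= ckap c j <= cKM c, `|csg c j - 1| <= 2 &
        (ckap c j = 0 /\ csg c j = 1) \/
        (2 * ck c <= ckap c j /\ 2 * ckap c j <= cL c)],
      2 * (cth c / ck c + 2 * (cth c / cL c)) <= 2^-1 &
      2 * ((caf c + 4 * (cKb c * expR (- ck c * cX c))) / ck c +
           (caf c + 4 * cKb c) / cL c) <= cth c / 2].

Variable c : consts.
Hypothesis gc : good_consts c.

Local Notation k := (ck c).
Local Notation L := (cL c).
Local Notation X := (cX c).
Local Notation th := (cth c).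
Local Notation a := (ca c).
Local Notation Kb := (cKb c).
Local Notation KM := (cKM c).
Local Notation kap := (ckap c).
Local Notation sg := (csg c).
Local Notation af := (caf c).
Local Notation wt := (wt k L X).
Local Notation bdd := (bdd k L X).
Local Notation bdd2 := (bdd2 k L X).
Implicit Types (B : idx -> idx -> R -> R) (eta w b : idx -> R -> C) (g : C).

Lemma ck0 : 0 < k. Proof. by case: gc => [[]]. Qed.
Lemma cL0 : 0 < L. Proof. by case: gc => [[]]. Qed.
Lemma cth0 : 0 < th. Proof. by case: gc => [[]]. Qed.
Lemma cth1 : th <= 1. Proof. by case: gc => [[]]. Qed.
Lemma ca0 : 0 < a. Proof. by case: gc => [[]]. Qed.
Lemma cX0 : 0 <= X. Proof. by case: gc => _ []. Qed.
Lemma cKb0 : 0 <= Kb. Proof. by case: gc => _ []. Qed.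
Lemma cKM0 : 0 <= KM. Proof. by case: gc => _ []. Qed.
Lemma ckap0 j : 0 <= kap j. Proof. by case: gc => _ _ /(_ j) [/andP[]]. Qed.
Lemma ckapM j : kap j <= KM. Proof. by case: gc => _ _ /(_ j) [/andP[]]. Qed.
Lemma csg2 j : `|sg j - 1| <= 2. Proof. by case: gc => _ _ /(_ j) [/andP[]]. Qed.
Lemma ckapP j : (kap j = 0 /\ sg j = 1) \/ (2 * k <= kap j /\ 2 * kap j <= L).
Proof. by case: gc => _ _ /(_ j) []. Qed.

Lemma ckap_neq0 j : kap j != 0 -> 2 * k <= kap j /\ 2 * kap j <= L.
Proof. by case: (ckapP j) => [[-> _]|//]; rewrite eqxx. Qed.

Lemma caf0 : 0 <= af.
Proof.
have := ca0; have := cth0; have := cKM0 => h1 h2 h3.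
by rewrite /caf addr_ge0 ?mulr_ge0 ?sqr_ge0 ?addr_ge0 // ltW.
Qed.

Definition pot B := forall i j, [/\ continuous (B i j),
  forall x, `|B i j x| <= Kb &
  forall x, X <= x -> `|B i j x| <= Kb * expR (- k * x)].

(* For psi = e^{-g x} chi and w = chi' + kap chi, the equation
   psi_j'' = (kap_j^2 + sg_j g^2) psi_j - (B psi)_j becomes chi_j' = - kap_j chi_j + w_j and
   w_j' = kap_j w_j + (Qop chi w)_j, which stays regular at g = 0 when kap_j = 0. *)
Definition Qop g B eta w j x : C :=
  2 * g * (w j x - (kap j)%:C * eta j x) + (sg j - 1)%:C * g ^+ 2 * eta j x
  - \sum_i (B j i x)%:C * eta i x.

Lemma Qop_bound g B eta w j x (M b0 : R) : cn g <= a ->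
  (forall i, cn (eta i x) <= M) -> cn (w j x) <= th * M ->
  (forall i, `|B j i x| <= b0) -> cn (Qop g B eta w j x) <= (af + 4 * b0) * M.
Proof.
move=> ga hM hw hB.
have M0 : 0 <= M by apply: le_trans (hM ord0); exact: cn_ge0.
have h1 : cn (w j x - (kap j)%:C * eta j x) <= (th + KM) * M.
  apply: le_trans (cnB _ _) _; rewrite cnM cnR (ger0_norm (ckap0 j)) mulrDl lerD //.
  by apply: ler_pM => //; [exact: ckap0 | exact: cn_ge0 | exact: ckapM].
have h2 : cn (2 * g * (w j x - (kap j)%:C * eta j x)) <= 2 * a * ((th + KM) * M).
  rewrite !cnM; have -> : cn (2 : C) = 2.
    have -> : (2 : C) = (2 : R)%:C by rewrite rmorphMn rmorph1.
    by rewrite cnR ger0_norm.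
  apply: ler_pM => //; rewrite ?mulr_ge0 ?cn_ge0 //.
  by rewrite ler_wpM2l.
have h3 : cn ((sg j - 1)%:C * g ^+ 2 * eta j x) <= 2 * a ^+ 2 * M.
  rewrite 2!cnM cnR cnX; apply: ler_pM; rewrite ?mulr_ge0 ?exprn_ge0 ?cn_ge0 //.
  apply: ler_pM; rewrite ?exprn_ge0 ?cn_ge0 ?csg2 //.
  by rewrite lerXn2r ?nnegrE ?cn_ge0 ?(ltW ca0).
have h4 : cn (\sum_i (B j i x)%:C * eta i x) <= 4 * b0 * M.
  apply: le_trans (cn_sum _ _ _) _.
  have : \sum_(i < 2 + 2) cn ((B j i x)%:C * eta i x) <= \sum_(i < 2 + 2) b0 * M.
    apply: ler_sum => i _; rewrite cnM cnR; apply: ler_pM => //; exact: cn_ge0.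
  by rewrite sumr_const card_ord -mulrA mulr_natl.
rewrite /Qop; apply: le_trans (cnB _ _) _.
apply: le_trans (lerD (cnD _ _) (lexx _)) _; rewrite /caf; lra.
Qed.

Lemma QopB g B eta w eta' w' j x :
  Qop g B eta w j x - Qop g B eta' w' j x =
  Qop g B (fun i t => eta i t - eta' i t) (fun i t => w i t - w' i t) j x.
Proof.
rewrite /Qop.
under [X in _ = _ - X]eq_bigr do rewrite mulrBr.
rewrite sumrB; ring.
Qed.

Lemma ccts_Qop g B eta w j : pot B -> (forall i, ccts (eta i)) -> ccts (w j) ->
  ccts (Qop g B eta w j).
Proof.
move=> hB he hw; apply: cctsB; first apply: cctsD.
- by apply: cctsZ; apply: cctsB => //; apply: cctsZ.
- exact: cctsZ.
- apply: (@ccts_sum _ _ _ (fun i t => (B j i t)%:C * eta i t)) => i; apply: cctsM => //.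
  by apply: cctsR; case: (hB j i).
Qed.

(** Norm of the scalar solution operators with [w] scaled by [th]: a source bounded by [be]
    contributes [cc * be] to one step of the iteration. *)
Definition cc := 2 * (k^-1 + L^-1) / th.

Lemma cc0 : 0 <= cc.
Proof.
by rewrite /cc mulr_ge0 ?invr_ge0 ?mulr_ge0 ?addr_ge0 ?invr_ge0 // ltW //;
  [exact: ck0|exact: cL0|exact: cth0].
Qed.

(** One iteration step: [Qop] is evaluated at the old pair, so each new component solves a scalar
    equation; a fixed point solves the full system. Only nonzero exponents carry a condition at [X],
    since for exponent 0 decay already fixes the solution. *)
Definition zodes g B b eta w eta' w' :=
  [/\ forall j x, cder (eta' j) x (- (kap j)%:C * eta' j x + w' j x),
      forall j x, cder (w' j) x ((kap j)%:C * w' j x + (Qop g B eta w j x + b j x)) &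
      forall j, kap j != 0 -> eta' j X = 0].

Definition zbdd N eta w := forall j, bdd N (eta j) /\ bdd N (w j).

Lemma Qop_bdd2 g B b eta w N be j : cn g <= a -> pot B ->
  (forall i, bdd N (eta i)) -> bdd (th * N) (w j) -> bdd be (b j) ->
  bdd2 ((af + 4 * (Kb * expR (- k * X))) * N + be) ((af + 4 * Kb) * N + be)
    (fun x => Qop g B eta w j x + b j x).
Proof.
move=> ga hB he hw hb; split=> x hx; apply: le_trans (cnD _ _) _; rewrite mulrDl lerD //.
- rewrite -mulrA; apply: Qop_bound => // [i||i]; first exact: he.
    by rewrite mulrA; exact: hw.
  case: (hB j i) => _ _ /(_ x hx) /le_trans; apply.
  apply: ler_wpM2l; first exact: cKb0.
  by rewrite ler_expR; have := mulr_ge0 (ltW ck0) (_ : 0 <= x - X); rewrite subr_ge0 => /(_ hx); lra.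
- rewrite -mulrA; apply: Qop_bound => // [i||i]; first exact: he.
    by rewrite mulrA; exact: hw.
  by case: (hB j i).
Qed.

Lemma bdd_le N M (f : R -> C) : bdd N f -> N <= M -> bdd M f.
Proof. by move=> h NM x; apply: le_trans (h x) _; rewrite ler_wpM2r // ltW // wt_gt0. Qed.

(** [tail_est] bounds [w']; then [eta'] is bounded by [tail_est] with exponent 0 or by [head_est],
    according to the mode. The inequalities in [good_consts] turn the result into a contraction by
    1/2, and the unspecified [N'] serves only to identify the decaying solutions. *)
Lemma step_est g B b eta w eta' w' (N be : R) : cn g <= a -> pot B ->
  zodes g B b eta w eta' w' -> (exists N', zbdd N' eta' w') ->
  (forall j, bdd N (eta j)) -> (forall j, bdd (th * N) (w j)) ->
  (forall j, bdd be (b j)) ->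
  forall j, bdd (N / 2 + cc * be) (eta' j) /\ bdd (th * (N / 2 + cc * be)) (w' j).
Proof.
move=> ga hB [ o1 o2 bc] [N' hN'] he hw hb j.
have N0 : 0 <= N := bdd_ge0 (he j).
have be0 : 0 <= be := bdd_ge0 (hb j).
set N1 := N / 2 + cc * be.
have N10 : 0 <= N1 by have := mulr_ge0 cc0 be0; rewrite /N1; lra.
have hw' : bdd (th * N1) (w' j).
  apply: (bdd_le (tail_est ck0 cL0 (ckap0 j) (Qop_bdd2 ga hB he (hw j) (hb j)) (o2 j)
    (fun x _ => (hN' j).2 x))).
  have [_ _ _ _ hA] := gc.
  have E : th * (cc * be) = 2 * (be / k + be / L).
    by have t0 := cth0; rewrite /cc; field; rewrite !gt_eqF // ?ck0 ?cL0.
  have := ler_wpM2r N0 hA; rewrite /N1; lra.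
split=> //.
have h2 : 2 * (th * N1 / k + 2 * (th * N1 / L)) <= N1 / 2.
  by have [_ _ _ /(ler_wpM2r N10) h _] := gc; lra.
have [kj|kj] := eqVneq (kap j) 0.
  have o1' x : cder (eta' j) x ((0:R)%:C * eta' j x + w' j x).
    by apply: cder_eq (o1 j x) _; rewrite kj oppr0.
  apply: (bdd_le (tail_est ck0 cL0 (lexx 0) (bdd_bdd2 hw') o1' (fun x _ => (hN' j).1 x))).
  have : 0 <= th * N1 / L.
    by rewrite mulr_ge0 ?mulr_ge0 ?invr_ge0 // ltW // ?cth0 ?cL0.
  lra.
have [k1 k2] := ckap_neq0 kj.
apply: (bdd_le (head_est ck0 cL0 k1 k2 (bdd_bdd2 hw') (o1 j) (bc j kj))); lra.
Qed.

Definition psol g B b eta w := zodes g B b eta w eta w /\ exists N, zbdd N eta w.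

(** Applying the contraction [n] times to a fixed point divides the unknown initial bound by 2^n and
    leaves a geometric sum of the source terms. Uniqueness and all the dependence estimates rest on
    this bound. *)
Lemma psol_est g B b eta w be : cn g <= a -> pot B -> psol g B b eta w ->
  (forall j, bdd be (b j)) -> zbdd (2 * cc * be) eta w.
Proof.
move=> ga hB [ho [N hN]] hb.
have N0 : 0 <= N := bdd_ge0 (hN ord0).1.
have be0 : 0 <= be := bdd_ge0 (hb ord0).
have t0 := cth0; have t1 := cth1.
have H n j : bdd (N / th / 2 ^+ n + 2 * cc * be) (eta j) /\
    bdd (th * (N / th / 2 ^+ n + 2 * cc * be)) (w j).
  have cb : 0 <= cc * be by rewrite mulr_ge0 // cc0.
  elim: n j => [|n IH] j.
    rewrite expr0 divr1; split.
      apply: bdd_le (hN j).1 _; have : N <= N / th by rewrite ler_pdivlMr //; nra.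
      lra.
    apply: bdd_le (hN j).2 _; rewrite mulrDr mulrCA divff ?gt_eqF // mulr1.
    by have := mulr_ge0 (ltW t0) cb; lra.
  have [h1 h2] := step_est ga hB ho (ex_intro _ N hN) (fun j => (IH j).1) (fun j => (IH j).2) hb j.
  have E : (N / th / 2 ^+ n + 2 * cc * be) / 2 + cc * be = N / th / 2 ^+ n.+1 + 2 * cc * be.
    by rewrite exprS invfM; move: (_ ^+ n)^-1 => q; field; rewrite gt_eqF.
  by rewrite E in h1 h2.
have lim (x y : R) : (forall n : nat, x <= N / th / 2 ^+ n * wt y + 2 * cc * be * wt y) ->
    x <= 2 * cc * be * wt y.
  move=> h; rewrite -subr_le0; apply: (@small_le0 R _ (N / th * wt y + 1)).
    by rewrite ltr_wpDl // mulr_ge0 ?divr_ge0 // ?ltW // ?wt_gt0.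
  move=> e e0; have [n hn] : exists n, (2 ^+ n : R)^-1 <= e.
    by have [n hn] := geom_small e0; exists n.
  have P : 0 <= N / th * wt y by rewrite mulr_ge0 ?divr_ge0 ?(ltW t0) // ltW // wt_gt0.
  have := h n; have := ler_wpM2l P hn; lra.
move=> j; split=> x; apply: lim => n; have [h1 h2] := H n j.
  by rewrite -mulrDl; exact: h1.
rewrite -mulrDl; apply: le_trans (h2 x) _; rewrite ler_wpM2r ?(ltW (wt_gt0 _ _ _ _)) //.
have P : 0 <= N / th / 2 ^+ n by rewrite !divr_ge0 ?exprn_ge0 ?(ltW t0).
have P2 := mulr_ge0 cc0 be0.
by rewrite ler_piMl //; lra.
Qed.

Lemma exists_tail_step (u0 : idx -> R) (f : idx -> R -> C) (A A' : R) :
  (forall j, 0 <= u0 j) -> (forall j, ccts (f j)) -> (forall j, bdd2 A A' (f j)) ->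
  exists u : idx -> R -> C, forall j, (forall x, cder (u j) x ((u0 j)%:C * u j x + f j x)) /\
    bdd (2 * (A / k + A' / L)) (u j).
Proof.
move=> h0 cf hf.
have /choice [u hu] j : exists u : R -> C, (forall x, cder u x ((u0 j)%:C * u x + f j x)) /\
    bdd (2 * (A / k + A' / L)) u.
  exact: (tail_solve ck0 cL0 (h0 j) (cf j) (hf j)).
by exists u.
Qed.

Definition regular eta w := (forall j, ccts (eta j) /\ ccts (w j)) /\
  exists N, zbdd N eta w.

Lemma exists_step g B b eta w be : cn g <= a -> pot B ->
  (forall j, ccts (b j)) -> (forall j, bdd be (b j)) -> regular eta w ->
  exists eta' w', regular eta' w' /\ zodes g B b eta w eta' w'.
Proof.
move=> ga hB cb hb [cz [N hN]].
have t0 := cth0; have t1 := cth1.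
have N0 : 0 <= N := bdd_ge0 (hN ord0).1.
have hN2 j : bdd (N / th) (eta j).
  by apply: bdd_le (hN j).1 _; rewrite ler_pdivlMr //; nra.
have hN3 j : bdd (th * (N / th)) (w j).
  by apply: bdd_le (hN j).2 _; rewrite mulrCA divff ?gt_eqF // mulr1.
have [w' hw'] := @exists_tail_step kap _ _ _ ckap0
  (fun j => cctsD (ccts_Qop g hB (fun i => (cz i).1) (cz j).2) (cb j))
  (fun j => Qop_bdd2 ga hB hN2 (hN3 j) (hb j)).
set W := 2 * (_ + _) in hw'.
have W0 : 0 <= W := bdd_ge0 (hw' ord0).2.
have cw' j : ccts (w' j) := cder_ccts (hw' j).1.
pose M := 2 * (W / k + 2 * (W / L)).
have WL : 0 <= W / L by rewrite divr_ge0 // ltW // cL0.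
have /choice [eta' heta'] j : exists u : R -> C,
    [/\ forall x, cder u x (- (kap j)%:C * u x + w' j x), bdd M u &
        kap j != 0 -> u X = 0].
  have [kj|kj] := eqVneq (kap j) 0.
    have [u [h1 h2]] := tail_solve ck0 cL0 (lexx 0) (cw' j) (bdd_bdd2 (hw' j).2).
    exists u; split=> // [x|]; first by apply: cder_eq (h1 x) _; rewrite kj oppr0.
    by apply: bdd_le h2 _; rewrite /M; lra.
  have [u [h1 h2]] := head_solve X (kap j) (cw' j).
  exists u; split => //.
  have [k1 k2] := ckap_neq0 kj.
  exact: (head_est ck0 cL0 k1 k2 (bdd_bdd2 (hw' j).2) h1 h2).
exists eta', w'; split; last first.
  by split=> [j x|j x|j]; [case: (heta' j) | exact: (hw' j).1 | case: (heta' j)].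
split=> [j|].
  by split => //; apply: (@cder_ccts _ _ (fun x => - (kap j)%:C * eta' j x + w' j x)); case: (heta' j).
exists (W + M) => j; split.
  by case: (heta' j) => _ h _; apply: bdd_le h _; lra.
apply: bdd_le (hw' j).2 _.
by have [_ /bdd_ge0 + _] := heta' j; lra.
Qed.

(** Makes weighted convergence locally uniform, as [cder_lim] requires. *)
Lemma wt_loc x y : `|y - x| <= 1 -> wt y <= expR (k + L) * wt x.
Proof.
move=> h; have k0 := ck0; have L0 := cL0; rewrite /wt -expRD ler_expR.
have h1 : - k * y <= k - k * x.
  by move: h; rewrite ler_norml => /andP[h1 h2]; nra.
have h2 : Num.max 0 (X - y) <= 1 + Num.max 0 (X - x).
  move: h; rewrite ler_norml => /andP[h2 h3].
  have m1 : X - x <= Num.max 0 (X - x) by rewrite le_max lexx orbT.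
  have m0 : 0 <= Num.max 0 (X - x) by rewrite le_max lexx.
  by rewrite ge_max; apply/andP; split; lra.
have := ler_wpM2l (ltW L0) h2; lra.
Qed.

End System.

(** * Existence for the weighted system by Picard iteration *)

Section Solve.
Context {R : realType}.
Local Notation C := R[i].
Variable c : @consts R.
Hypothesis gc : good_consts c.

Local Notation k := (ck c).
Local Notation L := (cL c).
Local Notation X := (cX c).
Local Notation th := (cth c).
Local Notation a := (ca c).
Local Notation Kb := (cKb c).
Local Notation KM := (cKM c).
Local Notation kap := (ckap c).
Local Notation af := (caf c).
Local Notation wt := (wt k L X).
Local Notation bdd := (bdd k L X).
Local Notation pot := (pot c).
Local Notation Qop := (Qop c).
Local Notation zodes := (zodes c).
Local Notation zbdd := (zbdd c).
Local Notation psol := (psol c).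
Local Notation cc := (cc c).
Implicit Types (B : idx -> idx -> R -> R) (eta w b : idx -> R -> C) (g : C).

Lemma zodesB g B b eta w eta' w' b2 y z y' z' :
  zodes g B b eta w eta' w' -> zodes g B b2 y z y' z' ->
  zodes g B (fun j x => b j x - b2 j x) (fun j x => eta j x - y j x)
    (fun j x => w j x - z j x) (fun j x => eta' j x - y' j x)
    (fun j x => w' j x - z' j x).
Proof.
move=> [h1 h2 h3] [h4 h5 h6]; split=> [j x|j x|j kj].
- by apply: cder_eq (cderB (h1 j x) (h4 j x)) _; ring.
- apply: cder_eq (cderB (h2 j x) (h5 j x)) _; rewrite -QopB; ring.
- by rewrite h3 // h6 // subrr.
Qed.

Lemma QopZ (t : C) g B eta w j x : t * Qop g B eta w j x =
  Qop g B (fun i y => t * eta i y) (fun i y => t * w i y) j x.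
Proof.
rewrite /Qop mulrBr mulr_sumr; congr (_ - _); first by ring.
by apply: eq_bigr => i _; ring.
Qed.

Lemma zodesZ (t : C) g B b eta w eta' w' : zodes g B b eta w eta' w' ->
  zodes g B (fun j x => t * b j x) (fun j x => t * eta j x)
    (fun j x => t * w j x) (fun j x => t * eta' j x) (fun j x => t * w' j x).
Proof.
move=> [h1 h2 h3]; split=> [j x|j x|j kj].
- by apply: cder_eq (cderZ t (h1 j x)) _; ring.
- by apply: cder_eq (cderZ t (h2 j x)) _; rewrite -QopZ; ring.
- by rewrite h3 // mulr0.
Qed.

Lemma bddB N M (f h : R -> C) : bdd N f -> bdd M h -> bdd (N + M) (fun x => f x - h x).
Proof. by move=> h1 h2 x; apply: le_trans (cnB _ _) _; rewrite mulrDl lerD. Qed.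

Lemma bddD N M (f h : R -> C) : bdd N f -> bdd M h -> bdd (N + M) (fun x => f x + h x).
Proof. by move=> h1 h2 x; apply: le_trans (cnD _ _) _; rewrite mulrDl lerD. Qed.

Lemma bddZ (t : C) N (f : R -> C) : bdd N f -> bdd (cn t * N) (fun x => t * f x).
Proof. by move=> h x; rewrite cnM -mulrA ler_wpM2l // cn_ge0. Qed.

Lemma bdd0 : bdd 0 (fun=> 0).
Proof. by move=> x; rewrite cn0 mul0r. Qed.

Lemma psolB g B b eta w b2 y z : psol g B b eta w -> psol g B b2 y z ->
  psol g B (fun j x => b j x - b2 j x) (fun j x => eta j x - y j x)
    (fun j x => w j x - z j x).
Proof.
move=> [h1 [N hN]] [h2 [M hM]]; split; first exact: zodesB.
by exists (N + M) => j; split; apply: bddB; case: (hN j); case: (hM j).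
Qed.

Lemma psolZ (t : C) g B b eta w : psol g B b eta w ->
  psol g B (fun j x => t * b j x) (fun j x => t * eta j x) (fun j x => t * w j x).
Proof.
move=> [h1 [N hN]]; split; first exact: zodesZ.
by exists (cn t * N) => j; split; apply: bddZ; case: (hN j).
Qed.

Lemma psol_change g B b eta w g' B' b' : psol g B b eta w ->
  (forall j x, Qop g B eta w j x + b j x = Qop g' B' eta w j x + b' j x) ->
  psol g' B' b' eta w.
Proof.
move=> [[h1 h2 h3] h4] E; split => //; split => // j x.
by rewrite -E; exact: h2.
Qed.

Lemma cvg_shift1 (u : nat -> R) (l : R) : u n @[n --> \oo] --> l -> u n.+1 @[n --> \oo] --> l.
Proof. by move=> h; rewrite (cvg_shiftS u). Qed.

Lemma wt_ge0 x : 0 <= wt x. Proof. exact: ltW (wt_gt0 _ _ _ x). Qed.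

Lemma half_ge0 n : 0 <= (2^-1 : R) ^+ n.
Proof. by rewrite exprn_ge0 // invr_ge0. Qed.

Local Ltac nneg := repeat first [done | exact: wt_ge0 | exact: half_ge0
  | exact: expR_ge0 | exact: (cKM0 gc) | exact: (cKb0 gc) | exact: (caf0 gc) | apply: mulr_ge0 | apply: addr_ge0].

Lemma psol_exists g B b be : cn g <= a -> pot B -> (forall j, ccts (b j)) ->
  (forall j, bdd be (b j)) -> exists eta w, psol g B b eta w.
Proof.
move=> ga hB cb hb.
(* The iterates live in a sigma type of continuous bounded pairs, so that choice yields a step
   function that can be iterated from the zero pair. *)
pose T := {z : (idx -> R -> C) * (idx -> R -> C) | regular c z.1 z.2}.
have be0 : 0 <= be := bdd_ge0 (hb ord0).
have /choice [F hF] : forall z : T, exists z' : T,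
    zodes g B b (sval z).1 (sval z).2 (sval z').1 (sval z').2.
  move=> [[y z] /= hz].
  have [y' [z' [r h]]] := exists_step gc ga hB cb hb hz.
  by exists (exist _ (y', z') r).
have r0 : regular c (fun=> fun=> 0) (fun=> fun=> 0).
  by split=> [j|]; [split; exact: ccts_cst | exists 0 => j; split; exact: bdd0].
pose Z n := sval (iter n F (exist _ (_, _) r0)).
have hZ n : zodes g B b (Z n).1 (Z n).2 (Z n.+1).1 (Z n.+1).2 by exact: hF.
have bZ n : exists N, zbdd N (Z n).1 (Z n).2.
  by rewrite /Z; case: (iter _ _ _) => z [].
pose N0 := cc * be.
have N00 : 0 <= N0 by rewrite mulr_ge0 // cc0.
have dZ n j : bdd (N0 * 2^-1 ^+ n) (fun x => (Z n.+1).1 j x - (Z n).1 j x) /\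
    bdd (th * (N0 * 2^-1 ^+ n)) (fun x => (Z n.+1).2 j x - (Z n).2 j x).
  elim: n j => [|n IH] j.
    have [||h1 h2] := @step_est _ _ gc g B b _ _ _ _ 0 be ga hB (hZ 0%N) (bZ 1%N) _ _ hb j.
    - by move=> i; exact: bdd0.
    - by move=> i; rewrite mulr0; exact: bdd0.
    rewrite mul0r add0r in h1 h2; rewrite expr0 mulr1; split=> x.
      by rewrite subr0; exact: h1.
    by rewrite subr0; exact: h2.
  have := zodesB (hZ n.+1) (hZ n); set b' := fun _ => _ => hD.
  have [||||h1 h2] := @step_est _ _ gc g B b' _ _ _ _ (N0 * 2^-1 ^+ n) 0 ga hB hD _ _ _ _ j.
  - have [M1 h1] := bZ n.+2; have [M2 h2] := bZ n.+1; exists (M1 + M2) => i.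
    by split; apply: bddB; case: (h1 i); case: (h2 i).
  - by move=> i; case: (IH i).
  - by move=> i; case: (IH i).
  - by move=> i x; rewrite /b' subrr cn0 mul0r.
  have E : N0 * 2^-1 ^+ n / 2 + cc * 0 = N0 * 2^-1 ^+ n.+1 by rewrite exprS; ring.
  by rewrite E in h1 h2.
have /choice [eta1 heta] : forall jx : idx * R, exists l : C,
  [/\ complex.Re ((Z n).1 jx.1 jx.2) @[n --> \oo] --> complex.Re l,
    complex.Im ((Z n).1 jx.1 jx.2) @[n --> \oo] --> complex.Im l &
    forall n, cn ((Z n).1 jx.1 jx.2 - l) <= 4 * (N0 * wt jx.2) * 2^-1 ^+ n].
  move=> [j x]; apply: cgeom_cauchy => n.
  by have := (dZ n j).1 x => /=; rewrite -!mulrA (mulrC (wt x)).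
have /choice [w1 hw] : forall jx : idx * R, exists l : C,
  [/\ complex.Re ((Z n).2 jx.1 jx.2) @[n --> \oo] --> complex.Re l,
    complex.Im ((Z n).2 jx.1 jx.2) @[n --> \oo] --> complex.Im l &
    forall n, cn ((Z n).2 jx.1 jx.2 - l) <= 4 * (th * N0 * wt jx.2) * 2^-1 ^+ n].
  move=> [j x]; apply: cgeom_cauchy => n.
  by have := (dZ n j).2 x => /=; rewrite -!mulrA (mulrC (wt x)).
pose eta j x := eta1 (j, x); pose w j x := w1 (j, x).
have He n j x : cn ((Z n).1 j x - eta j x) <= 4 * (N0 * wt x) * 2^-1 ^+ n.
  by case: (heta (j, x)).
have Hw n j x : cn ((Z n).2 j x - w j x) <= th * (4 * (N0 * wt x) * 2^-1 ^+ n).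
  by case: (hw (j, x)) => _ _ /(_ n) /=; rewrite -!mulrA (mulrCA 4 th).
have Z0 : Z 0%N = ((fun=> fun=> 0), (fun=> fun=> 0)) by [].
have t0 := cth0 gc; have t1 := cth1 gc.
(* Geometric convergence in the weighted norm, made uniform on unit neighbourhoods; applied below to
   the right-hand sides of both equations. *)
have unif (dn : nat -> R -> C) (d : R -> C) (M : R) x : 0 <= M ->
    (forall n y, cn (dn n y - d y) <= M * (N0 * wt y) * 2^-1 ^+ n) ->
    forall e : R, 0 < e -> exists N, forall n y, (N <= n)%N -> `|y - x| <= 1 ->
     cn (dn n y - d y) <= e.
  move=> M0 hd e e0.
  pose S := M * N0 * (expR (k + L) * wt x).
  have S0 : 0 <= S by rewrite /S; by nneg.
  have [|N hN] := @geom_small R (e / (S + 1)); first by rewrite divr_gt0 //; lra.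
  exists N => n y Nn yx; apply: le_trans (hd n y) _.
  have h1 : M * (N0 * wt y) <= S.
    by rewrite mulrA; apply: ler_wpM2l; [nneg | exact: wt_loc].
  have h2 : (2^-1 : R) ^+ n <= e / (S + 1).
    apply: le_trans hN; rewrite -exprVn.
    by apply: ler_wiXn2l => //; rewrite ?invr_ge0 // invf_le1 // ler1n.
  have h0 : 0 <= M * (N0 * wt y) by nneg.
  apply: le_trans (ler_pM h0 (half_ge0 n) h1 h2) _.
  rewrite mulrCA; apply: ler_piMr; [exact: ltW | rewrite ler_pdivrMr; lra].
exists eta, w; split; last first.
  exists (4 * N0) => j; split=> x.
    by have := He 0%N j x; rewrite Z0 /= sub0r cnN expr0 mulr1 mulrA.
  have := Hw 0%N j x; rewrite Z0 /= sub0r cnN expr0 mulr1 mulrA => /le_trans; apply.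
  have : 0 <= 4 * (N0 * wt x) by nneg.
  by nra.
split=> [j x|j x|j kj].
- apply: (@cder_lim _ (fun n => (Z n.+1).1 j)
    (fun n x => - (kap j)%:C * (Z n.+1).1 j x + (Z n.+1).2 j x) (eta j)
    (fun x => - (kap j)%:C * eta j x + w j x) x 1 ltr01).
  + by move=> n y; case: (hZ n) => h _ _; exact: h.
  + by move=> y; apply: (@cvg_shift1 (fun n => complex.Re ((Z n).1 j y))); case: (heta (j, y)).
  + by move=> y; apply: (@cvg_shift1 (fun n => complex.Im ((Z n).1 j y))); case: (heta (j, y)).
  apply: (unif _ _ (4 * (KM + 1))); first nneg.
  move=> n y.
  have -> : - (kap j)%:C * (Z n.+1).1 j y + (Z n.+1).2 j y - (- (kap j)%:C * eta j y + w j y)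
    = ((Z n.+1).2 j y - w j y) - (kap j)%:C * ((Z n.+1).1 j y - eta j y) by ring.
  apply: le_trans (cnB _ _) _; rewrite cnM cnR (ger0_norm (ckap0 gc j)).
  have h1 := He n.+1 j y; have h2 := Hw n.+1 j y.
  have hS : 0 <= 4 * (N0 * wt y) * 2^-1 ^+ n by nneg.
  have E : 4 * (N0 * wt y) * 2^-1 ^+ n.+1 = 4 * (N0 * wt y) * 2^-1 ^+ n / 2 by rewrite exprS; ring.
  rewrite E in h1 h2; have := ler_pM (ckap0 gc j) (cn_ge0 _) (ckapM gc j) h1.
  have := cKM0 gc; nra.
- apply: (@cder_lim _ (fun n => (Z n.+1).2 j)
    (fun n x => (kap j)%:C * (Z n.+1).2 j x + (Qop g B (Z n).1 (Z n).2 j x + b j x)) (w j)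
    (fun x => (kap j)%:C * w j x + (Qop g B eta w j x + b j x)) x 1 ltr01).
  + by move=> n y; case: (hZ n) => _ h _; exact: h.
  + by move=> y; apply: (@cvg_shift1 (fun n => complex.Re ((Z n).2 j y))); case: (hw (j, y)).
  + by move=> y; apply: (@cvg_shift1 (fun n => complex.Im ((Z n).2 j y))); case: (hw (j, y)).
  have af0 := caf0 gc; have Kb0 := cKb0 gc.
  apply: (unif _ _ (4 * (KM + (af + 4 * Kb)))).
    nneg.
  move=> n y.
  have -> : (kap j)%:C * (Z n.+1).2 j y + (Qop g B (Z n).1 (Z n).2 j y + b j y)
     - ((kap j)%:C * w j y + (Qop g B eta w j y + b j y))
    = (kap j)%:C * ((Z n.+1).2 j y - w j y) + (Qop g B (Z n).1 (Z n).2 j y - Qop g B eta w j y) by ring.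
  rewrite QopB; apply: le_trans (cnD _ _) _; rewrite cnM cnR (ger0_norm (ckap0 gc j)).
  have h2 := Hw n.+1 j y.
  have hS : 0 <= 4 * (N0 * wt y) * 2^-1 ^+ n by nneg.
  have E : 4 * (N0 * wt y) * 2^-1 ^+ n.+1 = 4 * (N0 * wt y) * 2^-1 ^+ n / 2 by rewrite exprS; ring.
  rewrite E in h2; have h3 := ler_pM (ckap0 gc j) (cn_ge0 _) (ckapM gc j) h2.
  have h4 := Qop_bound gc (B := B) (eta := fun i t => (Z n).1 i t - eta i t)
     (w := fun i t => (Z n).2 i t - w i t) ga (fun i => He n i y) (Hw n j y)
     (fun i => let: And3 _ h _ := hB j i in h y).
  have := cKM0 gc; have := mulr_ge0 (cKM0 gc) hS => h5 h6.
  have h7 : KM * (th * (4 * (N0 * wt y) * 2^-1 ^+ n / 2)) <= KM * (4 * (N0 * wt y) * 2^-1 ^+ n).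
    by rewrite ler_wpM2l //; nra.
  have -> : 4 * (KM + (af + 4 * Kb)) * (N0 * wt y) * 2^-1 ^+ n =
    KM * (4 * (N0 * wt y) * 2^-1 ^+ n) + (af + 4 * Kb) * (4 * (N0 * wt y) * 2^-1 ^+ n) by ring.
  lra.
- have hn n : (Z n.+1).1 j X = 0 by case: (hZ n) => _ _ h; exact: h.
  apply/eqP; rewrite -cn_le0; apply: (@small_le0 R _ (4 * (N0 * wt X) + 1)).
    rewrite ltr_wpDl //; nneg.
  move=> e e0; have [n Hn] := geom_small e0.
  have := He n.+1 j X; rewrite hn sub0r cnN => /le_trans; apply.
  have P : 0 <= 4 * (N0 * wt X) by nneg.
  have h1 : (2^-1 : R) ^+ n.+1 <= e.
    apply: le_trans Hn; rewrite -exprVn.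
    by apply: ler_wiXn2l => //; rewrite ?invr_ge0 // invf_le1 // ler1n.
  have := ler_wpM2l P h1; nra.
Qed.

End Solve.

(** * The four solutions [rsol] and their Lipschitz dependence on the data *)

Section Family.
Context {R : realType}.
Local Notation C := R[i].
Variable c : @consts R.
Hypothesis gc : good_consts c.

Local Notation k := (ck c).
Local Notation L := (cL c).
Local Notation X := (cX c).
Local Notation a := (ca c).
Local Notation Kb := (cKb c).
Local Notation KM := (cKM c).
Local Notation kap := (ckap c).
Local Notation sg := (csg c).
Local Notation wt := (wt k L X).
Local Notation bdd := (bdd k L X).
Local Notation pot := (pot c).
Local Notation Qop := (Qop c).
Local Notation zbdd := (zbdd c).
Local Notation psol := (psol c).
Local Notation cc := (cc c).
Local Notation sys := ((idx -> R -> C) * (idx -> R -> C))%type.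
Implicit Types (B : idx -> idx -> R -> R) (eta w b : idx -> R -> C) (g h : C) (F G : sys).

Local Ltac nneg := repeat first [done | exact: wt_ge0 | exact: expR_ge0 | exact: cn_ge0
  | exact: normr_ge0 | exact: (cKM0 gc) | exact: (cKb0 gc) | exact: (cX0 gc) | exact: (ltW (ck0 gc))
  | exact: (ltW (ca0 gc)) | exact: cc0 | apply: mulr_ge0 | apply: addr_ge0].

Definition sol g B b : sys := xget ((fun=> fun=> 0), (fun=> fun=> 0))
  [set z | psol g B b z.1 z.2].

Lemma psol_solP g B b be : cn g <= a -> pot B -> (forall j, ccts (b j)) ->
  (forall j, bdd be (b j)) ->
  psol g B b (sol g B b).1 (sol g B b).2 /\ zbdd (2 * cc * be) (sol g B b).1 (sol g B b).2.
Proof.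
move=> ga hB cb hb; have [eta [w hz]] := psol_exists gc ga hB cb hb.
have H : psol g B b (sol g B b).1 (sol g B b).2.
  by rewrite /sol; case: xgetP => [z -> //|/(_ (eta, w))].
by split => //; exact: (psol_est gc ga hB H hb).
Qed.

Lemma psol_uniq g B b eta w y z : cn g <= a -> pot B -> psol g B b eta w ->
  psol g B b y z -> (forall j x, eta j x = y j x /\ w j x = z j x).
Proof.
move=> ga hB h1 h2 j x.
have := psol_est gc ga hB (psolB h1 h2) (be := 0) _ => /(_ _)/wrap[].
  by move=> i t; rewrite subrr cn0 mul0r.
rewrite mulr0 => /(_ j) [/(_ x) + /(_ x)].
by rewrite !mul0r !cn_le0 !subr_eq0 => /eqP -> /eqP ->.
Qed.

Definition dsm (d : R) (D : R -> R) := (forall x, `|D x| <= d) /\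
  (forall x, X <= x -> `|D x| <= d * expR (- k * x)).

(** The leading term of a mode with exponent 0 is a constant and so lies outside the weighted space.
    Its products with [kap j], with [sg j - 1] and with a decaying potential do lie in it, and these
    are the only ways in which it enters [Qop]. *)
Definition pb (M : R) F := forall j,
  [/\ bdd M (F.2 j), bdd M (fun x => (kap j)%:C * F.1 j x),
      bdd M (fun x => (sg j - 1)%:C * F.1 j x) &
      forall d D, dsm d D -> bdd (d * M) (fun x => (D x)%:C * F.1 j x)].

Lemma dsm_ge0 d D : dsm d D -> 0 <= d.
Proof. by case=> /(_ 0) /(le_trans (normr_ge0 _)). Qed.

Lemma pb_zbdd N F : zbdd N F.1 F.2 -> pb ((3 + KM) * N) F.
Proof.
move=> h j; have [h1 h2] := h j; have N0 := bdd_ge0 h2; have M0 := cKM0 gc.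
have MN := mulr_ge0 M0 N0.
split=> [|||d D hD].
- by apply: bdd_le h2 _; lra.
- apply: bdd_le (bddZ _ h1) _; rewrite cnR ger0_norm ?(ckap0 gc) //.
  by apply: ler_wpM2r => //; have := ckapM gc j; lra.
- apply: bdd_le (bddZ _ h1) _; rewrite cnR.
  by apply: ler_wpM2r => //; have := csg2 gc j; lra.
- have d0 := dsm_ge0 hD.
  move=> x; rewrite cnM cnR; apply: le_trans (ler_pM (normr_ge0 _) (cn_ge0 _) (hD.1 x) (h1 x)) _.
  rewrite -!mulrA ler_wpM2l // mulrA ler_wpM2r ?wt_ge0 //; lra.
Qed.

Definition sysD F G : sys := ((fun j x => F.1 j x + G.1 j x), (fun j x => F.2 j x + G.2 j x)).
Definition sysB F G : sys := ((fun j x => F.1 j x - G.1 j x), (fun j x => F.2 j x - G.2 j x)).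

Lemma pbD M N F G : pb M F -> pb N G -> pb (M + N) (sysD F G).
Proof.
move=> h1 h2 j; have [a1 a2 a3 a4] := h1 j; have [b1 b2 b3 b4] := h2 j.
split=> [|||d D hD] /=; [exact: bddD| | | ].
- by move=> x; rewrite mulrDr; exact: (bddD a2 b2).
- by move=> x; rewrite mulrDr; exact: (bddD a3 b3).
- by move=> x; rewrite !mulrDr; exact: (bddD (a4 d D hD) (b4 d D hD)).
Qed.

Lemma pb_le M N F : pb M F -> M <= N -> pb N F.
Proof.
move=> h1 MN j; have [a1 a2 a3 a4] := h1 j; split=> [|||d D hD].
- exact: bdd_le a1 MN.
- exact: bdd_le a2 MN.
- exact: bdd_le a3 MN.
- by apply: bdd_le (a4 d D hD) _; rewrite ler_wpM2l // (dsm_ge0 hD).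
Qed.

Definition dpot (d : R) B B' := forall i j, dsm d (fun x => B i j x - B' i j x).

(** [P1] and [P2] are the coefficients of [g] and [g ^+ 2] in [Qop]; they make the factor [g - g']
    explicit in a difference of two [Qop]. *)
Definition P1 F : idx -> R -> C := fun j x => 2 * (F.2 j x - (kap j)%:C * F.1 j x).
Definition P2 F : idx -> R -> C := fun j x => (sg j - 1)%:C * F.1 j x.

Lemma P1_bdd M F j : pb M F -> bdd (4 * M) (P1 F j).
Proof.
move=> /(_ j) [h1 h2 _ _]; apply: bdd_le (bddZ 2 (bddB h1 h2)) _.
have -> : (2 : C) = (2 : R)%:C by rewrite rmorphMn rmorph1.
rewrite cnR ger0_norm //; lra.
Qed.

Lemma P2_bdd M F j : pb M F -> bdd M (P2 F j).
Proof. by move=> /(_ j) []. Qed.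

Lemma QopE g B g' B' F j x : Qop g B F.1 F.2 j x - Qop g' B' F.1 F.2 j x =
  (g - g') * (P1 F j x + (g + g') * P2 F j x)
  - \sum_i (B j i x - B' j i x)%:C * F.1 i x.
Proof.
rewrite /Qop /P1 /P2.
under [in RHS]eq_bigr do rewrite rmorphB /= mulrBl.
rewrite sumrB; ring.
Qed.

Lemma QopE1 g g' B F j x : Qop g B F.1 F.2 j x - Qop g' B F.1 F.2 j x =
  (g - g') * (P1 F j x + (g + g') * P2 F j x).
Proof.
rewrite QopE big1 ?subr0 // => i _; by rewrite subrr mul0r.
Qed.

Lemma sum4_le (u : R) : \sum_(i < 2 + 2) u = 4 * u.
Proof. by rewrite sumr_const card_ord mulr_natl. Qed.

Definition c4 := 4 + 2 * a.

Lemma c40 : 0 <= c4. Proof. by rewrite /c4; have := ca0 gc; lra. Qed.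

Lemma Pg_bdd M F g g' j : cn g <= a -> cn g' <= a -> pb M F ->
  bdd (c4 * M) (fun x => P1 F j x + (g + g') * P2 F j x).
Proof.
move=> ga ga' hF; have M0 : 0 <= M := bdd_ge0 (P2_bdd j hF).
apply: bdd_le (bddD (P1_bdd j hF) (bddZ (g + g') (P2_bdd j hF))) _.
have h : cn (g + g') <= 2 * a by apply: le_trans (cnD _ _) _; lra.
by have := ler_wpM2r M0 h; rewrite /c4; lra.
Qed.

Lemma Qdiff M d F g B g' B' j : cn g <= a -> cn g' <= a -> dpot d B B' -> pb M F ->
  bdd (c4 * (cn (g - g') + d) * M) (fun x => Qop g B F.1 F.2 j x - Qop g' B' F.1 F.2 j x).
Proof.
move=> ga ga' hd hF x; have M0 : 0 <= M := bdd_ge0 (P2_bdd j hF).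
have d0 := dsm_ge0 (hd j j).
rewrite QopE; apply: le_trans (cnB _ _) _.
have h1 := Pg_bdd j ga ga' hF x.
have h2 : cn (\sum_i (B j i x - B' j i x)%:C * F.1 i x) <= 4 * (d * M * wt x).
  apply: le_trans (cn_sum _ _ _) _; rewrite -sum4_le; apply: ler_sum => i _.
  by have [_ _ _ /(_ _ _ (hd j i)) /(_ x)] := hF i.
have h3 := ler_wpM2l (cn_ge0 (g - g')) h1; rewrite -cnM in h3.
have : 0 <= a * (d * M * wt x) by nneg.
move: h2 h3; rewrite /c4; lra.
Qed.

(** The free mode [i], which solves the first equation with [w = 0]. It is normalised at [X] because
    the corrections with nonzero exponent vanish there. *)
Definition chi0 (i j : idx) (x : R) : C :=
  if i == j then (expR (- kap j * (x - X)))%:C else 0.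

Definition base i : sys := (chi0 i, fun=> fun=> 0).

Lemma der_chi0 i j x : cder (chi0 i j) x (- (kap j)%:C * chi0 i j x).
Proof.
rewrite /chi0; case: eqP => _; last by rewrite mulr0; exact: cder_cst.
apply: cder_eq (cderR (der_exp (derZ _ (derB (der_id x) (der_cst X x))))) _.
by rewrite subr0 mulr1 rmorphM rmorphN.
Qed.

Lemma ccts_chi0 i j : ccts (chi0 i j).
Proof. exact: cder_ccts (der_chi0 i j). Qed.

Definition S0 := expR (k * X) * (3 + KM).

Lemma kapL j : kap j <= L.
Proof.
case: (ckapP gc j) => [[-> _]|[_]]; first exact: ltW (cL0 gc).
by have := ckap0 gc j; lra.
Qed.

Lemma expX_le (kp : R) x : 0 <= kp -> kp <= L -> x <= X ->
  expR (- kp * (x - X)) <= expR (k * X) * wt x.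
Proof.
move=> h0 h1 xX; rewrite wt_le // -expRD ler_expR.
have := ler_wpM2r (_ : 0 <= X - x) h1; have := mulr_ge0 (ltW (ck0 gc)) (_ : 0 <= X - x).
by rewrite subr_ge0 => /(_ xX) ? /(_ xX) ?; lra.
Qed.

(** For exponent 0 the factors [kap j] and [sg j - 1] vanish and a decaying potential supplies the
    missing decay; for a nonzero exponent kap >= k puts e^{-kap (x - X)} itself in the weighted
    space. *)
Lemma base_pb i : pb S0 (base i).
Proof.
have M0 := cKM0 gc; have e0 : 0 < expR (k * X) := expR_gt0 _.
have S00 : 0 <= S0 by rewrite /S0; nneg.
have z : bdd S0 (fun=> 0) by apply: bdd_le (bdd0 c) _.
have hyp j x : kap j != 0 -> expR (- kap j * (x - X)) <= expR (k * X) * wt x.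
  move=> kj; have [k1 k2] := ckap_neq0 gc kj.
  have [xX|/ltW Xx] := leP x X; first exact: expX_le (ckap0 gc j) (kapL j) xX.
  rewrite wt_ge // -expRD ler_expR.
  have h : k <= kap j by have := ck0 gc; lra.
  have := ler_wpM2r (_ : 0 <= x - X) h.
  by rewrite subr_ge0 => /(_ Xx) ?; lra.
have bd j (t : R) : `|t| <= 3 + KM -> kap j != 0 -> bdd S0 (fun x => t%:C * chi0 i j x).
  move=> tM kj x; rewrite /chi0; case: eqP => _; last by rewrite mulr0; exact: z.
  rewrite cnM !cnR (ger0_norm (expR_ge0 _)).
  have -> : S0 * wt x = (3 + KM) * (expR (k * X) * wt x) by rewrite /S0; ring.
  by apply: ler_pM; [exact: normr_ge0 | exact: expR_ge0 | | exact: hyp].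
move=> j; split=> [|||d D hD] //=.
- have [kj|kj] := eqVneq (kap j) 0; first by move=> x; rewrite kj mul0r; exact: z.
  by apply: bd => //; rewrite ger0_norm ?(ckap0 gc) //; have := ckapM gc j; lra.
- have [kj|kj] := eqVneq (kap j) 0.
    case: (ckapP gc j) => [[_ ->]|[h1 _]]; last by have := ck0 gc; lra.
    by move=> x; rewrite subrr mul0r; exact: z.
  by apply: bd => //; have := csg2 gc j; lra.
- have d0 := dsm_ge0 hD.
  move=> x; rewrite /chi0; case: eqP => _; last first.
    by rewrite mulr0 cn0; nneg.
  rewrite cnM !cnR (ger0_norm (expR_ge0 _)).
  have K3 : expR (k * X) <= S0 by rewrite /S0 ler_peMr ?ltW //; lra.
  have [xX|/ltW Xx] := leP x X.
    rewrite -mulrA; apply: ler_pM; [exact: normr_ge0 | exact: expR_ge0 | exact: hD.1|].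
    apply: le_trans (expX_le (ckap0 gc j) (kapL j) xX) _.
    by rewrite ler_wpM2r // wt_ge0.
  have h1 : expR (- kap j * (x - X)) <= 1.
    rewrite -expR0 ler_expR mulNr oppr_le0 mulr_ge0 ?(ckap0 gc) //; lra.
  have h2 : 1 <= S0.
    apply: le_trans K3; rewrite -expR0 ler_expR; nneg.
  have := ler_pM (normr_ge0 _) (expR_ge0 _) (hD.2 x Xx) h1.
  rewrite wt_ge // mulr1 => /le_trans; apply.
  rewrite ler_wpM2r ?expR_ge0 // ler_peMr //.
Qed.

Definition src g B i : idx -> R -> C := Qop g B (base i).1 (base i).2.

Lemma pot_dpot B : pot B -> dpot Kb B (fun _ _ _ => 0).
Proof.
move=> hB i j; case: (hB i j) => _ h1 h2; split=> x; first by rewrite subr0.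
by move=> hx; rewrite subr0; exact: h2.
Qed.

Lemma Qop0 F j x : Qop 0 (fun _ _ _ => 0) F.1 F.2 j x = 0.
Proof.
rewrite /Qop big1 => [|i _]; last by rewrite mul0r.
by rewrite expr0n /=; ring.
Qed.

Lemma cn0a : cn (0 : C) <= a. Proof. by rewrite cn0 ltW // (ca0 gc). Qed.

Definition be0 := c4 * (a + Kb) * S0.

Lemma src_bdd g B i j : cn g <= a -> pot B -> bdd be0 (src g B i j).
Proof.
move=> ga hB x.
have := Qdiff j ga cn0a (pot_dpot hB) (base_pb i) x.
rewrite Qop0 !subr0 => /le_trans; apply; rewrite ler_wpM2r ?wt_ge0 //.
rewrite /be0 ler_wpM2r // ?ler_wpM2l ?c40 ?lerD //.
by rewrite /S0 mulr_ge0 ?expR_ge0 //; have := cKM0 gc; lra.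
Qed.

Lemma src_ccts g B i j : pot B -> ccts (src g B i j).
Proof. by move=> hB; apply: ccts_Qop => //; [move=> l; exact: ccts_chi0|exact: ccts_cst]. Qed.

(** The solution asymptotic to the mode [i], in the variables (chi, w); [psi] below undoes the
    change of variables. *)
Definition rsol g B i : sys := sysD (base i) (sol g B (src g B i)).

Definition CE := 2 * cc * be0.

Lemma rsolP g B i : cn g <= a -> pot B ->
  psol g B (src g B i) (sol g B (src g B i)).1 (sol g B (src g B i)).2 /\
  zbdd CE (sol g B (src g B i)).1 (sol g B (src g B i)).2.
Proof.
by move=> ga hB; apply: psol_solP => // j; [exact: src_ccts | exact: src_bdd].
Qed.

Definition MF := S0 + (3 + KM) * CE.

Lemma rsol_pb g B i : cn g <= a -> pot B -> pb MF (rsol g B i).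
Proof.
move=> ga hB; apply: pbD; first exact: base_pb.
by apply: pb_zbdd; case: (rsolP i ga hB).
Qed.

Lemma QopD g B F G j x : Qop g B F.1 F.2 j x + Qop g B G.1 G.2 j x =
  Qop g B (sysD F G).1 (sysD F G).2 j x.
Proof.
rewrite /Qop /=; under [in RHS]eq_bigr do rewrite mulrDr.
rewrite big_split /=; ring.
Qed.

Lemma cder_rsol g B i j x : cn g <= a -> pot B ->
  cder ((rsol g B i).1 j) x (- (kap j)%:C * (rsol g B i).1 j x + (rsol g B i).2 j x) /\
  cder ((rsol g B i).2 j) x ((kap j)%:C * (rsol g B i).2 j x +
     Qop g B (rsol g B i).1 (rsol g B i).2 j x).
Proof.
move=> ga hB; have [[[h1 h2 _] _] _] := rsolP i ga hB; split.
  by apply: cder_eq (cderD (der_chi0 i j x) (h1 j x)) _ => /=; ring.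
apply: cder_eq (cderD (cder_cst 0 x) (h2 j x)) _.
by rewrite -QopD /src /=; ring.
Qed.

(** The free terms cancel in the difference, which therefore lies in the weighted space, where
    [psol_est] applies. *)
Lemma psol_rsolB g B g' B' i : cn g <= a -> pot B -> cn g' <= a -> pot B' ->
  psol g B (fun j x => Qop g B (rsol g' B' i).1 (rsol g' B' i).2 j x
                      - Qop g' B' (rsol g' B' i).1 (rsol g' B' i).2 j x)
    (sysB (rsol g B i) (rsol g' B' i)).1 (sysB (rsol g B i) (rsol g' B' i)).2.
Proof.
move=> ga hB ga' hB'.
have [h1 _] := rsolP i ga hB; have [h2 _] := rsolP i ga' hB'.
set z := sol g B _ in h1; set z' := sol g' B' _ in h2.
have h3 : psol g B (fun j x => src g' B' i j x + Qop g' B' z'.1 z'.2 j x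
     - Qop g B z'.1 z'.2 j x) z'.1 z'.2.
  by apply: psol_change h2 _ => j x; ring.
have := psolB h1 h3.
have -> : (fun j x => z.1 j x - z'.1 j x) = (sysB (rsol g B i) (rsol g' B' i)).1.
  by apply/funext => j; apply/funext => x; rewrite /rsol /= -/z -/z'; ring.
have -> : (fun j x => z.2 j x - z'.2 j x) = (sysB (rsol g B i) (rsol g' B' i)).2.
  by apply/funext => j; apply/funext => x; rewrite /rsol /= -/z -/z'; ring.
congr psol; apply/funext => j; apply/funext => x.
by rewrite /rsol -!QopD -/z' /src; ring.
Qed.

Lemma rsol_dep d g B g' B' i : cn g <= a -> pot B -> cn g' <= a -> pot B' ->
  dpot d B B' ->
  zbdd (2 * cc * (c4 * (cn (g - g') + d) * MF))
    (sysB (rsol g B i) (rsol g' B' i)).1 (sysB (rsol g B i) (rsol g' B' i)).2.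
Proof.
move=> ga hB ga' hB' hd; apply: (psol_est gc ga hB (psol_rsolB i ga hB ga' hB')) => j.
exact: Qdiff (rsol_pb i ga' hB').
Qed.

End Family.

(** * Analyticity and strict differentiability *)

Section Taylor.
Context {R : realType}.
Local Notation C := R[i].
Implicit Types (f : C -> C) (z : C).

(* Analyticity of f at z0, through the geometrically bounded remainders
   f_n(z) = a_n + (z - z0) f_(n+1)(z) of its Taylor expansion. *)
Definition taylor_at f z0 := exists r K A : R, exists fn : nat -> C -> C,
  exists an : nat -> C, [/\ 0 < r, 0 <= A,
    forall z, cn (z - z0) < r -> fn 0%N z = f z &
    forall n z, cn (z - z0) < r -> fn n z = an n + (z - z0) * fn n.+1 z /\
      cn (fn n z) <= K * A ^+ n].

Lemma taylor_ext f g z0 : (forall z, f z = g z) -> taylor_at f z0 -> taylor_at g z0.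
Proof. by move=> /funext ->. Qed.

Lemma taylor_cst (c : C) z0 : taylor_at (fun=> c) z0.
Proof.
exists 1, (cn c), 1, (fun n _ => if n is 0%N then c else 0), (fun n => if n is 0%N then c else 0).
split => // n z _; split; first by case: n => [|n]; rewrite mulr0 addr0.
by rewrite expr1n mulr1; case: n => [|n] //; rewrite cn0 cn_ge0.
Qed.

(** Evaluating the recursion at [z0] gives [an n = fn n z0], so the remainder bound passes to the
    coefficients. [1 <= A] allows bounds with different rates to be merged. *)
Lemma taylor_wlog f z0 : taylor_at f z0 -> exists r K A : R,
  exists fn : nat -> C -> C, exists an : nat -> C, [/\ 0 < r, 0 <= K, 1 <= A,
    forall z, cn (z - z0) < r -> fn 0%N z = f z &
    forall n z, cn (z - z0) < r -> [/\ fn n z = an n + (z - z0) * fn n.+1 z,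
      cn (fn n z) <= K * A ^+ n & cn (an n) <= K * A ^+ n]].
Proof.
move=> [r [K [A [fn [an [r0 A0 h0 h]]]]]].
have hz0 : cn (z0 - z0) < r by rewrite subrr cn0.
have K0 : 0 <= K.
  by have := (h 0%N z0 hz0).2; rewrite expr0 mulr1; apply: le_trans; exact: cn_ge0.
have AA n : K * A ^+ n <= K * (1 + A) ^+ n.
  by rewrite ler_wpM2l // lerXn2r ?nnegrE //; lra.
exists r, K, (1 + A), fn, an; split => //; first by lra.
move=> n z hz; have [h1 h2] := h n z hz; split => //; first exact: le_trans (AA n).
have [h3 h4] := h n z0 hz0; rewrite subrr mul0r addr0 in h3.
by rewrite -h3; exact: le_trans (AA n).
Qed.

Lemma taylorD f g z0 : taylor_at f z0 -> taylor_at g z0 ->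
  taylor_at (fun z => f z + g z) z0.
Proof.
move=> /taylor_wlog[r [K [A [fn [an [r0 K0 A1 f0 hf]]]]]].
move=> /taylor_wlog[s [M [B [gn [bn [s0 M0 B1 g0 hg]]]]]].
exists (Num.min r s), (K + M), (A + B), (fun n z => fn n z + gn n z), (fun n => an n + bn n).
have AB n : A ^+ n <= (A + B) ^+ n by rewrite lerXn2r ?nnegrE //; lra.
have BA n : B ^+ n <= (A + B) ^+ n by rewrite lerXn2r ?nnegrE //; lra.
split; [by rewrite lt_min r0|lra| | ].
  by move=> z; rewrite lt_min => /andP[/f0 -> /g0 ->].
move=> n z; rewrite lt_min => /andP[/(hf n) [h1 h2 _] /(hg n) [h3 h4 _]].
split; first by rewrite h1 h3; ring.
apply: le_trans (cnD _ _) _; rewrite mulrDl; apply: lerD.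
  by apply: le_trans h2 _; rewrite ler_wpM2l.
by apply: le_trans h4 _; rewrite ler_wpM2l.
Qed.

(** Leibniz form of the remainder: [n.+1] terms, each at most [K * M * (A + B) ^+ n], and n + 1 <=
    2^n, whence the rate [2 * D]. *)
Lemma taylorM f g z0 : taylor_at f z0 -> taylor_at g z0 ->
  taylor_at (fun z => f z * g z) z0.
Proof.
move=> /taylor_wlog[r [K [A [fn [an [r0 K0 A1 f0 hf]]]]]].
move=> /taylor_wlog[s [M [B [gn [bn [s0 M0 B1 g0 hg]]]]]].
pose D := A + B.
have A0 : 0 <= A by lra.
have B0 : 0 <= B by lra.
have D0 : 0 <= D by rewrite /D; lra.
have AD n : A ^+ n <= D ^+ n by rewrite lerXn2r ?nnegrE // /D; lra.
have BD n : B ^+ n <= D ^+ n by rewrite lerXn2r ?nnegrE // /D; lra.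
exists (Num.min r s), (K * M), (2 * D).
exists (fun n z => \sum_(i < n) an i * gn (n - i)%N z + fn n z * gn 0%N z).
exists (fun n => \sum_(i < n.+1) an i * bn (n - i)%N).
split; [by rewrite lt_min r0|by rewrite mulr_ge0| | ].
  by move=> z; rewrite lt_min => /andP[/f0 h1 /g0 h2]; rewrite big_ord0 add0r h1 h2.
move=> n z; rewrite lt_min => /andP[zr zs]; split.
  rewrite !big_ord_recr /= subnn subSn // subnn.
  have [-> _ _] := hf n z zr.
  have E1 : \sum_(i < n) an i * gn (n - i)%N z =
     \sum_(i < n) an i * bn (n - i)%N + (z - z0) * \sum_(i < n) an i * gn (n - i).+1 z.
    rewrite mulr_sumr -big_split /=; apply: eq_bigr => i _.
    by have [-> _ _] := hg (n - i)%N z zs; ring.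
  have E2 : \sum_(i < n) an i * gn (n.+1 - i)%N z = \sum_(i < n) an i * gn (n - i).+1 z.
    by apply: eq_bigr => i _; rewrite subSn // ltnW.
  rewrite E1 E2; move: (\sum_(i < n) _) (\sum_(i < n) _) => S1 S2.
  by have [-> _ _] := hg 0%N z zs; ring.
apply: le_trans (cnD _ _) _.
have t1 : cn (\sum_(i < n) an i * gn (n - i)%N z) <= \sum_(i < n) (K * M * D ^+ n).
  apply: le_trans (cn_sum _ _ _) _; apply: ler_sum => i _.
  have [_ _ h1] := hf i z zr; have [_ h2 _] := hg (n - i)%N z zs.
  rewrite cnM; apply: le_trans (ler_pM (cn_ge0 _) (cn_ge0 _) h1 h2) _.
  rewrite mulrACA ler_wpM2l ?mulr_ge0 //.
  rewrite -[in D ^+ n](subnKC (ltnW (ltn_ord i))) exprD.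
  by apply: ler_pM; rewrite ?exprn_ge0.
have t2 : cn (fn n z * gn 0%N z) <= K * M * D ^+ n.
  have [_ h1 _] := hf n z zr; have [_ h2 _] := hg 0%N z zs.
  rewrite cnM; apply: le_trans (ler_pM (cn_ge0 _) (cn_ge0 _) h1 h2) _.
  by rewrite expr0 mulr1 mulrAC ler_wpM2l ?mulr_ge0.
rewrite sumr_const card_ord in t1; apply: le_trans (lerD t1 t2) _.
have T0 : 0 <= K * M * D ^+ n by rewrite mulr_ge0 ?exprn_ge0 // mulr_ge0.
have -> : K * M * (2 * D) ^+ n = 2 ^+ n * (K * M * D ^+ n) by rewrite exprMn; ring.
have -> : (K * M * D ^+ n) *+ n + K * M * D ^+ n = n.+1%:R * (K * M * D ^+ n).
  by rewrite mulr_natl mulrSr.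
rewrite ler_wpM2r // -natrX ler_nat; exact: ltn_expl.
Qed.

Lemma taylorN f z0 : taylor_at f z0 -> taylor_at (fun z => - f z) z0.
Proof.
move=> h; apply: taylor_ext (taylorM (taylor_cst (-1) z0) h) => z; exact: mulN1r.
Qed.

Lemma taylorB f g z0 : taylor_at f z0 -> taylor_at g z0 ->
  taylor_at (fun z => f z - g z) z0.
Proof. by move=> h1 h2; apply: taylorD => //; exact: taylorN. Qed.

Lemma taylor_sum (I : Type) (r : seq I) (F : I -> C -> C) z0 :
  (forall i, taylor_at (F i) z0) -> taylor_at (fun z => \sum_(i <- r) F i z) z0.
Proof.
move=> h; elim: r => [|i r IH].
  by apply: taylor_ext (taylor_cst 0 z0) => z; rewrite big_nil.
by apply: taylor_ext (taylorD (h i) IH) => z; rewrite big_cons.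
Qed.

Lemma taylor_prod (I : Type) (r : seq I) (F : I -> C -> C) z0 :
  (forall i, taylor_at (F i) z0) -> taylor_at (fun z => \prod_(i <- r) F i z) z0.
Proof.
move=> h; elim: r => [|i r IH].
  by apply: taylor_ext (taylor_cst 1 z0) => z; rewrite big_nil.
by apply: taylor_ext (taylorM (h i) IH) => z; rewrite big_cons.
Qed.

Lemma taylor_id z0 : taylor_at (fun z => z) z0.
Proof.
exists 1, (1 + cn z0), 1, (fun n z => if n is n'.+1 then (if n' is 0%N then 1 else 0) else z),
  (fun n => if n is n'.+1 then (if n' is 0%N then 1 else 0) else z0).
split => // n z hz; split.
  case: n => [|[|n]]; rewrite ?mulr1 ?mulr0 ?addr0 //; first by rewrite addrC subrK.
rewrite expr1n mulr1; case: n => [|[|n]].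
- have -> : z = (z - z0) + z0 by ring.
  by apply: le_trans (cnD _ _) _; lra.
- by rewrite cn1; have := cn_ge0 z0; lra.
- by rewrite cn0; have := cn_ge0 z0; lra.
Qed.

Lemma taylor_det (n : nat) (M : C -> 'M[C]_n) z0 :
  (forall i j, taylor_at (fun z => M z i j) z0) -> taylor_at (fun z => \det (M z)) z0.
Proof.
move=> h; rewrite /determinant; apply: taylor_sum => s; apply: taylorM.
  exact: taylor_cst.
by apply: taylor_prod => i.
Qed.

Lemma taylor_expand f z0 : taylor_at f z0 -> exists r K : R, exists d : C,
  [/\ 0 < r, 0 <= K, forall z, cn (z - z0) < r -> cn (f z - f z0) <= K * cn (z - z0) &
   forall z, cn (z - z0) < r -> cn (f z - f z0 - d * (z - z0)) <= K * cn (z - z0) ^+ 2].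
Proof.
move=> /taylor_wlog[r [K [A [fn [an [r0 K0 A1 f0 hf]]]]]].
have hz0 : cn (z0 - z0) < r by rewrite subrr cn0.
have e0 : f z0 = an 0%N.
  by rewrite -f0 //; have [-> _ _] := hf 0%N z0 hz0; rewrite subrr mul0r addr0.
have A0 : 0 <= A by lra.
have KA : K * A <= K * A ^+ 2 by rewrite ler_wpM2l //; nra.
exists r, (K * A ^+ 2), (an 1%N); split => // [|z hz|z hz].
- by rewrite mulr_ge0 // exprn_ge0.
- have [h1 _ _] := hf 0%N z hz; have [_ h2 _] := hf 1%N z hz.
  have -> : f z - f z0 = (z - z0) * fn 1%N z by rewrite e0 -f0 // h1; ring.
  rewrite cnM mulrC ler_wpM2r ?cn_ge0 //; apply: le_trans h2 _; by rewrite expr1.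
- have [h1 _ _] := hf 0%N z hz; have [h2 _ _] := hf 1%N z hz; have [_ h3 _] := hf 2%N z hz.
  have -> : f z - f z0 - an 1%N * (z - z0) = (z - z0) ^+ 2 * fn 2%N z.
    by rewrite e0 -f0 // h1 h2; ring.
  by rewrite cnM cnX mulrC ler_wpM2r ?exprn_ge0 ?cn_ge0.
Qed.

(** Inductively each remainder vanishes at the nearby zeros of [f], hence so does its value at [z0],
    and all coefficients are 0. Then f = (z - z0)^n fn_n is at most K / 2^n as soon as |z - z0| < 1
    / (2A). *)
Lemma taylor_zero f z0 : taylor_at f z0 ->
  (forall d : R, 0 < d -> exists z, [/\ 0 < cn (z - z0), cn (z - z0) < d & f z = 0]) ->
  exists2 r : R, 0 < r & forall z, cn (z - z0) < r -> f z = 0.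
Proof.
move=> /taylor_wlog[r [K [A [fn [an [r0 K0 A1 f0 hf]]]]]] hacc.
have A0 : 0 < A by lra.
have H n : (forall z, 0 < cn (z - z0) -> cn (z - z0) < r -> f z = 0 -> fn n z = 0) /\
   an n = 0.
  have step m : (forall z, 0 < cn (z - z0) -> cn (z - z0) < r -> f z = 0 -> fn m z = 0) ->
     an m = 0.
    move=> hz; apply/eqP; rewrite -cn_le0.
    have P : 0 <= K * A ^+ m.+1 by rewrite mulr_ge0 // exprn_ge0 // ltW.
    apply: (@small_le0 R _ (K * A ^+ m.+1 + 1)) => [|e e0]; first by lra.
    have [|z [z1 z2 z3]] := hacc (Num.min e r); first by rewrite lt_min e0.
    move: z2; rewrite lt_min => /andP[ze zr].
    have [+ _ _] := hf m z zr; rewrite hz // => /eqP; rewrite eq_sym addr_eq0 => /eqP ->.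
    have [_ h _] := hf m.+1 z zr.
    rewrite cnN cnM; apply: le_trans (ler_pM (cn_ge0 _) (cn_ge0 _) (ltW ze) h) _.
    rewrite mulrC; nra.
  elim: n => [|n [IH1 IH2]].
    have h : forall z, 0 < cn (z - z0) -> cn (z - z0) < r -> f z = 0 -> fn 0%N z = 0.
      by move=> z _ /f0 ->.
    by split => //; exact: step.
  have h : forall z, 0 < cn (z - z0) -> cn (z - z0) < r -> f z = 0 -> fn n.+1 z = 0.
    move=> z h1 h2 h3; have [+ _ _] := hf n z h2; rewrite IH1 // IH2 add0r => /eqP.
    by rewrite eq_sym mulf_eq0 -cn_eq0 gt_eqF //= => /eqP.
  by split => //; exact: step.
exists (Num.min r (2 * A)^-1); first by rewrite lt_min r0 invr_gt0 mulr_gt0.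
move=> z; rewrite lt_min => /andP[zr zA].
have E n : f z = (z - z0) ^+ n * fn n z.
  elim: n => [|n ->]; first by rewrite expr0 mul1r f0.
  by have [-> _ _] := hf n z zr; rewrite (H n).2 add0r exprSr mulrA.
apply/eqP; rewrite -cn_le0; apply: (@small_le0 R _ (K + 1)) => [|e e0]; first by lra.
have [n hn] := geom_small e0.
rewrite (E n) cnM cnX; have [_ h _] := hf n z zr.
have h2 : cn (z - z0) ^+ n <= (2 * A)^-1 ^+ n.
  by rewrite lerXn2r ?nnegrE ?cn_ge0 ?invr_ge0 ?mulr_ge0 // ltW.
apply: le_trans (ler_pM _ (cn_ge0 _) h2 h) _; first by rewrite exprn_ge0 // cn_ge0.
rewrite exprVn exprMn invfM mulrCA -!mulrA mulVf ?expf_neq0 ?gt_eqF // mulr1.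
by have := ler_wpM2l K0 hn; nra.
Qed.

(** Continuation along the segment: at the supremum [T] of the parameters reached, zeros accumulate,
    so [taylor_zero] yields a full disc around that point, and [T] cannot be smaller than 1. *)
Lemma taylor_identity f (p q : C) :
  (forall t : R, 0 <= t <= 1 -> taylor_at f (p + t%:C * (q - p))) ->
  (exists2 r : R, 0 < r & forall z, cn (z - p) < r -> f z = 0) -> f q = 0.
Proof.
move=> ht [r0 r00 hr0].
have [E|pq] := eqVneq p q; first by apply: hr0; rewrite E subrr cn0.
have pq0 : 0 < cn (q - p) by rewrite cn_gt0 subr_eq0 eq_sym.
pose pt (t : R) := p + t%:C * (q - p).
have dpt s t : cn (pt s - pt t) = `|s - t| * cn (q - p).
  by rewrite -cnR -cnM /pt rmorphB /=; congr cn; ring.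
pose good (t : R) := exists2 r : R, 0 < r & forall z, cn (z - pt t) < r -> f z = 0.
pose S := [set t : R | 0 <= t <= 1 /\ forall s, 0 <= s <= t -> good s].
have S0 : S 0.
  split=> [|s /andP[s1 s2]]; first by rewrite lexx ler01.
  have -> : s = 0 by lra.
  by exists r0 => // z; rewrite /pt mul0r addr0; exact: hr0.
have Sub : has_sup S.
  by split; [exists 0 | exists 1 => t [/andP[]]].
pose T := sup S.
have T0 : 0 <= T by apply: ub_le_sup => //; case: Sub.
have T1 : T <= 1.
  have NE : S !=set0 by exists 0.
  by apply: (ge_sup NE) => t [/andP[]].
have below s : 0 <= s -> s < T -> good s.
  move=> s0 sT; have d0 : 0 < T - s by rewrite subr_gt0.
  have [t [_ St] st] := sup_adherent d0 Sub.
  by apply: St; apply/andP; split => //; move: st; rewrite -/T; lra.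
have [rT rT0 hT] : exists2 r : R, 0 < r & forall z, cn (z - pt T) < r -> f z = 0.
  have [T00|T00] := eqVneq T 0.
    by exists r0 => // z; rewrite T00 /pt mul0r addr0; exact: hr0.
  have {}T00 : 0 < T by rewrite lt_neqAle eq_sym T00.
  apply: taylor_zero; first by apply: ht; rewrite T0 T1.
  move=> d d0.
  pose s := Num.max (T / 2) (T - d / (2 * cn (q - p))).
  have dd : 0 < d / (2 * cn (q - p)) by rewrite divr_gt0 // mulr_gt0.
  have sT : s < T by rewrite gt_max; apply/andP; split; lra.
  have s0 : 0 <= s by rewrite le_max; apply/orP; left; lra.
  have sd : T - d / (2 * cn (q - p)) <= s by rewrite le_max lexx orbT.
  have [r rr0 hr] := below s s0 sT.
  exists (pt s); rewrite dpt distrC gtr0_norm ?subr_gt0 //; split.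
  - by rewrite mulr_gt0 // subr_gt0.
  - have : T - s <= d / (2 * cn (q - p)) by lra.
    move=> /(ler_wpM2r (ltW pq0)); rewrite invfM mulrA mulfVK ?gt_eqF //; lra.
  - by apply: hr; rewrite subrr cn0.
have T1E : T = 1.
  apply/eqP; rewrite eq_le T1 /= leNgt; apply/negP => T1'.
  pose u := Num.min 1 (T + rT / (2 * cn (q - p))).
  have dd : 0 < rT / (2 * cn (q - p)) by rewrite divr_gt0 // mulr_gt0.
  have uT : T < u by rewrite lt_min T1'; lra.
  have u1 : u <= 1 by rewrite ge_min lexx.
  have u2 : u <= T + rT / (2 * cn (q - p)) by rewrite ge_min lexx orbT.
  suff : S u by move=> Su; have := ub_le_sup (proj2 Sub) Su; rewrite -/T; lra.
  split=> [|s /andP[s0 su]]; first by apply/andP; split; lra.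
  have [sT|Ts] := ltP s T; first exact: below.
  exists (rT / 2) => [|z hz]; first by lra.
  apply: hT; have -> : z - pt T = (z - pt s) + (pt s - pt T) by ring.
  apply: le_lt_trans (cnD _ _) _.
  rewrite dpt ger0_norm ?subr_ge0 //.
  have : s - T <= rT / (2 * cn (q - p)) by lra.
  move=> /(ler_wpM2r (ltW pq0)); rewrite invfM mulrA mulfVK ?gt_eqF //; lra.
apply: hT; rewrite T1E /pt mul1r [p + _]addrC subrK subrr cn0.
exact: rT0.
Qed.

End Taylor.

(** * From convergent power series to bounded Taylor remainders *)

Section PowerSeries.
Context {R : realType}.
Local Notation C := R[i].

Lemma cn_lt (z : C) (r : R) : (`|z| < r%:C) = (cn z < r).
Proof. by rewrite cnE ltcR. Qed.

Lemma analytic_taylor (f : C -> C) z0 : analytic_at f z0 -> taylor_at f z0.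
Proof.
move=> [r [a [r0 ha]]].
pose u (z : C) (n : nat) : C := \sum_(k < n) a k * (z - z0) ^+ k.
have cvu z : cn (z - z0) < r -> forall e : R, 0 < e -> exists N, forall n, (N <= n)%N ->
    cn (f z - u z n) < e.
  rewrite -cn_lt => /ha /cvgrPdist_lt h e e0.
  have [|N _ HN] := h (e%:C); first by rewrite -[0]/((0:R)%:C) ltcR.
  exists N => n Nn; have := HN n Nn; rewrite -cn_lt.
  by rewrite /series /= /u big_mkord.
pose rho := r / 2.
have rho0 : 0 < rho by rewrite divr_gt0.
(* The terms of a convergent series are bounded; at radius [r / 2] this gives geometric bounds on
   the coefficients. *)
have [K K0 HK] : exists2 K : R, 0 <= K & forall n, cn (a n) * rho ^+ n <= K.
  have Hr : cn (z0 + rho%:C - z0) < r.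
    by rewrite addrC addKr cnR gtr0_norm // /rho; lra.
  have [N HN] := cvu _ Hr 1 ltr01.
  have term n : (N <= n)%N -> cn (a n) * rho ^+ n <= 2.
    move=> Nn; have h1 := HN n Nn; have h2 := HN n.+1 (leqW Nn).
    have E : u (z0 + rho%:C) n.+1 - u (z0 + rho%:C) n = a n * rho%:C ^+ n.
      by rewrite /u big_ord_recr /= [z0 + _]addrC addrK; ring.
    have := cnB (f (z0 + rho%:C) - u (z0 + rho%:C) n) (f (z0 + rho%:C) - u (z0 + rho%:C) n.+1).
    rewrite opprB addrC addrA subrK E cnM cnX cnR gtr0_norm //; lra.
  exists (2 + \sum_(k < N) cn (a k) * rho ^+ k).
    rewrite addr_ge0 // sumr_ge0 // => i _; rewrite mulr_ge0 ?cn_ge0 // exprn_ge0 // ltW //.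
  move=> n; have P : 0 <= \sum_(k < N) cn (a k) * rho ^+ k.
    by rewrite sumr_ge0 // => i _; rewrite mulr_ge0 ?cn_ge0 // exprn_ge0 // ltW.
  have [Nn|nN] := leqP N n; first by have := term n Nn; lra.
  rewrite (bigD1 (Ordinal nN)) //=.
  have : 0 <= \sum_(i < N | i != Ordinal nN) cn (a i) * rho ^+ i.
    by rewrite sumr_ge0 // => i _; rewrite mulr_ge0 ?cn_ge0 // exprn_ge0 // ltW.
  lra.
pose A := rho^-1.
have A0 : 0 < A by rewrite invr_gt0.
have aK n : cn (a n) <= K * A ^+ n.
  by rewrite exprVn -ler_pdivrMr ?invr_gt0 ?exprn_gt0 // invrK.
have tail z n : A * cn (z - z0) <= 2^-1 ->
    cn (f z - u z n) <= 2 * K * (A * cn (z - z0)) ^+ n.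
  set q := A * _ => q2.
  have q0 : 0 <= q by rewrite mulr_ge0 ?cn_ge0 // ltW.
  have zr : cn (z - z0) < r.
    move: q2; rewrite /q /A mulrC ler_pdivrMr // /rho; lra.
  have part m : cn (u z (n + m)%N - u z n) <= 2 * K * q ^+ n - 2 * K * q ^+ (n + m).
    elim: m => [|m IH]; first by rewrite addn0 !subrr cn0.
    have -> : u z (n + m.+1)%N - u z n =
      (u z (n + m)%N - u z n) + a (n + m)%N * (z - z0) ^+ (n + m).
      by rewrite addnS /u big_ord_recr /=; ring.
    apply: le_trans (cnD _ _) _.
    have : cn (a (n + m)%N * (z - z0) ^+ (n + m)) <= K * q ^+ (n + m).
      rewrite cnM cnX /q exprMn mulrA; apply: ler_wpM2r; [exact: exprn_ge0 (cn_ge0 _)|exact: aK].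
    have qm : 0 <= q ^+ (n + m) by rewrite exprn_ge0.
    rewrite addnS exprS; have := mulr_ge0 K0 qm => h.
    have := ler_wpM2r h q2; move: IH; lra.
  apply/ler_addgt0Pr => e e0; have [N HN] := cvu z zr e e0.
  have h1 := HN (n + N)%N (leq_addl _ _); have h2 := part N.
  have h3 : 0 <= 2 * K * q ^+ (n + N) by rewrite mulr_ge0 ?exprn_ge0 // mulr_ge0.
  have -> : f z - u z n = (f z - u z (n + N)%N) + (u z (n + N)%N - u z n) by ring.
  by apply: le_trans (cnD _ _) _; lra.
(* Remainders by repeated division by [z - z0], with the coefficient as value at [z0], so that the
   recursion holds there too; their size is read off from [tail]. *)
pose fn := fix fn (n : nat) (z : C) : C := if n is n'.+1 then
  (if z == z0 then a n'.+1 else (fn n' z - a n') / (z - z0)) else f z.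
have fz0 : f z0 = a 0%N.
  have := tail z0 1%N; rewrite subrr cn0 mulr0 => /(_ _)/wrap[]; first by rewrite invr_ge0.
  by rewrite expr1 mulr0 cn_le0 /u big_ord1 expr0 mulr1 subr_eq0 => /eqP.
exists (rho / 2), (2 * K), A, fn, a; split => //; [by rewrite divr_gt0|exact: ltW|].
move=> n z hz.
have rel m : fn m z = a m + (z - z0) * fn m.+1 z.
  have [->|zz] := eqVneq z z0.
    by rewrite subrr mul0r addr0; case: m => [|m] //=; rewrite eqxx.
  by rewrite /= (negbTE zz) mulrC mulfVK ?subr_eq0 // addrC subrK.
split => //.
have [->|zz] := eqVneq z z0.
  have h : cn (a n) <= 2 * K * A ^+ n.
    by apply: le_trans (aK n) _; rewrite ler_wpM2r ?exprn_ge0 ?(ltW A0) //; lra.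
  by case: n h => [|n] h /=; rewrite ?eqxx ?fz0.
have E m : f z - u z m = (z - z0) ^+ m * fn m z.
  elim: m => [|m IH]; first by rewrite /u big_ord0 subr0 expr0 mul1r.
  have -> : f z - u z m.+1 = (f z - u z m) - a m * (z - z0) ^+ m.
    by rewrite /u big_ord_recr /=; ring.
  by rewrite IH (rel m) exprSr; ring.
have := tail z n; rewrite E cnM cnX exprMn => /(_ _)/wrap[].
  by rewrite /A mulrC ler_pdivrMr //; move: hz; lra.
have h0 : 0 < cn (z - z0) ^+ n by rewrite exprn_gt0 // cn_gt0 subr_eq0.
by rewrite [leRHS]mulrA [leRHS]mulrC ler_pM2l.
Qed.

End PowerSeries.

Section StrictDerivative.
Context {R : realType}.
Local Notation C := R[i].
Implicit Types (f g : R -> C -> C).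

(* Strict differentiability in the second variable at (0, 0), uniformly in the
   small parameter e >= 0, and right continuity in e. *)
Definition sd f (d : C) := (forall t : R, 0 < t -> exists2 r : R, 0 < r &
    forall (e : R) x y, 0 <= e < r -> cn x < r -> cn y < r ->
      cn (f e x - f e y - d * (x - y)) <= t * cn (x - y)) /\
  (forall t : R, 0 < t -> exists2 r : R, 0 < r &
    forall e : R, 0 <= e < r -> cn (f e 0 - f 0 0) <= t).

Lemma sd_ext f g d : (forall e x, f e x = g e x) -> sd f d -> sd g d.
Proof. by move=> h; have -> : f = g by apply/funext => e; apply/funext. Qed.

Lemma sd_near f d : sd f d -> forall t : R, 0 < t -> exists2 r : R, 0 < r &
  forall (e : R) x, 0 <= e < r -> cn x < r -> cn (f e x - f 0 0) <= t.
Proof.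
move=> [h1 h2] t t0; have [r r0 hr] := h1 1 ltr01; have [s s0 hs] := h2 (t / 2) (divr_gt0 t0 (ltr0Sn _ 1)).
pose M := 1 + cn d.
have M0 : 0 < M by rewrite /M; have := cn_ge0 d; lra.
exists (Num.min (Num.min r s) (t / 2 / M)).
  by rewrite !lt_min r0 s0 !divr_gt0.
move=> e x; rewrite !lt_min => /andP[e0 /andP[/andP[er es] _]] /andP[/andP[xr xs] xt].
have z0 : cn (0 : C) < r by rewrite cn0.
have := hr e x 0 ltac:(by rewrite e0) xr z0; rewrite subr0 mul1r => H1.
have H2 := hs e ltac:(by rewrite e0).
have -> : f e x - f 0 0 = (f e x - f e 0 - d * x) + d * x + (f e 0 - f 0 0) by ring.
apply: le_trans (cnD _ _) _; apply: le_trans (lerD (cnD _ _) H2) _.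
rewrite cnM; have : M * cn x <= t / 2 by rewrite mulrC -ler_pdivlMr // ltW.
rewrite /M; lra.
Qed.

Lemma sd_cst (c : C) : sd (fun _ _ => c) 0.
Proof.
split=> t t0; exists 1 => // *; first by rewrite subrr mul0r subrr cn0 mulr_ge0 ?cn_ge0 // ltW.
by rewrite subrr cn0 ltW.
Qed.

Lemma sdD f g d d' : sd f d -> sd g d' -> sd (fun e x => f e x + g e x) (d + d').
Proof.
move=> [h1 h2] [h3 h4]; split=> t t0.
  have t2 : 0 < t / 2 by rewrite divr_gt0.
  have [r r0 hr] := h1 _ t2; have [s s0 hs] := h3 _ t2.
  exists (Num.min r s); first by rewrite lt_min r0.
  move=> e x y; rewrite !lt_min => /andP[e0 /andP[e1 e2]] /andP[x1 x2] /andP[y1 y2].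
  have H1 := hr e x y ltac:(by rewrite e0) x1 y1; have H2 := hs e x y ltac:(by rewrite e0) x2 y2.
  have -> : f e x + g e x - (f e y + g e y) - (d + d') * (x - y) =
    (f e x - f e y - d * (x - y)) + (g e x - g e y - d' * (x - y)) by ring.
  by apply: le_trans (cnD _ _) _; lra.
have t2 : 0 < t / 2 by rewrite divr_gt0.
have [r r0 hr] := h2 _ t2; have [s s0 hs] := h4 _ t2.
exists (Num.min r s); first by rewrite lt_min r0.
move=> e; rewrite !lt_min => /andP[e0 /andP[e1 e2]].
have H1 := hr e ltac:(by rewrite e0); have H2 := hs e ltac:(by rewrite e0).
have -> : f e 0 + g e 0 - (f 0 0 + g 0 0) = (f e 0 - f 0 0) + (g e 0 - g 0 0) by ring.
by apply: le_trans (cnD _ _) _; lra.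
Qed.

Lemma sdM f g d d' : sd f d -> sd g d' ->
  sd (fun e x => f e x * g e x) (d * g 0 0 + f 0 0 * d').
Proof.
move=> hf hg.
pose M := 1 + cn (f 0 0) + cn (g 0 0) + cn d + cn d'.
have P := (cn_ge0 (f 0 0), cn_ge0 (g 0 0), cn_ge0 d, cn_ge0 d').
have M1 : 1 <= M by rewrite /M; case: P => [[[]]] *; lra.
have Mf : 1 + cn (f 0 0) <= M by rewrite /M; case: P => [[[]]] *; lra.
have Mg : 1 + cn (g 0 0) <= M by rewrite /M; case: P => [[[]]] *; lra.
have Md : cn d <= M by rewrite /M; case: P => [[[]]] *; lra.
have Md' : cn d' <= M by rewrite /M; case: P => [[[]]] *; lra.
have bnd h dh : sd h dh -> 1 + cn (h 0 0) <= M -> exists2 r : R, 0 < r &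
   forall (e : R) x, 0 <= e < r -> cn x < r -> cn (h e x) <= M.
  move=> hh hM; have [r r0 hr] := sd_near hh ltr01; exists r => // e x er xr.
  have -> : h e x = (h e x - h 0 0) + h 0 0 by ring.
  by apply: le_trans (cnD _ _) _; have := hr e x er xr; lra.
have [rf rf0 hrf] := bnd _ _ hf Mf; have [rg rg0 hrg] := bnd _ _ hg Mg.
split=> t t0.
  pose t' := t / (4 * M).
  have t'0 : 0 < t' by rewrite divr_gt0 //; lra.
  have Mt' : M * t' = t / 4 by rewrite /t'; field; rewrite gt_eqF //; lra.
  have [r1 r10 h1] := hf.1 _ t'0; have [r2 r20 h2] := hg.1 _ t'0.
  have [r3 r30 h3] := sd_near hf t'0; have [r4 r40 h4] := sd_near hg t'0.
  pose r := Num.min (Num.min (Num.min r1 r2) (Num.min r3 r4)) (Num.min rf rg).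
  exists r; first by rewrite !lt_min r10 r20 r30 r40 rf0 rg0.
  move=> e x y /andP[e0 er] xr yr.
  have sub s : r <= s -> [/\ 0 <= e < s, cn x < s & cn y < s].
    by move=> rs; rewrite e0 (lt_le_trans er rs) (lt_le_trans xr rs) (lt_le_trans yr rs).
  have [a1 a2 a3] := sub r1 ltac:(by rewrite /r !ge_min lexx).
  have [b1 b2 b3] := sub r2 ltac:(by rewrite /r !ge_min lexx !orbT).
  have [c1 c2 c3] := sub r3 ltac:(by rewrite /r !ge_min lexx !orbT).
  have [d1 d2 d3] := sub r4 ltac:(by rewrite /r !ge_min lexx !orbT).
  have [e1 e2 e3] := sub rf ltac:(by rewrite /r !ge_min lexx !orbT).
  have [f1 f2 f3] := sub rg ltac:(by rewrite /r !ge_min lexx !orbT).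
  have H1 := h1 e x y a1 a2 a3; have H2 := h2 e x y b1 b2 b3.
  have H3 := h3 e y c1 c3; have H4 := h4 e x d1 d2.
  have H5 := hrf e y e1 e3; have H6 := hrg e x f1 f2.
  (* Two terms contain the divided differences of [f] and [g]; the other two are small by joint
     continuity at the origin ([sd_near]). *)
  have -> : f e x * g e x - f e y * g e y - (d * g 0 0 + f 0 0 * d') * (x - y) =
    (f e x - f e y - d * (x - y)) * g e x + d * (x - y) * (g e x - g 0 0)
    + (f e y * (g e x - g e y - d' * (x - y)) + (f e y - f 0 0) * d' * (x - y)) by ring.
  have nxy := cn_ge0 (x - y).
  have M0 : 0 <= M by lra.
  have K1 := ler_pM (cn_ge0 _) (cn_ge0 _) H1 H6.
  have K2 := ler_pM (mulr_ge0 (cn_ge0 d) nxy) (cn_ge0 _) (ler_wpM2r nxy Md) H4.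
  have K3 := ler_pM (cn_ge0 _) (cn_ge0 _) H5 H2.
  have K4 := ler_wpM2r nxy (ler_pM (cn_ge0 _) (cn_ge0 _) H3 Md').
  apply: le_trans (cnD _ _) _; apply: le_trans (lerD (cnD _ _) (cnD _ _)) _.
  rewrite !cnM in K1 K2 K3 K4 *.
  have Z : t * cn (x - y) = 4 * (M * t') * cn (x - y) by rewrite Mt'; field.
  rewrite Z; lra.
pose t' := t / (2 * M).
have t'0 : 0 < t' by rewrite divr_gt0 //; lra.
have Mt' : M * t' = t / 2 by rewrite /t'; field; rewrite gt_eqF //; lra.
have [r3 r30 h3] := hf.2 _ t'0; have [r4 r40 h4] := hg.2 _ t'0.
pose r := Num.min (Num.min r3 r4) rg.
exists r; first by rewrite !lt_min r30 r40 rg0.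
move=> e; rewrite !lt_min => /andP[e0 /andP[/andP[e1 e2] e3]].
have H3 := h3 e ltac:(by rewrite e0); have H4 := h4 e ltac:(by rewrite e0).
have H6 := hrg e 0 ltac:(by rewrite e0) ltac:(by rewrite cn0).
have -> : f e 0 * g e 0 - f 0 0 * g 0 0 = (f e 0 - f 0 0) * g e 0 + f 0 0 * (g e 0 - g 0 0) by ring.
apply: le_trans (cnD _ _) _; rewrite !cnM.
have K1 := ler_pM (cn_ge0 _) (cn_ge0 _) H3 H6.
have K2 : cn (f 0 0) * cn (g e 0 - g 0 0) <= M * t'.
  by apply: ler_pM => //; [exact: cn_ge0|exact: cn_ge0|lra].
lra.
Qed.

Lemma sd_sum (I : Type) (r : seq I) (F : I -> R -> C -> C) :
  (forall i, exists d, sd (F i) d) -> exists d, sd (fun e x => \sum_(i <- r) F i e x) d.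
Proof.
move=> h; elim: r => [|i r [d IH]].
  by exists 0; apply: sd_ext (sd_cst 0) => e x; rewrite big_nil.
have [d' hd] := h i; exists (d' + d).
by apply: sd_ext (sdD hd IH) => e x; rewrite big_cons.
Qed.

Lemma sd_prod (I : Type) (r : seq I) (F : I -> R -> C -> C) :
  (forall i, exists d, sd (F i) d) -> exists d, sd (fun e x => \prod_(i <- r) F i e x) d.
Proof.
move=> h; elim: r => [|i r [d IH]].
  by exists 0; apply: sd_ext (sd_cst 1) => e x; rewrite big_nil.
have [d' hd] := h i; eexists.
by apply: sd_ext (sdM hd IH) => e x; rewrite big_cons.
Qed.

Lemma sd_det (n : nat) (M : R -> C -> 'M[C]_n) :
  (forall i j, exists d, sd (fun e x => M e x i j) d) ->
  exists d, sd (fun e x => \det (M e x)) d.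
Proof.
move=> h; apply: sd_sum => s.
have [d hd] := sd_prod (index_enum _) (fun i => h i (s i)).
by eexists; apply: sdM (sd_cst _) hd.
Qed.

End StrictDerivative.

(** * Analyticity in [g] and strict differentiability in [(g, e)] *)

Section FamilyDependence.
Context {R : realType}.
Local Notation C := R[i].
Variable c : @consts R.
Hypothesis gc : good_consts c.

Local Notation k := (ck c).
Local Notation L := (cL c).
Local Notation X := (cX c).
Local Notation a := (ca c).
Local Notation KM := (cKM c).
Local Notation wt := (wt k L X).
Local Notation bdd := (bdd k L X).
Local Notation pot := (pot c).
Local Notation Qop := (Qop c).
Local Notation zbdd := (zbdd c).
Local Notation psol := (psol c).
Local Notation cc := (cc c).
Local Notation sys := ((idx -> R -> C) * (idx -> R -> C))%type.
Local Notation P1 := (P1 c).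
Local Notation P2 := (P2 c).
Local Notation rsol := (rsol c).
Local Notation MF := (MF c).
Local Notation c4 := (c4 c).
Implicit Types (B : idx -> idx -> R -> R) (g h : C) (F G : sys).

Local Ltac nneg := repeat first [done | exact: wt_ge0 | exact: expR_ge0 | exact: cn_ge0
  | exact: normr_ge0 | exact: (cKM0 gc) | exact: (cKb0 gc) | exact: (cX0 gc) | exact: (ltW (ck0 gc))
  | exact: (ltW (ca0 gc)) | exact: cc0 | exact: c40 | exact: exprn_ge0 | apply: mulr_ge0 | apply: addr_ge0].

Definition cctsS F := forall j, ccts (F.1 j) /\ ccts (F.2 j).

Lemma psol_ccts g B b F : psol g B b F.1 F.2 -> cctsS F.
Proof.
move=> [[h1 h2 _] _] j; split; [exact: cder_ccts (h1 j) | exact: cder_ccts (h2 j)].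
Qed.

Lemma rsol_ccts g B i : cn g <= a -> pot B -> cctsS (rsol g B i).
Proof.
move=> ga hB j; split.
  exact: (cder_ccts (fun x => (cder_rsol gc i j x ga hB).1)).
exact: (cder_ccts (fun x => (cder_rsol gc i j x ga hB).2)).
Qed.

(** What remains of a difference of two [Qop] after division by [g - g']. The term with [G], the
    preceding coefficient, arises when the factor [g + g'] in front of [P2] is itself divided once
    more. *)
Definition rsrc g g' F G : idx -> R -> C :=
  fun j x => P1 F j x + (g + g') * P2 F j x + P2 G j x.

Lemma rsrc_ccts g g' F G j : cctsS F -> cctsS G -> ccts (rsrc g g' F G j).
Proof.
move=> /(_ j) [h1 h2] /(_ j) [h3 h4].
apply: cctsD; last exact: cctsZ.
apply: cctsD; first by apply: cctsZ; apply: cctsB => //; exact: cctsZ.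
by apply: cctsZ; exact: cctsZ.
Qed.

Lemma rsrc_bdd M g g' F G j : cn g <= a -> cn g' <= a -> pb c M F -> pb c M G ->
  bdd ((c4 + 1) * M) (rsrc g g' F G j).
Proof.
move=> ga ga' hF hG; have H := bddD (Pg_bdd j ga ga' hF) (P2_bdd j hG).
by apply: (bdd_le H); rewrite [leRHS]mulrDl mul1r.
Qed.

Definition rr B g g' (p : sys * sys) := sol c g B (rsrc g g' p.1 p.2).

Definition zsys : sys := (fun=> fun=> 0, fun=> fun=> 0).

(* Taylor coefficients of rsol at g0, paired with their predecessors because g enters the
   equation quadratically. *)
Fixpoint tc B g0 i n : sys * sys := if n is n'.+1 then
  let p := tc B g0 i n' in (rr B g0 g0 p, p.1) else (rsol g0 B i, zsys).

Definition trem B g0 i n g : sys :=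
  if n is n'.+1 then rr B g g0 (tc B g0 i n') else rsol g B i.

(** Growth rate of the Taylor coefficients: one application of [rr] multiplies a [pb] bound by at
    most [(3 + KM) * (2 * cc * (c4 + 1))]. *)
Definition tA := 1 + (3 + KM) * (2 * cc * (c4 + 1)).

Lemma tA1 : 1 <= tA. Proof. by rewrite /tA lerDl; nneg. Qed.

Lemma CE0 : 0 <= CE c.
Proof. by rewrite /CE /be0 /S0; nneg. Qed.

Lemma MF0 : 0 <= MF.
Proof. by have := CE0; rewrite /MF /S0 => h; nneg. Qed.

Lemma rrP B g g' M p : cn g <= a -> cn g' <= a -> pot B ->
  pb c M p.1 -> pb c M p.2 -> cctsS p.1 -> cctsS p.2 ->
  psol g B (rsrc g g' p.1 p.2) (rr B g g' p).1 (rr B g g' p).2 /\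
  zbdd (2 * cc * ((c4 + 1) * M)) (rr B g g' p).1 (rr B g g' p).2.
Proof.
move=> ga ga' hB h1 h2 h3 h4; apply: (psol_solP gc ga hB) => j.
  exact: rsrc_ccts.
exact: rsrc_bdd.
Qed.

Lemma zsys_pb M : 0 <= M -> pb c M zsys.
Proof.
move=> M0; have z N : 0 <= N -> bdd N (fun=> 0) by move=> N0; apply: bdd_le (bdd0 c) _.
move=> j; split=> [|||d D hD] /=; [exact: z| | | ].
- by move=> x; rewrite mulr0; exact: z.
- by move=> x; rewrite mulr0; exact: z.
- by move=> x; rewrite mulr0; apply: z; rewrite mulr_ge0 // (dsm_ge0 hD).
Qed.

Lemma tcP B g0 i n : cn g0 <= a -> pot B ->
  [/\ pb c (MF * tA ^+ n) (tc B g0 i n).1, pb c (MF * tA ^+ n) (tc B g0 i n).2,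
     cctsS (tc B g0 i n).1 & cctsS (tc B g0 i n).2].
Proof.
move=> ga hB; have M0 := MF0; have t1 := tA1.
elim: n => [|n [h1 h2 h3 h4]].
  rewrite expr0 mulr1; split; [exact: rsol_pb | exact: zsys_pb| exact: rsol_ccts|].
  by move=> j; split; exact: ccts_cst.
have [r1 r2] := rrP ga ga hB h1 h2 h3 h4.
have P : 0 <= MF * tA ^+ n by rewrite mulr_ge0 // exprn_ge0 //; lra.
split => //=; last exact: psol_ccts r1.
  apply: pb_le (pb_zbdd gc r2) _; rewrite exprS /tA; lra.
by apply: pb_le h1 _; rewrite exprS; nra.
Qed.

(** The remainder minus the coefficient and [g - g0] times the next remainder solve the same
    inhomogeneous problem at [g]; [psol_uniq] identifies them. *)
Lemma trem_step B g0 i n g j x : cn g0 <= a -> cn g <= a -> pot B ->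
  (trem B g0 i n g).1 j x = (tc B g0 i n).1.1 j x + (g - g0) * (trem B g0 i n.+1 g).1 j x /\
  (trem B g0 i n g).2 j x = (tc B g0 i n).1.2 j x + (g - g0) * (trem B g0 i n.+1 g).2 j x.
Proof.
move=> ga0 ga hB.
suff H : psol g B (fun j x => (g - g0) * rsrc g g0 (tc B g0 i n).1 (tc B g0 i n).2 j x)
    (sysB (trem B g0 i n g) (tc B g0 i n).1).1 (sysB (trem B g0 i n g) (tc B g0 i n).1).2.
  have [p1 p2 p3 p4] := tcP i n ga0 hB.
  have [r1 _] := rrP ga ga0 hB p1 p2 p3 p4.
  have [E1 E2] := psol_uniq gc ga hB H (psolZ (g - g0) r1) j x.
  by rewrite -E1 -E2 /= addrC subrK addrC subrK.
case: n => [|n] /=.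
  have := psol_rsolB gc i ga hB ga0 hB; congr psol.
  apply/funext => l; apply/funext => y; rewrite QopE1 /rsrc /P2 /=.
  by rewrite mulr0 addr0.
have [p1 p2 p3 p4] := tcP i n ga0 hB.
set p := tc B g0 i n in p1 p2 p3 p4 *.
have [r1 _] := rrP ga ga0 hB p1 p2 p3 p4.
have [r2 _] := rrP ga0 ga0 hB p1 p2 p3 p4.
set q := rr B g0 g0 p in r2 *.
have r3 : psol g B (fun j x => rsrc g0 g0 p.1 p.2 j x + Qop g0 B q.1 q.2 j x
     - Qop g B q.1 q.2 j x) q.1 q.2.
  by apply: psol_change r2 _ => l y; ring.
have := psolB r1 r3; congr psol; apply/funext => l; apply/funext => y.
have E := QopE1 c g g0 B q l y.
have -> : Qop g B q.1 q.2 l y = Qop g0 B q.1 q.2 l y + (g - g0) * (P1 q l y + (g + g0) * P2 q l y).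
  by rewrite -E; ring.
by rewrite /rsrc; ring.
Qed.

Lemma rsol_taylor B i j x g0 : cn g0 < a -> pot B ->
  taylor_at (fun g => (rsol g B i).1 j x) g0 /\ taylor_at (fun g => (rsol g B i).2 j x) g0.
Proof.
move=> ga0 hB; have M0 := MF0; have t1 := tA1.
have ga z : cn (z - g0) < a - cn g0 -> cn z <= a.
  by move=> h; have -> : z = (z - g0) + g0 by [ring|]; apply: le_trans (cnD _ _) _; lra.
have ga0' := ltW ga0; have r0 : 0 < a - cn g0 by lra.
pose K := cn (chi0 c i j x) + (MF + CE c) * wt x.
have CE0' := CE0; have w0 := wt_ge0 c x.
have K1 : MF * wt x <= K.
  by have := mulr_ge0 CE0' w0; have := cn_ge0 (chi0 c i j x); rewrite /K; lra.
have bnd n z : cn (z - g0) < a - cn g0 ->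
    cn ((trem B g0 i n z).1 j x) <= K * tA ^+ n /\ cn ((trem B g0 i n z).2 j x) <= K * tA ^+ n.
  move=> /ga hz; case: n => [|n].
    rewrite expr0 mulr1; have [_ /(_ j) [h1 h2]] := rsolP gc i hz hB.
    have MW := mulr_ge0 M0 w0.
    split; first by apply: le_trans (cnD _ _) _; rewrite lerD2l; have := h1 x; lra.
    by rewrite /= add0r; have := h2 x; have := cn_ge0 (chi0 c i j x); rewrite /K; lra.
  have [p1 p2 p3 p4] := tcP i n ga0' hB.
  have [_ /(_ j) [h1 h2]] := rrP hz ga0' hB p1 p2 p3 p4.
  have P : 0 <= MF * tA ^+ n by rewrite mulr_ge0 // exprn_ge0 //; lra.
  have E : 2 * cc * ((c4 + 1) * (MF * tA ^+ n)) <= MF * tA ^+ n.+1.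
    rewrite exprS /tA; have Z : 0 <= 2 * cc * ((c4 + 1) * (MF * tA ^+ n)) by nneg.
    have := mulr_ge0 (cKM0 gc) Z; lra.
  have E2 : MF * tA ^+ n.+1 * wt x <= K * tA ^+ n.+1.
    by rewrite mulrAC ler_wpM2r // exprn_ge0 //; lra.
  by split; [apply: le_trans (bdd_le h1 E x) E2 | apply: le_trans (bdd_le h2 E x) E2].
have tA0 : 0 <= tA by lra.
split.
  exists (a - cn g0), K, tA, (fun n g => (trem B g0 i n g).1 j x), (fun n => (tc B g0 i n).1.1 j x).
  split=> // n z hz; split; last exact: (bnd n z hz).1.
  exact: (trem_step i n j x ga0' (ga z hz) hB).1.
exists (a - cn g0), K, tA, (fun n g => (trem B g0 i n g).2 j x), (fun n => (tc B g0 i n).1.2 j x).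
split=> // n z hz; split; last exact: (bnd n z hz).2.
exact: (trem_step i n j x ga0' (ga z hz) hB).2.
Qed.

Section Perturbation.
Variable Bf : R -> idx -> idx -> R -> R.
Variable e1 : R.
Hypothesis e10 : 0 < e1.
Hypothesis hBf : forall e, 0 <= e < e1 -> pot (Bf e).
Hypothesis hdB : forall d : R, 0 < d -> exists2 e2 : R, 0 < e2 &
  forall e, 0 <= e < e2 -> dpot c d (Bf e) (Bf 0).

Lemma Qop_small M F g e d j : cn g <= a -> pb c M F -> dpot c d (Bf e) (Bf 0) ->
  bdd (c4 * (cn g + d) * M) (fun x => Qop g (Bf e) F.1 F.2 j x - Qop 0 (Bf 0) F.1 F.2 j x).
Proof. by move=> ga hF hd; have := Qdiff gc j ga (cn0a gc) hd hF; rewrite subr0. Qed.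

Let B00 : pot (Bf 0). Proof. by apply: hBf; rewrite lexx. Qed.

(** The divided difference at (e, g, g') solves a problem with source [rsrc], and the derivative is
    the same object at (0, 0, 0). Their difference solves a problem whose source is O(d), where [d]
    bounds |g|, |g'| and the distance of the potentials, so [psol_est] makes it small. *)
Lemma rsol_sd i j x : (exists d, sd (fun e g => (rsol g (Bf e) i).1 j x) d) /\
  (exists d, sd (fun e g => (rsol g (Bf e) i).2 j x) d).
Proof.
have M0 := MF0; have t1 := tA1; have CE0' := CE0; have w0 := wt_ge0 c x.
have K0 := cKM0 gc; have cc00 : 0 <= cc := cc0 gc; have c400 : 0 <= c4 := c40 gc.
have a0 := ca0 gc; have wt0 := wt_gt0 k L X x.
pose p0 : sys * sys := (rsol 0 (Bf 0) i, zsys).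
have [p1 p2 p3 p4] := tcP i 0 (cn0a gc) B00.
rewrite expr0 mulr1 in p1 p2.
have [r1 r2] := rrP (cn0a gc) (cn0a gc) B00 p1 p2 p3 p4.
rewrite -[tc _ _ _ _]/p0 in r1 r2 p1 p2 p3 p4.
(* Candidate for the derivative in [g]: the first Taylor coefficient at 0 for the unperturbed
   potential. *)
set rs := rr (Bf 0) 0 0 p0 in r1 r2.
have rspb := pb_zbdd gc r2.
set Mr := _ * _ in rspb.
have Mr0 : 0 <= Mr by rewrite /Mr; nneg.
pose c5 := 2 * cc * (c4 * MF).
have c50 : 0 <= c5 by rewrite /c5; nneg.
pose c6 := 4 * ((3 + KM) * c5) + 2 * MF + c4 * Mr.
have c60 : 0 <= c6 by rewrite /c6; nneg.
have main d e g g' : 0 <= e < e1 -> 0 <= d -> cn g <= a -> cn g' <= a -> cn g <= d -> cn g' <= d ->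
    dpot c d (Bf e) (Bf 0) ->
    cn ((rsol g (Bf e) i).1 j x - (rsol g' (Bf e) i).1 j x - rs.1 j x * (g - g')) <=
      2 * cc * (2 * c6 * d) * wt x * cn (g - g') /\
    cn ((rsol g (Bf e) i).2 j x - (rsol g' (Bf e) i).2 j x - rs.2 j x * (g - g')) <=
      2 * cc * (2 * c6 * d) * wt x * cn (g - g').
  move=> he d0 ga ga' gd gd' hd; have Be := hBf he.
  have q1 := rsol_pb gc i ga' Be; have q3 := rsol_ccts i ga' Be.
  have [s1 _] := rrP (p := (rsol g' (Bf e) i, zsys)) ga ga' Be q1 p2 q3 p4.
  set q := rr (Bf e) g g' _ in s1.
  have E l y : (rsol g (Bf e) i).1 l y - (rsol g' (Bf e) i).1 l y = (g - g') * q.1 l y /\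
     (rsol g (Bf e) i).2 l y - (rsol g' (Bf e) i).2 l y = (g - g') * q.2 l y.
    have H1 := psol_rsolB gc i ga Be ga' Be.
    have H2 : psol g (Bf e) (fun m z => Qop g (Bf e) (rsol g' (Bf e) i).1 (rsol g' (Bf e) i).2 m z
       - Qop g' (Bf e) (rsol g' (Bf e) i).1 (rsol g' (Bf e) i).2 m z)
       (fun m z => (g - g') * q.1 m z) (fun m z => (g - g') * q.2 m z).
      have := psolZ (g - g') s1; congr psol; apply/funext => m; apply/funext => z.
      by rewrite QopE1 /rsrc /= /P2 /= mulr0 addr0.
    exact: (psol_uniq gc ga Be H1 H2).
  have s2 : psol g (Bf e) (fun l y => rsrc 0 0 p0.1 p0.2 l y + Qop 0 (Bf 0) rs.1 rs.2 l y
     - Qop g (Bf e) rs.1 rs.2 l y) rs.1 rs.2.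
    by apply: psol_change r1 _ => l y; ring.
  pose D := sysB (rsol g' (Bf e) i) (rsol 0 (Bf 0) i).
  have hD : pb c ((3 + KM) * (2 * cc * (c4 * (cn (g' - 0) + d) * MF))) D.
    exact: (pb_zbdd gc (F := D) (rsol_dep gc i ga' Be (cn0a gc) B00 hd)).
  have := psol_est gc ga Be (psolB s1 s2) (be := 2 * c6 * d) => /(_ _)/wrap[].
    move=> l y.
    have -> : rsrc g g' (rsol g' (Bf e) i, zsys).1 (rsol g' (Bf e) i, zsys).2 l y -
       (rsrc 0 0 p0.1 p0.2 l y + Qop 0 (Bf 0) rs.1 rs.2 l y - Qop g (Bf e) rs.1 rs.2 l y) =
       P1 D l y + (g + g') * P2 (rsol g' (Bf e) i) l y
       + (Qop g (Bf e) rs.1 rs.2 l y - Qop 0 (Bf 0) rs.1 rs.2 l y).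
      by rewrite /rsrc /P1 /P2 /D /=; ring.
    apply: le_trans (cnD _ _) _; apply: le_trans (lerD (cnD _ _) (lexx _)) _.
    have b1 := P1_bdd l hD y; have b2 := P2_bdd l q1 y; have b3 := Qop_small l ga rspb hd y.
    rewrite subr0 in b1.
    have wy := wt_ge0 c y.
    have b1' : cn (P1 D l y) <= 4 * ((3 + KM) * c5) * (2 * d) * wt y.
      apply: le_trans b1 _; rewrite ler_wpM2r //.
      have -> : 4 * ((3 + KM) * (2 * cc * (c4 * (cn g' + d) * MF))) = 4 * ((3 + KM) * c5) * (cn g' + d).
        by rewrite /c5; ring.
      by apply: ler_wpM2l; [nneg | lra].
    have b2' : cn ((g + g') * P2 (rsol g' (Bf e) i) l y) <= 2 * MF * d * wt y.
      rewrite cnM; apply: le_trans (ler_pM (cn_ge0 _) (cn_ge0 _) _ b2) (_ : 2 * d * (MF * wt y) <= _).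
        by apply: le_trans (cnD _ _) _; lra.
      lra.
    have b3' : cn (Qop g (Bf e) rs.1 rs.2 l y - Qop 0 (Bf 0) rs.1 rs.2 l y) <= c4 * Mr * (2 * d) * wt y.
      apply: le_trans b3 _; rewrite ler_wpM2r //.
      by rewrite mulrAC ler_wpM2l //; [nneg | lra].
    have P : 0 <= 2 * MF * d * wt y by nneg.
    rewrite /c6; lra.
  move=> /(_ j) [/(_ x) F1 /(_ x) F2]; have [-> ->] := E j x.
  have cm (u v w : C) : u * v - w * u = (v - w) * u by rewrite mulrBl [v * u]mulrC.
  by split; rewrite cm cnM ler_wpM2r ?cn_ge0.
have main2 d e : 0 <= e < e1 -> 0 <= d -> dpot c d (Bf e) (Bf 0) ->
    cn ((rsol 0 (Bf e) i).1 j x - (rsol 0 (Bf 0) i).1 j x) <= c5 * d * wt x /\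
    cn ((rsol 0 (Bf e) i).2 j x - (rsol 0 (Bf 0) i).2 j x) <= c5 * d * wt x.
  move=> he d0 hd; have Be := hBf he.
  have [h1 h2] := rsol_dep gc i (cn0a gc) Be (cn0a gc) B00 hd j.
  rewrite subrr cn0 add0r in h1 h2.
  have E : 2 * cc * (c4 * d * MF) = c5 * d by rewrite /c5; ring.
  rewrite E in h1 h2; split; [exact: h1 | exact: h2].
pose W1 := 2 * cc * (2 * c6) * wt x; pose W2 := c5 * wt x.
have W10 : 0 <= W1 by rewrite /W1; nneg.
have W20 : 0 <= W2 by rewrite /W2; nneg.
have get t : 0 < t -> exists d : R, [/\ 0 < d, d <= a, W1 * d <= t & W2 * d <= t].
  move=> t0; exists (Num.min a (t / (W1 + W2 + 1))).
  have W3 : 0 < W1 + W2 + 1 by lra.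
  have m2 : Num.min a (t / (W1 + W2 + 1)) <= t / (W1 + W2 + 1) by rewrite ge_min lexx orbT.
  have tW : 0 < t / (W1 + W2 + 1) by rewrite divr_gt0.
  split; [by rewrite lt_min a0 | by rewrite ge_min lexx | |].
    apply: le_trans (ler_wpM2l W10 m2) _; rewrite mulrCA; apply: ler_piMr; [exact: ltW | rewrite ler_pdivrMr; lra].
  apply: le_trans (ler_wpM2l W20 m2) _; rewrite mulrCA; apply: ler_piMr; [exact: ltW | rewrite ler_pdivrMr; lra].
have hh t : 0 < t -> exists2 r : R, 0 < r & exists d : R, [/\ 0 <= d, W1 * d <= t, W2 * d <= t,
    r <= a /\ r <= d & forall e, 0 <= e < r -> 0 <= e < e1 /\ dpot c d (Bf e) (Bf 0)].
  move=> t0; have [d [d0 da h1 h2]] := get t t0; have [e2 e20 he2] := hdB d0.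
  exists (Num.min (Num.min e1 e2) (Num.min a d)); first by rewrite !lt_min e10 e20 a0.
  exists d; split => //; rewrite ?(ltW d0) ?ge_min ?lexx ?orbT //.
  move=> e; rewrite !lt_min => /andP[e0 /andP[/andP[h3 h4] _]].
  by rewrite e0 h3; split => //; apply: he2; rewrite e0.
have fin (W d t u : R) : 0 <= u -> W * d <= t -> W * d * u <= t * u by move=> *; exact: ler_wpM2r.
split.
  exists (rs.1 j x); split=> t t0; have [r r0 [d [d0 w1 w2 [ra rd] H]]] := hh t t0; exists r => //.
    move=> e g g' /H[he hd] gr gr'.
    have [h1 _] := main d e g g' he d0 (ltW (lt_le_trans gr ra)) (ltW (lt_le_trans gr' ra))
      (ltW (lt_le_trans gr rd)) (ltW (lt_le_trans gr' rd)) hd.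
    apply: le_trans h1 _; rewrite ler_wpM2r ?cn_ge0 //; move: w1; rewrite /W1; lra.
  move=> e /H[he hd]; have [h1 _] := main2 d e he d0 hd.
  apply: le_trans h1 _; move: w2; rewrite /W2; lra.
exists (rs.2 j x); split=> t t0; have [r r0 [d [d0 w1 w2 [ra rd] H]]] := hh t t0; exists r => //.
  move=> e g g' /H[he hd] gr gr'.
  have [_ h1] := main d e g g' he d0 (ltW (lt_le_trans gr ra)) (ltW (lt_le_trans gr' ra))
    (ltW (lt_le_trans gr rd)) (ltW (lt_le_trans gr' rd)) hd.
  apply: le_trans h1 _; rewrite ler_wpM2r ?cn_ge0 //; move: w1; rewrite /W1; lra.
move=> e /H[he hd]; have [_ h1] := main2 d e he d0 hd.
apply: le_trans h1 _; move: w2; rewrite /W2; lra.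
Qed.

End Perturbation.

End FamilyDependence.

(** * Wronskians *)

Section LinearODE.
Context {R : realType}.
Local Notation C := R[i].
Implicit Types (p q : idx -> R -> C) (B : idx -> idx -> R -> R) (nn : idx -> C).

Definition msol nn B p q := forall j x, cder (p j) x (q j x) /\
  cder (q j) x (nn j * p j x - \sum_i (B j i x)%:C * p i x).

Definition wron p q p' q' (x : R) : C := \sum_j (p j x * q' j x - q j x * p' j x).

Lemma cder_wron p q p' q' u v x :
  (forall j, cder (p j) x (q j x) /\ cder (q j) x (u j)) ->
  (forall j, cder (p' j) x (q' j x) /\ cder (q' j) x (v j)) ->
  cder (wron p q p' q') x (\sum_j (p j x * v j - u j * p' j x)).
Proof.
move=> h1 h2; apply: (@cder_sum _ _ _ (fun j t => p j t * q' j t - q j t * p' j t)) => j.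
have [a1 a2] := h1 j; have [b1 b2] := h2 j.
by apply: cder_eq (cderB (cderM a1 b2) (cderM a2 b1)) _; ring.
Qed.

Definition symB B := forall i j x, B i j x = B j i x.

Lemma symB_sum B (u v : idx -> C) x : symB B ->
  \sum_j u j * (\sum_i (B j i x)%:C * v i) = \sum_j (\sum_i (B j i x)%:C * u i) * v j.
Proof.
move=> hB; under eq_bigr do rewrite mulr_sumr.
under [RHS]eq_bigr do rewrite mulr_suml.
rewrite exchange_big /=; apply: eq_bigr => i _; apply: eq_bigr => j _.
by rewrite hB; ring.
Qed.

(** In the derivative the diagonal terms cancel mode by mode, the potential terms by symmetry of
    [B]. *)
Lemma wron_const nn B p q p' q' x y : symB B -> msol nn B p q -> msol nn B p' q' ->
  wron p q p' q' x = wron p q p' q' y.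
Proof.
move=> hB h1 h2; apply: cder_const => t.
apply: cder_eq (cder_wron (h1^~ t) (h2^~ t)) _.
have E : \sum_j (p j t * (\sum_i (B j i t)%:C * p' i t)) =
   \sum_j ((\sum_i (B j i t)%:C * p i t) * p' j t).
  exact: (symB_sum (fun j => p j t) (fun j => p' j t) t hB).
rewrite (eq_bigr (fun j => (\sum_i (B j i t)%:C * p i t) * p' j t
   - p j t * (\sum_i (B j i t)%:C * p' i t))); last by move=> j _; ring.
by rewrite sumrB E subrr.
Qed.

Lemma wronC p q p' q' x : wron p q p' q' x = - wron p' q' p q x.
Proof. by rewrite /wron -sumrN; apply: eq_bigr => j _; ring. Qed.

Lemma msol_refl nn B p q : msol nn B p q ->
  msol nn (fun i j x => B i j (- x)) (fun j x => p j (- x)) (fun j x => - q j (- x)).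
Proof.
move=> h j x; have [h1 h2] := h j (- x); split; first exact: cder_opp h1.
by apply: cder_eq (cderN (cder_opp h2)) _; rewrite opprK.
Qed.

Lemma msol_lin nn B (I : finType) (t : I -> C) (P Q : I -> idx -> R -> C) :
  (forall i, msol nn B (P i) (Q i)) ->
  msol nn B (fun j x => \sum_i t i * P i j x) (fun j x => \sum_i t i * Q i j x).
Proof.
move=> h j x; split.
  apply: (@cder_sum _ _ _ (fun i y => t i * P i j y) (fun i => t i * Q i j x)) => i.
  by apply: cderZ; case: (h i j x).
have := @cder_sum R _ (index_enum I) (fun i y => t i * Q i j y)
  (fun i => t i * (nn j * P i j x - \sum_l (B j l x)%:C * P i l x)) x _.
move=> /(_ _)/wrap[]; first by move=> i; apply: cderZ; case: (h i j x).
move=> H; apply: cder_eq H _.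
under eq_bigr do rewrite mulrBr.
rewrite sumrB; congr (_ - _).
  by rewrite mulr_sumr; apply: eq_bigr => i _; ring.
under eq_bigr do rewrite mulr_sumr.
rewrite exchange_big /=; apply: eq_bigr => l _; rewrite mulr_sumr.
by apply: eq_bigr => i _; ring.
Qed.

Lemma msolB nn B p q p' q' : msol nn B p q -> msol nn B p' q' ->
  msol nn B (fun j x => p j x - p' j x) (fun j x => q j x - q' j x).
Proof.
move=> h1 h2 j x; have [a1 a2] := h1 j x; have [b1 b2] := h2 j x.
split; first exact: cderB.
apply: cder_eq (cderB a2 b2) _.
under [in RHS]eq_bigr do rewrite mulrBr.
by rewrite sumrB; ring.
Qed.

Lemma der_cn2 (f : R -> C) x l : cder f x l ->
  der (fun t => cn (f t) ^+ 2) x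
    (2 * (complex.Re (f x) * complex.Re l + complex.Im (f x) * complex.Im l)).
Proof.
move=> [h1 h2]; apply: der_ext (der_eq (derD (derM h1 h1) (derM h2 h2)) _) => [t|].
  by rewrite cn_sqr -!expr2.
by ring.
Qed.

Lemma dot_le (z w : C) :
  complex.Re z * complex.Re w + complex.Im z * complex.Im w <= cn z * cn w.
Proof.
apply: le_trans (ler_norm _) _.
rewrite -(ler_pXn2r (n := 2)) ?nnegrE ?mulr_ge0 ?cn_ge0 //.
rewrite real_normK ?num_real // exprMn !cn_sqr.
have := sqr_ge0 (complex.Re z * complex.Im w - complex.Im z * complex.Re w); nra.
Qed.

Lemma rder_sum (I : Type) (r : seq I) (F : I -> R -> R) (D : I -> R) (x : R) :
  (forall i, der (F i) x (D i)) ->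
  der (fun t => \sum_(i <- r) F i t) x (\sum_(i <- r) D i).
Proof.
move=> h; elim: r => [|i r IH].
  by rewrite big_nil; apply: der_ext (der_cst 0 x) => t; rewrite big_nil.
rewrite big_cons; apply: der_ext (derD (h i) IH) => t; by rewrite big_cons.
Qed.

Definition bndB (M : R) B := forall i j x, `|B i j x| <= M.

(** Gronwall argument: the energy [E] satisfies E' <= Q E, so e^{-Qx} E is nonincreasing; it starts
    at 0 and is nonnegative. *)
Lemma msol0_ge nn B (M : R) p q x : bndB M B -> msol nn B p q ->
  (forall j, p j 0 = 0) -> (forall j, q j 0 = 0) -> 0 <= x ->
  forall j, p j x = 0 /\ q j x = 0.
Proof.
move=> hB h p0 q0 x0.
have M0 : 0 <= M by apply: le_trans (hB ord0 ord0 0); exact: normr_ge0.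
pose E (t : R) := \sum_j (cn (p j t) ^+ 2 + cn (q j t) ^+ 2).
pose NN := \sum_j cn (nn j).
have NN0 : 0 <= NN by apply: sumr_ge0 => j _; exact: cn_ge0.
pose u j (t : R) : C := nn j * p j t - \sum_i (B j i t)%:C * p i t.
pose dE (t : R) := \sum_j
  (2 * (complex.Re (p j t) * complex.Re (q j t) + complex.Im (p j t) * complex.Im (q j t)) +
   2 * (complex.Re (q j t) * complex.Re (u j t) + complex.Im (q j t) * complex.Im (u j t))).
have hE t : der E t (dE t).
  apply: (@rder_sum _ _ (fun j y => cn (p j y) ^+ 2 + cn (q j y) ^+ 2)) => j.
  by have [h1 h2] := h j t; apply: derD; exact: der_cn2.
have E0 t : 0 <= E t by apply: sumr_ge0 => j _; rewrite addr_ge0 ?sqr_ge0.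
pose r t := Num.sqrt (E t).
have r0 t : 0 <= r t by exact: sqrtr_ge0.
have rE t : r t * r t = E t by rewrite -expr2 sqr_sqrtr.
have le_r j t : cn (p j t) <= r t /\ cn (q j t) <= r t.
  have H : cn (p j t) ^+ 2 + cn (q j t) ^+ 2 <= E t.
    rewrite /E (bigD1 j) //= lerDl; apply: sumr_ge0 => i _; by rewrite addr_ge0 ?sqr_ge0.
  have := sqr_ge0 (cn (p j t)); have := sqr_ge0 (cn (q j t)) => s1 s2.
  by split; rewrite -[leLHS]ger0_norm ?cn_ge0 // -sqrtr_sqr; apply: ler_wsqrtr; lra.
pose Q := 4 * (2 + 2 * (NN + 4 * M)).
have dEle t : dE t <= Q * E t.
  have u_le j : cn (u j t) <= (NN + 4 * M) * r t.
    apply: le_trans (cnB _ _) _; rewrite mulrDl; apply: lerD.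
      rewrite cnM; apply: ler_pM; rewrite ?cn_ge0 //; last by case: (le_r j t).
      by rewrite /NN (bigD1 j) //= lerDl; apply: sumr_ge0 => i _; exact: cn_ge0.
    apply: le_trans (cn_sum _ _ _) _; rewrite -mulrA -sum4_le; apply: ler_sum => i _.
    by rewrite cnM cnR; apply: ler_pM; rewrite ?cn_ge0 //; case: (le_r i t).
  have -> : Q * E t = \sum_(j < 2 + 2) ((2 + 2 * (NN + 4 * M)) * (r t * r t)).
    by rewrite sum4_le rE /Q; ring.
  apply: ler_sum => j _; have [a1 a2] := le_r j t.
  have := dot_le (p j t) (q j t); have := dot_le (q j t) (u j t).
  have := ler_pM (cn_ge0 _) (cn_ge0 _) a1 a2; have := ler_pM (cn_ge0 _) (cn_ge0 _) a2 (u_le j).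
  lra.
pose G (t : R) := expR (- Q * t) * E t.
have hG t : der G t (expR (- Q * t) * (dE t - Q * E t)).
  by apply: der_eq (derM (der_expl (- Q) t) (hE t)) _; ring.
have G0 : G 0 = 0.
  rewrite /G /E big1 ?mulr0 // => j _; by rewrite p0 q0 cn0 expr0n /= addr0.
have Gx : G x <= G 0.
  have := @der_incr R (fun t => - G t) (fun t => - (expR (- Q * t) * (dE t - Q * E t))) 0 x x0 _ _.
  rewrite lerN2; apply.
    by move=> t _; exact: derN.
  move=> t _; rewrite oppr_ge0; apply: mulr_ge0_le0; first exact: expR_ge0.
  by rewrite subr_le0.
have Ex : E x = 0.
  by apply/eqP; rewrite eq_le E0 andbT -(pmulr_rle0 _ (expR_gt0 (- Q * x))); move: Gx; rewrite G0.
have rx : r x = 0 by rewrite /r Ex sqrtr0.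
by move=> j; have [] := le_r j x; rewrite rx !cn_le0 => /eqP -> /eqP ->.
Qed.

Lemma msol0 nn B (M : R) p q : bndB M B -> msol nn B p q ->
  (forall j, p j 0 = 0) -> (forall j, q j 0 = 0) ->
  forall j x, p j x = 0 /\ q j x = 0.
Proof.
move=> hB h p0 q0 j x; have [x0|/ltW x0] := leP 0 x; first exact: msol0_ge hB h p0 q0 x0 j.
have hB' : bndB M (fun i j x => B i j (- x)) by move=> *; exact: hB.
have x1 : 0 <= - x by rewrite oppr_ge0.
have H := msol0_ge hB' (msol_refl h) _ _ x1 j; have [] := H.
- by move=> i; rewrite oppr0.
- by move=> i; rewrite oppr0 q0 oppr0.
by rewrite opprK => -> /eqP; rewrite oppr_eq0 => /eqP ->.
Qed.

End LinearODE.

(** * The solutions [psi]: bounds, Wronskians, independence, reality *)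

Section Jost.
Context {R : realType}.
Local Notation C := R[i].
Variable c : @consts R.
Hypothesis gc : good_consts c.

Local Notation k := (ck c).
Local Notation L := (cL c).
Local Notation X := (cX c).
Local Notation a := (ca c).
Local Notation KM := (cKM c).
Local Notation kap := (ckap c).
Local Notation sg := (csg c).
Local Notation wt := (wt k L X).
Local Notation pot := (pot c).
Local Notation Qop := (Qop c).
Local Notation rsol := (rsol c).
Local Notation MF := (MF c).
Implicit Types (B : idx -> idx -> R -> R) (g h : C).

Local Ltac nneg := repeat first [done | exact: wt_ge0 | exact: expR_ge0 | exact: cn_ge0
  | exact: normr_ge0 | exact: (cKM0 gc) | exact: (cKb0 gc) | exact: (cX0 gc) | exact: (ltW (ck0 gc))
  | exact: (ltW (ca0 gc)) | exact: cc0 | exact: c40 | exact: MF0 | exact: CE0 | apply: mulr_ge0 | apply: addr_ge0].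

Definition nng g (j : idx) : C := (kap j ^+ 2)%:C + (sg j)%:C * g ^+ 2.

Definition gau g (x : R) : C := cexp (- g * x%:C).

(** Restores the gauge factor e^{-gx}; the formula for the derivative [psi1] follows from chi' = -
    kap chi + w. *)
Definition psi g B i j x : C := gau g x * (rsol g B i).1 j x.
Definition psi1 g B i j x : C :=
  gau g x * ((rsol g B i).2 j x - ((kap j)%:C + g) * (rsol g B i).1 j x).

Lemma psi_msol g B i : cn g <= a -> pot B -> msol (nng g) B (psi g B i) (psi1 g B i).
Proof.
move=> ga hB j x; have [h1 h2] := cder_rsol gc i j x ga hB.
have hg := cder_cexp (- g) x; split.
  by apply: cder_eq (cderM hg h1) _; rewrite /psi1 /gau; ring.
apply: cder_eq (cderM hg (cderB h2 (cderZ ((kap j)%:C + g) h1))) _.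
have E : \sum_l (B j l x)%:C * psi g B i l x = gau g x * \sum_l (B j l x)%:C * (rsol g B i).1 l x.
  by rewrite mulr_sumr; apply: eq_bigr => l _; rewrite /psi; ring.
rewrite E /Qop /psi /nng /gau rmorphXn rmorphB rmorph1 /=; ring.
Qed.

Lemma cn_gau g (x : R) : cn (gau g x) = expR (- complex.Re g * x).
Proof. by rewrite cn_cexp cReM cReN /= mulr0 subr0. Qed.

Definition Cchi := expR (KM * X) + CE c * expR (L * X).

Lemma Cchi0 : 0 <= Cchi.
Proof. by rewrite /Cchi; nneg. Qed.

Lemma wt_le1 x : 0 <= x -> wt x <= expR (L * X).
Proof.
move=> x0; rewrite /wt ler_expR.
have : Num.max 0 (X - x) <= X by rewrite ge_max (cX0 gc); lra.
move=> /(ler_wpM2l (ltW (cL0 gc))); have := mulr_ge0 (ltW (ck0 gc)) x0; lra.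
Qed.

Lemma rsol_bound g B i j x : cn g <= a -> pot B -> 0 <= x ->
  cn ((rsol g B i).1 j x) <= Cchi /\ cn ((rsol g B i).2 j x) <= Cchi.
Proof.
move=> ga hB x0; have [_ /(_ j) [h1 h2]] := rsolP gc i ga hB.
have w := wt_le1 x0; have CE00 : 0 <= CE c by nneg.
have CW := ler_wpM2l CE00 w; have e0 := expR_ge0 (KM * X); have e1 := expR_ge0 (L * X).
split; rewrite /Cchi.
  apply: le_trans (cnD _ _) _; apply: lerD; last exact: le_trans (h1 x) CW.
  rewrite /base /chi0 /=; case: eqP => _; last by rewrite cn0.
  rewrite cnR ger0_norm ?expR_ge0 // ler_expR.
  have := ler_wpM2r (cX0 gc) (ckapM gc j); have := mulr_ge0 (ckap0 gc j) x0; lra.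
by rewrite /= add0r; apply: le_trans (h2 x) _; lra.
Qed.

Definition Cpsi := Cchi * (2 + KM + a).

Lemma psi_bound g B i j x : cn g <= a -> pot B -> 0 <= x ->
  cn (psi g B i j x) <= Cpsi * expR (- complex.Re g * x) /\
  cn (psi1 g B i j x) <= Cpsi * expR (- complex.Re g * x).
Proof.
move=> ga hB x0; have [h1 h2] := rsol_bound i j ga hB x0.
have C0 := Cchi0; have K0 := cKM0 gc; have a0 := ca0 gc.
have e0 := expR_ge0 (- complex.Re g * x).
rewrite /psi /psi1 2!(cnM (gau g x)) cn_gau /Cpsi; split; rewrite mulrC ler_wpM2r //.
  by have := mulr_ge0 C0 K0; have := mulr_ge0 C0 (ltW a0); lra.
apply: le_trans (cnB _ _) _; rewrite cnM.
have h3 : cn ((kap j)%:C + g) <= KM + a.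
  apply: le_trans (cnD _ _) _; rewrite cnR ger0_norm ?(ckap0 gc) //.
  by have := ckapM gc j; lra.
have := ler_pM (cn_ge0 _) (cn_ge0 _) h3 h1; lra.
Qed.

(** Contained in the last contraction condition: [caf] is at least 2 a th, while caf / k is at most
    th / 4. It lets e^{-kx} absorb the gauge growth e^{2ax}. *)
Lemma ca_ck : 8 * a <= k.
Proof.
have [_ _ _ _] := gc; have k0 := ck0 gc; have L0 := cL0 gc; have a0 := ca0 gc.
have t0 := cth0 gc; have Kb0 := cKb0 gc; have e0 := expR_ge0 (- k * X); have af0 := caf0 gc.
set A := _ + 4 * (cKb c * _); set A' := _ + 4 * cKb c => h.
have A0 : 0 <= A' / L by rewrite divr_ge0 ?(ltW L0) // /A'; nneg; lra.
have h1 : 2 * (A / k) <= cth c / 2 by lra.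
have h2 : 2 * a * cth c <= A.
  have := mulr_ge0 (ltW a0) (cKM0 gc); have := sqr_ge0 a.
  have : 0 <= cKb c * expR (- k * X) by nneg.
  rewrite /A /caf; lra.
have h3 : 4 * A <= cth c * k.
  have : A / k <= cth c / 4 by lra.
  by rewrite ler_pdivrMr // => ?; lra.
rewrite -(ler_pM2l t0); lra.
Qed.

Lemma expR_decay (q M e : R) : 0 < q -> 0 < e -> exists2 x : R, M <= x & expR (- q * x) <= e.
Proof.
move=> q0 e0; have [Y [_ hY]] := expR_small q0 e0; exists (Num.max M Y).
  by rewrite le_max lexx.
by apply: hY; rewrite le_max lexx orbT.
Qed.

(** The terms with [g] cancel and only the differences w - kap chi remain, which are O(e^{-kx}) for
    every mode. This beats the gauge factor e^{2ax}, so the conclusion covers Re g < 0 as well. *)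
Lemma psi_wron0 g B i l x : cn g <= a -> pot B -> symB B ->
  wron (psi g B i) (psi1 g B i) (psi g B l) (psi1 g B l) x = 0.
Proof.
move=> ga hB sB; apply/eqP; rewrite -cn_le0.
have k0 := ck0 gc; have a0 := ca0 gc; have M0 := MF0 gc; have Ch := Cchi0.
have q0 : 0 < k - 2 * a by have := ca_ck; lra.
pose D := 4 * (Cchi * (2 * MF) + 2 * MF * Cchi).
have D0 : 0 <= D by have := mulr_ge0 Ch M0; rewrite /D; lra.
apply: (@small_le0 R _ (D + 1)) => [|e e0]; first by lra.
have [y Xy hy] := expR_decay X q0 e0.
rewrite (wron_const x y sB (psi_msol i ga hB) (psi_msol l ga hB)).
have y0 : 0 <= y by apply: le_trans Xy; exact: cX0.
have small m j : cn ((rsol g B m).2 j y - (kap j)%:C * (rsol g B m).1 j y) <= 2 * MF * expR (- k * y).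
  have [p1 p2 _ _] := rsol_pb gc m ga hB j.
  by have := bddB p1 p2 y; rewrite wt_ge // => H; apply: le_trans H _; rewrite -mulr2n mulr_natl.
have -> : wron (psi g B i) (psi1 g B i) (psi g B l) (psi1 g B l) y =
   gau g y ^+ 2 * \sum_j ((rsol g B i).1 j y * ((rsol g B l).2 j y - (kap j)%:C * (rsol g B l).1 j y)
     - ((rsol g B i).2 j y - (kap j)%:C * (rsol g B i).1 j y) * (rsol g B l).1 j y).
  by rewrite /wron mulr_sumr; apply: eq_bigr => j _; rewrite /psi /psi1; ring.
have hs : cn (\sum_j ((rsol g B i).1 j y * ((rsol g B l).2 j y - (kap j)%:C * (rsol g B l).1 j y)
     - ((rsol g B i).2 j y - (kap j)%:C * (rsol g B i).1 j y) * (rsol g B l).1 j y)) <= D * expR (- k * y).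
  apply: le_trans (cn_sum _ _ _) _; rewrite /D -mulrA -sum4_le; apply: ler_sum => j _.
  apply: le_trans (cnB _ _) _; rewrite !cnM.
  have [b1 _] := rsol_bound i j ga hB y0; have [b2 _] := rsol_bound l j ga hB y0.
  have := ler_pM (cn_ge0 _) (cn_ge0 _) b1 (small l j).
  have := ler_pM (cn_ge0 _) (cn_ge0 _) (small i j) b2; lra.
rewrite (cnM (gau g y ^+ 2)) cnX cn_gau expr2 -expRD.
have h1 : expR (- complex.Re g * y + - complex.Re g * y) <= expR (2 * a * y).
  rewrite ler_expR.
  have : - complex.Re g <= a by have := Re_le g; rewrite ler_norml => /andP[]; lra.
  by move=> /(ler_wpM2r y0); lra.
apply: le_trans (ler_pM (expR_ge0 _) (cn_ge0 _) h1 hs) _.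
rewrite mulrCA -expRD.
have -> : 2 * a * y + - k * y = - (k - 2 * a) * y by ring.
have := ler_wpM2l D0 hy; nra.
Qed.

(** The free parts are independent and the corrections can be made invisible: at the point [X] for a
    nonzero exponent, in the limit at +oo for exponent 0. *)
Lemma psi_indep g B (t : idx -> C) : cn g <= a -> pot B ->
  (forall j x, \sum_i t i * psi g B i j x = 0) -> forall i, t i = 0.
Proof.
move=> ga hB h l.
have h' x : \sum_i t i * (rsol g B i).1 l x = 0.
  apply: (mulfI (cexp_neq0 (- g * x%:C))); rewrite mulr0 mulr_sumr -[RHS](h l x).
  by apply: eq_bigr => i _; rewrite /psi /gau; ring.
pose z i := (sol c g B (src c g B i)).1 l.
have hspl x : t l * chi0 c l l x = - \sum_i t i * z i x.
  have := h' x; under eq_bigr do rewrite [(rsol g B _).1 l x]/= mulrDr.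
  rewrite big_split /= => /eqP; rewrite addr_eq0 => /eqP <-.
  by rewrite (bigD1 l) //= big1 ?addr0 // => i il; rewrite /chi0 (negbTE il) mulr0.
have [kl|kl] := eqVneq (kap l) 0; last first.
  have := hspl X; rewrite big1 ?oppr0 => [|i _].
    by rewrite /chi0 eqxx subrr mulr0 expR0 mulr1.
  by have [[[_ _ /(_ l kl)] h1 _] _] := rsolP gc i ga hB; rewrite /z h1 mulr0.
have k0 := ck0 gc; have C0 : 0 <= CE c by nneg.
pose T := \sum_i cn (t i).
have T0 : 0 <= T by apply: sumr_ge0 => i _; exact: cn_ge0.
apply/eqP; rewrite -cn_le0; apply: (@small_le0 R _ (T * CE c + 1)) => [|e e0].
  by have := mulr_ge0 T0 C0; lra.
have [y Xy hy] := expR_decay X k0 e0.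
have := hspl y; rewrite /chi0 eqxx kl oppr0 mul0r expR0 mulr1 => ->.
rewrite cnN; apply: le_trans (cn_sum _ _ _) _.
have : \sum_i cn (t i * z i y) <= T * (CE c * e).
  rewrite /T mulr_suml; apply: ler_sum => i _; rewrite cnM ler_wpM2l ?cn_ge0 //.
  have [_ /(_ l) [h1 _]] := rsolP gc i ga hB; apply: le_trans (h1 y) _.
  by rewrite wt_ge // ler_wpM2l.
by move/le_trans; apply; nra.
Qed.

Lemma psi0E g B i j : psi g B i j 0 = (rsol g B i).1 j 0.
Proof. by rewrite /psi /gau mulr0 cexp0 mul1r. Qed.

Lemma psi10E g B i j :
  psi1 g B i j 0 = (rsol g B i).2 j 0 - ((kap j)%:C + g) * (rsol g B i).1 j 0.
Proof. by rewrite /psi1 /gau mulr0 cexp0 mul1r. Qed.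

Lemma psi_taylor g0 B i j : cn g0 < a -> pot B ->
  taylor_at (fun g => psi g B i j 0) g0 /\ taylor_at (fun g => psi1 g B i j 0) g0.
Proof.
move=> ga hB; have [h1 h2] := rsol_taylor gc i j 0 ga hB; split.
  by apply: taylor_ext h1 => z; rewrite psi0E.
apply: taylor_ext (taylorB h2 (taylorM (taylorD (taylor_cst _ _) (taylor_id _)) h1)) => z.
by rewrite psi10E.
Qed.

Definition cjS (F : (idx -> R -> C) * (idx -> R -> C)) : (idx -> R -> C) * (idx -> R -> C) :=
  (fun j x => (conjc (F.1 j x)), fun j x => (conjc (F.2 j x))).

Lemma cder_conj (f : R -> C) x l : cder f x l -> cder (fun t => (conjc (f t))) x (conjc l).
Proof.
move=> [h1 h2]; split.
  by case: l h1 h2 => u v /= h1 _; apply: der_ext h1 => t; case: (f t).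
by case: l h1 h2 => u v /= _ h2; apply: der_ext (derN h2) => t; case: (f t).
Qed.

Lemma cn_conj (z : C) : cn (conjc z) = cn z.
Proof. by case: z => u v; rewrite /cn /= sqrrN. Qed.

Lemma cjM (u v : C) : conjc (u * v) = conjc u * conjc v. Proof. exact: rmorphM. Qed.
Lemma cjD (u v : C) : conjc (u + v) = conjc u + conjc v. Proof. exact: rmorphD. Qed.
Lemma cjN (u : C) : conjc (- u) = - conjc u. Proof. exact: rmorphN. Qed.

Lemma Qop_conj (r : R) B F j x :
  Qop r%:C B (cjS F).1 (cjS F).2 j x = (conjc (Qop r%:C B F.1 F.2 j x)).
Proof.
have two : (conjc (2 : C)) = 2 by exact: conjc_nat.
rewrite /Qop /cjS [LHS]/=; move: (2 : C) two => t2 two.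
rewrite !(cjN, cjD, cjM) two !conjc_real -expr2.
congr (_ - _); rewrite [RHS]rmorph_sum; apply: eq_bigr => i _.
by rewrite -[RHS]/(conjc (_ * _)) cjM conjc_real.
Qed.

(** For real [g] conjugation preserves the equation, the source and the conditions at [X], so
    uniqueness applies. *)
Lemma rsol_real (r : R) B i j x : cn r%:C <= a -> pot B ->
  complex.Im ((rsol r%:C B i).1 j x) = 0 /\ complex.Im ((rsol r%:C B i).2 j x) = 0.
Proof.
move=> ga hB; have [h _] := rsolP gc i ga hB.
set z := sol _ _ _ _ in h.
have bc j0 y : (conjc (chi0 c i j0 y)) = chi0 c i j0 y.
  by rewrite /chi0; case: eqP => _; rewrite ?conjc_real ?conjc0.
have sc j0 y : (conjc (src c r%:C B i j0 y)) = src c r%:C B i j0 y.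
  rewrite /src -Qop_conj /cjS /=; congr (Qop _ _ _ _ _ _).
    by apply/funext => m; apply/funext => t; exact: bc.
  by apply/funext => m; apply/funext => t; apply: complex_eq; rewrite /= ?oppr0.
have h2 : psol c r%:C B (src c r%:C B i) (cjS z).1 (cjS z).2.
  case: h => [[h1 h2 h3] [N hN]]; split; last first.
    by exists N => m; split=> y; rewrite cn_conj; case: (hN m) => a1 a2; [exact: a1|exact: a2].
  split=> [m y|m y|m km] /=.
  - apply: cder_eq (cder_conj (h1 m y)) _.
    by rewrite cjD cjM cjN conjc_real.
  - apply: cder_eq (cder_conj (h2 m y)) _.
    by rewrite Qop_conj (cjD (_ * _)) cjM conjc_real (cjD (Qop _ _ _ _ _ _)) sc.
  - by rewrite h3 // conjc0.
have im0 (u : C) : u = (conjc u) -> complex.Im u = 0.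
  by case: u => p q [] /eqP; rewrite -addr_eq0 -mulr2n mulrn_eq0 => /eqP.
have [E1 E2] := psol_uniq gc ga hB h h2 j x.
split; last by rewrite /= add0r; exact: im0.
by rewrite /= cImD [complex.Im (chi0 _ _ _ _)]im0 ?bc // add0r; exact: im0.
Qed.

Lemma psi_real (r : R) B i j : cn r%:C <= a -> pot B ->
  complex.Im (psi r%:C B i j 0) = 0 /\ complex.Im (psi1 r%:C B i j 0) = 0.
Proof.
move=> ga hB; have [h1 h2] := rsol_real i j 0 ga hB.
rewrite psi0E psi10E; split => //.
by rewrite cImD cImN cImM h1 h2 /= addr0 mul0r mulr0 addr0 subrr.
Qed.

End Jost.

(** * Symplectic linear algebra and adjugates *)

Section LinearAlgebra.
Context {F : fieldType}.
Variable n : nat.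
Implicit Types (H P : 'M[F]_(n + n, n)).

(** The standard symplectic form on Cauchy data; when the columns are data of solutions, the entries
    are Wronskians. *)
Definition wrM (m m' : nat) (H : 'M[F]_(n + n, m)) (P : 'M[F]_(n + n, m')) : 'M[F]_(m, m') :=
  (usubmx H)^T *m dsubmx P - (dsubmx H)^T *m usubmx P.

Definition wrK (m : nat) (H : 'M[F]_(n + n, m)) : 'M[F]_(m, n + n) :=
  row_mx (- (dsubmx H)^T) (usubmx H)^T.

Lemma wrKE m m' (H : 'M[F]_(n + n, m)) (P : 'M[F]_(n + n, m')) : wrK H *m P = wrM H P.
Proof. by rewrite /wrK -{1}[P]vsubmxK mul_row_col mulNmx addrC. Qed.

Definition inj_mx (m m' : nat) (A : 'M[F]_(m, m')) := forall v : 'cV[F]_m', A *m v = 0 -> v = 0.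

Lemma inj_mx_free (m m' : nat) (A : 'M[F]_(m, m')) : inj_mx A -> row_free A^T.
Proof.
move=> h; rewrite -kermx_eq0; apply/eqP/row_matrixP => i; rewrite row0.
have /h : A *m (row i (kermx A^T))^T = 0.
  by apply: trmx_inj; rewrite trmx_mul trmxK -row_mul mulmx_ker row0 trmx0.
by move=> /(congr1 trmx); rewrite trmxK trmx0.
Qed.

Lemma inj_mx_wrK (m : nat) (H : 'M[F]_(n + n, m)) (v : 'rV[F]_m) : v *m wrK H = 0 -> H *m v^T = 0.
Proof.
rewrite /wrK mul_mx_row => /eqP; rewrite row_mx_eq0 => /andP[/eqP h1 /eqP h2].
rewrite -[H]vsubmxK mul_col_mx; have -> : usubmx H *m v^T = 0.
  by apply: trmx_inj; rewrite trmx_mul trmxK h2 trmx0.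
have -> : dsubmx H *m v^T = 0.
  apply: trmx_inj; rewrite trmx_mul trmxK trmx0.
  by move: h1; rewrite mulmxN => /eqP; rewrite oppr_eq0 => /eqP.
by rewrite col_mx0.
Qed.

(** The columns of [H] lie in the kernel of [wrK H], of dimension 2n - n = n; being n independent
    vectors they span it, and the columns of [P] lie in it too. *)
Lemma lagrangian_span H P : inj_mx H -> wrM H H = 0 -> wrM H P = 0 ->
  exists T : 'M[F]_n, P = H *m T.
Proof.
move=> hH HH HP.
have rH : \rank H^T = n by apply/eqP; exact: inj_mx_free.
have KF : row_free (wrK H).
  rewrite -kermx_eq0; apply/eqP/row_matrixP => i; rewrite row0.
  have : row i (kermx (wrK H)) *m wrK H = 0 by rewrite -row_mul mulmx_ker row0.
  by move=> /inj_mx_wrK /hH /(congr1 trmx); rewrite trmxK trmx0.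
have rK : \rank (wrK H)^T = n by rewrite mxrank_tr; apply/eqP.
have s1 : (H^T <= kermx (wrK H)^T)%MS.
  by apply/sub_kermxP; rewrite -trmx_mul wrKE HH trmx0.
have s2 : (P^T <= kermx (wrK H)^T)%MS.
  by apply/sub_kermxP; rewrite -trmx_mul wrKE HP trmx0.
have e : (H^T == kermx (wrK H)^T)%MS.
  by rewrite -(geq_leqif (mxrank_leqif_eq s1)) mxrank_ker rK rH addnK.
have : (P^T <= H^T)%MS by apply: submx_trans s2 _; move/andP: e => [].
case/submxP => T hT; exists T^T; apply: trmx_inj; by rewrite hT trmx_mul trmxK.
Qed.

Lemma inj_mx_unit H P (T : 'M[F]_n) : inj_mx P -> P = H *m T -> \det T != 0.
Proof.
move=> hP e; apply/negP => /eqP d0.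
have /eqP /det0P [v v0 hv] : \det T^T = 0 by rewrite det_tr.
have : P *m v^T = 0.
  by rewrite e -mulmxA -[T *m _]trmxK trmx_mul trmxK hv trmx0 mulmx0.
by move=> /hP /(congr1 trmx); rewrite trmxK trmx0 => /eqP; rewrite (negbTE v0).
Qed.

Lemma det_row_mulD (Hm Hp : 'M[F]_(n + n, n)) (Tm Tp : 'M[F]_n) :
  \det (row_mx (Hm *m Tm) (Hp *m Tp)) = \det (row_mx Hm Hp) * (\det Tm * \det Tp).
Proof.
rewrite -(det_ublock Tm 0 Tp) -det_mulmx mul_row_block !mulmx0 addr0 add0r.
reflexivity.
Qed.

Lemma det0_kernel (m : nat) (A : 'M[F]_m) : \det A = 0 -> exists2 v : 'cV[F]_m, v != 0 & A *m v = 0.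
Proof.
move=> d0; have /eqP /det0P [v v0 hv] : \det A^T = 0 by rewrite det_tr.
exists v^T; first by apply: contra v0 => /eqP/(congr1 trmx); rewrite trmxK trmx0 => ->.
by apply: trmx_inj; rewrite trmx_mul trmxK hv trmx0.
Qed.

(** For each index [i] some nonzero combination of [u] and [v] vanishes at [i]; it restricts to a
    left null vector of every minor with row [i] removed. *)
Lemma adj0 (m : nat) (A : 'M[F]_m) (u v : 'rV[F]_m) :
  u *m A = 0 -> v *m A = 0 -> (forall a b : F, a *: u + b *: v = 0 -> a = 0 /\ b = 0) ->
  \adj A = 0.
Proof.
case: m A u v => [|m] A u v hu hv ind; first by apply/matrixP => -[].
apply/matrixP => j i; rewrite !mxE.
suff [t [t0 ti tA]] : exists t : 'rV[F]_m.+1, [/\ t != 0, t 0 i = 0 & t *m A = 0].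
  rewrite /cofactor; have -> : \det (row' i (col' j A)) = 0; last by rewrite mulr0.
  apply/eqP/det0P; exists (col' i t).
    apply/negP => /eqP c0; move/negP: t0; apply; apply/eqP/rowP => l; rewrite mxE.
    have [l' ->|->] := unliftP i l; last by rewrite ti.
    by have /rowP /(_ l') := c0; rewrite !mxE.
  apply/rowP => l; have /rowP /(_ (lift j l)) := tA; rewrite !mxE => {2}<-.
  rewrite [RHS](bigD1_ord i) //= ti mul0r add0r.
  by apply: eq_bigr => l' _; rewrite !mxE.
have [ui|ui] := eqVneq (u 0 i) 0.
  exists u; split => //; apply/negP => /eqP u0.
  have [|/eqP] := ind 1 0; first by rewrite u0 scaler0 scale0r addr0.
  by rewrite oner_eq0.
exists (v 0 i *: u - u 0 i *: v); split.
- apply/negP => /eqP z; have [|_ /eqP] := ind (v 0 i) (- u 0 i); first by rewrite scaleNr.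
  by rewrite oppr_eq0 (negbTE ui).
- by rewrite !mxE; ring.
- by rewrite mulmxBl -!scalemxAl hu hv !scaler0 subrr.
Qed.

End LinearAlgebra.

(** * The Evans matrix *)

Section Link.
Context {R : realType}.
Local Notation C := R[i].
Variable c : @consts R.
Hypothesis gc : good_consts c.

Local Notation a := (ca c).
Local Notation pot := (pot c).
Local Notation nng := (nng c).
Local Notation psi := (psi c).
Local Notation psi1 := (psi1 c).
Implicit Types (B : idx -> idx -> R -> R) (g : C).

Definition colm (p q : idx -> idx -> R -> C) : 'M[C]_((2 + 2) + (2 + 2), 2 + 2) :=
  col_mx (\matrix_(j, i) p i j 0) (\matrix_(j, i) q i j 0).

Definition Hmat g B := colm (psi g B) (psi1 g B).

Lemma wrM_colm p q p' q' i l :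
  wrM (colm p q) (colm p' q') i l = wron (p i) (q i) (p' l) (q' l) 0.
Proof.
rewrite /wrM /colm !col_mxKu !col_mxKd !mxE -sumrB; apply: eq_bigr => j _.
by rewrite !mxE.
Qed.

Lemma colm_inj nn B (M : R) p q : bndB M B -> (forall i, msol nn B (p i) (q i)) ->
  (forall t : idx -> C, (forall j x, \sum_i t i * p i j x = 0) -> forall i, t i = 0) ->
  inj_mx (colm p q).
Proof.
move=> hB hpq ind v; rewrite mul_col_mx => /eqP; rewrite col_mx_eq0 => /andP[/eqP h1 /eqP h2].
have H := msol0 hB (msol_lin (fun i => v i 0) hpq).
have {}H : forall j x, \sum_i v i 0 * p i j x = 0.
  move=> j x; case: (H _ _ j x) => // l.
    have := congr1 (fun m : 'cV_(2 + 2) => m l 0) h1; rewrite !mxE => E.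
    by rewrite -[RHS]E; apply: eq_bigr => i _; rewrite mxE mulrC.
  have := congr1 (fun m : 'cV_(2 + 2) => m l 0) h2; rewrite !mxE => E.
  by rewrite -[RHS]E; apply: eq_bigr => i _; rewrite mxE mulrC.
by apply/colP => i; rewrite (ind _ H) mxE.
Qed.

Lemma pot_bndB B : pot B -> bndB (cKb c) B.
Proof. by move=> h i j x; case: (h i j). Qed.

Lemma Hmat_inj g B : cn g <= a -> pot B -> inj_mx (Hmat g B).
Proof.
move=> ga hB; apply: (colm_inj (pot_bndB hB) (fun i => psi_msol gc i ga hB)).
by move=> t; exact: (psi_indep gc ga hB).
Qed.

Lemma Hmat_lag g B : cn g <= a -> pot B -> symB B -> wrM (Hmat g B) (Hmat g B) = 0.
Proof.
by move=> ga hB sB; apply/matrixP => i l; rewrite wrM_colm mxE (psi_wron0 gc).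
Qed.

Definition decays (p : idx -> R -> C) := forall (j : idx) (e : R), 0 < e ->
  exists M : R, forall x, M <= x -> cn (p j x) <= e.

(** For Re g >= 0 the solutions [psi] stay bounded, so the constant Wronskian equals its limit 0. *)
Lemma wron_decay p q g B l : cn g <= a -> 0 <= complex.Re g -> pot B -> symB B ->
  msol (nng g) B p q -> decays p -> decays q ->
  wron p q (psi g B l) (psi1 g B l) 0 = 0.
Proof.
move=> ga g0 hB sB hpq dp dq; apply/eqP; rewrite -cn_le0.
have C0 : 0 <= Cpsi c.
  have [h _] := psi_bound gc ord0 ord0 ga hB (lexx 0).
  by move: h; rewrite mulr0 expR0 mulr1; apply: le_trans; exact: cn_ge0.
apply: (@small_le0 R _ (8 * Cpsi c + 1)) => [|e e0]; first by lra.
have /choice [M1 h1] j := dp j e e0; have /choice [M2 h2] j := dq j e e0.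
pose y := \sum_j (`|M1 j| + `|M2 j|).
have y0 : 0 <= y by apply: sumr_ge0 => j _; rewrite addr_ge0.
have yM j : M1 j <= y /\ M2 j <= y.
  have H : `|M1 j| + `|M2 j| <= y.
    by rewrite /y (bigD1 j) //= lerDl; apply: sumr_ge0 => i _; rewrite addr_ge0.
  split; apply: le_trans (ler_norm _) (le_trans _ H); first by rewrite lerDl.
  by rewrite lerDr.
rewrite (wron_const 0 y sB hpq (psi_msol gc l ga hB)).
apply: le_trans (cn_sum _ _ _) _.
have -> : (8 * Cpsi c + 1) * e = 4 * (2 * (e * Cpsi c)) + e by ring.
apply: ler_wpDr; first exact: ltW.
rewrite -sum4_le; apply: ler_sum => j _.
have [b1 b2] := psi_bound gc l j ga hB y0.
have e1 : expR (- complex.Re g * y) <= 1.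
  by rewrite -expR0 ler_expR mulNr oppr_le0 mulr_ge0.
have {}b1 : cn (psi g B l j y) <= Cpsi c.
  by apply: le_trans b1 _; rewrite ler_piMr.
have {}b2 : cn (psi1 g B l j y) <= Cpsi c.
  by apply: le_trans b2 _; rewrite ler_piMr.
apply: le_trans (cnB _ _) _; rewrite (cnM (p j y)) (cnM (q j y)).
have := ler_pM (cn_ge0 _) (cn_ge0 _) (h1 j y (yM j).1) b2.
have := ler_pM (cn_ge0 _) (cn_ge0 _) (h2 j y (yM j).2) b1; lra.
Qed.

(* The conditions singling out, for Re g > 0, the decaying solutions, continued
   analytically to Re g <= 0. *)
Definition analytic_decaying B (p q : C -> idx -> idx -> R -> C) :=
  [/\ forall g i, cn g < a -> msol (nng g) B (p g i) (q g i),
      forall g i, cn g < a -> 0 < complex.Re g -> decays (p g i) /\ decays (q g i),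
      forall g i j, cn g < a -> taylor_at (fun z => p z i j 0) g /\
                                taylor_at (fun z => q z i j 0) g &
      forall g (t : idx -> C), cn g < a -> (forall j x, \sum_i t i * p g i j x = 0) ->
         forall i, t i = 0].

(** The Wronskians with [psi] vanish on a disc around a/2 in Re g > 0, where the given solutions
    decay, hence at any [g] by the identity theorem along a segment; [lagrangian_span] then applies.
    [T] is obtained separately for each [g]. *)
Lemma span_psi B p q g : pot B -> symB B -> analytic_decaying B p q -> cn g < a ->
  exists2 T : 'M[C]_(2 + 2), colm (p g) (q g) = Hmat g B *m T & \det T != 0.
Proof.
move=> hB sB [h1 h2 h3 h4] ga; have a0 := ca0 gc.
have inj : inj_mx (colm (p g) (q g)).
  by apply: (colm_inj (pot_bndB hB) (fun i => h1 g i ga)) => t; exact: h4.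
suff [T hT] : exists T : 'M[C]_(2 + 2), colm (p g) (q g) = Hmat g B *m T.
  by exists T => //; exact: inj_mx_unit inj hT.
apply: lagrangian_span; [exact: Hmat_inj (ltW ga) hB|exact: Hmat_lag (ltW ga) hB sB|].
apply/matrixP => l i; rewrite wrM_colm mxE wronC; apply/eqP; rewrite oppr_eq0; apply/eqP.
pose f z := wron (p z i) (q z i) (psi z B l) (psi1 z B l) 0.
have cvx (t : R) : 0 <= t <= 1 -> cn ((a / 2)%:C + t%:C * (g - (a / 2)%:C)) < a.
  move=> /andP[t0 t1].
  have -> : (a / 2)%:C + t%:C * (g - (a / 2)%:C) = (1 - t)%:C * (a / 2)%:C + t%:C * g.
    by rewrite rmorphB rmorph1; ring.
  have n1 : `|1 - t| = 1 - t by rewrite ger0_norm // subr_ge0.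
  have n2 : `|t| = t by rewrite ger0_norm.
  have n3 : `|a / 2| = a / 2 by rewrite ger0_norm // divr_ge0 // ltW.
  apply: le_lt_trans (cnD _ _) _; rewrite (cnM (1 - t)%:C) (cnM t%:C) !cnR n1 n2 n3.
  have [->|tn] := eqVneq t 0; first by lra.
  have tp : 0 < t by rewrite lt_neqAle eq_sym tn.
  have : t * cn g < t * a by rewrite ltr_pM2l.
  nra.
apply: (@taylor_identity R f (a / 2)%:C g) => [t ht|].
  apply: taylor_sum => j; have ht' := cvx t ht.
  have [p1 p2] := h3 _ i j ht'; have [p3 p4] := psi_taylor gc l j ht' hB.
  by apply: taylorB; exact: taylorM.
exists (a / 2) => [|z hz]; first by lra.
have za : cn z < a.
  have -> : z = (z - (a / 2)%:C) + (a / 2)%:C by rewrite subrK.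
  apply: le_lt_trans (cnD _ _) _; rewrite cnR ger0_norm; lra.
have Rz : 0 < complex.Re z.
  have := Re_le (z - (a / 2)%:C); rewrite cReD cReN /= ler_norml => /andP[+ _]; lra.
have [d1 d2] := h2 z i za Rz.
exact: wron_decay (ltW za) (ltW Rz) hB sB (h1 z i za) d1 d2.
Qed.

(** [T] is known only pointwise. With [D^T] a left inverse of [H 0], its determinant is det (D^T P)
    / det (D^T H), and the denominator stays above 1/2 near 0. *)
Lemma det_bounded (H P : C -> 'M[C]_((2 + 2) + (2 + 2), 2 + 2)) :
  (forall i j, taylor_at (fun z => H z i j) 0) -> (forall i j, taylor_at (fun z => P z i j) 0) ->
  inj_mx (H 0) -> exists r K : R, 0 < r /\ forall g (T : 'M[C]_(2 + 2)), cn g < r ->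
    P g = H g *m T -> cn (\det T) <= K.
Proof.
move=> tH tP /inj_mx_free/row_freeP[D hD].
have DH : D^T *m H 0 = 1%:M by apply: trmx_inj; rewrite trmx_mul trmxK hD trmx1.
have tay (Q : C -> 'M[C]_((2 + 2) + (2 + 2), 2 + 2)) : (forall i j, taylor_at (fun z => Q z i j) 0) ->
    taylor_at (fun z => \det (D^T *m Q z)) 0.
  move=> tQ; apply: taylor_det => i j.
  have -> : (fun z => (D^T *m Q z) i j) = fun z => \sum_l D^T i l * Q z l j.
    by apply/funext => z; rewrite mxE.
  by apply: taylor_sum => l; apply: taylorM => //; exact: taylor_cst.
have [r1 [K1 [d1 [r10 K10 e1 _]]]] := taylor_expand (tay H tH).
have [r2 [K2 [d2 [r20 K20 e2 _]]]] := taylor_expand (tay P tP).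
have dH0 : \det (D^T *m H 0) = 1 by rewrite DH det1.
pose K3 := K2 + cn (\det (D^T *m P 0)).
have K30 : 0 <= K3 by rewrite addr_ge0 ?cn_ge0.
exists (Num.min (Num.min r1 r2) (Num.min 1 (2 * (K1 + 1))^-1)), (2 * K3).
split; first by rewrite !lt_min r10 r20 ltr01 invr_gt0; lra.
move=> g T; rewrite !lt_min => /andP[/andP[g1 g2] /andP[g3 g4]] hT.
have E : \det (D^T *m P g) = \det (D^T *m H g) * \det T by rewrite -det_mulmx hT mulmxA.
have h1 : 2^-1 <= cn (\det (D^T *m H g)).
  have := e1 g; rewrite !subr0 dH0 => /(_ g1) h.
  have h' : K1 * cn g <= 2^-1.
    have K11 : 0 < K1 + 1 by lra.
    have : (K1 + 1) * cn g <= (K1 + 1) * (2 * (K1 + 1))^-1 by rewrite ler_pM2l // ltW.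
    rewrite invfM mulrCA divff ?gt_eqF // mulr1; have := cn_ge0 g; lra.
  have : cn (1 : C) <= cn (\det (D^T *m H g)) + cn (\det (D^T *m H g) - 1).
    rewrite cnC; have {1}-> : (1 : C) = \det (D^T *m H g) + (1 - \det (D^T *m H g)) by ring.
    exact: cnD.
  rewrite cn1; lra.
have h2 : cn (\det (D^T *m P g)) <= K3.
  have := e2 g; rewrite !subr0 => /(_ g2) h.
  have -> : \det (D^T *m P g) = (\det (D^T *m P g) - \det (D^T *m P 0)) + \det (D^T *m P 0) by rewrite subrK.
  apply: le_trans (cnD _ _) _; rewrite /K3 lerD2r; apply: le_trans h _.
  by rewrite ler_piMr // ltW.
move: h2; rewrite E cnM => h2.
have := ler_wpM2r (cn_ge0 (\det T)) h1; lra.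
Qed.

(* Cauchy data at 0 of the reflection x |-> - x of a solution. *)
Definition flip (m : nat) (P : 'M[C]_((2 + 2) + (2 + 2), m)) := col_mx (usubmx P) (- dsubmx P).

Lemma flipM (m m' : nat) (P : 'M[C]_((2 + 2) + (2 + 2), m)) (T : 'M[C]_(m, m')) :
  flip (P *m T) = flip P *m T.
Proof. by rewrite /flip mul_col_mx mulNmx !mul_usub_mx mul_dsub_mx. Qed.

Definition Brefl B := fun i j (x : R) => B i j (- x).

(** Solutions decaying at -oo are reflections of those decaying at +oo for the reflected potential,
    so one construction serves both ends. *)
Definition Ehat g B := \det (row_mx (flip (Hmat g (Brefl B))) (Hmat g B)).

Lemma Hmat_taylor g0 B i j : cn g0 < a -> pot B -> taylor_at (fun g => Hmat g B i j) g0.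
Proof.
move=> ga hB; rewrite /Hmat /colm.
case: (splitP i) => [i' ei|i' ei].
  have -> : i = lshift _ i' by apply: val_inj.
  apply: taylor_ext (psi_taylor gc j i' ga hB).1 => z; by rewrite col_mxEu mxE.
have -> : i = rshift _ i' by apply: val_inj.
apply: taylor_ext (psi_taylor gc j i' ga hB).2 => z; by rewrite col_mxEd mxE.
Qed.

Section TwoSided.
Variables (B : idx -> idx -> R -> R).
Hypotheses (hB : pot B) (hB' : pot (Brefl B)) (sB : symB B).
Variables (pm qm pp qp : C -> idx -> idx -> R -> C).
Hypothesis (hm : analytic_decaying (Brefl B) pm qm).
Hypothesis (hp : analytic_decaying B pp qp).
Variable f : C -> C.
Hypothesis hf : forall g, cn g < a ->
  f g = \det (row_mx (flip (colm (pm g) (qm g))) (colm (pp g) (qp g))).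

Let sB' : symB (Brefl B). Proof. by move=> i j x; exact: sB. Qed.

Lemma f_Ehat g : cn g < a -> exists Tm Tp : 'M[C]_(2 + 2),
  [/\ colm (pm g) (qm g) = Hmat g (Brefl B) *m Tm, colm (pp g) (qp g) = Hmat g B *m Tp,
     \det Tm * \det Tp != 0 & f g = Ehat g B * (\det Tm * \det Tp)].
Proof.
move=> ga; have [Tm h1 d1] := span_psi hB' sB' hm ga; have [Tp h2 d2] := span_psi hB sB hp ga.
exists Tm, Tp; split => //; first by rewrite mulf_neq0.
by rewrite hf // h1 h2 flipM det_row_mulD.
Qed.

Lemma f_eq0 g : cn g < a -> (f g = 0 <-> Ehat g B = 0).
Proof.
move=> /f_Ehat [Tm [Tp [_ _ d ->]]]; split=> [/eqP|->]; last by rewrite mul0r.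
by rewrite mulf_eq0 (negbTE d) orbF => /eqP.
Qed.

(** This direction transfers simplicity of the zero: if [Ehat] vanished to higher order at 0, so
    would [f]. *)
Lemma f_le_Ehat : exists r K : R, 0 < r /\ forall g, cn g < r -> cn (f g) <= K * cn (Ehat g B).
Proof.
have a0 := ca0 gc; have z0 : cn (0 : C) < a by rewrite cn0.
have tc (p q : C -> idx -> idx -> R -> C) B1 : analytic_decaying B1 p q -> forall i j,
    taylor_at (fun z => colm (p z) (q z) i j) 0.
  move=> [_ _ h _] i j; rewrite /colm; case: (splitP i) => [i' ei|i' ei].
    have -> : i = lshift _ i' by apply: val_inj.
    apply: taylor_ext (h 0 j i' z0).1 => z; by rewrite col_mxEu mxE.
  have -> : i = rshift _ i' by apply: val_inj.
  apply: taylor_ext (h 0 j i' z0).2 => z; by rewrite col_mxEd mxE.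
have [r1 [K1 [r10 H1]]] := det_bounded (fun i j => Hmat_taylor i j z0 hB') (tc _ _ _ hm)
  (Hmat_inj (ltW z0) hB').
have [r2 [K2 [r20 H2]]] := det_bounded (fun i j => Hmat_taylor i j z0 hB) (tc _ _ _ hp)
  (Hmat_inj (ltW z0) hB).
exists (Num.min a (Num.min r1 r2)), (K1 * K2); split; first by rewrite !lt_min a0 r10.
move=> g; rewrite !lt_min => /andP[ga /andP[g1 g2]].
have [Tm [Tp [e1 e2 _ ->]]] := f_Ehat ga.
rewrite !cnM mulrC ler_wpM2r ?cn_ge0 //.
by apply: ler_pM; rewrite ?cn_ge0 //; [exact: H1 g1 e1 | exact: H2 g2 e2].
Qed.

End TwoSided.

End Link.

(** * Persistence of a real simple zero *)

Section SimpleZero.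
Context {R : realType}.
Local Notation C := R[i].
Implicit Types (f : R -> C -> C).

Lemma lipschitz_continuous (F : R -> R) (K : R) :
  (forall x y, `|F x - F y| <= K * `|x - y|) -> continuous F.
Proof.
move=> hF x; apply/cvgrPdist_le => e e0.
have K0 : 0 <= K by have := hF 1 0; rewrite subr0 normr1 mulr1; apply: le_trans.
apply/nbhs_ballP; exists (e / (K + 1)); first by rewrite /= divr_gt0 //; lra.
move=> y; rewrite /ball /= => xy; apply: le_trans (hF x y) _.
have : `|x - y| * (K + 1) <= e by rewrite -ler_pdivlMr ?ltW //; lra.
have := normr_ge0 (x - y); lra.
Qed.

Lemma min_lip (s x y : R) : `|Num.min x s - Num.min y s| <= `|x - y|.
Proof.
have := ler_norm (x - y); have := ler_norm (y - x); rewrite (distrC y) => h3 h4.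
by rewrite ler_norml; case: (leP x s) => ?; case: (leP y s) => ?; apply/andP; split; lra.
Qed.

Lemma max_lip (s x y : R) : `|Num.max s x - Num.max s y| <= `|x - y|.
Proof.
have := ler_norm (x - y); have := ler_norm (y - x); rewrite (distrC y) => h3 h4.
by rewrite ler_norml; case: (leP s x) => ?; case: (leP s y) => ?; apply/andP; split; lra.
Qed.

(** Strict differentiability with tolerance |d| / 4 gives a lower bound on divided differences,
    hence uniqueness, and a sign change on the real axis, hence existence. The radius [r0] is fixed
    before [r], so uniqueness holds on a disc that does not shrink with the required accuracy. *)
Lemma sd_zero f d (e1 rho : R) : sd f d -> d != 0 -> f 0 0 = 0 -> 0 < e1 -> 0 < rho ->
  (forall (e t : R), 0 <= e < e1 -> `|t| < rho -> complex.Im (f e t%:C) = 0) ->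
  exists2 r0 : R, 0 < r0 & forall r : R, 0 < r <= r0 -> exists2 e2 : R, 0 < e2 &
    forall e, 0 <= e < e2 -> exists t : R, [/\ `|t| < r, f e t%:C = 0 &
      forall x y, cn x < r0 -> cn y < r0 -> cn d / 2 * cn (x - y) <= cn (f e x - f e y)].
Proof.
move=> [h1 h2] d0 f0 e10 rho0 hre.
have cd : 0 < cn d by rewrite cn_gt0.
have d4 : 0 < cn d / 4 by rewrite divr_gt0.
have [r1 r10 H1] := h1 _ d4.
exists (Num.min r1 rho) => [|r /andP[rr0]]; first by rewrite lt_min r10.
rewrite le_min => /andP[rr1 rrho].
pose s := r / 2.
have s0 : 0 < s by rewrite divr_gt0.
have ds : 0 < cn d * s / 4 by rewrite divr_gt0 // mulr_gt0.
have [e3 e30 H2] := h2 _ ds.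
exists (Num.min (Num.min r1 e1) e3); first by rewrite !lt_min r10 e10.
move=> e; rewrite !lt_min => /andP[e0 /andP[/andP[er1 ee1] ee3]].
have {}H1 x y : cn x < r1 -> cn y < r1 -> cn (f e x - f e y - d * (x - y)) <= cn d / 4 * cn (x - y).
  by apply: H1; rewrite e0.
have {}H2 : cn (f e 0 - f 0 0) <= cn d * s / 4 by apply: H2; rewrite e0.
have lip x y : cn x < r1 -> cn y < r1 -> cn (f e x - f e y) <= 2 * cn d * cn (x - y).
  move=> xr yr; have -> : f e x - f e y = (f e x - f e y - d * (x - y)) + d * (x - y) by ring.
  apply: le_trans (cnD _ _) _; have := H1 x y xr yr; rewrite (cnM d).
  have := mulr_ge0 (ltW cd) (cn_ge0 (x - y)); lra.
have cR (t : R) : `|t| <= s -> cn t%:C < r1 by rewrite cnR /s; lra.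
have sR (t : R) : `|t| <= s -> `|t| < rho by rewrite /s; lra.
have im (t : R) : `|t| <= s -> complex.Im (f e t%:C) = 0.
  by move=> /sR; apply: hre; rewrite e0.
pose F (t : R) := complex.Re (f e t%:C).
have z0 : `|0 : R| <= s by rewrite normr0 ltW.
have step (t : R) : `|t| <= s -> `|complex.Im d| * `|t| <= cn d / 4 * `|t| /\
   `|F t - F 0 - complex.Re d * t| <= cn d / 4 * `|t|.
  move=> ts; have := H1 t%:C 0 (cR t ts) (cR 0 z0); rewrite subr0 cnR => H; split.
    rewrite -normrM; apply: le_trans H.
    have -> : complex.Im d * t = - complex.Im (f e t%:C - f e 0 - d * t%:C).
      rewrite cImD cImN cImD cImN cImM (im t ts) (im 0 z0) /=; ring.
    by rewrite normrN; exact: Im_le.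
  apply: le_trans H.
  have -> : F t - F 0 - complex.Re d * t = complex.Re (f e t%:C - f e 0 - d * t%:C).
    by rewrite cReD cReN cReD cReN cReM /= /F; ring.
  exact: Re_le.
have ss : `|s| <= s by rewrite gtr0_norm.
have sN : `|- s| <= s by rewrite normrN gtr0_norm.
(* Reality on the real axis forces |Im d| <= |d| / 4, so [d] is nearly real. *)
have Red : 3 / 4 * cn d <= `|complex.Re d|.
  have [] := step s ss; rewrite (gtr0_norm s0) ler_pM2r // => h _.
  by move: h (cn_le2 d); clear; lra.
have F0 : `|F 0| <= cn d * s / 4.
  have -> : F 0 = complex.Re (f e 0 - f 0 0) by rewrite f0 subr0.
  by apply: le_trans (Re_le _) H2.
have [_ Fs] := step s ss; have [_ FN] := step (- s) sN.
rewrite normrN in FN; rewrite (gtr0_norm s0) in Fs FN.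
(* Clamping to [-s, s], where the Lipschitz bound is available, produces a function continuous on
   the whole line. *)
pose cl (x : R) := Num.max (- s) (Num.min x s).
have cls x : `|cl x| <= s.
  by rewrite ler_norml /cl le_max lexx /= ge_max ge_min lexx orbT andbT; move: s0; clear; lra.
have cl1 x y : `|cl x - cl y| <= `|x - y| by exact: le_trans (max_lip _ _ _) (min_lip _ _ _).
have cG : continuous (F \o cl).
  apply: (@lipschitz_continuous _ (2 * cn d)) => x y.
  rewrite /= /F -cReN -cReD; apply: le_trans (Re_le _) _.
  apply: le_trans (lip _ _ (cR _ (cls x)) (cR _ (cls y))) _.
  rewrite -rmorphB cnR; apply: ler_wpM2l; last exact: cl1.
  by rewrite mulr_ge0 // ltW.
have Es : (F \o cl) s = F s by rewrite /= /cl minxx (max_idPr _) //; move: s0; clear; lra.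
have EN : (F \o cl) (- s) = F (- s) by rewrite /= /cl (min_idPl _) ?maxxx //; move: s0; clear; lra.
have [|||t ts Ft] := @IVT R (F \o cl) (- s) s 0 _ _ _.
- by move: s0; clear; lra.
- exact: continuous_subspaceT.
- rewrite Es EN; have ds' : 0 < cn d * s by rewrite mulr_gt0.
  rewrite ge_min le_max.
  move: Fs FN F0 ; rewrite !ler_norml => /andP[a1 a2] /andP[b1 b2] /andP[c1 c2].
  have [Rd|Rd] := leP 0 (complex.Re d).
    rewrite ger0_norm // in Red.
    have := ler_wpM2r (ltW s0) Red => h; apply/andP; split; apply/orP; [left|right]; move: h a1 a2 b1 b2 c1 c2 ds'; clear; lra.
  rewrite ltr0_norm // in Red.
  have := ler_wpM2r (ltW s0) Red => h; apply/andP; split; apply/orP; [right|left]; move: h a1 a2 b1 b2 c1 c2 ds'; clear; lra.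
exists (cl t); split.
- by apply: le_lt_trans (cls t) _; move: s0; rewrite /s; clear; lra.
- by apply: complex_eq; [exact: Ft | exact: im].
- move=> x y; rewrite !lt_min => /andP[x1 _] /andP[y1 _].
  have := H1 x y x1 y1; set W := (X in cn X <= _) => hW.
  have : cn (d * (x - y)) <= cn (f e x - f e y) + cn W.
    by have {1}-> : d * (x - y) = (f e x - f e y) - W; [rewrite /W; ring | exact: cnB].
  have := mulr_ge0 (ltW cd) (cn_ge0 (x - y)); rewrite cnM; move: hW; clear; lra.
Qed.

Lemma sd_id : sd (fun (_ : R) (x : C) => x) 1.
Proof.
split=> t t0; exists 1 => // *; last by rewrite subrr cn0 ltW.
by rewrite mul1r subrr cn0 mulr_ge0 ?cn_ge0 // ltW.
Qed.

End SimpleZero.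

(** * Dependence of [Ehat] on [e] and its reality *)

Section EhatDependence.
Context {R : realType}.
Local Notation C := R[i].
Variable c : @consts R.
Hypothesis gc : good_consts c.
Local Notation a := (ca c).
Local Notation pot := (pot c).
Lemma Hmat_sd (Bf : R -> idx -> idx -> R -> R) (e1 : R) i j : 0 < e1 -> (forall e, 0 <= e < e1 -> pot (Bf e)) ->
  (forall d : R, 0 < d -> exists2 e2 : R, 0 < e2 &
     forall e, 0 <= e < e2 -> dpot c d (Bf e) (Bf 0)) ->
  exists d, sd (fun e g => Hmat c g (Bf e) i j) d.
Proof.
move=> e10 h1 h2; rewrite /Hmat /colm; have S i' := rsol_sd gc e10 h1 h2 j i' 0.
case: (splitP i) => [i' ei|i' ei].
  have -> : i = lshift _ i' by apply: val_inj.
  have [[d hd] _] := S i'; exists d.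
  by apply: sd_ext hd => e g; rewrite col_mxEu mxE psi0E.
have -> : i = rshift _ i' by apply: val_inj.
have [[d hd] [d' hd']] := S i'.
have H := sdM (sd_cst (-1)) (sdM (sdD (sd_cst (ckap c i')%:C) sd_id) hd).
eexists; apply: sd_ext (sdD hd' H) => e g.
by rewrite col_mxEd mxE psi10E; ring.
Qed.

Variable Bf : R -> idx -> idx -> R -> R.
Variable e1 : R.
Hypothesis e10 : 0 < e1.
Hypothesis hB : forall e, 0 <= e < e1 -> pot (Bf e).
Hypothesis hB' : forall e, 0 <= e < e1 -> pot (Brefl (Bf e)).
Hypothesis hd : forall d : R, 0 < d -> exists2 e2 : R, 0 < e2 &
  forall e, 0 <= e < e2 -> dpot c d (Bf e) (Bf 0).
Hypothesis hd' : forall d : R, 0 < d -> exists2 e2 : R, 0 < e2 &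
  forall e, 0 <= e < e2 -> dpot c d (Brefl (Bf e)) (Brefl (Bf 0)).

Lemma Ehat_sd : exists d, sd (fun e g => Ehat c g (Bf e)) d.
Proof.
apply: sd_det => i j; case: (splitP j) => [j' ej|j' ej].
  have -> : j = lshift _ j' by apply: val_inj.
  case: (splitP i) => [i' ei|i' ei].
    have -> : i = lshift _ i' by apply: val_inj.
    have [d h] := Hmat_sd (lshift _ i') j' e10 hB' hd'; exists d.
    by apply: sd_ext h => e g; rewrite [RHS]row_mxEl [RHS]col_mxEu [RHS]mxE.
  have -> : i = rshift _ i' by apply: val_inj.
  have [d h] := Hmat_sd (rshift _ i') j' e10 hB' hd'; eexists.
  apply: sd_ext (sdM (sd_cst (-1)) h) => e g.
  by rewrite [RHS]row_mxEl [RHS]col_mxEd [RHS]mxE [X in _ = - X]mxE mulN1r.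
have -> : j = rshift _ j' by apply: val_inj.
have [d h] := Hmat_sd i j' e10 hB hd; exists d.
by apply: sd_ext h => e g; rewrite [RHS]row_mxEr.
Qed.

Definition realc (z : C) := complex.Im z = 0.

Lemma real_det (n : nat) (M : 'M[C]_n) : (forall i j, realc (M i j)) -> realc (\det M).
Proof.
move=> h; pose Mr := \matrix_(i, j) complex.Re (M i j) : 'M[R]_n.
have -> : M = map_mx (real_complex R) Mr.
  by apply/matrixP => i j; rewrite !mxE; apply: complex_eq => //=; exact: h.
by rewrite det_map_mx.
Qed.

Lemma Hmat_real (r : R) B i j : cn r%:C <= a -> pot B -> realc (Hmat c r%:C B i j).
Proof.
move=> ga h; rewrite /Hmat /colm; case: (splitP i) => [i' ei|i' ei].
  have -> : i = lshift _ i' by apply: val_inj.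
  by rewrite col_mxEu mxE; case: (psi_real gc j i' ga h).
have -> : i = rshift _ i' by apply: val_inj.
by rewrite col_mxEd mxE; case: (psi_real gc j i' ga h).
Qed.

Lemma Ehat_real (r e : R) : `|r| <= a -> 0 <= e < e1 -> realc (Ehat c r%:C (Bf e)).
Proof.
rewrite -cnR => ra he; apply: real_det => i j; case: (splitP j) => [j' ej|j' ej].
  have -> : j = lshift _ j' by apply: val_inj.
  case: (splitP i) => [i' ei|i' ei].
    have -> : i = lshift _ i' by apply: val_inj.
    rewrite row_mxEl col_mxEu [usubmx _ _ _]mxE; exact: Hmat_real ra (hB' he).
  have -> : i = rshift _ i' by apply: val_inj.
  rewrite row_mxEl col_mxEd 2!mxE /realc cImN.
  by rewrite (Hmat_real (rshift _ i') j' ra (hB' he)) oppr0.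
have -> : j = rshift _ j' by apply: val_inj.
by rewrite row_mxEr; exact: Hmat_real ra (hB he).
Qed.

End EhatDependence.

(** * Bounds on the bifurcated waves *)

Section Constants.
Context {R : realType}.

(** Order of choice: [k] below the decay rate and half the nonzero exponents, [th = k / 16], then
    [a] so small that [caf] is at most k^2 / 256, [X] so far out that the tail of the potential is
    equally small, and [L] last, large enough to absorb [Kb] and the exponents. *)
Lemma exists_consts (kap sg : idx -> R) (c0 Kb amax : R) :
  (forall j, 0 <= kap j) -> (forall j, sg j = 1 \/ sg j = -1) ->
  (forall j, kap j = 0 -> sg j = 1) -> 0 < c0 -> 0 <= Kb -> 0 < amax ->
  exists c : consts, [/\ good_consts c, ckap c = kap /\ csg c = sg, cKb c = Kb,
    ck c <= c0 & ca c <= amax].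
Proof.
move=> kap0 sg1 kapsg c00 Kb0 am0.
have [kk kk0 hkk] : exists2 kk : R, 0 < kk & forall j, kap j != 0 -> 2 * kk <= kap j.
  (* Zero exponents are replaced by 1 so that the minimum is positive. *)
  pose f j := if kap j == 0 then 1 else kap j.
  have f0 j : 0 < f j by rewrite /f; case: eqP => // /eqP h; rewrite lt_neqAle eq_sym h kap0.
  exists (\big[Num.min/1]_j f j / 2).
    by rewrite divr_gt0 //; elim/big_ind : _ => // x y x0 y0; rewrite lt_min x0.
  move=> j kj; have : \big[Num.min/1]_j f j <= f j by rewrite (bigD1 j) //= ge_min lexx.
  rewrite {2}/f (negbTE kj); lra.
pose k := Num.min (Num.min 1 c0) kk.
have k0 : 0 < k by rewrite !lt_min ltr01 c00.
have k1 : k <= 1 by rewrite !ge_min lexx.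
have kc0 : k <= c0 by rewrite !ge_min lexx orbT.
have kkk : k <= kk by rewrite !ge_min lexx orbT.
pose KM := \sum_j kap j.
have KM0 : 0 <= KM by apply: sumr_ge0 => j _; exact: kap0.
have kM j : kap j <= KM.
  by rewrite /KM (bigD1 j) //= lerDl; apply: sumr_ge0 => i _; exact: kap0.
have p256 : (0 : R) < 256 by rewrite ltr0n.
pose th := k / 16.
pose a := Num.min amax (Num.min 1 (k ^+ 2 / (256 * (4 + 2 * KM)))).
have ke : 0 < k ^+ 2 by rewrite exprn_gt0.
have a0 : 0 < a.
  have K4 : 0 < 4 + 2 * KM by clear -KM0; lra.
  by rewrite !lt_min am0 ltr01 /=; exact: divr_gt0 ke (mulr_gt0 p256 K4).
have a1 : a <= 1 by rewrite !ge_min lexx orbT.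
have a2 : a * (4 + 2 * KM) <= k ^+ 2 / 256.
  have : a <= k ^+ 2 / (256 * (4 + 2 * KM)) by rewrite !ge_min lexx !orbT.
  have q : 0 < 4 + 2 * KM by lra.
  move=> /(ler_wpM2r (ltW q)) /le_trans; apply.
  by rewrite invfM mulrA mulfVK // gt_eqF.
have q : 0 < 4 * Kb + 1 by lra.
have q1 : 0 < k ^+ 2 / 256 / (4 * Kb + 1) by apply: divr_gt0 q; exact: divr_gt0.
have [X [X0 hX]] := expR_small k0 q1.
have hX1 : 4 * (Kb * expR (- k * X)) <= k ^+ 2 / 256.
  have := hX X (lexx _); rewrite ler_pdivlMr //; have := expR_ge0 (- k * X); lra.
pose L := 2 * KM + 256 * (1 + 4 * Kb) / k + k.
have G0 : 0 <= 256 * (1 + 4 * Kb) / k.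
  by apply: mulr_ge0; [clear -Kb0; lra | rewrite invr_ge0 ltW].
have L0 : 0 < L by clear -KM0 G0 k0; rewrite /L; lra.
have L1 : 256 * (1 + 4 * Kb) <= k * L.
  have -> : k * L = 256 * (1 + 4 * Kb) + (2 * KM * k + k * k) by rewrite /L; field; rewrite gt_eqF.
  by rewrite lerDl addr_ge0 // ?mulr_ge0 // ltW.
have Lk : k <= L by clear -KM0 G0; rewrite /L; lra.
have LK : 2 * KM <= L.
  by clear -G0 k0; rewrite /L; lra.
have th0 : 0 < th by rewrite /th divr_gt0.
have th1 : th <= 1 by rewrite /th; move: k0 k1; clear; lra.
exists (Consts k L X th a Kb KM kap sg); split => //; last by rewrite ge_min lexx.
split=> //=.
- move=> j; split; first by rewrite kap0 kM.
    by case: (sg1 j) => ->; rewrite ?subrr ?normr0 // ler_norml; apply/andP; split; clear; lra.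
  have [kj|kj] := eqVneq (kap j) 0; first by left; split => //; exact: kapsg.
  right; split; first by move: (hkk j kj) kkk; clear; lra.
  by move: (kM j) LK; clear; lra.
- have -> : th / k = 16^-1 by rewrite /th; field; rewrite gt_eqF.
  have : th / L <= 16^-1 by rewrite ler_pdivrMr // /th; move: Lk; clear; lra.
  by clear; lra.
have af : caf (Consts k L X th a Kb KM kap sg) <= k ^+ 2 / 256.
  rewrite /caf /=; apply: le_trans a2.
  by have aK := mulr_ge0 (ltW a0) KM0; move: aK a0 a1 th0 th1; clear; nra.
set AF := caf _ in af *.
have h1 : (AF + 4 * (Kb * expR (- k * X))) / k <= k / 128.
  rewrite ler_pdivrMr //; have -> : k / 128 * k = k ^+ 2 / 256 + k ^+ 2 / 256 by field.
  by apply: lerD.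
have h2 : (AF + 4 * Kb) / L <= k / 256.
  rewrite ler_pdivrMr //; have : k ^+ 2 <= 1 by rewrite expr_le1 // ltW.
  by move: af L1; clear; lra.
by rewrite /th; move: h1 h2 k0; clear; lra.
Qed.

End Constants.

(** * Exponential decay from a convexity inequality *)

Section WaveDecay.
Context {R : realType}.
Implicit Types (h u : R -> R).

(** For p = h' + cc h, the hypothesis makes e^{-cc x} p nondecreasing. A positive value of p would
    persist and keep h away from 0 near +oo, against the limit; so p <= 0, and e^{cc x} h is
    nonincreasing. *)
Lemma convex_decay h h1 h2 (cc X : R) : 0 < cc ->
  (forall x, der h x (h1 x)) -> (forall x, der h1 x (h2 x)) ->
  (forall x, X <= x -> cc ^+ 2 * h x <= h2 x) -> h x @[x --> +oo] --> 0 ->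
  forall x, X <= x -> h x <= h X * expR (- cc * (x - X)).
Proof.
move=> c0 d1 d2 hc lim0.
pose p x := h1 x + cc * h x.
have dp x : der p x (h2 x + cc * h1 x) by apply: derD => //; exact: derZ.
have mono x y : X <= x -> x <= y -> expR (- cc * x) * p x <= expR (- cc * y) * p y.
  move=> Xx xy; apply: (@der_incr _ (fun t => expR (- cc * t) * p t)
    (fun t => expR (- cc * t) * (h2 t + cc * h1 t - cc * p t)) x y xy).
    by move=> t _; apply: der_eq (derM (der_expl (- cc) t) (dp t)) _; ring.
  move=> t /andP[xt _]; rewrite mulr_ge0 ?expR_ge0 // /p.
  have := hc t (le_trans Xx xt); lra.
have ple x : X <= x -> p x <= 0.
  move=> Xx; rewrite leNgt; apply/negP => px.
  have pge y : x <= y -> p x <= p y.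
    move=> xy; have := mono x y Xx xy.
    have -> : expR (- cc * x) = expR (- cc * y) * expR (cc * (y - x)).
      by rewrite -expRD; congr expR; ring.
    rewrite -mulrA ler_pM2l ?expR_gt0 //; apply: le_trans.
    apply: ler_peMl; first exact: ltW.
    by rewrite -expR0 ler_expR mulr_ge0 ?subr_ge0 // ltW.
  pose de := p x / cc.
  have de0 : 0 < de by rewrite divr_gt0.
  have grow y : x <= y -> expR (cc * x) * (h x - de) <= expR (cc * y) * (h y - de).
    move=> xy; apply: (@der_incr _ (fun t => expR (cc * t) * (h t - de))
      (fun t => expR (cc * t) * (p t - p x)) x y xy).
      move=> t _; apply: der_eq (derM (der_expl cc t) (derB (d1 t) (der_cst de t))) _.
      by rewrite /de /p; field; rewrite gt_eqF.
    by move=> t /andP[xt _]; rewrite mulr_ge0 ?expR_ge0 // subr_ge0 pge.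
  pose K := `|expR (cc * x) * (h x - de)|.
  have low y : x <= y -> de - K * expR (- cc * y) <= h y.
    move=> xy; have := grow y xy; have : - K <= expR (cc * x) * (h x - de).
      by rewrite /K; have := ler_norm (- (expR (cc * x) * (h x - de))); rewrite normrN; lra.
    move=> k1 k2; have k3 : - K <= expR (cc * y) * (h y - de) by lra.
    have := ler_wpM2l (expR_ge0 (- cc * y)) k3.
    rewrite mulrA -expRD mulNr addNr expR0 mul1r mulrN; lra.
  have de4 : 0 < de / 4 by lra.
  have /cvgrPdist_le /(_ _ de4) [Y [_ hY]] := lim0.
  have K1 : 0 < K + 1 by rewrite ltr_wpDl // /K normr_ge0.
  have q1 : 0 < de / 4 / (K + 1) by rewrite divr_gt0.
  have [Z [_ hZ]] := expR_small c0 q1.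
  pose y := Num.max (Num.max x (Y + 1)) Z.
  have xy : x <= y by rewrite !le_max lexx.
  have Yy : Y < y by apply: (@lt_le_trans _ _ (Y + 1)); [lra | rewrite !le_max lexx orbT].
  have Zy : Z <= y by rewrite !le_max lexx orbT.
  have := hY y Yy; rewrite sub0r normrN => H1.
  have := hZ y Zy; rewrite ler_pdivlMr // => H2.
  have := low y xy; have := ler_norm (h y); have := expR_ge0 (- cc * y); lra.
move=> x Xx.
have := @der_incr R (fun t => - (expR (cc * t) * h t)) (fun t => - (expR (cc * t) * p t)) X x Xx.
move=> /(_ _)/wrap[].
  by move=> t _; apply: der_eq (derN (derM (der_expl cc t) (d1 t))) _; rewrite /p; ring.
move=> /(_ _)/wrap[].
  by move=> t /andP[Xt _]; rewrite oppr_ge0 mulr_ge0_le0 ?expR_ge0 ?ple.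
rewrite lerN2 => H; have := ler_wpM2l (expR_ge0 (- cc * x)) H.
rewrite !mulrA -!expRD mulNr addNr expR0 mul1r => /le_trans; apply.
rewrite mulrC le_eqVlt; apply/orP; left; apply/eqP; congr (_ * expR _); ring.
Qed.

Lemma cvg0_bounded (u : R -> R) : continuous u -> u x @[x --> +oo] --> 0 ->
  u x @[x --> -oo] --> 0 -> exists M : R, forall x, `|u x| <= M.
Proof.
move=> cu lp lm.
have /cvgrPdist_le /(_ _ ltr01) [P [_ hP]] := lp.
have /cvgrPdist_le /(_ _ ltr01) [Q [_ hQ]] := lm.
pose a := Num.min (Q - 1) (P + 1); pose b := Num.max (Q - 1) (P + 1).
have ab : a <= b by rewrite ge_min /b le_max lexx.
have cu' : {within `[a, b], continuous (fun x => `|u x|)}.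
  by apply: continuous_subspaceT => x; apply: continuous_comp; [exact: cu | exact: norm_continuous].
have [m _ hm] := EVT_max ab cu'.
exists (Num.max 1 `|u m|) => x; rewrite le_max.
have [xP|Px] := leP x P; last first.
  by have := hP x Px; rewrite sub0r normrN => ->.
have [Qx|xQ] := leP Q x; last first.
  by have := hQ x xQ; rewrite sub0r normrN => ->.
apply/orP; right; apply: hm; rewrite in_itv /=; apply/andP; split.
  by rewrite /a ge_min; apply/orP; left; lra.
by rewrite /b le_max; apply/orP; right; lra.
Qed.

End WaveDecay.

Section Lipschitz.
Context {R : realType}.

Lemma box_bounded (G : R -> R -> R -> R) (M : R) :
  continuous (fun p : R * R * R => G p.1.1 p.1.2 p.2) ->
  exists2 K : R, 0 <= K & forall x y z, `|x| <= M -> `|y| <= M -> `|z| <= M -> `|G x y z| <= K.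
Proof.
move=> cG.
have cb : compact ([set` `[- M, M]] `*` [set` `[- M, M]] `*` [set` `[- M, M]] : set (R * R * R)).
  by apply: compact_setX; [apply: compact_setX|]; exact: segment_compact.
have := continuous_compact (continuous_subspaceT cG) cb.
move=> /compact_bounded [K [_ hK]].
exists (`|K| + 1) => [|x y z hx hy hz]; first by rewrite addr_ge0.
apply: (hK (`|K| + 1)); first by have := ler_norm K; lra.
exists (x, y, z) => //=.
by rewrite !in_itv /= -!ler_norml.
Qed.

(** The variables are changed one at a time, so that each segment stays in the box. *)
Lemma box_lipschitz (G : R -> R -> R -> R) (M : R) : Ck 1 G ->
  exists2 K : R, 0 <= K & forall x y z x' y' z',
    `|x| <= M -> `|y| <= M -> `|z| <= M -> `|x'| <= M -> `|y'| <= M -> `|z'| <= M ->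
    `|G x y z - G x' y' z'| <= K * (`|x - x'| + `|y - y'| + `|z - z'|).
Proof.
move=> [cG [dG [c1 _] [c2 _] [c3 _]]].
have [K1 K10 h1] := box_bounded M c1; have [K2 K20 h2] := box_bounded M c2.
have [K3 K30 h3] := box_bounded M c3.
have seg (f df : R -> R) (K s t : R) : (forall x, der f x (df x)) ->
   (forall x, `|x| <= M -> `|df x| <= K) -> `|s| <= M -> `|t| <= M -> `|f s - f t| <= K * `|s - t|.
  move=> hf hd.
  wlog st : s t / t <= s.
    move=> H hs ht; have [ts|/ltW st] := leP t s; first exact: H.
    by rewrite distrC (distrC s); exact: H.
  move=> hs ht; rewrite (ger0_norm (_ : 0 <= s - t)) ?subr_ge0 // mulrBr.
  apply: (@der_cmp _ f (fun t => K * t) df (fun=> K) t s st) => x.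
  - by move=> _; exact: hf.
  - by move=> _; apply: der_eq (derZ K (der_id x)) _; rewrite mulr1.
  - move=> /andP[tx xs]; apply: hd; move: hs ht; rewrite !ler_norml => /andP[? ?] /andP[? ?].
    by apply/andP; split; lra.
exists (K1 + K2 + K3) => [|x y z x' y' z' hx hy hz hx' hy' hz']; first by lra.
have e1 : `|G x y z - G x' y z| <= K1 * `|x - x'|.
  apply: (seg (fun t => G t y z) (fun t => d1 G t y z)) => // [t|t ht]; last exact: h1.
  by have [h _ _] := dG t y z; rewrite /d1; exact: (derI h).
have e2 : `|G x' y z - G x' y' z| <= K2 * `|y - y'|.
  apply: (seg (fun t => G x' t z) (fun t => d2 G x' t z)) => // [t|t ht]; last exact: h2.
  by have [_ h _] := dG x' t z; rewrite /d2; exact: (derI h).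
have e3 : `|G x' y' z - G x' y' z'| <= K3 * `|z - z'|.
  apply: (seg (fun t => G x' y' t) (fun t => dmu G x' y' t)) => // [t|t ht]; last exact: h3.
  by have [_ _ h] := dG x' y' t; rewrite /dmu; exact: (derI h).
have -> : G x y z - G x' y' z' = (G x y z - G x' y z) + (G x' y z - G x' y' z)
  + (G x' y' z - G x' y' z') by ring.
apply: le_trans (ler_normD _ _) _; apply: le_trans (lerD (ler_normD _ _) (lexx _)) _.
have := normr_ge0 (x - x'); have := normr_ge0 (y - y'); have := normr_ge0 (z - z').
set A := `|x - x'| in e1 *; set B := `|y - y'| in e2 *; set D := `|z - z'| in e3 *.
move=> D0 B0 A0.
have := mulr_ge0 K10 B0; have := mulr_ge0 K10 D0; have := mulr_ge0 K20 A0.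
have := mulr_ge0 K20 D0; have := mulr_ge0 K30 A0; have := mulr_ge0 K30 B0; lra.
Qed.

Lemma Ck_pred k (G : R -> R -> R -> R) : Ck k.+1 G -> Ck k G.
Proof.
elim: k G => [|k IH] G; first by case=> cG _; split; [exact: cG|].
case=> cG [h1 h2 h3 h4]; split; first exact: cG.
by split; [exact: h1 | exact: IH h2 | exact: IH h3 | exact: IH h4].
Qed.

Lemma Ck_d1 k (G : R -> R -> R -> R) : Ck k.+1 G -> Ck k (d1 G).
Proof. by case=> _ []. Qed.

Lemma Ck_d2 k (G : R -> R -> R -> R) : Ck k.+1 G -> Ck k (d2 G).
Proof. by case=> _ []. Qed.

End Lipschitz.

(** * The potential as a real symmetric matrix *)

Section Blocks.
Context {R : realType}.

Definition blk (c11 d11 c12 c22 d22 : R) : 'M[R]_(2 + 2) :=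
  block_mx (c11 *: (1%:M + sigma1) + d11 *: 1%:M) (c12 *: (1%:M + sigma1))
    (c12 *: (1%:M + sigma1)) (c22 *: (1%:M + sigma1) + d22 *: 1%:M).

(** Reduces bounds, differences and continuity of the sixteen entries to the five scalar
    coefficients. *)
Lemma blk_lin (i j : idx) : exists a1 a2 a3 a4 a5 : R,
  [/\ 0 <= a1 <= 1 /\ 0 <= a2 <= 1, 0 <= a3 <= 1 /\ 0 <= a4 <= 1, 0 <= a5 <= 1 &
    forall c11 d11 c12 c22 d22, blk c11 d11 c12 c22 d22 i j =
      a1 * c11 + a2 * d11 + a3 * c12 + a4 * c22 + a5 * d22].
Proof.
have b01 (b : bool) : 0 <= (b%:R : R) <= 1 by case: b; apply/andP; split; rewrite ?ler01.
have z01 : 0 <= (0 : R) <= 1 := b01 false.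
have o01 : 0 <= (1 : R) <= 1 := b01 true.
have bb (b : bool) : (b%:R + (~~ b)%:R : R) = 1 by case: b; rewrite /= ?addr0 ?add0r.
rewrite /blk; case: (splitP i) => i' ei; case: (splitP j) => j' ej.
- have -> : i = lshift _ i' by apply: val_inj.
  have -> : j = lshift _ j' by apply: val_inj.
  exists 1, (i' == j')%:R, 0, 0, 0; split=> // *.
  by rewrite block_mxEul !mxE bb; ring.
- have -> : i = lshift _ i' by apply: val_inj.
  have -> : j = rshift _ j' by apply: val_inj.
  exists 0, 0, 1, 0, 0; split=> // *.
  by rewrite block_mxEur !mxE bb; ring.
- have -> : i = rshift _ i' by apply: val_inj.
  have -> : j = lshift _ j' by apply: val_inj.
  exists 0, 0, 1, 0, 0; split=> // *.
  by rewrite block_mxEdl !mxE bb; ring.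
- have -> : i = rshift _ i' by apply: val_inj.
  have -> : j = rshift _ j' by apply: val_inj.
  exists 0, 0, 0, 1, (i' == j')%:R; split=> // *.
  by rewrite block_mxEdr !mxE bb; ring.
Qed.

Lemma blk_bound (i j : idx) c11 d11 c12 c22 d22 :
  `|blk c11 d11 c12 c22 d22 i j| <= `|c11| + `|d11| + `|c12| + `|c22| + `|d22|.
Proof.
have [a1 [a2 [a3 [a4 [a5 [[h1 h2] [h3 h4] h5 ->]]]]]] := blk_lin i j.
have le (a c : R) : 0 <= a <= 1 -> `|a * c| <= `|c|.
  by move=> /andP[a0 a1']; rewrite normrM ger0_norm // ler_piMl.
do 4 (apply: le_trans (ler_normD _ _) _; apply: lerD; last exact: le).
exact: le.
Qed.

Lemma blkB c11 d11 c12 c22 d22 c11' d11' c12' c22' d22' (i j : idx) :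
  blk c11 d11 c12 c22 d22 i j - blk c11' d11' c12' c22' d22' i j =
  blk (c11 - c11') (d11 - d11') (c12 - c12') (c22 - c22') (d22 - d22') i j.
Proof. by have [a1 [a2 [a3 [a4 [a5 [_ _ _ h]]]]]] := blk_lin i j; rewrite !h; ring. Qed.

Lemma blk_tr c11 d11 c12 c22 d22 : (blk c11 d11 c12 c22 d22)^T = blk c11 d11 c12 c22 d22.
Proof.
have t1 (u v : R) : (u *: (1%:M + sigma1) + v *: 1%:M : 'M[R]_2)^T = u *: (1%:M + sigma1) + v *: 1%:M.
  by apply/matrixP => i j; rewrite !mxE eq_sym.
have t2 (u : R) : (u *: (1%:M + sigma1) : 'M[R]_2)^T = u *: (1%:M + sigma1).
  by apply/matrixP => i j; rewrite !mxE eq_sym.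
by rewrite /blk tr_block_mx !t1 !t2.
Qed.

Definition Bw (F : R -> R -> R -> R) (U V : R -> R) (m : R) (i j : idx) (x : R) : R :=
  let z1 := U x ^+ 2 in let z2 := V x ^+ 2 in
  blk (d1 (d1 F) z1 z2 m * U x ^+ 2) (d1 F z1 z2 m) (d1 (d2 F) z1 z2 m * (U x * V x))
    (d2 (d2 F) z1 z2 m * V x ^+ 2) (d2 F z1 z2 m) i j.

Lemma potentialE F U V (m x : R) (i j : idx) : potential F U V m x i j = (Bw F U V m i j x)%:C.
Proof. by rewrite /potential mxE. Qed.

Lemma Bw_sym F U V m : symB (Bw F U V m).
Proof. by move=> i j x; rewrite /Bw -[in LHS]blk_tr mxE. Qed.

Lemma Bw_continuous F U V m i j : Ck 3 F -> continuous U -> continuous V ->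
  continuous (Bw F U V m i j).
Proof.
move=> hF cU cV.
have [a1 [a2 [a3 [a4 [a5 [_ _ _ h]]]]]] := blk_lin i j.
have cG (G : R -> R -> R -> R) : Ck 1 G -> continuous (fun x => G (U x ^+ 2) (V x ^+ 2) m).
  move=> [cG _] x.
  have c2 : (fun x : R => ((U x ^+ 2, V x ^+ 2), m)) y @[y --> x] --> ((U x ^+ 2, V x ^+ 2), m).
    have cU2 : (U y ^+ 2 @[y --> x] --> U x ^+ 2)%classic by apply: cvgM; exact: cU.
    have cV2 : (V y ^+ 2 @[y --> x] --> V x ^+ 2)%classic by apply: cvgM; exact: cV.
    have cm : ((fun=> m) y @[y --> x] --> m)%classic by exact: cvg_cst.
    exact: (cvg_pair (cvg_pair cU2 cV2) cm).
  exact: (cvg_comp _ _ c2 (cG ((U x ^+ 2, V x ^+ 2), m))).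
have F2 := Ck_d1 hF; have F2' := Ck_d2 hF.
pose T x := a1 * (d1 (d1 F) (U x ^+ 2) (V x ^+ 2) m * U x ^+ 2) + a2 * d1 F (U x ^+ 2) (V x ^+ 2) m
  + a3 * (d1 (d2 F) (U x ^+ 2) (V x ^+ 2) m * (U x * V x))
  + a4 * (d2 (d2 F) (U x ^+ 2) (V x ^+ 2) m * V x ^+ 2) + a5 * d2 F (U x ^+ 2) (V x ^+ 2) m.
have -> : Bw F U V m i j = T by apply/funext => x; rewrite /Bw h.
move=> x.
have g1 := cG _ (Ck_d1 F2) x; have g2 := cG _ (Ck_pred F2) x.
have g3 := cG _ (Ck_d1 F2') x; have g4 := cG _ (Ck_d2 F2') x; have g5 := cG _ (Ck_pred F2') x.
apply: cvgD; last by apply: cvgM; [exact: cvg_cst | exact: g5].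
apply: cvgD; last first.
  apply: cvgM; first exact: cvg_cst.
  by apply: cvgM; [exact: g4 | apply: cvgM; exact: cV].
apply: cvgD; last first.
  apply: cvgM; first exact: cvg_cst.
  by apply: cvgM; [exact: g3 | apply: cvgM; [exact: cU | exact: cV]].
apply: cvgD; last by apply: cvgM; [exact: cvg_cst | exact: g2].
apply: cvgM; first exact: cvg_cst.
by apply: cvgM; [exact: g1 | apply: cvgM; exact: cU].
Qed.

End Blocks.

(** * Closeness and decay along the bifurcated branch *)

Section Branch.
Context {R : realType}.
Variables (omega s mb : R) (F : R -> R -> R -> R) (U V : R -> R -> R) (W2 V1 : R -> R).
Variables (c : bool) (eps0 K : R).
Hypotheses (om0 : 0 < omega) (s0 : 0 < s) (hF : nonlinearity F) (ep0 : 0 < eps0).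
Hypothesis V0 : V 0 = fun=> 0.
Hypothesis hw : forall e, 0 <= e < eps0 -> homoclinic_wave F omega s (mb * e ^+ 2) (U e) (V e).
Hypothesis hK : forall e, 0 < e < eps0 -> forall x,
  `|U e x - (U 0 x + e ^+ 2 * W2 x)| <= K * e ^+ 4 /\
  `|V e x - (-1) ^+ c * (e * V1 x)| <= K * e ^+ 3.
Hypothesis hV1 : exists M : R, forall x, `|V1 x| <= M.

Lemma wave_der e : 0 <= e < eps0 ->
  [/\ forall x, der (U e) x (derive1 (U e) x), forall x, der (derive1 (U e)) x (derive1n 2 (U e) x),
   forall x, der (V e) x (derive1 (V e) x) & forall x, der (derive1 (V e)) x (derive1n 2 (V e) x)].
Proof. by move=> /hw [[[u1 u2] [v1 v2]] _ _ _ _]; split=> x; apply: derI. Qed.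

Lemma wave_bounded e : 0 <= e < eps0 -> (exists M : R, forall x, `|U e x| <= M) /\
  continuous (U e) /\ continuous (V e).
Proof.
move=> he; have [u1 _ v1 _] := wave_der he; have [_ _ _ [lp lm] _] := hw he.
have cu : continuous (U e) by move=> x; exact: der_cts (u1 x).
have cv : continuous (V e) by move=> x; exact: der_cts (v1 x).
by split; [exact: cvg0_bounded | split].
Qed.

(** A bound for [W2] comes from the expansion at the single value e = eps0 / 2, since the waves at
    that value and at 0 are bounded. For e < 1 the higher powers of [e] are then below [e]. *)
Lemma branch_near : exists2 C : R, 0 <= C & forall e, 0 <= e < Num.min eps0 1 -> forall x,
  `|U e x - U 0 x| <= C * e /\ `|V e x| <= C * e.
Proof.
have [M1 hM1] := hV1.
have M10 : 0 <= M1 by apply: le_trans (hM1 0); exact: normr_ge0.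
have e20 : 0 < eps0 / 2 < eps0 by apply/andP; split; have := ep0; lra.
have [[M3 h3] _] := wave_bounded (e := eps0 / 2) ltac:(apply/andP; split; have := ep0; lra).
have [[M0 h0] _] := wave_bounded (e := 0) ltac:(rewrite lexx ep0 //).
pose E := eps0 / 2.
have E0 : 0 < E ^+ 2 by rewrite exprn_gt0 //; case/andP: e20.
pose M2 := (M3 + M0 + `|K * E ^+ 4|) / E ^+ 2.
have hM2 x : `|W2 x| <= M2.
  rewrite ler_pdivlMr //; have [+ _] := hK e20 x; rewrite -/E => h.
  have -> : `|W2 x| * E ^+ 2 = `|U E x - U 0 x - (U E x - (U 0 x + E ^+ 2 * W2 x))|.
    rewrite -[X in _ * X](gtr0_norm E0) -normrM; congr `|_|; ring.
  apply: le_trans (ler_normB _ _) _; apply: lerD.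
    by apply: le_trans (ler_normB _ _) _; apply: lerD; [exact: h3 | exact: h0].
  by apply: le_trans h _; exact: ler_norm.
have M20 : 0 <= M2 by apply: le_trans (hM2 0); exact: normr_ge0.
pose C := M1 + M2 + `|K|.
have nK := normr_ge0 K.
exists C => [|e /andP[e0]]; first by rewrite /C; lra.
rewrite lt_min => /andP[ee e1] x.
have [->|en] := eqVneq e 0; first by rewrite V0 subrr normr0 mulr0.
have ep : 0 < e by rewrite lt_neqAle eq_sym en.
have [hu hv] := hK (e := e) ltac:(rewrite ep ee //) x.
have KK : K <= `|K| := ler_norm K.
have q2 : e ^+ 2 <= e by rewrite expr2 ler_piMl // ltW.
have q3 : e ^+ 3 <= e by rewrite exprS ler_piMr // expr_le1 // ltW.
have q4 : e ^+ 4 <= e by rewrite exprS ler_piMr // expr_le1 // ltW.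
have p4 : 0 <= e ^+ 4 by rewrite exprn_ge0.
have p3 : 0 <= e ^+ 3 by rewrite exprn_ge0.
split.
  have -> : U e x - U 0 x = (U e x - (U 0 x + e ^+ 2 * W2 x)) + e ^+ 2 * W2 x by ring.
  apply: le_trans (ler_normD _ _) _.
  have : `|e ^+ 2 * W2 x| <= e * M2.
    rewrite normrM ger0_norm ?exprn_ge0 //; apply: ler_pM => //; exact: exprn_ge0.
  have := ler_wpM2r p4 KK; have := ler_wpM2l nK q4; have := mulr_ge0 M10 e0; rewrite /C; lra.
have -> : V e x = (V e x - (-1) ^+ c * (e * V1 x)) + (-1) ^+ c * (e * V1 x) by ring.
apply: le_trans (ler_normD _ _) _.
have : `|(-1) ^+ c * (e * V1 x)| <= e * M1.
  by rewrite normrM normrX normrN1 expr1n mul1r normrM (ger0_norm e0) ler_wpM2l.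
have := ler_wpM2r p3 KK; have := ler_wpM2l nK q3; have := mulr_ge0 M20 e0; rewrite /C; lra.
Qed.

(** Since (u^2)'' = 2 u'^2 + 2 a u^2 >= cc^2 u^2 whatever the sign of u, the convexity argument
    applies to the square. *)
Lemma sq_decay (u a : R -> R) (cc X : R) : 0 < cc -> 
  (forall x, der u x (derive1 u x)) -> (forall x, der (derive1 u) x (derive1n 2 u x)) ->
  (forall x, derive1n 2 u x = a x * u x) -> (forall x, X <= x -> cc ^+ 2 <= 2 * a x) ->
  u x @[x --> +oo] --> 0 ->
  forall x, X <= x -> u x ^+ 2 <= u X ^+ 2 * expR (- cc * (x - X)).
Proof.
move=> c0 d1u d2u hu ha lu.
apply: (@convex_decay _ (fun x => u x ^+ 2) (fun x => 2 * (u x * derive1 u x))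
  (fun x => 2 * (derive1 u x ^+ 2 + a x * u x ^+ 2))) => // [x|x|x Xx|].
- by apply: der_eq (derM (d1u x) (d1u x)) _; ring.
- by apply: der_eq (derZ 2 (derM (d1u x) (d2u x))) _; rewrite hu; ring.
- have := ler_wpM2r (sqr_ge0 (u x)) (ha x Xx); have := sqr_ge0 (derive1 u x); lra.
- have -> : (0 : R) = 0 * 0 by rewrite mulr0.
  by apply: cvgM.
Qed.

End Branch.

Section BranchBounds.
Context {R : realType}.

Lemma Ck1_bound (F G : R -> R -> R -> R) (M : R) : Ck 1 G ->
  exists2 K : R, 0 <= K & forall x y z, `|x| <= M -> `|y| <= M -> `|z| <= M -> `|G x y z| <= K.
Proof. by case=> cG _; exact: box_bounded. Qed.

Lemma cvg_refl0 (u : R -> R) : u x @[x --> -oo] --> 0 -> u (- x) @[x --> +oo] --> 0.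
Proof. by move/cvgNy_compNP. Qed.

(** Uniformity in [e] is the point. The first derivatives of F vanish at the origin and are
    Lipschitz, so they are at most [ll * q] with q = U^2 + V^2. Closeness to U_0 makes this at most
    mu / 2 outside a fixed interval, which gives decay of q at a rate independent of [e]; the
    potential is bounded by a multiple of q. *)
Lemma branch_bounds (omega s mb : R) (F : R -> R -> R -> R) (U V : R -> R -> R) (W2 V1 : R -> R)
    (c : bool) (eps0 K : R) (Bf := fun e => Bw F (U e) (V e) (mb * e ^+ 2)) :
  0 < omega -> 0 < s -> nonlinearity F -> 0 < eps0 -> V 0 = (fun=> 0) ->
  (forall e : R, 0 <= e < eps0 -> homoclinic_wave F omega s (mb * e ^+ 2) (U e) (V e)) ->
  (forall e : R, 0 < e < eps0 -> forall x,
    `|U e x - (U 0 x + e ^+ 2 * W2 x)| <= K * e ^+ 4 /\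
    `|V e x - (-1) ^+ c * (e * V1 x)| <= K * e ^+ 3) ->
  (exists M : R, forall x, `|V1 x| <= M) ->
  exists c0 Kb e1 : R, [/\ 0 < c0, 0 <= Kb, 0 < e1 <= eps0 &
  forall e : R, 0 <= e < e1 -> [/\ forall i j, continuous (Bf e i j),
     forall i j x, `|Bf e i j x| <= Kb * expR (- c0 * `|x|) &
     forall i j x, `|Bf e i j x - Bf 0 i j x| <= Kb * e]].
Proof.
move=> om0 s0 hF ep0 V0 hw hK hV1.
have [C C0 hC] := branch_near ep0 V0 hw hK hV1.
have e00 : 0 <= (0 : R) < eps0 by rewrite lexx ep0.
have [[M0 hM0] _] := wave_bounded hw e00.
have M00 : 0 <= M0 by apply: le_trans (hM0 0); exact: normr_ge0.
have [C3 hF0 _] := hF.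
pose M := M0 + C.
have MM : 0 <= M by rewrite /M addr_ge0.
pose N := M ^+ 2 + `|mb|.
have N1 : M ^+ 2 <= N by rewrite /N lerDl.
have N2 : `|mb| <= N by rewrite /N lerDr sqr_ge0.
have N0 : 0 <= N by apply: le_trans N2; exact: normr_ge0.
have CF1 := Ck_d1 C3; have CF2 := Ck_d2 C3.
have [l1 l10 L1] := box_lipschitz N (Ck_pred CF1).
have [l2 l20 L2] := box_lipschitz N (Ck_pred CF2).
have [l3 l30 L3] := box_lipschitz N (Ck_d1 CF1).
have [l4 l40 L4] := box_lipschitz N (Ck_d1 CF2).
have [l5 l50 L5] := box_lipschitz N (Ck_d2 CF2).
have [b3 b30 B3] := Ck1_bound F N (Ck_d1 CF1).
have [b4 b40 B4] := Ck1_bound F N (Ck_d1 CF2).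
have [b5 b50 B5] := Ck1_bound F N (Ck_d2 CF2).
pose ll := l1 + l2 + l3 + l4 + l5 + b3 + b4 + b5.
have ll0 : 0 <= ll by rewrite /ll !addr_ge0.
have [[k1 k2] [k3 k4] [k5 k6] [k7 k8]] : [/\ l1 <= ll /\ l2 <= ll, l3 <= ll /\ l4 <= ll,
    l5 <= ll /\ b3 <= ll & b4 <= ll /\ b5 <= ll].
  by rewrite /ll; clear -l10 l20 l30 l40 l50 b30 b40 b50; split; split; lra.
have bndU (e x : R) : 0 <= e < Num.min eps0 1 -> `|U e x| <= M /\ `|V e x| <= M.
  move=> he; have [h1 h2] := hC e he x; move: he; rewrite lt_min => /andP[e0 /andP[_ e1]].
  have Ce : C * e <= C by rewrite ler_piMr // ltW.
  split; last by apply: le_trans h2 (le_trans Ce _); rewrite /M lerDr.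
  have -> : U e x = (U e x - U 0 x) + U 0 x by ring.
  by apply: le_trans (ler_normD _ _) _; move: h1 Ce (hM0 x); rewrite /M; clear; lra.
have bndsq (t : R) : `|t| <= M -> `|t ^+ 2| <= N.
  by move=> tM; rewrite normrX; apply: le_trans N1; rewrite lerXn2r ?nnegrE.
have bndm (e : R) : 0 <= e < Num.min eps0 1 -> `|mb * e ^+ 2| <= N.
  rewrite lt_min => /andP[e0 /andP[_ e1]].
  rewrite normrM normrX (ger0_norm e0); apply: le_trans N2.
  by rewrite ler_piMr // expr_le1 // ltW.
have n0 : `|0 : R| <= N by rewrite normr0.
pose q e x := U e x ^+ 2 + V e x ^+ 2.
have q0 e x : 0 <= q e x by rewrite addr_ge0 ?sqr_ge0.
have dF (e x : R) : 0 <= e < Num.min eps0 1 ->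
   `|d1 F (U e x ^+ 2) (V e x ^+ 2) (mb * e ^+ 2)| <= ll * q e x /\
   `|d2 F (U e x ^+ 2) (V e x ^+ 2) (mb * e ^+ 2)| <= ll * q e x.
  move=> he; have [hu hv] := bndU e x he; have hm := bndm e he.
  have [_ z1 z2] := hF0 (mb * e ^+ 2).
  have := L1 _ _ _ _ _ _ (bndsq _ hu) (bndsq _ hv) hm n0 n0 hm.
  have := L2 _ _ _ _ _ _ (bndsq _ hu) (bndsq _ hv) hm n0 n0 hm.
  rewrite z1 z2 !subr0 subrr normr0 addr0 !(ger0_norm (sqr_ge0 _)) -/(q e x) => h1 h2.
  split; [apply: le_trans h2 _ | apply: le_trans h1 _]; exact: ler_wpM2r.
pose mu := Num.min omega s.
have mu0 : 0 < mu by rewrite lt_min om0.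
have muo : mu <= omega by rewrite ge_min lexx.
have mus : mu <= s by rewrite ge_min lexx orbT.
(* Outside [-X, X] one will have |U e| <= 2 eta and |V e| <= eta, hence q <= 5 eta and ll q <= mu /
   2; this dictates the factor 10. *)
pose eta := Num.min 1 (mu / (10 * (ll + 1))).
have llp : 0 < 10 * (ll + 1) by rewrite mulr_gt0 // ltr_wpDl.
have eta0 : 0 < eta by rewrite lt_min ltr01 divr_gt0.
have eta1 : eta <= 1 by rewrite ge_min lexx.
have eta2 : eta * (10 * (ll + 1)) <= mu.
  by rewrite -ler_pdivlMr // ge_min lexx orbT.
pose e1 := Num.min (Num.min eps0 1) (eta / (C + 1)).
have Cp : 0 < C + 1 by rewrite ltr_wpDl.
have e10 : 0 < e1 by rewrite !lt_min ep0 ltr01 divr_gt0.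
have e1e (e : R) : 0 <= e < e1 -> 0 <= e < Num.min eps0 1 /\ C * e <= eta.
  rewrite !lt_min => /andP[e0 /andP[/andP[h1 h2] h3]]; rewrite e0 h1 h2; split => //.
  by move: h3 e0; rewrite ltr_pdivlMr //; clear; lra.
have [_ _ _ [Ulp Ulm] _] := hw _ e00.
have /cvgrPdist_le /(_ _ eta0) [P [_ hP]] := Ulp.
have /cvgrPdist_le /(_ _ eta0) [Q [_ hQ]] := Ulm.
pose X := `|P| + `|Q| + 1.
have nP := ler_norm P; have nQ := ler_norm (- Q); rewrite normrN in nQ.
have pP := normr_ge0 P; have pQ := normr_ge0 Q.
have X0 : 0 <= X by rewrite /X !addr_ge0.
have small (e x : R) : 0 <= e < e1 -> X <= `|x| -> ll * q e x <= mu / 2.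
  move=> /e1e[he Ce] Xx; have [h1 h2] := hC e he x.
  have hU0 : `|U 0 x| <= eta.
    have [x0|x0] := leP 0 x.
      have /hP : P < x by move: Xx nP pQ; rewrite ger0_norm // /X; clear; lra.
      by rewrite sub0r normrN.
    have /hQ : x < Q by move: Xx nQ pP; rewrite ltr0_norm // /X; clear; lra.
    by rewrite sub0r normrN.
  have hU : `|U e x| <= 2 * eta.
    have -> : U e x = (U e x - U 0 x) + U 0 x by ring.
    by apply: le_trans (ler_normD _ _) _; move: h1 hU0 Ce; clear; lra.
  have hV : `|V e x| <= eta by exact: le_trans h2 Ce.
  have sU : U e x ^+ 2 <= (2 * eta) ^+ 2.
    by rewrite -real_normK ?num_real // lerXn2r ?nnegrE // mulr_ge0 // ltW.
  have sV : V e x ^+ 2 <= eta ^+ 2.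
    by rewrite -real_normK ?num_real // lerXn2r ?nnegrE // ltW.
  have ee : eta ^+ 2 <= eta by rewrite expr2 ler_piMl // ltW.
  have hq : q e x <= 5 * eta.
    apply: le_trans (lerD sU sV) _; rewrite exprMn; clear -ee; lra.
  have := ler_wpM2l ll0 hq; clear -eta2 eta0; lra.
pose cc := Num.min 1 mu.
have cc0 : 0 < cc by rewrite lt_min ltr01.
have cc2 : cc ^+ 2 <= mu.
  have c1 : cc <= 1 by rewrite ge_min lexx.
  have c2 : cc <= mu by rewrite ge_min lexx orbT.
  by apply: le_trans c2; rewrite expr2 ler_piMl // ltW.
have e1eps (e : R) : 0 <= e < e1 -> 0 <= e < eps0.
  by move=> /e1e[]; rewrite lt_min => /andP[-> /andP[-> _]].
have decU (e x : R) : 0 <= e < e1 -> X <= x ->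
    [/\ U e x ^+ 2 <= M ^+ 2 * expR (- cc * (x - X)), V e x ^+ 2 <= M ^+ 2 * expR (- cc * (x - X)),
     U e (- x) ^+ 2 <= M ^+ 2 * expR (- cc * (x - X)) & V e (- x) ^+ 2 <= M ^+ 2 * expR (- cc * (x - X))].
  move=> he Xx; have he' := e1eps e he; have [he2 _] := e1e e he.
  have [u1 u2 v1 v2] := wave_der hw he'.
  have [_ eqU eqV [up um] [vp vm]] := hw _ he'.
  have Msq (t : R) : `|t| <= M -> t ^+ 2 <= M ^+ 2.
    by move=> tM; rewrite -real_normK ?num_real // lerXn2r ?nnegrE.
  have fin (t : R) (f : R -> R) : `|f X| <= M -> t <= f X ^+ 2 * expR (- cc * (x - X)) ->
      t <= M ^+ 2 * expR (- cc * (x - X)).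
    by move=> fM /le_trans; apply; rewrite ler_wpM2r ?expR_ge0 // Msq.
  pose au y := omega - d1 F (U e y ^+ 2) (V e y ^+ 2) (mb * e ^+ 2).
  pose av y := s - d2 F (U e y ^+ 2) (V e y ^+ 2) (mb * e ^+ 2).
  have aub y : X <= `|y| -> cc ^+ 2 <= 2 * au y /\ cc ^+ 2 <= 2 * av y.
    move=> Xy; have [h1 h2] := dF e y he2; have h3 := small e y he Xy.
    move: h1 h2; rewrite !ler_norml => /andP[_ h1] /andP[_ h2].
    rewrite /au /av; clear -h1 h2 h3 muo mus cc2; split; lra.
  have eU y : derive1n 2 (U e) y = au y * U e y by have := eqU y; rewrite /au; clear; lra.
  have eV y : derive1n 2 (V e) y = av y * V e y by have := eqV y; rewrite /av; clear; lra.
  have pos y : X <= y -> X <= `|y| by move=> h; rewrite ger0_norm //; exact: le_trans h.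
  (* Both ends at once: the left tail is the right tail of the reflected function. *)
  have refl (f : R -> R) (al : R -> R) : (forall y, der f y (derive1 f y)) ->
     (forall y, der (derive1 f) y (derive1n 2 f y)) -> (forall y, derive1n 2 f y = al y * f y) ->
     (forall y, X <= `|y| -> cc ^+ 2 <= 2 * al y) -> f y @[y --> +oo] --> 0 -> f y @[y --> -oo] --> 0 ->
     (forall y, `|f y| <= M) ->
     f x ^+ 2 <= M ^+ 2 * expR (- cc * (x - X)) /\ f (- x) ^+ 2 <= M ^+ 2 * expR (- cc * (x - X)).
    move=> g1 g2 ge ga gp gm gM; split.
      apply: (fin _ f) => //; apply: (@sq_decay _ f al) => // y Xy; exact: ga (pos _ Xy).
    pose h y := f (- y).
    have dh y : der h y (- derive1 f (- y)) by exact: der_opp.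
    have dh1 : derive1 h = fun y => - derive1 f (- y).
      by apply/funext => y; case: (derE (dh y)).
    have ddh y : der (derive1 h) y (derive1n 2 f (- y)).
      by rewrite dh1; apply: der_eq (derN (der_opp (g2 (- y)))) _; rewrite opprK.
    have dh2 y : derive1n 2 h y = derive1n 2 f (- y) by case: (derE (ddh y)).
    apply: (fin _ h); first exact: gM.
    apply: (@sq_decay R h (fun y => al (- y)) cc X cc0 _ _ _ _ _ x Xx).
    - by move=> y; rewrite dh1.
    - by move=> y; rewrite dh2.
    - by move=> y; rewrite dh2 ge.
    - by move=> y Xy; apply: ga; rewrite normrN; exact: pos.
    - exact: cvg_refl0.
  have [r1 r2] := refl (U e) au u1 u2 eU (fun y h => (aub y h).1) up um (fun y => (bndU e y he2).1).
  have [r3 r4] := refl (V e) av v1 v2 eV (fun y h => (aub y h).2) vp vm (fun y => (bndU e y he2).2).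
  by split.
(* The factor e^{cc X} makes the exponential bound hold on [-X, X] too, where q <= 2 M^2 is all that
   is known. *)
pose D := 2 * M ^+ 2 * expR (cc * X).
have D0 : 0 <= D by rewrite /D mulr_ge0 ?expR_ge0 // mulr_ge0 // sqr_ge0.
have qdec (e x : R) : 0 <= e < e1 -> q e x <= D * expR (- cc * `|x|).
  move=> he.
  have far y : X <= y -> q e y <= D * expR (- cc * y) /\ q e (- y) <= D * expR (- cc * y).
    move=> Xy; have [r1 r2 r3 r4] := decU e y he Xy.
    have E : D * expR (- cc * y) = 2 * (M ^+ 2 * expR (- cc * (y - X))).
      have -> : expR (- cc * (y - X)) = expR (cc * X) * expR (- cc * y).
        by rewrite -expRD; congr expR; ring.
      by rewrite /D; ring.
    by rewrite E /q; clear -r1 r2 r3 r4; split; lra.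
  have [x0|x0] := leP 0 x.
    rewrite ger0_norm //; have [Xx|xX] := leP X x; first by case: (far x Xx).
    have [he2 _] := e1e e he; have [hu hv] := bndU e x he2.
    have h1 : q e x <= 2 * M ^+ 2.
      rewrite /q -(real_normK (num_real (U e x))) -(real_normK (num_real (V e x))).
      have : `|U e x| ^+ 2 <= M ^+ 2 by rewrite lerXn2r ?nnegrE.
      have : `|V e x| ^+ 2 <= M ^+ 2 by rewrite lerXn2r ?nnegrE.
      by clear; lra.
    apply: le_trans h1 _; rewrite /D -mulrA -expRD ler_peMr ?mulr_ge0 ?sqr_ge0 //.
    by rewrite -expR0 ler_expR; have := ltW xX; clear -cc0; nra.
  rewrite ltr0_norm //; have [Xx|xX] := leP X (- x); first by case: (far (- x) Xx); rewrite opprK.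
  have [he2 _] := e1e e he; have [hu hv] := bndU e x he2.
  have h1 : q e x <= 2 * M ^+ 2.
    rewrite /q -(real_normK (num_real (U e x))) -(real_normK (num_real (V e x))).
    have : `|U e x| ^+ 2 <= M ^+ 2 by rewrite lerXn2r ?nnegrE.
    have : `|V e x| ^+ 2 <= M ^+ 2 by rewrite lerXn2r ?nnegrE.
    by clear; lra.
  apply: le_trans h1 _; rewrite /D -mulrA -expRD ler_peMr ?mulr_ge0 ?sqr_ge0 //.
  by rewrite -expR0 ler_expR; have := ltW xX; clear -cc0; nra.
have UVq (u v : R) : `|u * v| <= u ^+ 2 + v ^+ 2.
  rewrite normrM -(real_normK (num_real u)) -(real_normK (num_real v)).
  have := sqr_ge0 (`|u| - `|v|); have := mulr_ge0 (normr_ge0 u) (normr_ge0 v); clear; nra.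
(* [E0 * e] bounds the total displacement of the three arguments of F; [G0 * e] below bounds the
   change of a second derivative of F times a quadratic expression in (U, V). *)
pose E0 := 2 * M * C + C * C + `|mb|.
have E00 : 0 <= E0.
  by do 2 (apply: addr_ge0 => //); apply: mulr_ge0 => //; apply: mulr_ge0.
pose G0 := ll * (E0 * (N + 1) + (E0 + M * C)).
have N10 : 0 <= N + 1 by rewrite addr_ge0.
have EM0 : 0 <= E0 + M * C by apply: addr_ge0 => //; apply: mulr_ge0.
have G00 : 0 <= G0 by apply: mulr_ge0 => //; apply: addr_ge0 => //; apply: mulr_ge0.
pose Kb := 5 * ll * D + 5 * G0.
have Kb1 : 0 <= 5 * ll * D by apply: mulr_ge0 => //; apply: mulr_ge0.
have Kb2 : 0 <= 5 * G0 by apply: mulr_ge0.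
exists cc, Kb, e1; split => //; first by rewrite /Kb addr_ge0.
  by rewrite e10 !ge_min lexx.
move=> e he; have he' := e1eps e he; have [he2 _] := e1e e he.
have [_ [cU cV]] := wave_bounded hw he'.
split=> [i j|i j x|i j x].
- exact: Bw_continuous.
- apply: le_trans (blk_bound _ _ _ _ _ _ _) _.
  have [hu hv] := bndU e x he2; have hm := bndm e he2.
  have [dF1 dF2] := dF e x he2.
  have g3 := B3 _ _ _ (bndsq _ hu) (bndsq _ hv) hm.
  have g4 := B4 _ _ _ (bndsq _ hu) (bndsq _ hv) hm.
  have g5 := B5 _ _ _ (bndsq _ hu) (bndsq _ hv) hm.
  have lb (b : R) : `|b| <= ll -> forall t : R, `|t| <= q e x -> `|b * t| <= ll * q e x.
    by move=> hb t ht; rewrite normrM; exact: ler_pM.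
  have t1 : `|U e x ^+ 2| <= q e x by rewrite ger0_norm ?sqr_ge0 // /q lerDl sqr_ge0.
  have t2 : `|V e x ^+ 2| <= q e x by rewrite ger0_norm ?sqr_ge0 // /q lerDr sqr_ge0.
  have a1 := lb _ (le_trans g3 k6) _ t1.
  have a2 := lb _ (le_trans g4 k7) _ (UVq (U e x) (V e x)).
  have a3 := lb _ (le_trans g5 k8) _ t2.
  have step : 5 * (ll * q e x) <= Kb * expR (- cc * `|x|).
    have := ler_wpM2l (_ : 0 <= 5 * ll) (qdec e x he); rewrite mulr_ge0 // => /(_ isT) h.
    have := mulr_ge0 Kb2 (expR_ge0 (- cc * `|x|)); rewrite /Kb; clear -h; lra.
  apply: le_trans step; clear -a1 a2 a3 dF1 dF2; lra.
rewrite /Bw blkB; apply: le_trans (blk_bound _ _ _ _ _ _ _) _.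
have he0 : 0 <= (0 : R) < Num.min eps0 1 by rewrite lexx lt_min ep0 ltr01.
have [hu hv] := bndU e x he2; have hm := bndm e he2.
have [hu0 hv0] := bndU 0 x he0; have hm0 := bndm 0 he0.
have [nu nv] := hC e he2 x.
have e0 : 0 <= e by case/andP: he.
have e11 : e <= 1 by move: he2; rewrite lt_min => /andP[_ /andP[_ /ltW]].
have ee : e ^+ 2 <= e by rewrite expr2 ler_piMl.
have Ce0 : 0 <= C * e by rewrite mulr_ge0.
have x1 : `|U e x ^+ 2 - U 0 x ^+ 2| <= 2 * M * C * e.
  have -> : U e x ^+ 2 - U 0 x ^+ 2 = (U e x + U 0 x) * (U e x - U 0 x) by ring.
  rewrite normrM -mulrA; apply: ler_pM => //.
  by apply: le_trans (ler_normD _ _) _; clear -hu hu0; lra.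
have v00 : V 0 x = 0 by rewrite V0.
have x2 : `|V e x ^+ 2 - V 0 x ^+ 2| <= C * C * e.
  rewrite v00 expr0n subr0 normrX; apply: (@le_trans _ _ ((C * e) ^+ 2)).
    by rewrite lerXn2r ?nnegrE.
  have -> : (C * e) ^+ 2 = C * C * e ^+ 2 by ring.
  by rewrite ler_wpM2l ?mulr_ge0.
have x3 : `|mb * e ^+ 2 - mb * 0 ^+ 2| <= `|mb| * e.
  by rewrite expr0n mulr0 subr0 normrM normrX (ger0_norm e0) ler_wpM2l.
have sum : `|U e x ^+ 2 - U 0 x ^+ 2| + `|V e x ^+ 2 - V 0 x ^+ 2| + `|mb * e ^+ 2 - mb * 0 ^+ 2| <= E0 * e.
  by rewrite /E0; clear -x1 x2 x3; lra.
have x4 : `|U e x * V e x - U 0 x * V 0 x| <= M * (C * e).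
  by rewrite v00 mulr0 subr0 normrM; exact: ler_pM.
have lipE (G : R -> R -> R -> R) (l : R) : 0 <= l -> l <= ll ->
   (forall x y z x' y' z', `|x| <= N -> `|y| <= N -> `|z| <= N -> `|x'| <= N ->
      `|y'| <= N -> `|z'| <= N -> `|G x y z - G x' y' z'| <= l * (`|x - x'| + `|y - y'| + `|z - z'|)) ->
   `|G (U e x ^+ 2) (V e x ^+ 2) (mb * e ^+ 2) - G (U 0 x ^+ 2) (V 0 x ^+ 2) (mb * 0 ^+ 2)| <= ll * (E0 * e).
  move=> lp lle hG; apply: le_trans (hG _ _ _ _ _ _ (bndsq _ hu) (bndsq _ hv) hm (bndsq _ hu0) (bndsq _ hv0) hm0) _.
  by apply: ler_pM => //; do 2 apply: addr_ge0 => //.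
have y1 := lipE _ _ l10 k1 L1; have y2 := lipE _ _ l20 k2 L2; have y3 := lipE _ _ l30 k3 L3.
have y4 := lipE _ _ l40 k4 L4; have y5 := lipE _ _ l50 k5 L5.
have prodE (g g' t t' : R) : `|g - g'| <= ll * (E0 * e) -> `|g'| <= ll -> `|t| <= N ->
    `|t - t'| <= (E0 + M * C) * e -> `|g * t - g' * t'| <= G0 * e.
  move=> h1 h2 h3 h4; have -> : g * t - g' * t' = (g - g') * t + g' * (t - t') by ring.
  apply: le_trans (ler_normD _ _) _; rewrite !normrM.
  have p1 : `|g - g'| * `|t| <= ll * (E0 * e) * N by apply: ler_pM.
  have p2 : `|g'| * `|t - t'| <= ll * ((E0 + M * C) * e) by apply: ler_pM.
  have p3 : 0 <= ll * (E0 * e) by do 2 apply: mulr_ge0 => //.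
  by apply: le_trans (lerD p1 p2) _; rewrite /G0; clear -p3; nra.
have G0E : ll * (E0 * e) <= G0 * e.
  have q1 : 0 <= ll * (E0 * e) * N by apply: mulr_ge0 => //; do 2 apply: mulr_ge0 => //.
  have q2 : 0 <= ll * ((E0 + M * C) * e) by do 2 apply: mulr_ge0 => //.
  by rewrite /G0; clear -q1 q2; lra.
have MC0 : 0 <= M * C * e by do 2 apply: mulr_ge0 => //.
have mbe : 0 <= `|mb| * e by apply: mulr_ge0.
have sq0 : 0 <= C * C * e by do 2 apply: mulr_ge0 => //.
have msq0 : 0 <= 2 * M * C * e by do 3 apply: mulr_ge0 => //.
have t1 : `|U e x ^+ 2 - U 0 x ^+ 2| <= (E0 + M * C) * e.
  by apply: le_trans x1 _; rewrite /E0; clear -MC0 mbe sq0; lra.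
have t2 : `|V e x ^+ 2 - V 0 x ^+ 2| <= (E0 + M * C) * e.
  by apply: le_trans x2 _; rewrite /E0; clear -MC0 mbe msq0; lra.
have t3 : `|U e x * V e x - U 0 x * V 0 x| <= (E0 + M * C) * e.
  apply: le_trans x4 _; rewrite /E0; clear -MC0 mbe msq0 sq0; lra.
have t4 : `|U e x * V e x| <= N.
  by rewrite normrM; apply: le_trans N1; rewrite expr2; apply: ler_pM.
have z1 := prodE _ _ _ _ y3 (le_trans (B3 _ _ _ (bndsq _ hu0) (bndsq _ hv0) hm0) k6) (bndsq _ hu) t1.
have z2 := prodE _ _ _ _ y4 (le_trans (B4 _ _ _ (bndsq _ hu0) (bndsq _ hv0) hm0) k7) t4 t3.
have z3 := prodE _ _ _ _ y5 (le_trans (B5 _ _ _ (bndsq _ hu0) (bndsq _ hv0) hm0) k8) (bndsq _ hv) t2.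
have z4 := le_trans y1 G0E; have z5 := le_trans y2 G0E.
have De : 0 <= 5 * ll * D * e by apply: mulr_ge0.
rewrite /Kb; clear -z1 z2 z3 z4 z5 De; lra.
Qed.

End BranchBounds.

(** * Jost solutions in the gamma variable *)

Section Spectral.
Context {R : realType}.
Local Notation C := R[i].
Implicit Types (omega s : R) (b : bool) (g : C).

(** Sign of [gamma ^+ 2] in [nusq]; it is +1 exactly for the indices whose exponent may vanish at
    the branch point. *)
Definition sgb b (j : idx) : R := if odd j == ~~ b then 1 else -1.
Definition frq omega s (j : idx) : R := if (j < 2)%N then omega else s.
Definition nb omega s b (j : idx) : R := frq omega s j - sgb b j * Num.min omega s.
Definition kapb omega s b (j : idx) : R := Num.sqrt (nb omega s b j).

Lemma idx_cases (P : idx -> Prop) : (forall j : idx, (j = 0 :> nat)%N -> P j) ->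
  (forall j : idx, (j = 1 :> nat)%N -> P j) -> (forall j : idx, (j = 2 :> nat)%N -> P j) ->
  (forall j : idx, (j = 3 :> nat)%N -> P j) -> forall j, P j.
Proof.
move=> h0 h1 h2 h3 j; have := ltn_ord j; rewrite !ltnS leq_eqVlt => /predU1P[/h3//|].
rewrite !ltnS leq_eqVlt => /predU1P[/h2//|]; rewrite !ltnS leq_eqVlt => /predU1P[/h1//|].
by rewrite ltnS leqn0 => /eqP /h0.
Qed.

Lemma i_sqr : 'i%C * 'i%C = -1 :> C.
Proof. by rewrite -expr2 sqr_i. Qed.

Lemma nusqE omega s b g j :
  nusq omega s (lambda_of omega s b g) j = (nb omega s b j)%:C + (sgb b j)%:C * g ^+ 2.
Proof.
rewrite /nusq /nb /frq /sgb /lambda_of /lambda0; have ii := i_sqr.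
set m := Num.min omega s.
have e1 (u v : C) : 'i%C * (u * ('i%C * v)) = - (u * v).
  by rewrite mulrCA (mulrA 'i%C 'i%C) ii; ring.
case: b; move: j; apply: idx_cases => j -> /=; rewrite ?expr0 ?expr1 ?mul1r ?mulN1r ?opprK mulrDr ?mulrN ?mulrA ii;
  rewrite !(rmorphB, rmorphD, rmorphN, rmorphM, rmorph1); ring.
Qed.

Lemma frq_ge omega s j : Num.min omega s <= frq omega s j.
Proof. by rewrite /frq; case: ifP => _; rewrite ge_min lexx ?orbT. Qed.

Lemma sgb_or b j : sgb b j = 1 \/ sgb b j = -1.
Proof. by rewrite /sgb; case: ifP; [left|right]. Qed.

Lemma nb_ge0 omega s b j : 0 < omega -> 0 < s -> 0 <= nb omega s b j.
Proof.
move=> o0 s0; have := frq_ge omega s j; have : 0 < Num.min omega s by rewrite lt_min o0.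
by rewrite /nb; case: (sgb_or b j) => ->; lra.
Qed.

Lemma kapb_sqr omega s b j : 0 < omega -> 0 < s -> kapb omega s b j ^+ 2 = nb omega s b j.
Proof. by move=> o0 s0; rewrite sqr_sqrtr // nb_ge0. Qed.

Lemma kapb0 omega s b j : 0 < omega -> 0 < s -> kapb omega s b j = 0 -> sgb b j = 1.
Proof.
move=> o0 s0 /eqP; rewrite sqrtr_eq0 /nb.
have := frq_ge omega s j; have : 0 < Num.min omega s by rewrite lt_min o0.
by case: (sgb_or b j) => -> //; lra.
Qed.

Lemma nusq_lambda0 omega s b j : nusq omega s (lambda0 omega s b) j = (nb omega s b j)%:C.
Proof.
have <- : lambda_of omega s b 0 = lambda0 omega s b.
  by rewrite /lambda_of expr0n !mulr0 subr0.
by rewrite nusqE expr0n mulr0 addr0.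
Qed.

Lemma Re_sqrt_up (z : C) : 0 < complex.Re z -> 0 < complex.Re (sqrt_up z).
Proof.
have := sqrtCK z; rewrite /sqrt_up; move: (sqrtC z) => w <-; rewrite expr2 cReM; case: w => x y /=.
by move=> h; case: ifP => h2 /=; nra.
Qed.

Lemma Re_sqrt_down (z : C) : 0 < complex.Re z -> 0 < complex.Re (sqrt_down z).
Proof.
have := sqrtCK z; rewrite /sqrt_down; move: (sqrtC z) => w <-; rewrite expr2 cReM; case: w => x y /=.
by move=> h; case: ifP => h2 /=; nra.
Qed.

(** A replaced exponent is [g] itself. For the others |g| < ca <= kap keeps [nusq] in the right
    half-plane, where both branches of the square root have positive real part. *)
Lemma Re_nu_ext c omega s b g j : good_consts c -> 0 < omega -> 0 < s ->
  ckap c = kapb omega s b -> cn g < ca c -> 0 < complex.Re g ->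
  0 < complex.Re (nu_ext omega s b g j).
Proof.
move=> gc o0 s0 hk ga g0; rewrite /nu_ext nusq_lambda0.
case: ifP => [//|nz].
have nz' : nb omega s b j != 0 by apply: contraFN nz => /eqP ->.
suff h : 0 < complex.Re (nusq omega s (lambda_of omega s b g) j).
  by rewrite /nu; case: ifP => _; [apply: Re_sqrt_up | apply: Re_sqrt_down].
rewrite nusqE.
have k0 : 0 < kapb omega s b j by rewrite sqrtr_gt0 lt_neqAle eq_sym nz' nb_ge0.
have ak : ca c <= kapb omega s b j.
  have [h1 _ /(_ j)[_ _ hj] _ _] := gc; have := ca_ck gc.
  have [c0 _ _ _ a0] := h1; rewrite -hk in k0 *.
  by case: hj => [[h0 _]|[h2 _]]; [rewrite h0 ltxx in k0 | lra].
have h2 : cn (g ^+ 2) < kapb omega s b j ^+ 2.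
  by rewrite cnX ltrXn2r ?cn_ge0 //; apply: lt_le_trans ga ak.
rewrite cReD /= -kapb_sqr //.
have : `|complex.Re ((sgb b j)%:C * g ^+ 2)| <= cn (g ^+ 2).
  by apply: le_trans (Re_le _) _; case: (sgb_or b j) => ->; rewrite ?rmorphN ?rmorph1 ?mulN1r ?mul1r ?cnN.
by rewrite ler_norml => /andP[h3 _]; lra.
Qed.

Section Asymptotics.
Variables (n : idx -> C) (P Q : idx -> idx -> R -> C) (A : idx -> idx -> C).
Hypothesis hP : forall i, exists K k : R, 0 < k /\ forall j x, 0 <= x ->
  cn (cexp (n i * x%:C) * P i j x - (i == j)%:R) <= K * expR (- k * x) /\
  cn (cexp (n i * x%:C) * Q i j x - A i j) <= K * expR (- k * x).

Lemma asym_decays i : 0 < complex.Re (n i) -> decays (P i) /\ decays (Q i).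
Proof.
move=> n0; have [K [k [k0 h]]] := hP i.
have gen (f : idx -> R -> C) (a : idx -> C) : (forall j x, 0 <= x ->
    cn (cexp (n i * x%:C) * f j x - a j) <= K * expR (- k * x)) -> decays f.
  move=> hf j e e0.
  pose M := `|K| + cn (a j) + 1.
  have K0 := normr_ge0 K; have a0 := cn_ge0 (a j).
  have M0 : 0 < M by rewrite /M; lra.
  have [X [_ hX]] := expR_small n0 (divr_gt0 e0 M0).
  exists (`|X|) => x Xx; have x0 : 0 <= x by apply: le_trans Xx; exact: normr_ge0.
  have := hX x (le_trans (ler_norm X) Xx); rewrite ler_pdivlMr // => h1.
  have -> : f j x = cexp (- (n i * x%:C)) * ((cexp (n i * x%:C) * f j x - a j) + a j).
    by rewrite subrK mulrA -cexpD addNr cexp0 mul1r.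
  rewrite cnM cn_cexp.
  have -> : complex.Re (- (n i * x%:C)) = - complex.Re (n i) * x.
    by rewrite cReN cReM /= mulr0 subr0 mulNr.
  apply: le_trans h1; apply: ler_wpM2l; first exact: expR_ge0.
  have e1 : expR (- k * x) <= 1 by rewrite -expR0 ler_expR mulNr oppr_le0 mulr_ge0 // ltW.
  have := hf j x x0; have := cnD (cexp (n i * x%:C) * f j x - a j) (a j).
  have : K * expR (- k * x) <= `|K|.
    apply: le_trans (ler_wpM2r (expR_ge0 _) (ler_norm K)) _.
    by rewrite ler_piMr.
  by rewrite /M; lra.
split; first by apply: (gen _ (fun j => (i == j)%:R)) => j x x0; case: (h j x x0).
by apply: (gen _ (A i)) => j x x0; case: (h j x x0).
Qed.

(** Diagonal dominance at one far point: after rescaling by the exponentials, the matrix of the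
    solutions differs from the identity by at most 1/8 in each entry, so the sum [S] of the rescaled
    coefficients satisfies S <= 4 (S / 8). *)
Lemma asym_indep (t : idx -> C) : (forall j x, \sum_i t i * P i j x = 0) -> forall i, t i = 0.
Proof.
move=> hs.
have /choice [X hX] : forall i, exists X : R, forall j x, X <= x -> 0 <= x ->
    cn (cexp (n i * x%:C) * P i j x - (i == j)%:R) <= 8^-1.
  move=> i; have [K [k [k0 h]]] := hP i.
  have e8 : (0 : R) < 8^-1 / (`|K| + 1) by rewrite divr_gt0 ?invr_gt0 ?ltr0n // ltr_wpDl.
  have [X [_ hX]] := expR_small k0 e8; exists X => j x Xx x0.
  have [h1 _] := h j x x0; apply: le_trans h1 _.
  have := hX x Xx; rewrite ler_pdivlMr ?ltr_wpDl // => h2.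
  apply: le_trans h2; rewrite mulrC ler_wpM2l ?expR_ge0 //.
  by apply: le_trans (ler_norm K) _; rewrite lerDl.
pose x := \sum_i `|X i|.
have x0 : 0 <= x by apply: sumr_ge0 => i _; exact: normr_ge0.
have Xx i : X i <= x.
  apply: le_trans (ler_norm _) _; rewrite /x (bigD1 i) //= lerDl.
  by apply: sumr_ge0 => k _; exact: normr_ge0.
pose S := \sum_i cn (t i * cexp (- (n i * x%:C))).
have S0 : 0 <= S by apply: sumr_ge0 => i _; exact: cn_ge0.
have bound j : cn (t j * cexp (- (n j * x%:C))) <= 8^-1 * S.
  have -> : t j * cexp (- (n j * x%:C)) = - \sum_i t i * cexp (- (n i * x%:C)) *
      (cexp (n i * x%:C) * P i j x - (i == j)%:R).
    have -> : \sum_i t i * cexp (- (n i * x%:C)) * (cexp (n i * x%:C) * P i j x - (i == j)%:R) =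
       \sum_i t i * P i j x - \sum_i t i * cexp (- (n i * x%:C)) * (i == j)%:R.
      rewrite -sumrB; apply: eq_bigr => i _; rewrite mulrBr; congr (_ - _).
      by rewrite mulrA -[_ * _ * cexp _]mulrA cexpNK mulr1.
    rewrite hs sub0r opprK (bigD1 j) //= eqxx mulr1 big1 ?addr0 // => i /negbTE ->.
    by rewrite mulr0.
  rewrite cnN; apply: le_trans (cn_sum _ _ _) _; rewrite /S mulr_sumr; apply: ler_sum => i _.
  by rewrite cnM mulrC ler_wpM2r ?cn_ge0 //; apply: hX.
have SS : S <= 4 * (8^-1 * S).
  rewrite {1}/S; apply: le_trans (ler_sum _ (fun i _ => bound i)) _.
  by rewrite sumr_const card_ord mulr_natl.
have S00 : S = 0 by lra.
move=> i; have := bound i; rewrite S00 mulr0 cn_le0.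
by rewrite mulf_eq0 (negbTE (cexp_neq0 _)) orbF => /eqP.
Qed.

End Asymptotics.
End Spectral.

Section JostLink.
Context {R : realType}.
Local Notation C := R[i].
Implicit Types (omega s : R) (b : bool) (g lambda : C) (j k : idx).

Lemma diag_entry omega s lambda j k :
  freq omega s j k - ('i%C * lambda) * @Sigma3 R j k = nusq omega s lambda j *+ (j == k).
Proof.
rewrite /freq /Sigma3 !(mxE (map_mx_key)).
have [j0 ->|j0 ->] := split_ordP j; have [k0 ->|k0 ->] := split_ordP k.
- rewrite !block_mxEul !mxE eq_lshift /nusq.
  case: eqP => [_|_]; last by rewrite !mulr0n mulr0 subr0.
  by move: j0 => [[|[|//]] h] /=; rewrite !mulr1n ?expr0 ?expr1 ?rmorphN rmorph1; ring.
- by rewrite !block_mxEur !mxE eq_lrshift /= !mulr0n mulr0 subr0.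
- by rewrite !block_mxEdl !mxE eq_rlshift /= !mulr0n mulr0 subr0.
- rewrite !block_mxEdr !mxE eq_rshift /nusq.
  case: eqP => [_|_]; last by rewrite !mulr0n mulr0 subr0.
  by move: j0 => [[|[|//]] h] /=; rewrite !mulr1n ?expr0 ?expr1 ?rmorphN rmorph1; ring.
Qed.

Lemma field_entry omega s (Bx : 'M[C]_(2 + 2)) (Br : idx -> idx -> R) lambda (v : 'cV[C]_(2 + 2)) j :
  (forall i l, Bx i l = (Br i l)%:C) ->
  ((freq omega s - Bx - ('i%C * lambda) *: Sigma3) *m v) j 0 =
  nusq omega s lambda j * v j 0 - \sum_i (Br j i)%:C * v i 0.
Proof.
move=> hB; rewrite mxE.
rewrite (eq_bigr (fun i => nusq omega s lambda j *+ (j == i) * v i 0 - (Br j i)%:C * v i 0)).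
  rewrite sumrB (bigD1 j) //= eqxx mulr1n big1 ?addr0 // => i; rewrite eq_sym => /negbTE ->.
  by rewrite mulr0n mul0r.
have ent (X Y Z : 'M[C]_(2 + 2)) a i l : (X - Y - a *: Z) i l = X i l - Y i l - a * Z i l.
  by rewrite !mxE.
by move=> i _; rewrite -diag_entry ent hB; ring.
Qed.

Lemma jost_msol omega s (B : R -> 'M[C]_(2 + 2)) (Br : idx -> idx -> R -> R) lambda n Y
    (k : 'I_((2 + 2) + (2 + 2))) : (forall x i l, B x i l = (Br i l x)%:C) ->
  jost omega s B lambda n Y ->
  msol (nusq omega s lambda) Br (fun j x => Y x (lshift _ j) k) (fun j x => Y x (rshift _ j) k).
Proof.
move=> hB [hode _ _] j x.
have hY : Y x = col_mx (usubmx (Y x)) (dsubmx (Y x)) by rewrite vsubmxK.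
split.
  have [h1 h2] := hode x (lshift _ j) k.
  have e : (coefA omega s B lambda x *m Y x) (lshift _ j) k = Y x (rshift _ j) k.
    by rewrite hY /coefA mul_block_col mul0mx add0r mul1mx col_mxEu -hY mxE.
  by move: h1 h2; rewrite e.
have [h1 h2] := hode x (rshift _ j) k.
have e : (coefA omega s B lambda x *m Y x) (rshift _ j) k =
    nusq omega s lambda j * Y x (lshift _ j) k - \sum_i (Br j i x)%:C * Y x (lshift _ i) k.
  rewrite [in LHS]hY /coefA mul_block_col !mul0mx addr0 col_mxEd.
  have := @field_entry omega s (B x) (fun i l => Br i l x) lambda (col k (usubmx (Y x))) j (fun i l => hB x i l).
  have colM (A M : 'M[C]_(2 + 2, _)) : (A *m col k M) j 0 = (A *m M) j k.
    by rewrite [LHS]mxE [RHS]mxE; apply: eq_bigr => i _; rewrite mxE.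
  rewrite colM => ->; rewrite !mxE; congr (_ - _); apply: eq_bigr => i _.
  by rewrite !mxE.
by move: h1 h2; rewrite e.
Qed.

Lemma asym_top (n : C) j i : asym n j (lshift _ i) 0 = (j == i)%:R.
Proof. by rewrite /asym col_mxEu !mxE eqxx andbT eq_sym. Qed.

Lemma asym_bot (n : C) j i : asym n j (rshift _ i) 0 = n * (j == i)%:R.
Proof. by rewrite /asym col_mxEd !mxE eqxx andbT eq_sym. Qed.

Lemma jost_asym omega s B lambda n Y : jost omega s B lambda n Y ->
  (forall i, exists K k : R, 0 < k /\ forall j x, 0 <= x ->
    cn (cexp (n i * x%:C) * Y x (lshift _ j) (rshift _ i) - (i == j)%:R) <= K * expR (- k * x) /\
    cn (cexp (n i * x%:C) * Y x (rshift _ j) (rshift _ i) - - n i * (i == j)%:R) <= K * expR (- k * x)) /\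
  (forall i, exists K k : R, 0 < k /\ forall j x, 0 <= x ->
    cn (cexp (n i * x%:C) * Y (- x) (lshift _ j) (lshift _ i) - (i == j)%:R) <= K * expR (- k * x) /\
    cn (cexp (n i * x%:C) * (- Y (- x) (rshift _ j) (lshift _ i)) - - n i * (i == j)%:R) <= K * expR (- k * x)).
Proof.
move=> [_ hm hp]; split=> i.
  have [K [k [k0 h]]] := hp i; exists K, k; split=> // j x x0; split.
    by have := h x (lshift _ j) x0; rewrite cnE lecR asym_top.
  by have := h x (rshift _ j) x0; rewrite cnE lecR asym_bot.
have [K [k [k0 h]]] := hm i; exists K, k; split=> // j x x0.
have x0' : - x <= 0 by rewrite oppr_le0.
have ex : - n i * (- x)%:C = n i * x%:C by rewrite rmorphN mulrNN.
split.
  by have := h _ (lshift _ j) x0'; rewrite cnE lecR asym_top ex mulrN -mulNr.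
have := h _ (rshift _ j) x0'; rewrite cnE lecR asym_bot ex mulrN -mulNr => h1.
by rewrite -[X in cn X]opprK cnN mulrN opprB mulNr opprK addrC.
Qed.

(** Two reflections cancel; this presents the columns at -oo as reflected data, the form in which
    they are compared with [Ehat]. *)
Lemma evans_det (Y : C -> R -> 'M[C]_((2 + 2) + (2 + 2))) g :
  evans Y g = \det (row_mx
    (flip (colm (fun i j x => Y g (- x) (lshift _ j) (lshift _ i)) (fun i j x => - Y g (- x) (rshift _ j) (lshift _ i))))
    (colm (fun i j x => Y g x (lshift _ j) (rshift _ i)) (fun i j x => Y g x (rshift _ j) (rshift _ i)))).
Proof.
rewrite /evans; congr (\det _); apply/matrixP => i j.
have [j0 ->|j0 ->] := split_ordP j; have [i0 ->|i0 ->] := split_ordP i;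
  rewrite ?row_mxEl ?row_mxEr /flip /colm ?col_mxKu ?col_mxKd ?col_mxEu ?col_mxEd !mxE ?oppr0 ?opprK //.
Qed.

Lemma extended_decaying c omega s b r0 (B : R -> 'M[C]_(2 + 2)) (Br : idx -> idx -> R -> R) Y :
  good_consts c -> 0 < omega -> 0 < s -> ckap c = kapb omega s b -> csg c = sgb b ->
  ca c <= r0 -> (forall x i l, B x i l = (Br i l x)%:C) ->
  extended_jost_family omega s B b r0 Y ->
  analytic_decaying c (Brefl Br) (fun g i j x => Y g (- x) (lshift _ j) (lshift _ i))
      (fun g i j x => - Y g (- x) (rshift _ j) (lshift _ i)) /\
  analytic_decaying c Br (fun g i j x => Y g x (lshift _ j) (rshift _ i))
      (fun g i j x => Y g x (rshift _ j) (rshift _ i)).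
Proof.
move=> gc o0 s0 hk hs ar hB hY.
have hg g : cn g < ca c -> `|g| < r0%:C.
  by move=> h; rewrite cn_lt; apply: lt_le_trans h ar.
have nnE g : nusq omega s (lambda_of omega s b g) = nng c g.
  by apply/funext => j; rewrite nusqE /nng hk hs kapb_sqr.
split; split.
- move=> g i ga; have [hj _] := hY g (hg g ga).
  have := msol_refl (jost_msol (lshift _ i) hB hj); rewrite nnE; exact.
- move=> g i ga g0; have [hj _] := hY g (hg g ga); have [_ ha] := jost_asym hj.
  exact: (asym_decays ha (Re_nu_ext i gc o0 s0 hk ga g0)).
- move=> g i j ga; have [_ ha] := hY g (hg g ga); split.
    by apply: analytic_taylor; rewrite oppr0; exact: ha.
  by apply: taylorN; rewrite oppr0; apply: analytic_taylor; exact: ha.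
- move=> g t ga; have [hj _] := hY g (hg g ga); have [_ ha] := jost_asym hj.
  exact: (asym_indep ha).
- move=> g i ga; have [hj _] := hY g (hg g ga).
  have := jost_msol (rshift _ i) hB hj; rewrite nnE; exact.
- move=> g i ga g0; have [hj _] := hY g (hg g ga); have [ha _] := jost_asym hj.
  exact: (asym_decays ha (Re_nu_ext i gc o0 s0 hk ga g0)).
- move=> g i j ga; have [_ ha] := hY g (hg g ga).
  by split; apply: analytic_taylor; exact: ha.
- move=> g t ga; have [hj _] := hY g (hg g ga); have [ha _] := jost_asym hj.
  exact: (asym_indep ha).
Qed.

End JostLink.

Section EvansZeros.
Context {R : realType}.
Local Notation C := R[i].

(** Links the derivative appearing in [simple_zero] with the second-order expansion. *)
Lemma taylor_derive1 (f : C -> C) : taylor_at f 0 -> exists r K : R,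
  [/\ 0 < r, 0 <= K & forall z, cn z < r ->
     cn (f z - f 0 - derive1 (f : C^o -> C^o) 0 * z) <= K * cn z ^+ 2].
Proof.
move=> /taylor_expand [r [K [d [r0 K0 _ h]]]].
have {}h z : cn z < r -> cn (f z - f 0 - d * z) <= K * cn z ^+ 2.
  by move=> zr; have := h z; rewrite !subr0; apply.
suff -> : derive1 (f : C^o -> C^o) 0 = d by exists r, K.
rewrite /derive1; apply: cvg_lim => //.
apply/cvgrPdist_le => e e0.
have eE : e = (complex.Re e)%:C by rewrite RRe_real // gtr0_real.
have re0 : 0 < complex.Re e by move: e0; rewrite {1}eE ltcR.
pose r' := Num.min r (complex.Re e / (K + 1)).
have K10 : 0 < K + 1 by lra.
have r'0 : 0 < r'%:C by rewrite ltcR lt_min r0 divr_gt0.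
near=> z.
have z0 : z != 0 by near: z; exact: nbhs_dnbhs_neq.
have zr : `|z| < r'%:C by near: z; exact: (@dnbhs0_lt _ C^o).
move: zr; rewrite cn_lt lt_min => /andP[zr]; rewrite ltr_pdivlMr // => ze.
have cz : 0 < cn z by rewrite cn_gt0.
rewrite eE cnE lecR addr0.
have -> : d - z^-1 *: (f z - f 0) = - (z^-1 * (f z - f 0 - d * z)).
  by rewrite [X in d - X]/(z^-1 * _) mulrBr mulrCA mulVf // mulr1 opprB.
rewrite cnN cnM cnV -ler_pdivlMl ?invr_gt0 // invrK.
apply: le_trans (h z zr) _; rewrite expr2 mulrA [leRHS]mulrC ler_wpM2r ?(ltW cz) //.
by have := cn_ge0 z; lra.
Unshelve. all: by end_near.
Qed.

Lemma expR_interp (c0 k y : R) : 0 <= y -> k <= c0 -> expR (- c0 * y) <= expR (- k * y).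
Proof. by move=> y0 kc; rewrite ler_expR !mulNr lerN2 ler_wpM2r. Qed.

(** * The potentials of the branch in the weighted setting *)

Section Potentials.
Variables (Bf : R -> idx -> idx -> R -> R) (c : @consts R) (c0 Kb e1 : R).
Hypotheses (gc : good_consts c) (cc : ck c <= c0 / 2) (cK : cKb c = Kb) (c00 : 0 < c0)
  (Kb0 : 0 <= Kb) (e10 : 0 < e1).
Hypothesis hb : forall e : R, 0 <= e < e1 -> [/\ forall i j, continuous (Bf e i j),
     forall i j x, `|Bf e i j x| <= Kb * expR (- c0 * `|x|) &
     forall i j x, `|Bf e i j x - Bf 0 i j x| <= Kb * e].

Lemma exp_bound_pot (f : R -> R) : continuous f -> (forall x, `|f x| <= Kb * expR (- c0 * `|x|)) ->
  [/\ continuous f, forall x, `|f x| <= Kb & forall x, cX c <= x -> `|f x| <= Kb * expR (- ck c * x)].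
Proof.
move=> cf hf; split=> // [x|x Xx].
  apply: le_trans (hf x) _; rewrite ler_piMr // -expR0 ler_expR mulNr oppr_le0.
  by rewrite mulr_ge0 // ltW.
have [_ [X0 _ _] _ _ _] := gc; have x0 : 0 <= x := le_trans X0 Xx.
apply: le_trans (hf x) _; rewrite ger0_norm // ler_wpM2l // expR_interp //.
by have := cc; have := c00; lra.
Qed.

Lemma branch_pot e : 0 <= e < e1 -> pot c (Bf e) /\ pot c (Brefl (Bf e)).
Proof.
move=> he; have [h1 h2 _] := hb he; split=> i j; rewrite cK; apply: exp_bound_pot => // x.
- by apply: (@continuous_comp R R R (-%R) (Bf e i j) x); [exact: opp_continuous | exact: h1].
- by have := h2 i j (- x); rewrite normrN.
Qed.

(** Interpolation: the difference is at most 2 Kb e^{-c0|x|} and at most Kb times [e]; multiplying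
    the bounds and taking a square root keeps half of the decay rate, which is why [ck c <= c0 / 2]
    is imposed. *)
Lemma branch_dsm (d : R) : 0 < d -> exists2 e2, 0 < e2 & forall e : R, 0 <= e < e2 -> 
  forall i j x, `|Bf e i j x - Bf 0 i j x| <= d * expR (- ck c * `|x|).
Proof.
move=> d0.
have D0 : 0 < 2 * Kb ^+ 2 + 1 by have := sqr_ge0 Kb; lra.
exists (Num.min e1 (d ^+ 2 / (2 * Kb ^+ 2 + 1))).
  by rewrite lt_min e10 divr_gt0 // exprn_gt0.
move=> e; rewrite lt_min ltr_pdivlMr // => /and3P[e0 ee1 he] i j x.
have e1e : 0 <= e < e1 by rewrite e0.
have z1 : 0 <= (0 : R) < e1 by rewrite lexx.
have [_ h1 h2] := hb e1e; have [_ h3 _] := hb z1.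
have {}h2 := h2 i j x; have {}h1 := h1 i j x; have {}h3 := h3 i j x.
set D := Bf e i j x - _ in h2 *; set E := expR (- c0 * `|x|) in h1 h3.
have E0 : 0 <= E by exact: expR_ge0.
have hD : `|D| <= 2 * Kb * E by apply: le_trans (ler_normB _ _) _; lra.
have EE : E = expR (- (c0 / 2) * `|x|) ^+ 2.
  by rewrite expr2 -expRD; congr expR; field.
apply: (@le_trans _ _ (d * expR (- (c0 / 2) * `|x|))); last first.
  by rewrite ler_wpM2l ?(ltW d0) // expR_interp.
have n1 := normr_ge0 D; have n2 := expR_ge0 (- (c0 / 2) * `|x|).
rewrite -(@ler_pXn2r _ 2) ?nnegrE // ?mulr_ge0 ?(ltW d0) // exprMn -EE.
rewrite expr2; apply: (@le_trans _ _ (2 * Kb * E * (Kb * e))); first exact: ler_pM.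
have -> : 2 * Kb * E * (Kb * e) = e * (2 * Kb ^+ 2) * E by ring.
by rewrite ler_wpM2r //; lra.
Qed.

Lemma branch_dpot (d : R) : 0 < d -> exists2 e2, 0 < e2 & forall e : R, 0 <= e < e2 ->
  dpot c d (Bf e) (Bf 0) /\ dpot c d (Brefl (Bf e)) (Brefl (Bf 0)).
Proof.
move=> d0; have [e2 e20 h] := branch_dsm d0; exists e2 => // e he.
have [[k0 _ _ _ _] [X0 _ _] _ _ _] := gc.
have gen (f : R -> R) : (forall x, `|f x| <= d * expR (- ck c * `|x|)) -> dsm c d f.
  move=> hf; split=> [x|x Xx].
    apply: le_trans (hf x) _; rewrite ler_piMr ?(ltW d0) // -expR0 ler_expR mulNr oppr_le0.
    by rewrite mulr_ge0 // ltW.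
  by have := hf x; rewrite (ger0_norm (le_trans X0 Xx)).
split=> i j; apply: gen => x; first exact: h.
by have := h e he i j (- x); rewrite normrN.
Qed.

End Potentials.

End EvansZeros.

(** * The zero of the given Evans function along the branch *)

Section Setup.
Context {R : realType}.
Local Notation C := R[i].

Lemma trivial_wave (F : R -> R -> R -> R) (omega s mb : R) (u : R -> R) :
  fundamental_wave F omega u -> homoclinic_wave F omega s (mb * 0 ^+ 2) u (fun=> 0).
Proof.
move=> [du eu vu _ _].
have d0 x : derive1 (fun _ : R => 0 : R) x = 0 by rewrite derive1_cst.
have d0' : derive1 (fun _ : R => 0 : R) = fun=> 0 by apply/funext.
split.
- by split; [exact: du | split=> x; [exact: derivable_cst | rewrite d0'; exact: derivable_cst]].
- by move=> x; have := eu x; rewrite (expr0n R 2) mulr0.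
- move=> x; have -> : derive1n 2 (fun _ : R => 0 : R) x = 0 by rewrite /derive1n /= !d0'.
  by rewrite !mulr0; ring.
- exact: vu.
- by split; exact: cvg_cst.
Qed.

(** The order of quantifiers matters: the constants and the uniqueness radius [r1] come first, then
    [r], then the threshold for [e], so that the zero is unique in a disc that does not shrink. *)
Lemma bifurcation_setup (omega s : R) (F : R -> R -> R -> R) (U V : R -> R -> R) (W2 V1 : R -> R)
    (c : bool) (mb eps0 K : R) (b : bool) (r0 : R) (Y : R -> C -> R -> 'M[C]_((2 + 2) + (2 + 2)))
    (Bf := fun e => Bw F (U e) (V e) (mb * e ^+ 2))
    (B := fun e => potential F (U e) (V e) (mb * e ^+ 2)) :
  0 < omega -> 0 < s -> nonlinearity F -> 0 < eps0 -> V 0 = (fun=> 0) ->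
  fundamental_wave F omega (U 0) ->
  (forall e : R, 0 < e < eps0 -> homoclinic_wave F omega s (mb * e ^+ 2) (U e) (V e)) ->
  (forall e : R, 0 < e < eps0 -> forall x,
    `|U e x - (U 0 x + e ^+ 2 * W2 x)| <= K * e ^+ 4 /\
    `|V e x - (-1) ^+ c * (e * V1 x)| <= K * e ^+ 3) ->
  (exists M : R, forall x, `|V1 x| <= M) ->
  0 < r0 ->
  (forall e, 0 <= e < eps0 -> extended_jost_family omega s (B e) b r0 (Y e)) ->
  simple_zero (evans (Y 0)) 0 ->
  exists cc : @consts R, exists2 r1 : R, 0 < r1 <= ca cc &
    [/\ good_consts cc, ckap cc = kapb omega s b /\ csg cc = sgb b, ca cc <= r0 &
     forall r : R, 0 < r <= r1 -> exists2 e2 : R, 0 < e2 & forall e : R, 0 <= e < e2 ->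
      [/\ e < eps0, pot cc (Bf e) /\ pot cc (Brefl (Bf e)),
       forall g, cn g < ca cc -> (evans (Y e) g = 0 <-> Ehat cc g (Bf e) = 0),
       exists2 t : R, `|t| < r & Ehat cc t%:C (Bf e) = 0 &
       exists2 d0 : R, 0 < d0 & forall x y, cn x < r1 -> cn y < r1 ->
         d0 * cn (x - y) <= cn (Ehat cc x (Bf e) - Ehat cc y (Bf e))]].
Proof.
move=> o0 s0 hF ep0 V0 fw hw hK hV1 r00 hY [f00 f0d].
have hw' e : 0 <= e < eps0 -> homoclinic_wave F omega s (mb * e ^+ 2) (U e) (V e).
  move=> /andP[]; rewrite le_eqVlt => /predU1P[<- _|e0 ee]; last by apply: hw; rewrite e0.
  by rewrite V0; exact: trivial_wave.
have [c0 [Kb [e1 [c00 Kb0 /andP[e10 e1e] hb]]]] := branch_bounds o0 s0 hF ep0 V0 hw' hK hV1.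
have [cc [gc [hk hs] cK ckc cca]] := exists_consts (fun j => sqrtr_ge0 (nb omega s b j))
  (sgb_or b) (fun j => @kapb0 _ omega s b j o0 s0) (divr_gt0 c00 (ltr0n R 2)) Kb0 r00.
have hp e : 0 <= e < e1 -> pot cc (Bf e) /\ pot cc (Brefl (Bf e)) := branch_pot gc ckc cK c00 Kb0 hb (e := e).
have hd := branch_dpot gc ckc e10 hb.
have hd1 (d : R) : 0 < d -> exists2 e2, 0 < e2 & forall e : R, 0 <= e < e2 -> dpot cc d (Bf e) (Bf 0).
  by move=> /hd[e2 e20 h]; exists e2 => [//|e he]; exact: (h e he).1.
have hd2 (d : R) : 0 < d -> exists2 e2, 0 < e2 & forall e : R, 0 <= e < e2 ->
    dpot cc d (Brefl (Bf e)) (Brefl (Bf 0)).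
  by move=> /hd[e2 e20 h]; exists e2 => [//|e he]; exact: (h e he).2.
have [d sdE] := Ehat_sd gc e10 (fun e he => (hp e he).1) (fun e he => (hp e he).2) hd1 hd2.
have sB e : symB (Bf e) by exact: Bw_sym.
have BE e x i l : B e x i l = (Bf e i l x)%:C by exact: potentialE.
have link e : 0 <= e < e1 -> analytic_decaying cc (Brefl (Bf e))
      (fun g i j x => Y e g (- x) (lshift _ j) (lshift _ i))
      (fun g i j x => - Y e g (- x) (rshift _ j) (lshift _ i)) /\
    analytic_decaying cc (Bf e) (fun g i j x => Y e g x (lshift _ j) (rshift _ i))
      (fun g i j x => Y e g x (rshift _ j) (rshift _ i)).
  move=> /andP[e0 ee]; apply: (extended_decaying gc o0 s0 hk hs cca (BE e)).
  by apply: hY; rewrite e0 (lt_le_trans ee).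
have zeros e g : 0 <= e < e1 -> cn g < ca cc -> (evans (Y e) g = 0 <-> Ehat cc g (Bf e) = 0).
  move=> he ga; have [l1 l2] := link e he; have [p1 p2] := hp e he.
  exact: (f_eq0 gc p1 p2 (sB e) l1 l2 (fun g _ => evans_det (Y e) g) ga).
have z0 : 0 <= (0 : R) < e1 by rewrite lexx.
have a0 : 0 < ca cc by have [[_ _ _ _ ?] _ _ _ _] := gc.
have E00 : Ehat cc 0 (Bf 0) = 0 by apply/(zeros 0 0 z0) => //; rewrite cn0.
(* If [d] were 0, [Ehat] would be o(gamma) at [e = 0], and by [f_le_Ehat] so would the given Evans
   function, against its nonzero derivative. The point [z] is a positive real small enough for all
   the estimates. *)
have d0 : d != 0.
  apply/eqP => d0; move: f0d; apply/negP; rewrite negbK -cn_eq0.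
  have [l1 l2] := link 0 z0; have [p1 p2] := hp 0 z0.
  have [ra [K1 [ra0 hK1]]] := f_le_Ehat gc p1 p2 (sB 0) l1 l2 (fun g _ => evans_det (Y 0) g).
  have tE : taylor_at (evans (Y 0)) 0.
    apply: taylor_det => i j; apply: analytic_taylor.
    have n0 : `|0 : C| < r0%:C by rewrite cn_lt cn0.
    have z0' : 0 <= (0 : R) < eps0 by rewrite lexx.
    exact: (hY 0 z0' 0 n0).2.
  have [rb [K2 [rb0 K20 hK2]]] := taylor_derive1 tE.
  set dd := derive1 _ _ in hK2 *.
  have K10 : 0 <= `|K1| by [].
  rewrite eq_le cn_ge0 andbT; apply/ler_addgt0Pl => t t0; rewrite addr0.
  have [h1 _] := sdE; have [rc rc0 hc] := h1 (t / 2 / (`|K1| + 1)) ltac:(by rewrite !divr_gt0 // ltr_wpDl).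
  pose z := Num.min (Num.min ra rb) (Num.min rc (t / 2 / (K2 + 1))) / 2.
  have K2p : 0 < K2 + 1 by rewrite ltr_wpDl.
  have m0 : 0 < Num.min (Num.min ra rb) (Num.min rc (t / 2 / (K2 + 1))).
    by rewrite !lt_min ra0 rb0 rc0 !divr_gt0.
  have zz : 0 < z by rewrite divr_gt0.
  have : z < Num.min (Num.min ra rb) (Num.min rc (t / 2 / (K2 + 1))).
    by rewrite /z ltr_pdivrMr // ltr_pMr // ltr1n.
  rewrite !lt_min => /andP[/andP[za zb] /andP[zc]]; rewrite ltr_pdivlMr // => zt.
  have cz : cn z%:C = z by rewrite cnR gtr0_norm.
  have := hc 0 z%:C 0; rewrite !lexx rc0 cz cn0 zc E00 d0 mul0r !subr0 cz => /(_ isT isT rc0) hE.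
  have := hK1 z%:C; rewrite cz => /(_ za) hf.
  have := hK2 z%:C; rewrite cz f00 subr0 => /(_ zb) hg.
  have hdz : cn dd * z <= cn (evans (Y 0) z%:C) + cn (evans (Y 0) z%:C - dd * z%:C).
    rewrite -{1}cz -cnM; have -> : dd * z%:C = evans (Y 0) z%:C - (evans (Y 0) z%:C - dd * z%:C) by ring.
    by apply: le_trans (cnB _ _) _; rewrite opprB addrCA subrr addr0.
  have hf' : cn (evans (Y 0) z%:C) <= t / 2 * z.
    apply: le_trans hf _; apply: (@le_trans _ _ (`|K1| * cn (Ehat cc z%:C (Bf 0)))).
      by rewrite ler_wpM2r ?cn_ge0 // ler_norm.
    apply: (@le_trans _ _ ((`|K1| + 1) * (t / 2 / (`|K1| + 1) * z))).
      by apply: ler_pM; rewrite ?cn_ge0 // lerDl.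
    by rewrite mulrA [(`|K1| + 1) * _]mulrC divfK // gt_eqF // ltr_wpDl.
  have hg' : cn (evans (Y 0) z%:C - dd * z%:C) <= t / 2 * z.
    by apply: le_trans hg _; rewrite expr2 mulrA ler_wpM2r ?(ltW zz) //; have := zz; nra.
  rewrite -(ler_pM2r zz); apply: le_trans hdz _; apply: le_trans (lerD hf' hg') _.
  by rewrite -mulrDl -splitr.
have hre (e t : R) : 0 <= e < e1 -> `|t| < ca cc -> complex.Im (Ehat cc t%:C (Bf e)) = 0.
  move=> he ta.
  exact: (Ehat_real gc (fun e he => (hp e he).1) (fun e he => (hp e he).2) (ltW ta) he).
have [r1 r10 hz] := sd_zero sdE d0 E00 e10 a0 hre.
exists cc, (Num.min r1 (ca cc)); first by rewrite lt_min r10 a0 ge_min lexx orbT.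
split=> // r /andP[rr0]; rewrite le_min => /andP[rr1 _].
have [e2 e20 he2] := hz r ltac:(by rewrite rr0).
exists (Num.min e1 e2); first by rewrite lt_min e10.
move=> e; rewrite lt_min => /and3P[e0 ee1 ee2].
have he : 0 <= e < e1 by rewrite e0.
have [t [tr Et hxy]] := he2 e ltac:(by rewrite e0).
split.
- exact: lt_le_trans e1e.
- exact: hp.
- by move=> g; exact: zeros.
- by exists t.
- exists (cn d / 2); first by rewrite divr_gt0 // cn_gt0.
  by move=> x y; rewrite !lt_min => /andP[hx _] /andP[hy _]; exact: hxy.
Qed.

End Setup.

(** * Eigenfunctions *)

Section SquareIntegrable.
Context {R : realType}.
Local Notation leb := (@lebesgue_measure R).

Lemma continuous_integral (f F : R -> R) (a b : R) : (forall x, der F x (f x)) -> continuous f ->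
  a <= b -> (\int[leb]_(x in `[a, b]) (f x)%:E = (F b - F a)%:E)%E.
Proof.
move=> dF cf; rewrite le_eqVlt => /predU1P[->|ab].
  by rewrite set_itv1 integral_set1 subrr.
have cF : continuous F by move=> x; exact: der_cts (dF x).
rewrite (@continuous_FTC2 R f F a b ab) ?EFinB //.
- exact: continuous_subspaceT.
- split; [by move=> x _; exact: (derE (dF x)).1 | exact: cvg_at_right_filter (cF a) |
    exact: cvg_at_left_filter (cF b)].
- by move=> x _; exact: (derE (dF x)).2.
Qed.

(** Increments of a primitive of u^2 are integrals over intervals, hence lie between 0 and the full
    integral. *)
Lemma L2_primitive (u : R -> R) : continuous u -> u \in Lfun leb 2%:E ->
  exists (G : R -> R) (M : R), (forall x, der G x (u x ^+ 2)) /\ forall x, `|G x| <= M.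
Proof.
move=> cu /Lfun2_integrable_sqr iu.
have cu2 : continuous (fun x => u x ^+ 2) by move=> x; rewrite /=; under eq_fun do rewrite expr2; apply: cvgM; exact: cu.
have [G hG] := antider cu2.
have := integrable_lty measurableT iu; set I := (\int[leb]_x _)%E => Ioo.
have I0 : (0 <= I)%E by apply: integral_ge0 => x _; rewrite lee_fin sqr_ge0.
exists G, (`|G 0| + fine I); split=> // x.
have step a b : a <= b -> 0 <= G b - G a <= fine I.
  move=> ab; have e := continuous_integral hG cu2 ab.
  apply/andP; split.
    by rewrite -lee_fin -e; apply: integral_ge0 => y _; rewrite lee_fin sqr_ge0.
  rewrite -lee_fin -e fineK ?ge0_fin_numE //; apply: ge0_subset_integral => //.
    by have [] := integrableP _ _ _ iu.
  by move=> y _; rewrite lee_fin sqr_ge0.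
have fI : 0 <= fine I by exact: fine_ge0.
have [x0|x0] := leP 0 x.
  have /andP[h1 h2] := step _ _ x0.
  have -> : G x = G 0 + (G x - G 0) by ring.
  by apply: le_trans (ler_normD _ _) _; rewrite lerD2l ger0_norm.
have /andP[h1 h2] := step _ _ (ltW x0).
have -> : G x = G 0 - (G 0 - G x) by ring.
by apply: le_trans (ler_normB _ _) _; rewrite lerD2l ger0_norm.
Qed.

Lemma exp_decay_integral (K a : R) : 0 < a -> 0 <= K ->
  (\int[leb]_x (K * expR (- a * `|x : R|))%:E < +oo)%E.
Proof.
move=> a0 K0; pose f (x : R) : R := K * expR (- a * `|x|).
have cn' : continuous (fun x : R => `|x|) by move=> x; exact: norm_continuous.
have cf : continuous f.
  move=> x; apply: cvgM; first exact: cvg_cst.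
  apply: (@continuous_comp R R R (fun x : R => - a * `|x|) expR); last exact: continuous_expR.
  by apply: cvgM; [exact: cvg_cst | exact: cn'].
rewrite (@ge0_symfun_integralT R f) //.
- rewrite -set_itvcy.
  pose F x := - (K / a) * expR (- a * x).
  have dF x : der F x (K * expR (- a * x)).
    apply: der_eq (derZ _ (der_exp (derZ (- a) (der_id x)))) _.
    by field; rewrite gt_eqF.
  rewrite (@ge0_continuous_FTC2y R f F 0 0).
  + by rewrite -EFinB -EFinM ltry.
  + by move=> x _; rewrite mulr_ge0 ?expR_ge0.
  + exact: continuous_subspaceT.
  + rewrite -[X in _ --> X](mulr0 (- (K / a))); apply: cvgM; first exact: cvg_cst.
    apply/cvgrPdist_le => e e0; have [X [_ hX]] := expR_small a0 e0.
    exists X; split; first exact: num_real.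
    by move=> x /ltW/hX h; rewrite sub0r normrN ger0_norm ?expR_ge0.
  + by move=> x _; exact: (derE (dF x)).1.
  + by apply: cvg_at_right_filter; exact: der_cts (dF 0).
  + move=> x; rewrite in_itv /= andbT => x0; rewrite (derE (dF x)).2 /f ger0_norm //.
    exact: ltW.
- by move=> x; rewrite mulr_ge0 ?expR_ge0.
- by move=> x; rewrite /f /= normrN.
Qed.

Lemma L2_of_decay (u : R -> R) (K a : R) : 0 < a -> continuous u ->
  (forall x, `|u x| <= K * expR (- a * `|x|)) -> u \in Lfun leb 2%:E.
Proof.
move=> a0 cu hu.
have mu' : measurable_fun setT u by exact: continuous_measurable_fun.
have K0 : 0 <= K.
  by have := hu 0; rewrite normr0 mulr0 expR0 mulr1; apply: le_trans; exact: normr_ge0.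
rewrite inE; apply/andP; split; rewrite inE //=.
rewrite /finite_norm unlock; apply: poweR_lty.
rewrite (_ : (\int[leb]_x _ = \int[leb]_x (u x ^+ 2)%:E)%E); last first.
  by apply: eq_integral => x _; rewrite /= powR_mulrn ?normr_ge0 // real_normK ?num_real.
apply: le_lt_trans (exp_decay_integral (mulr_gt0 (ltr0n R 2) a0) (sqr_ge0 K)).
apply: ge0_le_integral => //.
- by move=> x _; rewrite lee_fin sqr_ge0.
- by apply/measurable_EFinP; exact: measurable_funX.
- apply/measurable_EFinP; apply: measurable_funM => //.
  by apply: measurableT_comp => //; apply: measurable_funM => //; exact: measurableT_comp.
move=> x _; rewrite lee_fin -(real_normK (num_real (u x))).
have -> : - (2 * a) * `|x| = (- a * `|x|) + (- a * `|x|) by ring.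
by rewrite expRD -expr2 -exprMn lerXn2r ?nnegrE // mulr_ge0 ?expR_ge0.
Qed.

(** Integrals over intervals ignore null sets, so [u1] differs from a primitive of [f] by a
    constant; the weak second derivative of [H2_real] thus becomes a classical one. *)
Lemma weak_der (u1 u2 f : R -> R) : u2 \in Lfun leb 2%:E ->
  (forall a b, a <= b -> u1 b - u1 a = \int[leb]_(t in `[a, b]) u2 t) ->
  {ae leb, forall x, u2 x = f x} -> continuous f -> forall x, der u1 x (f x).
Proof.
move=> hu2 hint hae cf x; have [F hF] := antider cf.
have mf : measurable_fun setT f by exact: continuous_measurable_fun.
have mu2 : measurable_fun setT u2 by move: hu2; rewrite inE => /andP[+ _]; rewrite inE.
have key a b : a <= b -> u1 b - u1 a = F b - F a.
  move=> ab; rewrite (hint a b ab) /Rintegral.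
  rewrite (@ae_eq_integral _ _ _ leb `[a, b]%classic (EFin \o f) (EFin \o u2)) //.
  - by rewrite (continuous_integral hF cf ab).
  - by apply/measurable_EFinP; apply: measurable_funS mu2.
  - by apply/measurable_EFinP; apply: measurable_funS mf.
  - by apply: (@filterS _ _ (ae_filter_ringOfSetsType leb) _ _ _ hae) => y /= -> _.
have E y : F y + (u1 0 - F 0) = u1 y.
  have [y0|y0] := leP 0 y; first by have := key _ _ y0; lra.
  by have := key _ _ (ltW y0); lra.
by apply: der_ext E _; apply: der_eq (derD (hF x) (der_cst _ x)) _; rewrite addr0.
Qed.

Lemma H2_classical (u u1 u2 : R -> R) (K a : R) : 0 < a ->
  (forall x, der u x (u1 x)) -> (forall x, der u1 x (u2 x)) -> continuous u2 ->
  (forall x, [/\ `|u x| <= K * expR (- a * `|x|), `|u1 x| <= K * expR (- a * `|x|) &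
     `|u2 x| <= K * expR (- a * `|x|)]) -> H2_real u u1 u2.
Proof.
move=> a0 du du1 cu2 hb; split=> //.
- by apply: (@L2_of_decay u K a a0) => x; [exact: der_cts (du x) | case: (hb x)].
- by apply: (@L2_of_decay u1 K a a0) => x; [exact: der_cts (du1 x) | case: (hb x)].
- by apply: (@L2_of_decay u2 K a a0) => // x; case: (hb x).
- by move=> x y xy; rewrite /Rintegral (continuous_integral du1 cu2 xy).
Qed.

End SquareIntegrable.

(** * The operator and the second-order system *)

Section OperatorGraph.
Context {R : realType}.
Local Notation C := R[i].
Local Notation leb := (@lebesgue_measure R).

Definition L2c (f : R -> C) : Prop :=
  (fun x => complex.Re (f x)) \in Lfun leb 2%:E /\ (fun x => complex.Im (f x)) \in Lfun leb 2%:E.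

Lemma Sigma3E (j k : idx) : @Sigma3 R j k = (-1) ^+ j *+ (j == k).
Proof.
rewrite /Sigma3 mxE.
have [j0 ->|j0 ->] := split_ordP j; have [k0 ->|k0 ->] := split_ordP k.
- rewrite block_mxEul mxE eq_lshift; case: eqP => [_|_]; last by rewrite !mulr0n.
  by rewrite !mulr1n rmorphXn rmorphN rmorph1.
- by rewrite block_mxEur mxE eq_lrshift.
- by rewrite block_mxEdl mxE eq_rlshift.
- rewrite block_mxEdr mxE eq_rshift; case: eqP => [_|_]; last by rewrite !mulr0n.
  by rewrite !mulr1n rmorphXn rmorphN rmorph1 /= exprD sqrrN expr1n mul1r.
Qed.

Lemma sgn_sqr (j : idx) : (-1) ^+ j * (-1) ^+ j = 1 :> C.
Proof. by rewrite -expr2 sqrr_sign. Qed.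

Variables (omega s : R).

(** The factor -i Sigma3 has inverse i Sigma3. The free [lambda] is added and subtracted so that one
    equivalence serves eigenvectors and root vectors alike. *)
Lemma field_graph (Bx : 'M[C]_(2 + 2)) (Bl : idx -> idx -> R) lambda (a v w : 'cV[C]_(2 + 2)) :
  (forall i l, Bx i l = (Bl i l)%:C) ->
  ((- 'i%C) *: (Sigma3 *m (- a + freq omega s *m v - Bx *m v)) = w <->
   forall j, a j 0 = nusq omega s lambda j * v j 0 - \sum_i (Bl j i)%:C * v i 0
                   - 'i%C * (-1) ^+ j * (w j 0 - lambda * v j 0)).
Proof.
move=> hBl.
have S3 (u : 'cV[C]_(2 + 2)) j : (Sigma3 *m u) j 0 = (-1) ^+ j * u j 0.
  rewrite mxE (bigD1 j) //= Sigma3E eqxx mulr1n big1 ?addr0 // => i.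
  by rewrite eq_sym Sigma3E => /negbTE ->; rewrite mulr0n mul0r.
have E j : (- a + freq omega s *m v - Bx *m v) j 0 =
    - a j 0 + (nusq omega s lambda j * v j 0 - \sum_i (Bl j i)%:C * v i 0) + 'i%C * lambda * ((-1) ^+ j * v j 0).
  have addE (u u' : 'cV[C]_(2 + 2)) : (u + u') j 0 = u j 0 + u' j 0 by rewrite mxE.
  have oppE (u : 'cV[C]_(2 + 2)) : (- u) j 0 = - u j 0 by rewrite mxE.
  rewrite -(@field_entry R omega s Bx Bl lambda v j hBl) -S3 !mulmxBl -scalemxAl !(addE, oppE).
  have scE k (u : 'cV[C]_(2 + 2)) : (k *: u) j 0 = k * u j 0 by rewrite mxE.
  by rewrite scE; ring.
have ii := @i_sqr R.
split=> [h j|h].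
  have /matrixP /(_ j 0) := h; rewrite mxE S3 E => <-.
  have sj := sgn_sqr j; set S := \sum_i _ in E *; set g := (-1) ^+ j in sj *.
  set n := nusq _ _ _ _; set vj := v j 0; set aj := a j 0.
  transitivity (n * vj - S + 'i%C * (g * (lambda * vj)) +
     ('i%C * 'i%C) * (g * g) * (- aj + (n * vj - S) + 'i%C * lambda * (g * vj))).
    by rewrite ii sj; ring.
  by ring.
apply/matrixP => j k; rewrite ord1 mxE S3 E h.
have sj := sgn_sqr j; set S := \sum_i _; set g := (-1) ^+ j in sj *.
transitivity (- ('i%C * 'i%C) * (g * g) * (w j 0 - lambda * v j 0) - ('i%C * 'i%C) * (g * g) * (lambda * v j 0)).
  by ring.
by rewrite ii sj; ring.
Qed.

Variables (B : R -> 'M[C]_(2 + 2)) (Br : idx -> idx -> R -> R).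
Hypotheses (hB : forall x i l, B x i l = (Br i l x)%:C) (cB : forall i l, continuous (Br i l)).

Lemma lin_op_ode lambda (psi chi : R -> 'cV[C]_(2 + 2)) :
  (forall j, ccts (fun x => chi x j 0)) ->
  lin_op omega s B psi (fun x => lambda *: psi x + chi x) ->
  exists q : idx -> R -> C, forall j, [/\ L2c (fun x => psi x j 0), L2c (q j) &
    forall x, cder (fun x => psi x j 0) x (q j x) /\
      cder (q j) x (nusq omega s lambda j * psi x j 0 - \sum_i (Br j i x)%:C * psi x i 0
                    - 'i%C * (-1) ^+ j * chi x j 0)].
Proof.
move=> cc [psi1 [psi2 [hH2 hae]]].
exists (fun j x => psi1 x j 0) => j.
have [[a1 a2 a3 a4 a5] [b1 b2 b3 b4 b5]] := hH2 j.
have dp i x : cder (fun x => psi x i 0) x (psi1 x i 0).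
  by have [[_ _ _ h1 _] [_ _ _ h2 _]] := hH2 i; split.
pose f x := nusq omega s lambda j * psi x j 0 - \sum_i (Br j i x)%:C * psi x i 0
                    - 'i%C * (-1) ^+ j * chi x j 0.
have cf : ccts f.
  apply: cctsB; last exact: cctsZ.
  apply: cctsB; first by apply: cctsZ; exact: cder_ccts (dp j).
  by apply: ccts_sum => i; apply: cctsM; [apply: cctsR | exact: cder_ccts (dp i)].
have hf : {ae leb, forall x, psi2 x j 0 = f x}.
  apply: (@filterS _ _ (ae_filter_ringOfSetsType leb) _ _ _ hae) => x.
  move/(field_graph lambda _ _ _ (hB x)) => /(_ j) ->; rewrite /f; congr (_ - _ * _).
  by rewrite !mxE; ring.
split=> // x; split=> //; split.
- apply: (weak_der a3 a5 _ cf.1).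
  by apply: (@filterS _ _ (ae_filter_ringOfSetsType leb) _ _ _ hf) => y ->.
- apply: (weak_der b3 b5 _ cf.2).
  by apply: (@filterS _ _ (ae_filter_ringOfSetsType leb) _ _ _ hf) => y ->.
Qed.

Lemma decaying_eigenvector lambda (p q : idx -> R -> C) (K a Kb : R) : 0 < a ->
  (forall i l x, `|Br i l x| <= Kb) ->
  msol (nusq omega s lambda) Br p q ->
  (forall j x, cn (p j x) <= K * expR (- a * `|x|) /\ cn (q j x) <= K * expR (- a * `|x|)) ->
  (exists j x, p j x != 0) ->
  L_eigenvector omega s B lambda (fun x => \col_j p j x).
Proof.
move=> a0 hKb hs hpq [j0 [x0 px0]]; split.
  by exists x0; apply: contra_neq px0 => /matrixP /(_ j0 0); rewrite !mxE.
pose r j x := nusq omega s lambda j * p j x - \sum_i (Br j i x)%:C * p i x.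
exists (fun x => \col_j q j x), (fun x => \col_j r j x); split; last first.
  apply: nearW => x; apply/(field_graph lambda _ _ _ (hB x)) => j.
  rewrite !mxE subrr mulr0 subr0 /r; congr (_ - _).
  by apply: eq_bigr => i _; rewrite mxE.
have K0 : 0 <= K.
  have [h _] := hpq j0 0; have := le_trans (cn_ge0 _) h.
  by rewrite normr0 mulr0 expR0 mulr1.
have Kb0 : 0 <= Kb by apply: le_trans (hKb j0 j0 0); exact: normr_ge0.
have cp j : ccts (p j) by apply: (cder_ccts (df := q j)) => x; case: (hs j x).
have cr j : ccts (r j).
  apply: cctsB; first exact: cctsZ.
  by apply: ccts_sum => i; apply: cctsM => //; apply: cctsR.
move=> j; pose n := cn (nusq omega s lambda j).
pose K' := (1 + n + 4 * Kb) * K.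
have n0 : 0 <= n := cn_ge0 _.
have KK : K <= K' by rewrite /K' ler_peMl //; lra.
have bp x : cn (p j x) <= K' * expR (- a * `|x|).
  by have [h _] := hpq j x; apply: le_trans h _; rewrite ler_wpM2r ?expR_ge0.
have bq x : cn (q j x) <= K' * expR (- a * `|x|).
  by have [_ h] := hpq j x; apply: le_trans h _; rewrite ler_wpM2r ?expR_ge0.
have br x : cn (r j x) <= K' * expR (- a * `|x|).
  set E := expR _; have E0 : 0 <= E := expR_ge0 _.
  have h1 : cn (nusq omega s lambda j * p j x) <= n * (K * E).
    by rewrite cnM ler_wpM2l //; case: (hpq j x).
  have h2 : cn (\sum_i (Br j i x)%:C * p i x) <= 4 * (Kb * (K * E)).
    apply: le_trans (cn_sum _ _ _) _.
    have h i : cn ((Br j i x)%:C * p i x) <= Kb * (K * E).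
      by rewrite cnM cnR; apply: ler_pM => //; [exact: cn_ge0 | case: (hpq i x)].
    apply: le_trans (ler_sum _ (fun i _ => h i)) _.
    by rewrite sumr_const card_ord mulr_natl.
  apply: le_trans (cnB _ _) _; have KE : 0 <= K * E by rewrite mulr_ge0.
  by rewrite /K'; have := lerD h1 h2; lra.
have ep (f : idx -> R -> C) (g : C -> R) :
    (fun x => g ((\col_i f i x : 'cV[C]_(2 + 2)) j 0)) = fun x => g (f j x).
  by apply/funext => x; rewrite mxE.
split; rewrite !ep; apply: (@H2_classical _ _ _ _ K' a a0).
- by move=> x; have [[h _] _] := hs j x.
- by move=> x; have [_ [h _]] := hs j x.
- exact: (cr j).1.
- by move=> x; split; apply: le_trans (Re_le _) _; [exact: bp | exact: bq | exact: br].
- by move=> x; have [[_ h] _] := hs j x.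
- by move=> x; have [_ [_ h]] := hs j x.
- exact: (cr j).2.
- by move=> x; split; apply: le_trans (Im_le _) _; [exact: bp | exact: bq | exact: br].
Qed.

End OperatorGraph.

Section SquarePrimitive.
Context {R : realType}.
Local Notation C := R[i].

(* A substitute for square integrability that is stable under x |-> - x without a change of
   variables in the integral. *)
Definition sqprim (f : R -> C) : Prop := exists (G : R -> R) (M : R),
  (forall x, der G x (cn (f x) ^+ 2)) /\ forall x, `|G x| <= M.

Lemma L2c_sqprim (f : R -> C) : ccts f -> L2c f -> sqprim f.
Proof.
move=> [c1 c2] [l1 l2].
have [G1 [M1 [d1 b1]]] := L2_primitive c1 l1; have [G2 [M2 [d2 b2]]] := L2_primitive c2 l2.
exists (fun x => G1 x + G2 x), (M1 + M2); split=> x.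
  by rewrite cn_sqr; exact: derD.
by apply: le_trans (ler_normD _ _) _; exact: lerD.
Qed.

Lemma sqprim_refl (f : R -> C) : sqprim f -> sqprim (fun x => f (- x)).
Proof.
move=> [G [M [dG bG]]]; exists (fun x => - G (- x)), M; split=> x; last by rewrite normrN.
by apply: der_eq (derN (der_opp (dG (- x)))) _; rewrite opprK.
Qed.

Lemma sqprimN (f : R -> C) : sqprim f -> sqprim (fun x => - f x).
Proof. by move=> [G [M [dG bG]]]; exists G, M; split=> // x; rewrite cnN. Qed.

Lemma sqprim_sum (p : idx -> R -> C) : (forall j, sqprim (p j)) ->
  exists (G : R -> R) (M : R), (forall x, der G x (\sum_j cn (p j x) ^+ 2)) /\ forall x, `|G x| <= M.
Proof.
move=> hp; have /choice [G hG] := hp; have /choice [M hM] := hG.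
exists (fun x => \sum_j G j x), (\sum_j M j); split=> x.
  by apply: (@rder_sum _ _ _ (fun j t => G j t)) => j; have [h _] := hM j; exact: h.
by apply: le_trans (ler_norm_sum _ _ _) _; apply: ler_sum => j _; have [_ h] := hM j; exact: h.
Qed.

Lemma sqprimZ (c : C) (f : R -> C) : sqprim f -> sqprim (fun x => c * f x).
Proof.
move=> [G [M [dG bG]]]; exists (fun x => cn c ^+ 2 * G x), (cn c ^+ 2 * M); split=> x.
  by rewrite cnM exprMn; exact: derZ.
by rewrite normrM ger0_norm ?sqr_ge0 // ler_wpM2l ?sqr_ge0.
Qed.

(* A bounded primitive forces the integrand to be small arbitrarily far out. *)
Lemma sqprim_small (p q : idx -> R -> C) (e X : R) : (forall j, sqprim (p j)) ->
  (forall j, sqprim (q j)) -> 0 < e ->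
  exists2 x, X <= x & forall j, cn (p j x) <= e /\ cn (q j x) <= e.
Proof.
move=> hp hq e0; have [G [M [dG bG]]] := sqprim_sum hp; have [G' [M' [dG' bG']]] := sqprim_sum hq.
pose N x := \sum_j cn (p j x) ^+ 2 + \sum_j cn (q j x) ^+ 2.
have [[x Xx xs]|hn] := pselect (exists2 x, X <= x & N x <= e ^+ 2).
  exists x => // j.
  have s0 (f : idx -> R -> C) : 0 <= \sum_j cn (f j x) ^+ 2 by apply: sumr_ge0 => i _; exact: sqr_ge0.
  have le1 (f : idx -> R -> C) : cn (f j x) ^+ 2 <= \sum_j cn (f j x) ^+ 2.
    by rewrite (bigD1 j) //= lerDl; apply: sumr_ge0 => i _; exact: sqr_ge0.
  have fin (z : C) : cn z ^+ 2 <= e ^+ 2 -> cn z <= e.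
    by rewrite ler_pXn2r // ?nnegrE ?cn_ge0 // ltW.
  have := s0 p; have := s0 q; have := le1 p; have := le1 q; move: xs; rewrite /N => h1 h2 h3 h4 h5.
  by split; apply: fin; lra.
have big x : X <= x -> e ^+ 2 <= N x.
  move=> Xx; rewrite leNgt; apply/negP => h; apply: hn; exists x => //; exact: ltW.
have ee : 0 < e ^+ 2 by rewrite exprn_gt0.
pose T := (2 * (M + M') + 1) / e ^+ 2.
have M0 : 0 <= M by apply: le_trans (bG 0); exact: normr_ge0.
have M'0 : 0 <= M' by apply: le_trans (bG' 0); exact: normr_ge0.
have T0 : 0 <= T by apply: divr_ge0; [lra | exact: ltW].
have XT : X <= X + T by lra.
have := @der_incr _ (fun x => G x + G' x - e ^+ 2 * x) (fun x => N x - e ^+ 2 * 1) X (X + T) XT.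
have h1 x : X <= x <= X + T -> der (fun x => G x + G' x - e ^+ 2 * x) x (N x - e ^+ 2 * 1).
  by move=> _; apply: derB; [exact: derD | apply: derZ; exact: der_id].
have h2 x : X <= x <= X + T -> 0 <= N x - e ^+ 2 * 1.
  by move=> /andP[/big + _]; rewrite mulr1; lra.
move=> /(_ h1 h2).
have eT : e ^+ 2 * T = 2 * (M + M') + 1 by rewrite /T mulrC divfK // gt_eqF.
rewrite mulrDr eT.
have := bG X; have := bG (X + T); have := bG' X; have := bG' (X + T); rewrite !ler_norml.
move=> /andP[a1 a2] /andP[a3 a4] /andP[a5 a6] /andP[a7 a8] h.
by exfalso; clear -a1 a2 a3 a4 a5 a6 a7 a8 h; lra.
Qed.

Section Wronskian.
Variables (c : @consts R) (B : idx -> idx -> R -> R).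
Hypotheses (gc : good_consts c) (pB : pot c B) (sB : symB B).

Lemma Cpsi_ge0 : 0 <= Cpsi c.
Proof.
have [[_ _ _ _ a0] _ _ _ _] := gc.
have [h _] := @psi_bound _ c gc 0 B 0 0 0 ltac:(by rewrite cn0 ltW) pB (lexx 0).
by apply: le_trans (cn_ge0 _) _; move: h; rewrite mulr0 expR0 mulr1; apply.
Qed.

Lemma wron_small (g : C) (p q : idx -> R -> C) l (x e : R) : cn g <= ca c -> 0 <= complex.Re g ->
  0 <= x -> (forall j, cn (p j x) <= e /\ cn (q j x) <= e) ->
  cn (wron p q (psi c g B l) (psi1 c g B l) x) <= 8 * Cpsi c * e.
Proof.
move=> ga g0 x0 h; have C0 := Cpsi_ge0.
have pb j : cn (psi c g B l j x) <= Cpsi c /\ cn (psi1 c g B l j x) <= Cpsi c.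
  have [h1 h2] := psi_bound gc l j ga pB x0.
  have e1 : expR (- complex.Re g * x) <= 1 by rewrite -expR0 ler_expR mulNr oppr_le0 mulr_ge0.
  by split; [apply: le_trans h1 _ | apply: le_trans h2 _]; rewrite ler_piMr.
have e0 : 0 <= e by have [h1 _] := h 0; apply: le_trans h1; exact: cn_ge0.
apply: le_trans (cn_sum _ _ _) _.
have hj j : cn (p j x * psi1 c g B l j x - q j x * psi c g B l j x) <= 2 * Cpsi c * e.
  apply: le_trans (cnB _ _) _; rewrite (cnM (p j x)) (cnM (q j x)).
  have [h1 h2] := h j; have [h3 h4] := pb j.
  have := ler_pM (cn_ge0 _) (cn_ge0 _) h1 h4; have := ler_pM (cn_ge0 _) (cn_ge0 _) h2 h3.
  by move=> i1 i2; apply: le_trans (lerD i2 i1) _; lra.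
apply: le_trans (ler_sum _ (fun j _ => hj j)) _.
by rewrite sumr_const card_ord -mulr_natl; lra.
Qed.

(** The Wronskian is constant, so it can be evaluated at the points supplied by [sqprim_small],
    where [p] and [q] are small while [psi] is bounded. *)
Lemma wron_sq0 (g : C) (p q : idx -> R -> C) l : cn g <= ca c -> 0 <= complex.Re g ->
  msol (nng c g) B p q -> (forall j, sqprim (p j)) -> (forall j, sqprim (q j)) ->
  wron p q (psi c g B l) (psi1 c g B l) 0 = 0.
Proof.
move=> ga g0 hm hp hq; apply/eqP; rewrite -cn_le0; have C0 := Cpsi_ge0.
apply: (@small_le0 _ _ (8 * Cpsi c + 1)); first by lra.
move=> e e0; have [x x0 hx] := sqprim_small 0 hp hq e0.
rewrite (@wron_const _ (nng c g) B p q _ _ 0 x sB hm (psi_msol gc l ga pB)).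
by apply: le_trans (wron_small l ga g0 x0 hx) _; rewrite ler_wpM2r ?(ltW e0) //; lra.
Qed.

(** With a forcing [h] the Wronskian has derivative - sum h psi, and it still tends to 0 along the
    points of [sqprim_small]. The bound Re g >= a > 0 gives exponential decay of [psi], hence an
    integrable majorant proportional to [ep]. *)
Lemma wron_sq_est (a : R) (P : idx -> R -> C) : 0 < a -> (forall j, sqprim (P j)) ->
  exists2 K : R, 0 <= K & forall (g : C) (p q h : idx -> R -> C) (ep : R) l,
   cn g <= ca c -> a <= complex.Re g -> 0 <= ep ->
   (forall j x, cder (p j) x (q j x) /\
      cder (q j) x (nng c g j * p j x - \sum_i (B j i x)%:C * p i x + h j x)) ->
   (forall j x, cn (h j x) <= ep * cn (P j x)) ->
   (forall j, sqprim (p j)) -> (forall j, sqprim (q j)) ->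
   cn (wron p q (psi c g B l) (psi1 c g B l) 0) <= ep * K.
Proof.
move=> a0 hP; have [G [M [dG bG]]] := sqprim_sum hP; have C0 := Cpsi_ge0.
(* Bounded primitive of the majorant: |P| e^{-ax} <= |P|^2 + e^{-2ax}, summed over the four
   components. *)
pose V x := Cpsi c * (G x - 4 / (2 * a) * expR (- (2 * a) * x)).
pose dV x := Cpsi c * (\sum_j cn (P j x) ^+ 2 + 4 * expR (- (2 * a) * x)).
have hV x : der V x (dV x).
  apply: der_eq (derZ _ (derB (dG x) (derZ _ (der_exp (derZ (- (2 * a)) (der_id x)))))) _.
  by rewrite /dV; congr (_ * _); field; rewrite gt_eqF.
have M0 : 0 <= M by apply: le_trans (bG 0); exact: normr_ge0.
have a20 : 0 <= 4 / (2 * a) by rewrite divr_ge0 // mulr_ge0 // ltW.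
exists (2 * (Cpsi c * (2 * M + 4 / (2 * a)))).
  by rewrite mulr_ge0 // mulr_ge0 // addr_ge0 // mulr_ge0.
move=> g p q h ep l ga ag ep0 hpq hh hp hq.
have g0 : 0 <= complex.Re g by apply: le_trans ag; exact: ltW.
set W := wron p q _ _.
have dW x : cder W x (\sum_j (- (h j x * psi c g B l j x))).
  have hs := psi_msol gc l ga pB.
  apply: cder_eq (cder_wron (hpq^~ x) (hs^~ x)) _.
  have E : \sum_j (p j x * (\sum_i (B j i x)%:C * psi c g B l i x)) =
     \sum_j ((\sum_i (B j i x)%:C * p i x) * psi c g B l j x).
    exact: (symB_sum (fun j => p j x) (fun j => psi c g B l j x) x sB).
  rewrite (eq_bigr (fun j => ((\sum_i (B j i x)%:C * p i x) * psi c g B l j x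
     - p j x * (\sum_i (B j i x)%:C * psi c g B l i x)) - h j x * psi c g B l j x)); last by move=> j _; ring.
  by rewrite sumrB sumrB E subrr sub0r sumrN.
have dWb x : 0 <= x -> cn (\sum_j (- (h j x * psi c g B l j x))) <= ep * dV x.
  move=> x0; apply: le_trans (cn_sum _ _ _) _.
  set E := expR (- a * x).
  have EE : expR (- (2 * a) * x) = E ^+ 2 by rewrite expr2 -expRD; congr expR; ring.
  have hj j : cn (- (h j x * psi c g B l j x)) <= ep * (Cpsi c * (cn (P j x) ^+ 2 + E ^+ 2)).
    rewrite cnN (cnM (h j x)).
    have [h1 _] := psi_bound gc l j ga pB x0.
    have h2 : cn (psi c g B l j x) <= Cpsi c * E.
      by apply: le_trans h1 _; rewrite ler_wpM2l // ler_expR !mulNr lerN2 ler_wpM2r.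
    apply: le_trans (ler_pM (cn_ge0 _) (cn_ge0 _) (hh j x) h2) _.
    have -> : ep * cn (P j x) * (Cpsi c * E) = ep * (Cpsi c * (cn (P j x) * E)) by ring.
    rewrite ler_wpM2l // ler_wpM2l //.
    have := sqr_ge0 (cn (P j x) - E); have := sqr_ge0 (cn (P j x)); have := sqr_ge0 E.
    by clear; nra.
  apply: le_trans (ler_sum _ (fun j _ => hj j)) _.
  rewrite -mulr_sumr -mulr_sumr big_split /= sumr_const card_ord /dV EE -[E ^+ 2 *+ _]mulr_natl.
  exact: lexx.
have step x : 0 <= x -> cn (W x - W 0) <= ep * (2 * (Cpsi c * (2 * M + 4 / (2 * a)))).
  move=> x0.
  have hd t : 0 <= t <= x -> der (fun t => ep * V t) t (ep * dV t) by move=> _; apply: derZ; exact: hV.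
  have hl t : 0 <= t <= x -> cn (\sum_j (- (h j t * psi c g B l j t))) <= ep * dV t.
    by move=> /andP[t0 _]; exact: dWb.
  apply: le_trans (cder_cmp x0 (fun t _ => dW t) hd hl) _.
  rewrite -mulrBr mulrCA ler_wpM2l // ler_wpM2l //.
  rewrite /V -mulrBr ler_wpM2l // mulr0 expR0 mulr1.
  have := bG x; have := bG 0; rewrite !ler_norml => /andP[b1 b2] /andP[b3 b4].
  have := mulr_ge0 a20 (expR_ge0 (- (2 * a) * x)).
  by clear -b1 b2 b3 b4; lra.
rewrite -subr_le0; apply: (@small_le0 _ _ (8 * Cpsi c + 1)); first by lra.
move=> e e0; have [x x0 hx] := sqprim_small 0 hp hq e0.
have h1 := wron_small l ga g0 x0 hx; have h2 := step x x0.
have h3 : cn (W 0) <= cn (W x) + cn (W x - W 0).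
  by rewrite cnC -[X in cn X <= _](subrK (W x)) addrC; exact: cnD.
by lra.
Qed.

End Wronskian.
End SquarePrimitive.

(** * Null vectors of the Evans matrix and eigenfunctions *)

Section CauchyData.
Context {R : realType}.
Local Notation C := R[i].
Implicit Types (p q : idx -> R -> C).

Definition data p q : 'cV[C]_((2 + 2) + (2 + 2)) := col_mx (\col_j p j 0) (\col_j q j 0).

Lemma data_eq0 p q : data p q = 0 -> forall j, p j 0 = 0 /\ q j 0 = 0.
Proof.
move=> h j; have /colP h' := h; split.
  by have := h' (lshift _ j); rewrite /data col_mxEu !mxE.
by have := h' (rshift _ j); rewrite /data col_mxEd !mxE.
Qed.

Definition Amat c g (B : idx -> idx -> R -> R) : 'M[C]_((2 + 2) + (2 + 2)) :=
  row_mx (flip (Hmat c g (Brefl B))) (Hmat c g B).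

Lemma wrM_data c g B p q l :
  wrM (data p q) (Hmat c g B) 0 l = wron p q (psi c g B l) (psi1 c g B l) 0.
Proof.
rewrite /wrM /data /Hmat /colm !col_mxKu !col_mxKd /wron !mxE -sumrB.
by apply: eq_bigr => j _; rewrite !mxE.
Qed.

Lemma wrM_data_flip c g B p q l :
  wrM (data p q) (flip (Hmat c g B)) 0 l =
  - wron (fun j x => p j (- x)) (fun j x => - q j (- x)) (psi c g B l) (psi1 c g B l) 0.
Proof.
rewrite /wrM /data /Hmat /colm /flip !col_mxKu !col_mxKd /wron !mxE -sumrB -sumrN.
by apply: eq_bigr => j _; rewrite !mxE oppr0; ring.
Qed.

Variables (omega s : R) (b : bool) (c : @consts R) (B : R -> 'M[C]_(2 + 2)) (Br : idx -> idx -> R -> R).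
Hypotheses (gc : good_consts c) (o0 : 0 < omega) (s0 : 0 < s)
  (hk : ckap c = kapb omega s b) (hs : csg c = sgb b)
  (hB : forall x i l, B x i l = (Br i l x)%:C)
  (pB : pot c Br) (pB' : pot c (Brefl Br)) (sB : symB Br).

Lemma nusq_nng g : nusq omega s (lambda_of omega s b g) = nng c g.
Proof. by apply/funext => j; rewrite nusqE /nng hk hs kapb_sqr. Qed.

Lemma pot_cts i l : continuous (Br i l).
Proof. by case: (pB i l). Qed.

Lemma symB_refl : symB (Brefl Br).
Proof. by move=> i j x; exact: sB. Qed.

Definition L2sol lambda p q := [/\ msol (nusq omega s lambda) Br p q,
  forall j, sqprim (p j) & forall j, sqprim (q j)].

Lemma eigenvector_L2sol lambda psi :
  lin_op omega s B psi (fun x => lambda *: psi x) ->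
  exists q, L2sol lambda (fun j x => psi x j 0) q.
Proof.
move=> h.
have [] := @lin_op_ode _ omega s B Br hB pot_cts lambda psi (fun=> 0).
- by move=> j; under eq_fun do rewrite mxE; exact: ccts_cst.
- by under eq_fun do rewrite addr0; exact: h.
move=> q hq; exists q; split=> [j x|j|j]; have [l1 l2 d] := hq j.
- have [d1 d2] := d x; split=> //; apply: cder_eq d2 _; by rewrite mxE mulr0 subr0.
- by apply: L2c_sqprim => //; apply: (cder_ccts (df := q j)) => x; case: (d x).
- apply: L2c_sqprim => //.
  by apply: cder_ccts => x; case: (d x) => _; exact.
Qed.

(** Vanishing Wronskians with both families say that the symplectic dual of the Cauchy data is a
    left null vector of the Evans matrix. This works up to Re g = 0, where [psi] is merely
    bounded. *)
Lemma L2sol_data g p q : cn g <= ca c -> 0 <= complex.Re g ->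
  L2sol (lambda_of omega s b g) p q -> wrK (data p q) *m Amat c g Br = 0.
Proof.
move=> ga g0 [hm hp hq]; rewrite nusq_nng in hm.
rewrite /Amat mul_mx_row !wrKE.
have -> : wrM (data p q) (Hmat c g Br) = 0.
  by apply/rowP => l; rewrite wrM_data (wron_sq0 gc pB sB l ga g0 hm hp hq) mxE.
have -> : wrM (data p q) (flip (Hmat c g (Brefl Br))) = 0.
  apply/rowP => l; rewrite wrM_data_flip.
  rewrite (wron_sq0 gc pB' symB_refl l ga g0 (msol_refl hm)) ?oppr0 ?mxE // => j.
    exact: sqprim_refl.
  by apply: sqprimN; exact: sqprim_refl.
exact: row_mx0.
Qed.

Lemma L2sol_neq0 lambda p q : L2sol lambda p q -> (exists j x, p j x != 0) -> wrK (data p q) != 0.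
Proof.
move=> [hm _ _] [j [x px]]; apply: contra_neq px => K0.
have d0 : data p q = 0.
  by have := @inj_mx_wrK _ _ 1 (data p q) 1%:M; rewrite K0 mulmx0 trmx1 mulmx1; apply.
by have [h _] := msol0 (pot_bndB pB) hm (fun j => (data_eq0 d0 j).1) (fun j => (data_eq0 d0 j).2) j x.
Qed.

Lemma eigenvalue_zero g : cn g <= ca c -> 0 <= complex.Re g ->
  L_eigenvalue omega s B (lambda_of omega s b g) -> Ehat c g Br = 0.
Proof.
move=> ga g0 [psi [[x px] hl]]; have [q hq] := eigenvector_L2sol hl.
have nz : exists j x, psi x j 0 != 0.
  apply: contrapT => h; move/negP: px; apply; apply/eqP/colP => j; rewrite mxE.
  by apply/eqP; apply: contrapT => /negP hj; apply: h; exists j, x.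
by apply/eqP/det0P; exists (wrK (data (fun j x => psi x j 0) q)); [exact: L2sol_neq0 hq nz | exact: L2sol_data hq].
Qed.

Lemma comb_bound g B' (t : idx -> C) : cn g <= ca c -> pot c B' -> exists2 K : R, 0 <= K &
  forall j x, 0 <= x -> cn (\sum_i t i * psi c g B' i j x) <= K * expR (- complex.Re g * x) /\
    cn (\sum_i t i * psi1 c g B' i j x) <= K * expR (- complex.Re g * x).
Proof.
move=> ga pB1; have C0 := Cpsi_ge0 gc pB.
exists (\sum_i cn (t i) * Cpsi c); first by apply: sumr_ge0 => i _; rewrite mulr_ge0 ?cn_ge0.
move=> j x x0; split; apply: le_trans (cn_sum _ _ _) _; rewrite mulr_suml; apply: ler_sum => i _;
  rewrite (cnM (t i)) -mulrA ler_wpM2l ?cn_ge0 //; by have [h1 h2] := psi_bound gc i j ga pB1 x0.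
Qed.

(* A kernel vector of the Evans matrix glues a combination of the solutions decaying at +oo
   with one of the solutions decaying at -oo. *)
Lemma zero_eigenvector (t : R) : 0 < t -> t < ca c -> Ehat c t%:C Br = 0 ->
  exists psi, L_eigenvector omega s B (lambda_of omega s b t%:C) psi.
Proof.
move=> t0 ta E0; set g : C := t%:C.
have ga : cn g <= ca c by rewrite cnR gtr0_norm // ltW.
have [v v0 hv] := det0_kernel E0.
pose al i := - usubmx v i 0; pose be i := dsubmx v i 0.
pose p j x := \sum_i be i * psi c g Br i j x.
pose q j x := \sum_i be i * psi1 c g Br i j x.
pose p' j x := \sum_i al i * psi c g (Brefl Br) i j (- x).
pose q' j x := \sum_i al i * - psi1 c g (Brefl Br) i j (- x).
have sp : msol (nng c g) Br p q by apply: msol_lin => i; exact: psi_msol.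
have BB : (fun i j x => Brefl Br i j (- x)) = Br.
  by apply/funext => i; apply/funext => j; apply/funext => x; rewrite /Brefl opprK.
have sp' : msol (nng c g) Br p' q'.
  by apply: msol_lin => i; have := msol_refl (psi_msol gc i ga pB'); rewrite BB.
have hv' : flip (Hmat c g (Brefl Br)) *m usubmx v + Hmat c g Br *m dsubmx v = 0.
  by rewrite -mul_row_col vsubmxK.
have e0 j : p j 0 = p' j 0.
  have /matrixP /(_ (lshift _ j) 0) := hv'.
  rewrite mxE [X in X + _ = _]mxE [X in _ + X = _]mxE [RHS]mxE addrC => /eqP.
  rewrite addr_eq0 => /eqP h; rewrite /p /p' oppr0.
  transitivity (\sum_i Hmat c g Br (lshift _ j) i * dsubmx v i 0).
    by apply: eq_bigr => i _; rewrite /Hmat /colm col_mxEu mxE mulrC.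
  rewrite h -sumrN; apply: eq_bigr => i _.
  by rewrite /flip /Hmat /colm col_mxKu col_mxEu mxE /al; ring.
have e1 j : q j 0 = q' j 0.
  have /matrixP /(_ (rshift _ j) 0) := hv'.
  rewrite mxE [X in X + _ = _]mxE [X in _ + X = _]mxE [RHS]mxE addrC => /eqP.
  rewrite addr_eq0 => /eqP h; rewrite /q /q' oppr0.
  transitivity (\sum_i Hmat c g Br (rshift _ j) i * dsubmx v i 0).
    by apply: eq_bigr => i _; rewrite /Hmat /colm col_mxEd mxE mulrC.
  rewrite h -sumrN; apply: eq_bigr => i _.
  have oppE (M : 'M[C]_(2 + 2)) k l : (- M) k l = - M k l by rewrite mxE.
  by rewrite /flip /Hmat /colm col_mxKd col_mxEd oppE mxE /al; ring.
have eqx j x : p j x = p' j x /\ q j x = q' j x.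
  have := msol0 (pot_bndB pB) (msolB sp sp') _ _ j x.
  move=> [] => [i|i|/eqP + /eqP]; rewrite ?e0 ?e1 ?subrr //.
  by rewrite !subr_eq0 => /eqP -> /eqP ->.
have [K1 K10 b1] := comb_bound be ga pB; have [K2 K20 b2] := comb_bound al ga pB'.
exists (fun x => \col_j p j x).
apply: (@decaying_eigenvector _ omega s B Br hB pot_cts _ p q (K1 + K2) t (cKb c) t0).
- by move=> i l x; case: (pB i l).
- by rewrite nusq_nng.
- move=> j x; have [x0|x0] := leP 0 x.
    have [h1 h2] := b1 j x x0; rewrite ger0_norm //.
    by split; [apply: le_trans h1 _ | apply: le_trans h2 _]; rewrite ler_wpM2r ?expR_ge0 // lerDl.
  have x0' : 0 <= - x by rewrite oppr_ge0 ltW.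
  have [h1 h2] := b2 j _ x0'; have [-> ->] := eqx j x; rewrite ltr0_norm //.
  split; first by apply: le_trans h1 _; rewrite ler_wpM2r ?expR_ge0 // lerDr.
  rewrite /q'; under eq_bigr do rewrite mulrN; rewrite sumrN cnN.
  by apply: le_trans h2 _; rewrite ler_wpM2r ?expR_ge0 // lerDr.
apply: contrapT => hn.
have z j x : p j x = 0 by apply/eqP; apply: contrapT => /negP h; apply: hn; exists j, x.
have be0 := psi_indep gc ga pB z.
have z' j x : \sum_i al i * psi c g (Brefl Br) i j x = 0.
  by have [h _] := eqx j (- x); move: h; rewrite z /p' opprK.
have al0 := psi_indep gc ga pB' z'.
move/negP: v0; apply; rewrite -[v]vsubmxK; apply/eqP/matrixP => i k; rewrite ord1.
have [j ->|j ->] := split_ordP i; rewrite ?col_mxEu ?col_mxEd [RHS]mxE; last exact: be0.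
by have /eqP := al0 j; rewrite oppr_eq0 => /eqP.
Qed.

End CauchyData.

(** * Algebraic simplicity *)

Section Simplicity.
Context {R : realType}.
Local Notation C := R[i].

Lemma fin_unif (I : finType) (P : I -> R -> R -> Prop) :
  (forall i, exists r K : R, 0 < r /\ P i r K) ->
  (forall i (r r' K K' : R), 0 < r' <= r -> K <= K' -> P i r K -> P i r' K') ->
  exists r K : R, 0 < r /\ forall i, P i r K.
Proof.
move=> h mono; have /choice [r hr] := h; have /choice [K hK] := hr.
have S0 (i : I) : 0 <= (r i)^-1 by have [h1 _] := hK i; rewrite invr_ge0 ltW.
have T0 : 0 < 1 + \sum_i (r i)^-1 by rewrite ltr_wpDr // sumr_ge0.
exists (1 + \sum_i (r i)^-1)^-1, (\sum_i `|K i|); split; first by rewrite invr_gt0.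
move=> i; have [ri Pi] := hK i; apply: mono Pi.
  rewrite invr_gt0 T0 /= -[leRHS]invrK lef_pV2 ?posrE ?invr_gt0 //.
  by rewrite (bigD1 i) //= addrCA lerDl addr_ge0 // sumr_ge0.
apply: le_trans (ler_norm _) _; rewrite (bigD1 i) //= lerDl.
by apply: sumr_ge0 => j _; exact: normr_ge0.
Qed.

Lemma taylor_lip (I : finType) (f : I -> C -> C) (z0 : C) : (forall i, taylor_at (f i) z0) ->
  exists r K : R, 0 < r /\ forall i z, cn (z - z0) < r -> cn (f i z - f i z0) <= K * cn (z - z0).
Proof.
move=> hf; apply: (@fin_unif _ (fun i r K => forall z, cn (z - z0) < r -> cn (f i z - f i z0) <= K * cn (z - z0))).
  by move=> i; have [r [K [_ [r0 _ h _]]]] := taylor_expand (hf i); exists r, K.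
move=> i r r' K K' /andP[_ rr] KK h z zr; apply: le_trans (h z (lt_le_trans zr rr)) _.
by rewrite ler_wpM2r ?cn_ge0.
Qed.

Lemma taylor_lip0 (I : finType) (f : I -> C -> C) (z0 : C) : (forall i, taylor_at (f i) z0) ->
  (forall i, f i z0 = 0) ->
  exists r K : R, 0 < r /\ forall i z, cn (z - z0) < r -> cn (f i z) <= K * cn (z - z0).
Proof.
move=> hf h0; have [r [K [r0 h]]] := taylor_lip hf; exists r, K; split=> // i z zr.
by have := h i z zr; rewrite h0 subr0.
Qed.

Lemma taylor_bdd (I : finType) (f : I -> C -> C) (z0 : C) : (forall i, taylor_at (f i) z0) ->
  exists r K : R, [/\ 0 < r, 0 <= K & forall i z, cn (z - z0) < r -> cn (f i z) <= K].
Proof.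
move=> hf; have [r [K [r0 h]]] := taylor_lip hf.
have S0 : 0 <= \sum_i cn (f i z0) by apply: sumr_ge0 => i _; exact: cn_ge0.
exists r, (\sum_i cn (f i z0) + `|K| * r); split=> //; first by rewrite addr_ge0 // mulr_ge0 // ltW.
move=> i z zr; rewrite -[f i z](subrK (f i z0)) addrC; apply: le_trans (cnD _ _) _.
apply: lerD; first by rewrite (bigD1 i) //= lerDl; apply: sumr_ge0 => l _; exact: cn_ge0.
apply: le_trans (h i z zr) _; apply: le_trans (ler_wpM2r (cn_ge0 _) (ler_norm K)) _.
by rewrite ler_wpM2l // ltW.
Qed.

(** From u det A = (u A) adj A: the determinant is small when [u] is nearly a left null vector. *)
Lemma det_le (n : nat) (A : 'M[C]_n) (u : 'rV[C]_n) i (e1 e2 eta : R) :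
  (forall k, cn ((u *m A) 0 k) <= e1) -> (forall k, cn (\adj A k i) <= e2) ->
  eta <= cn (u 0 i) -> eta * cn (\det A) <= n%:R * (e1 * e2).
Proof.
move=> h1 h2 he.
have E : u 0 i * \det A = \sum_k (u *m A) 0 k * \adj A k i.
  transitivity ((u *m A *m \adj A) 0 i); last by rewrite mxE.
  by rewrite -mulmxA mul_mx_adj mul_mx_scalar mxE mulrC.
apply: (@le_trans _ _ (cn (u 0 i) * cn (\det A))); first by rewrite ler_wpM2r ?cn_ge0.
rewrite -cnM E; apply: le_trans (cn_sum _ _ _) _.
have hk k : cn ((u *m A) 0 k * \adj A k i) <= e1 * e2.
  by rewrite cnM; apply: ler_pM; rewrite ?cn_ge0.
apply: le_trans (ler_sum _ (fun k _ => hk k)) _.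
by rewrite sumr_const card_ord mulr_natl.
Qed.

(** A linear lower bound against a quadratic upper bound: the contradiction that ends both parts of
    the proof of simplicity. *)
Lemma quad_contra (f : R -> R) (d0 de r K : R) : 0 < d0 -> 0 < de -> 0 < r ->
  (forall h, 0 < h < de -> d0 * h <= f h) -> (forall h, 0 < h < r -> f h <= K * h ^+ 2) -> False.
Proof.
move=> d00 de0 r0 h1 h2.
have K1 : 0 < `|K| + 1 by rewrite ltr_wpDl.
pose m := Num.min (Num.min de r) (d0 / (`|K| + 1)).
have m0 : 0 < m by rewrite !lt_min de0 r0 divr_gt0.
have hm : m / 2 < m by rewrite ltr_pdivrMr // ltr_pMr // ltr1n.
have m20 : 0 < m / 2 by rewrite divr_gt0.
move: (hm); rewrite !lt_min => /andP[/andP[a1 a2]]; rewrite ltr_pdivlMr // => a3.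
have b1 := h1 (m / 2) ltac:(by rewrite m20). have b2 := h2 (m / 2) ltac:(by rewrite m20).
have kk : 0 <= `|K| + 1 - K by have := ler_norm K; lra.
have b3 : K * (m / 2) ^+ 2 <= (m / 2 * (`|K| + 1)) * (m / 2).
  by have := mulr_ge0 kk (sqr_ge0 (m / 2)); clear; lra.
have b4 : (m / 2 * (`|K| + 1)) * (m / 2) < d0 * (m / 2) by rewrite ltr_pM2r.
by move: b1 b2 b3 b4; clear; lra.
Qed.

(** Continuity provides a primitive of |f + g|^2, and |f + g|^2 <= 2 |f|^2 + 2 |g|^2 bounds its
    increments. *)
Lemma sqprimD (f g : R -> C) : ccts f -> ccts g -> sqprim f -> sqprim g -> sqprim (fun x => f x + g x).
Proof.
move=> cf cg [G [M [dG bG]]] [G' [M' [dG' bG']]].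
have [c1 c2] := cctsD cf cg.
have ch : continuous (fun x => cn (f x + g x) ^+ 2).
  have -> : (fun x => cn (f x + g x) ^+ 2) =
     fun x => complex.Re (f x + g x) * complex.Re (f x + g x) + complex.Im (f x + g x) * complex.Im (f x + g x).
    by apply/funext => x; rewrite cn_sqr !expr2.
  by move=> x; apply: cvgD; apply: cvgM; [exact: c1 | exact: c1 | exact: c2 | exact: c2].
have [H dH] := antider ch.
exists H, (`|H 0| + 4 * (M + M')); split=> // x.
have step a b : a <= b -> `|H b - H a| <= 4 * (M + M').
  move=> ab; apply: le_trans (_ : _ <= (2 * (G b + G' b)) - (2 * (G a + G' a))) _.
    apply: (der_cmp ab (fun t _ => dH t) (v := fun t => 2 * (G t + G' t))
      (dv := fun t => 2 * (cn (f t) ^+ 2 + cn (g t) ^+ 2))).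
      by move=> t _; apply: derZ; exact: derD.
    move=> t _; rewrite ger0_norm ?sqr_ge0 //.
    have h : cn (f t + g t) ^+ 2 <= (cn (f t) + cn (g t)) ^+ 2.
      by rewrite lerXn2r ?nnegrE ?addr_ge0 ?cn_ge0 // cnD.
    apply: le_trans h _; have := sqr_ge0 (cn (f t) - cn (g t)); clear; nra.
  have := bG a; have := bG b; have := bG' a; have := bG' b; rewrite !ler_norml.
  by move=> /andP[a1 a2] /andP[a3 a4] /andP[a5 a6] /andP[a7 a8]; clear -a1 a2 a3 a4 a5 a6 a7 a8; lra.
have -> : H x = H 0 + (H x - H 0) by ring.
apply: le_trans (ler_normD _ _) _; rewrite lerD2l.
by have [x0|/ltW x0] := leP 0 x; [exact: step | rewrite distrC; exact: step].
Qed.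

Lemma Amat_taylor c B g0 i j : good_consts c -> cn g0 < ca c -> pot c B -> pot c (Brefl B) ->
  taylor_at (fun g => Amat c g B i j : C) g0.
Proof.
move=> gc ga pB pB'; rewrite /Amat.
have [j0 ->|j0 ->] := split_ordP j; last first.
  by apply: taylor_ext (Hmat_taylor gc i j0 ga pB) => g; rewrite row_mxEr.
have [i0 ->|i0 ->] := split_ordP i.
  by apply: taylor_ext (Hmat_taylor gc (lshift _ i0) j0 ga pB') => g;
    rewrite row_mxEl /flip col_mxEu [RHS]mxE.
by apply: taylor_ext (taylorN (Hmat_taylor gc (rshift _ i0) j0 ga pB')) => g;
  rewrite row_mxEl /flip col_mxEd !mxE.
Qed.

Lemma adj_taylor c B g0 i j : good_consts c -> cn g0 < ca c -> pot c B -> pot c (Brefl B) ->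
  taylor_at (fun g => \adj (Amat c g B) i j : C) g0.
Proof.
move=> gc ga pB pB'.
apply: (@taylor_ext _ (fun g => (-1) ^+ (j + i) * \det (row' j (col' i (Amat c g B))))).
  by move=> g; rewrite [RHS]mxE.
apply: taylorM; first exact: taylor_cst.
apply: taylor_det => k l; apply: taylor_ext (Amat_taylor (lift j k) (lift i l) gc ga pB pB') => g.
by rewrite !mxE.
Qed.

Lemma nusq_diff (omega s : R) (l l' : C) j :
  nusq omega s l j = nusq omega s l' j - 'i%C * (-1) ^+ j * (l - l').
Proof.
rewrite /nusq; move: ('i%C : C) (omega%:C) (s%:C) => I o z.
have e2 : (-1) ^+ 2 = 1 :> C by rewrite sqrrN expr1n.
have e3 : (-1) ^+ 3 = -1 :> C by rewrite exprS e2 mulr1.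
by move: j; apply: idx_cases => j ->; rewrite ?expr0 ?expr1 ?e2 ?e3 /=; ring.
Qed.

Variables (omega s : R) (b : bool) (c : @consts R) (B : R -> 'M[C]_(2 + 2)) (Br : idx -> idx -> R -> R).
Hypotheses (gc : good_consts c) (o0 : 0 < omega) (s0 : 0 < s)
  (hk : ckap c = kapb omega s b) (hs : csg c = sgb b)
  (hB : forall x i l, B x i l = (Br i l x)%:C)
  (pB : pot c Br) (pB' : pot c (Brefl Br)) (sB : symB Br).
Variables (t d0 de : R).
Hypotheses (t0 : 0 < t) (ta : t < ca c) (d00 : 0 < d0) (de0 : 0 < de)
  (hlow : forall h : R, 0 < h < de -> d0 * h <= cn (Ehat c (t + h)%:C Br)).

Local Notation lam := (lambda_of omega s b t%:C).

Let tC : cn (t%:C : C) < ca c. Proof. by rewrite cnR gtr0_norm. Qed.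

Let tC' : 0 <= complex.Re (t%:C : C). Proof. exact: ltW. Qed.

Lemma cn_shift (h : R) : 0 < h -> cn ((t + h)%:C - t%:C : C) = h.
Proof. by move=> h0; rewrite rmorphD addrAC subrr add0r cnR gtr0_norm. Qed.

(** Proportional null vectors mean proportional solutions, by uniqueness of the Cauchy problem. Two
    independent ones would make the adjugate vanish at [t]; then u A and adj A are both O(h) at t +
    h, and [det_le] makes [Ehat] quadratically small, against [hlow]. *)
Lemma eigenspace_dim1 p q p' q' : L2sol omega s Br lam p q -> L2sol omega s Br lam p' q' ->
  (exists j x, p j x != 0) -> exists k : C, forall j x, p' j x = k * p j x.
Proof.
move=> h1 h2 nz; set u := wrK (data p q); set w := wrK (data p' q').
have uA : u *m Amat c t%:C Br = 0 := L2sol_data gc o0 s0 hk hs pB pB' sB (ltW tC) tC' h1.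
have wA : w *m Amat c t%:C Br = 0 := L2sol_data gc o0 s0 hk hs pB pB' sB (ltW tC) tC' h2.
have u0 : u != 0 := L2sol_neq0 pB h1 nz.
have [[k hk']|hn] := pselect (exists k, w = k *: u).
  exists k => j x; apply/eqP; rewrite -subr_eq0; apply/eqP.
  have [m1 _ _] := h1; have [m2 _ _] := h2.
  have mk : msol (nusq omega s lam) Br (fun j x => k * p j x) (fun j x => k * q j x).
    move=> i y; have [e1 e2] := m1 i y; split; first exact: cderZ.
    apply: cder_eq (cderZ k e2) _; rewrite mulrBr mulrCA mulr_sumr; congr (_ - _).
    by apply: eq_bigr => l _; rewrite mulrCA.
  have dk i : p' i 0 - k * p i 0 = 0 /\ q' i 0 - k * q i 0 = 0.
    have /rowP hw := hk'; split.
      have := hw (rshift _ i); rewrite [RHS]mxE /w /u /wrK !row_mxEr /data !col_mxKu !mxE => ->.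
      by rewrite subrr.
    have := hw (lshift _ i); rewrite [RHS]mxE /w /u /wrK !row_mxEl /data !col_mxKd !mxE => h.
    by rewrite -[q' i 0]opprK h mulrN opprK subrr.
  by have [e _] := msol0 (pot_bndB pB) (msolB m2 mk) (fun i => (dk i).1) (fun i => (dk i).2) j x.
exfalso.
have ind (x y : C) : x *: u + y *: w = 0 -> x = 0 /\ y = 0.
  have [->|y0] := eqVneq y 0.
    by rewrite scale0r addr0 => /eqP; rewrite scaler_eq0 (negbTE u0) orbF => /eqP.
  move=> h; exfalso; apply: hn; exists (- x / y); apply: (scalerI y0).
  by rewrite scalerA mulrCA divff // mulr1 scaleNr; apply/eqP; rewrite -addr_eq0 addrC h.
have adjz := adj0 uA wA ind.
have [i ui] : exists i, u 0 i != 0 by apply/rV0Pn.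
have [|k|r1 [K1 [r10 H1]]] := @taylor_lip0 _ (fun k z => (u *m Amat c z Br) 0 k) t%:C.
- move=> k; apply: taylor_ext (taylor_sum (index_enum 'I_(2 + 2 + (2 + 2)))
    (fun m => taylorM (taylor_cst (u 0 m) t%:C) (Amat_taylor m k gc tC pB pB'))) => z.
  by rewrite [RHS]mxE.
- by rewrite uA mxE.
have [|k|r2 [K2 [r20 H2]]] := @taylor_lip0 _ (fun k z => \adj (Amat c z Br) k i) t%:C.
- by move=> k; exact: adj_taylor.
- by rewrite adjz mxE.
have cu : 0 < cn (u 0 i) by rewrite cn_gt0.
apply: (@quad_contra (fun h => cn (Ehat c (t + h)%:C Br)) d0 de (Num.min r1 r2)
   ((2 + 2 + (2 + 2))%N%:R * (K1 * K2) / cn (u 0 i)) d00 de0 _ hlow).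
  by rewrite lt_min r10.
move=> h; rewrite lt_min => /and3P[h0 hr1 hr2].
move: (cn_shift h0); move: (t + h)%:C => z zE.
have e1 k : cn ((u *m Amat c z Br) 0 k) <= K1 * h by rewrite -zE; apply: H1; rewrite zE.
have e2 k : cn (\adj (Amat c z Br) k i) <= K2 * h by rewrite -zE; apply: H2; rewrite zE.
have := det_le e1 e2 (lexx (cn (u 0 i))).
rewrite -[\det _]/(Ehat c z Br) mulrC -ler_pdivlMr // => hd; apply: le_trans hd _.
by rewrite le_eqVlt; apply/orP; left; apply/eqP; ring.
Qed.

End Simplicity.

(** * Exclusion of generalized eigenfunctions *)

Section JordanChains.
Context {R : realType}.
Local Notation C := R[i].

Definition fsol nn (B : idx -> idx -> R -> R) (p q h : idx -> R -> C) := forall j x,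
  cder (p j) x (q j x) /\ cder (q j) x (nn j * p j x - \sum_i (B j i x)%:C * p i x + h j x).

Lemma fsol_refl nn B p q h : fsol nn B p q h ->
  fsol nn (Brefl B) (fun j x => p j (- x)) (fun j x => - q j (- x)) (fun j x => h j (- x)).
Proof.
move=> hs j x; have [h1 h2] := hs j (- x); split; first exact: cder_opp.
by apply: cder_eq (cderN (cder_opp h2)) _; rewrite opprK.
Qed.

Variables (omega s : R) (b : bool) (c : @consts R) (B : R -> 'M[C]_(2 + 2)) (Br : idx -> idx -> R -> R).
Hypotheses (gc : good_consts c) (o0 : 0 < omega) (s0 : 0 < s)
  (hk : ckap c = kapb omega s b) (hs : csg c = sgb b)
  (hB : forall x i l, B x i l = (Br i l x)%:C)
  (pB : pot c Br) (pB' : pot c (Brefl Br)) (sB : symB Br).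

(** Approximate version of [L2sol_data]: a forcing of relative size [ep] gives a left null vector up
    to O(ep), with a constant uniform in [g]. *)
Lemma wrK_est (a : R) (P : idx -> R -> C) : 0 < a -> (forall j, sqprim (P j)) ->
  exists2 K : R, 0 <= K & forall (g : C) (p q h : idx -> R -> C) (ep : R) k,
   cn g <= ca c -> a <= complex.Re g -> 0 <= ep -> fsol (nng c g) Br p q h ->
   (forall j x, cn (h j x) <= ep * cn (P j x)) ->
   (forall j, sqprim (p j)) -> (forall j, sqprim (q j)) ->
   cn ((wrK (data p q) *m Amat c g Br) 0 k) <= ep * K.
Proof.
move=> a0 hP; have [K1 K10 h1] := wron_sq_est gc pB sB a0 hP.
have [K2 K20 h2] := wron_sq_est gc pB' (symB_refl sB) a0 (fun j => sqprim_refl (hP j)).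
exists (K1 + K2); first exact: addr_ge0.
move=> g p q h ep k ga ag ep0 hf hh hp hq.
rewrite /Amat mul_mx_row !wrKE; have [l ->|l ->] := split_ordP k.
  rewrite row_mxEl wrM_data_flip cnN.
  apply: (@le_trans _ _ (ep * K2)); last by rewrite ler_wpM2l // lerDr.
  apply: (h2 g _ _ (fun j x => h j (- x)) ep l ga ag ep0 (fsol_refl hf)).
  - by move=> j x; exact: hh.
  - by move=> j; exact: sqprim_refl.
  - by move=> j; apply: sqprimN; exact: sqprim_refl.
rewrite row_mxEr wrM_data.
apply: (@le_trans _ _ (ep * K1)); last by rewrite ler_wpM2l // lerDl.
exact: (h1 g p q h ep l ga ag ep0 hf hh hp hq).
Qed.

Lemma wrK_dataD p q P Q (y : C) i :
  wrK (data (fun j x => p j x + y * P j x) (fun j x => q j x + y * Q j x)) 0 i =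
  wrK (data p q) 0 i + y * wrK (data P Q) 0 i.
Proof.
rewrite /wrK /data; have [j ->|j ->] := split_ordP i.
  by rewrite !row_mxEl !col_mxKd !mxE; ring.
by rewrite !row_mxEr !col_mxKu !mxE; ring.
Qed.

Lemma lambda_diff (z z' : C) :
  cn (lambda_of omega s b z - lambda_of omega s b z') <= cn (z - z') * (cn z + cn z').
Proof.
have -> : lambda_of omega s b z - lambda_of omega s b z' = - ((-1) ^+ b * 'i%C) * ((z - z') * (z + z')).
  by rewrite /lambda_of; ring.
have i1 : cn ('i%C : C) = 1 by rewrite /cn /= expr0n expr1n add0r sqrtr1.
have b1 : cn ((-1) ^+ b : C) = 1 by rewrite cnX cnN cn1 expr1n.
rewrite cnM cnN (cnM ((-1) ^+ b)) i1 b1 mulr1 mul1r (cnM (z - z')).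
by rewrite ler_wpM2l ?cn_ge0 // cnD.
Qed.

Variables (t d0 de : R).
Hypotheses (t0 : 0 < t) (ta : t < ca c) (d00 : 0 < d0) (de0 : 0 < de)
  (hlow : forall h : R, 0 < h < de -> d0 * h <= cn (Ehat c (t + h)%:C Br)).

Local Notation lam := (lambda_of omega s b t%:C).

(* With (L - lam) chi = k psi, the function psi + (lam(z) - lam) / k * chi solves the equation
   for lam(z) up to O(|z - t|^2), so that the Evans function would vanish to second order. *)
Lemma no_jordan (psi chi : R -> 'cV[C]_(2 + 2)) (k : C) : k != 0 ->
  L_eigenvector omega s B lam psi ->
  lin_op omega s B chi (fun x => lam *: chi x + k *: psi x) -> False.
Proof.
move=> k0 [[x0 px0] hpsi] hchi.
have cB := pot_cts pB.
have [q hq] := eigenvector_L2sol hB pB hpsi.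
pose p j x := psi x j 0.
have nz : exists j x, p j x != 0.
  apply: contrapT => h; move/negP: px0; apply; apply/eqP/colP => j; rewrite mxE.
  by apply/eqP; apply: contrapT => /negP hj; apply: h; exists j, x0.
have [mp sp sq] := hq.
have cp j : ccts (p j) by apply: (cder_ccts (df := q j)) => x; case: (mp j x).
have cq j : ccts (q j) by apply: cder_ccts => x; case: (mp j x) => _; exact.
have [|Q hQ] := @lin_op_ode _ omega s B Br hB cB lam chi (fun x => k *: psi x) _ hchi.
  by move=> j; under eq_fun do rewrite mxE; apply: cctsZ; exact: cp.
pose P j x := chi x j 0.
have cP j : ccts (P j) by apply: (cder_ccts (df := Q j)) => x; have [_ _ h] := hQ j; case: (h x).
have cQ j : ccts (Q j) by apply: cder_ccts => x; have [_ _ h] := hQ j; case: (h x) => _; exact.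
have sP j : sqprim (P j) by have [h _ _] := hQ j; exact: L2c_sqprim.
have sQ j : sqprim (Q j) by have [_ h _] := hQ j; exact: L2c_sqprim.
have [K1 K10 hK1] := wrK_est t0 sP.
set u0 := wrK (data p q); set u1 := wrK (data P Q).
have u00 : u0 != 0 := L2sol_neq0 pB hq nz.
have [i ui] : exists i, u0 0 i != 0 by apply/rV0Pn.
have tC : cn (t%:C : C) < ca c by rewrite cnR gtr0_norm.
have [r3 [K3 [r30 K30 H3]]] := @taylor_bdd _ _ (fun l z => \adj (Amat c z Br) l i) t%:C
  (fun l => adj_taylor l i gc tC pB pB').
(* This factor cancels the terms linear in lam(z) - lam; the residual [h] below is proportional to
   (lam(z) - lam) times [y z], hence quadratic in z - t. *)
pose y z := (lambda_of omega s b z - lam) / k.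
pose h z (j : idx) x := 'i%C * (-1) ^+ j * ((lambda_of omega s b z - lam) * y z) * P j x.
have hf z : fsol (nng c z) Br (fun j x => p j x + y z * P j x) (fun j x => q j x + y z * Q j x) (h z).
  move=> j x; have [m1 m2] := mp j x; have [_ _ hQj] := hQ j; have [m3 m4] := hQj x.
  split; first by apply: cderD => //; exact: cderZ.
  apply: cder_eq (cderD m2 (cderZ (y z) m4)) _.
  rewrite -(nusq_nng o0 s0 hk hs) (nusq_diff omega s (lambda_of omega s b z) lam j) mxE.
  rewrite -/(p j x) -/(P j x).
  have -> : \sum_l (Br j l x)%:C * (p l x + y z * P l x) =
     \sum_l (Br j l x)%:C * p l x + y z * \sum_l (Br j l x)%:C * P l x.
    by rewrite mulr_sumr -big_split /=; apply: eq_bigr => l _; ring.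
  have yk : y z * k = lambda_of omega s b z - lam by rewrite /y divfK.
  rewrite /h -yk; move: (\sum_l _) (\sum_l _) => S1 S2; move: (nusq _ _ _ _) => n.
  move: (y z) (p j x) (P j x) ('i%C * (-1) ^+ j) => Y PP PC I.
  ring.
have ck0 : 0 < cn k by rewrite cn_gt0.
have a0 : 0 < ca c := lt_trans t0 ta.
pose a2 := 2 * ca c / cn k.
have a20 : 0 < a2 by rewrite divr_gt0 // mulr_gt0.
pose eta := cn (u0 0 i) / 2.
have eta0 : 0 < eta by rewrite divr_gt0 // cn_gt0.
have v0 : 0 < a2 * (cn (u1 0 i) + 1) by rewrite mulr_gt0 // ltr_wpDl ?cn_ge0.
apply: (@quad_contra _ (fun h => cn (Ehat c (t + h)%:C Br)) d0 de
   (Num.min (Num.min r3 (ca c - t)) (eta / (a2 * (cn (u1 0 i) + 1))))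
   ((2 + 2 + (2 + 2))%N%:R * (2 * ca c * a2 * K1 * K3) / eta) d00 de0 _ hlow).
  by rewrite !lt_min r30 subr_gt0 ta divr_gt0.
move=> e; rewrite !lt_min => /andP[e0 /andP[/andP[er3 eca]]]; rewrite ltr_pdivlMr // => eeta.
have := cn_shift t e0; have zR : complex.Re ((t + e)%:C : C) = t + e by [].
have : cn ((t + e)%:C : C) <= ca c.
  by rewrite cnR gtr0_norm ?addr_gt0 // addrC -lerBrDr ltW.
move: zR; move: (t + e)%:C => z zR za zE.
have tz : t <= complex.Re z by rewrite zR lerDl ltW.
have dl : cn (lambda_of omega s b z - lam) <= e * (2 * ca c).
  apply: le_trans (lambda_diff _ _) _; rewrite zE ler_wpM2l ?(ltW e0) //.
  by rewrite mulr_natl mulr2n; exact: lerD za (ltW tC).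
have yb : cn (y z) <= a2 * e.
  rewrite /y cnM cnV ler_pdivrMr //; apply: le_trans dl _.
  by rewrite /a2 le_eqVlt; apply/orP; left; apply/eqP; field; rewrite gt_eqF.
set u := wrK (data (fun j x => p j x + y z * P j x) (fun j x => q j x + y z * Q j x)).
pose ep := cn ((lambda_of omega s b z - lam) * y z).
have epb : ep <= 2 * ca c * a2 * e ^+ 2.
  rewrite /ep cnM; apply: le_trans (ler_pM (cn_ge0 _) (cn_ge0 _) dl yb) _.
  by rewrite le_eqVlt; apply/orP; left; apply/eqP; ring.
have e1 l : cn ((u *m Amat c z Br) 0 l) <= 2 * ca c * a2 * e ^+ 2 * K1.
  apply: le_trans (hK1 z _ _ (h z) ep l za tz (cn_ge0 _) (hf z) _ _ _) _.
  - move=> j x; have i1 : cn ('i%C : C) = 1 by rewrite /cn /= expr0n expr1n add0r sqrtr1.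
    have b1 : cn ((-1) ^+ j : C) = 1 by rewrite cnX cnN cn1 expr1n.
    by rewrite /h (cnM (_ * _ * _)) (cnM ('i%C * _)) (cnM 'i%C) i1 b1 mulr1 mul1r.
  - move=> j; apply: sqprimD; [exact: cp | apply: cctsZ; exact: cP | exact: sp | apply: sqprimZ; exact: sP].
  - move=> j; apply: sqprimD; [exact: cq | apply: cctsZ; exact: cQ | exact: sq | apply: sqprimZ; exact: sQ].
  by rewrite ler_wpM2r.
have e2 l : cn (\adj (Amat c z Br) l i) <= K3 by apply: H3; rewrite zE.
(* [u] is a perturbation of the nonzero null vector [u0], so its chosen entry keeps at least half of
   its modulus. *)
have ub : eta <= cn (u 0 i).
  rewrite /u wrK_dataD -/u0 -/u1.
  have h1 : cn (u0 0 i) <= cn (u0 0 i + y z * u1 0 i) + cn (y z * u1 0 i).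
    by apply: le_trans (cnB _ _); rewrite addrK.
  have h2 : cn (y z * u1 0 i) <= eta.
    rewrite cnM; apply: le_trans (ltW eeta).
    have -> : e * (a2 * (cn (u1 0 i) + 1)) = (a2 * e) * (cn (u1 0 i) + 1) by ring.
    by apply: ler_pM; rewrite ?cn_ge0 // lerDl.
  by move: h1 h2; rewrite /eta; lra.
have := det_le e1 e2 ub.
rewrite -[\det _]/(Ehat c z Br) mulrC -ler_pdivlMr // => hd; apply: le_trans hd _.
by rewrite le_eqVlt; apply/orP; left; apply/eqP; ring.
Qed.

(** Induction along the chain: the image of [chi] under L - lambda is a multiple [k] of [psi]. A
    nonzero [k] contradicts [no_jordan], and [k = 0] puts [chi] in the one-dimensional
    eigenspace. *)
Lemma simple_eigenvalue : Ehat c t%:C Br = 0 -> simple_L_eigenvalue omega s B lam.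
Proof.
move=> E0; have [psi hpsi] := zero_eigenvector gc o0 s0 hk hs hB pB pB' t0 ta E0.
exists psi => //; elim=> [|n IH] chi /=.
  by move=> h; exists 0 => x; rewrite h scale0r.
move=> [chi' hchi /IH [k hk']].
have chiE : chi' = fun x => k *: psi x by apply/funext.
rewrite {}chiE in hchi.
have [k0|k0] := eqVneq k 0; last by case: (no_jordan k0 hpsi hchi).
have hchi0 : lin_op omega s B chi (fun x => lam *: chi x).
  by move: hchi; rewrite k0; under eq_fun do rewrite scale0r addr0.
have [[x0 px0] hp] := hpsi.
have [q1 h1] := eigenvector_L2sol hB pB hp; have [q2 h2] := eigenvector_L2sol hB pB hchi0.
have nz : exists j x, psi x j 0 != 0.
  apply: contrapT => h; move/negP: px0; apply; apply/eqP/colP => j; rewrite mxE.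
  by apply/eqP; apply: contrapT => /negP hj; apply: h; exists j, x0.
have [k' hk2] := eigenspace_dim1 gc o0 s0 hk hs pB pB' sB t0 ta d00 de0 hlow h1 h2 nz.
by exists k' => x; apply/colP => j; rewrite mxE hk2.
Qed.

End JordanChains.

Section Parametrization.
Context {R : realType}.
Local Notation C := R[i].
Variables (omega s : R) (b : bool).
Local Notation l0 := (lambda0 omega s b : C).

Lemma sgn_i_sqr : ((-1) ^+ b * 'i%C) * ((-1) ^+ b * 'i%C) = -1 :> C.
Proof. by rewrite mulrACA i_sqr -expr2 sqrr_sign mul1r. Qed.

Lemma cn_lambda (g : C) : cn (lambda_of omega s b g - l0) = cn g ^+ 2.
Proof.
have -> : lambda_of omega s b g - l0 = - (((-1) ^+ b * 'i%C) * g ^+ 2) by rewrite /lambda_of; ring.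
have i1 : cn ((-1) ^+ b * 'i%C : C) = 1.
  by rewrite cnM cnX cnN cn1 expr1n mul1r /cn /= expr0n expr1n add0r sqrtr1.
by rewrite cnN cnM i1 mul1r cnX.
Qed.

(** One of the two square roots lies in the closed right half-plane, where [eigenvalue_zero]
    applies. *)
Lemma lambda_param (l : C) : exists2 g : C, 0 <= complex.Re g & l = lambda_of omega s b g.
Proof.
pose z := ((-1) ^+ b * 'i%C) * (l - l0); pose w := sqrtC z.
have ww : w ^+ 2 = z by exact: sqrtCK.
have lE (g : C) : g ^+ 2 = z -> l = lambda_of omega s b g.
  move=> gz; have -> : lambda_of omega s b g = l0 - ((-1) ^+ b * 'i%C) * g ^+ 2 by rewrite /lambda_of; ring.
  by rewrite gz /z mulrA sgn_i_sqr; ring.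
have [w0|w0] := leP 0 (complex.Re w); first by exists w => //; exact: lE.
exists (- w); first by rewrite cReN oppr_ge0 ltW.
by apply: lE; rewrite sqrrN.
Qed.

Lemma lambda_of0 : lambda_of omega s b 0 = l0.
Proof. by rewrite /lambda_of expr0n !mulr0 subr0. Qed.

Lemma half_line_lambda (t : R) : t != 0 -> half_line omega s b (lambda_of omega s b t%:C).
Proof.
move=> t0; exists (t ^+ 2); first by rewrite /= lt_neqAle eq_sym sqrf_eq0 t0 sqr_ge0.
by rewrite /lambda_of rmorphXn.
Qed.

End Parametrization.

Theorem theorem2p8 (R : realType) (omega s : R) (F : R -> R -> R -> R)
    (U0 : R -> R -> R) (V1 phi11 phi12 : R -> R)
    (c : bool) (eps0 : R) (U V : R -> R -> R)
    (b : bool)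
    (rho : R) (N : set R[i]) (J : R[i] -> R -> 'M[R[i]]_((2 + 2) + (2 + 2)))
    (r0 : R) (Y : R -> R[i] -> R -> 'M[R[i]]_((2 + 2) + (2 + 2))) :
  let u0 := U0 omega in
  let m (e : R) := mubar F u0 V1 phi11 phi12 * e ^+ 2 in
  let B (e : R) := potential F (U e) (V e) (m e) in
  let eig (e : R) := L_eigenvalue omega s (B e) in
  let simple_eig (e : R) := simple_L_eigenvalue omega s (B e) in
  let res (e : R) := resonance_pole omega s (B e) b r0 (Y e) in
  let l0 := lambda0 omega s b in
  let ball0 := near_lambda0 omega s b in
  let segm (r : R) := half_line omega s b `&` ball0 r in
  0 < omega -> 0 < s ->
  nonlinearity F ->
  (\forall w \near omega, fundamental_wave F w (U0 w)) ->
  transverse_mode F s u0 V1 ->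
  fundamental_pair F omega u0 phi11 phi12 ->
  abar2 F u0 V1 != 0 -> bbar2 F u0 V1 phi11 phi12 != 0 ->
  derivable (fun w => sqnorm (U0 w)) omega 1 ->
  0 < derive1 (fun w => sqnorm (U0 w)) omega ->
  0 < eps0 ->
  bifurcated_branch F omega s u0 V1 phi11 phi12 c eps0 U V ->
  0 < rho -> (exists K : R, forall x, `|u0 x| <= K * expR (- rho * `|x|)) ->
  open (N : set R[i]^o) -> N l0 -> jost_family omega s rho (B 0) N J ->
  evans J l0 = 0 ->
  0 < r0 ->
  (forall e, 0 <= e < eps0 -> extended_jost_family omega s (B e) b r0 (Y e)) ->
  simple_zero (evans (Y 0)) 0 ->
  \forall r \near 0^'+, \forall e \near 0^'+,
    [\/ (exists l, [/\ segm r l, simple_eig e l &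
                       forall l', segm r l' -> eig e l' -> l' = l]) /\
        (forall l, ball0 r l -> ~ res e l),
        (exists l, [/\ segm r l, res e l &
                       forall l', segm r l' -> res e l' -> l' = l]) /\
        (forall l, ball0 r l -> ~ eig e l) |
        eig e l0 \/ res e l0].
Proof.
move=> u0 m B eig simple_eig res l0 ball0 segm o0 s0 hF hU0 hV1 _ _ _ _ _ ep0 hbr _ _ _ _ _ _ r00 hY hz.
have [U00 V00 hw [K hK]] := hbr.
have fw : fundamental_wave F omega (U 0) by rewrite U00; exact: nbhs_singleton hU0.
have [_ _ _ hM _] := hV1.
have hK' (e : R) : 0 < e < eps0 -> forall x,
    `|U e x - (U 0 x + e ^+ 2 * U2 F u0 V1 phi11 phi12 x)| <= K * e ^+ 4 /\
    `|V e x - (-1) ^+ c * (e * V1 x)| <= K * e ^+ 3.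
  by rewrite U00; exact: hK.
have [cc [r1 /andP[r10 r1a] [gc [hk hs] car0 hset]]] :=
  bifurcation_setup o0 s0 hF ep0 V00 fw hw hK' hM r00 hY hz.
(* Since |lambda - lambda0| = |gamma|^2, the disc of radius [r] in lambda is the disc of radius sqrt
   r in gamma, whence the requirement [r < r1 ^+ 2]. *)
near=> r.
have r_0 : 0 < r by near: r; exact: nbhs_right_gt.
have rr : r < r1 ^+ 2 by near: r; apply: nbhs_right_lt; rewrite exprn_gt0.
have q0 : 0 < Num.sqrt r by rewrite sqrtr_gt0.
have qq : Num.sqrt r ^+ 2 = r by rewrite sqr_sqrtr // ltW.
have q1 : Num.sqrt r < r1 by rewrite -(@ltr_pXn2r _ 2) ?nnegrE ?qq // ltW.
have qr1 : 0 < Num.sqrt r <= r1 by rewrite q0 ltW.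
have [e2 e20 he2] := hset _ qr1.
near=> e.
have e0 : 0 < e by near: e; exact: nbhs_right_gt.
have ee2 : e < e2 by near: e; exact: nbhs_right_lt.
have [|eeps [pB pB'] hev [t tr Et] [d0 d00 hd]] := he2 e; first by rewrite (ltW e0).
set Br := Bw F (U e) (V e) (mubar F u0 V1 phi11 phi12 * e ^+ 2) in pB pB' hev Et hd.
have sB : symB Br by exact: Bw_sym.
have hB x i l : B e x i l = (Br i l x)%:C by exact: potentialE.
have ct : cn (t%:C : R[i]) < r1 by rewrite cnR; exact: lt_trans tr q1.
have small g : cn g ^+ 2 < r -> cn g < r1.
  by rewrite -qq ltr_pXn2r ?nnegrE ?cn_ge0 ?(ltW q0) // => /lt_trans; apply.
have uniq g : cn g < r1 -> Ehat cc g Br = 0 -> g = t%:C.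
  move=> gr Eg; have := hd _ _ gr ct; rewrite Eg Et subrr cn0 => h.
  have : cn (g - t%:C) <= 0 by rewrite -(ler_pM2l d00) mulr0.
  by rewrite cn_le0 subr_eq0 => /eqP.
have ballE l : ball0 r l -> cn (l - l0) < r by rewrite /ball0 /near_lambda0 /= cn_lt.
pose lt := lambda_of omega s b t%:C.
(* An eigenvalue is written with Re g >= 0; its [g] is the unique zero, the real number [t], so t >=
   0. *)
have eigE l : ball0 r l -> eig e l -> l = lt /\ 0 <= t.
  move=> /ballE; have [g g0 ->] := lambda_param omega s b l.
  rewrite cn_lambda => /small gr hl.
  have ga : cn g <= ca cc by apply: ltW; exact: lt_le_trans gr r1a.
  have Eg := eigenvalue_zero gc o0 s0 hk hs hB pB pB' sB ga g0 hl.
  by move: g0; rewrite (uniq g gr Eg).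
(* Here Re g may have either sign, since the zeros of the given Evans function and of [Ehat] agree
   on the whole disc. *)
have resE l : ball0 r l -> res e l -> l = lt.
  move=> /ballE hb [[g [gr0 lE Eg]] _]; move: hb; rewrite lE cn_lambda => /small gr.
  have Eg' : Ehat cc g Br = 0 by apply/(hev g (lt_le_trans gr r1a)).
  by rewrite (uniq g gr Eg').
have ballt : ball0 r lt.
  rewrite /ball0 /near_lambda0 /= cn_lt cn_lambda cnR -qq.
  by rewrite ltr_pXn2r ?nnegrE ?(ltW q0).
have ta : cn (t%:C : R[i]) < ca cc by exact: lt_le_trans ct r1a.
have rest : ~ eig e lt -> res e lt.
  move=> ne; split=> //; exists t%:C; split=> //; last by apply/hev.
  by rewrite cn_lt; exact: lt_le_trans ta car0.
have segt : t != 0 -> segm r lt by move=> t0; split=> //; exact: half_line_lambda.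
have [tneg|tpos|tz] := ltgtP t 0.
- have ne l : ball0 r l -> ~ eig e l by move=> hb /(eigE l hb)[_]; rewrite leNgt tneg.
  apply: Or32; split=> //; exists lt; split; [by apply: segt; rewrite lt_eqF | exact: rest (ne _ ballt) |].
  by move=> l' [_ hb]; exact: resE.
- have simp : simple_eig e lt.
    have tca : t < ca cc by move: ta; rewrite cnR gtr0_norm.
    have tr1 : t < r1 by move: ct; rewrite cnR gtr0_norm.
    have de0 : 0 < r1 - t by rewrite subr_gt0.
    (* The linear lower bound required here is the divided-difference bound between [t] and
       [t + h]. *)
    apply: (simple_eigenvalue gc o0 s0 hk hs hB pB pB' sB tpos tca d00 de0 _ Et).
    move=> h /andP[h0 hr].
    have th : cn ((t + h)%:C : R[i]) < r1 by rewrite cnR gtr0_norm ?addr_gt0 // addrC -ltrBrDr.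
    by have := hd _ _ th ct; rewrite cn_shift // Et subr0.
  have eigt : eig e lt by case: simp => psi hpsi _; exists psi.
  apply: Or31; split; last by move=> l hb hl; case: (hl) => _; rewrite (resE l hb hl).
  exists lt; split=> //; first by apply: segt; rewrite gt_eqF.
  by move=> l' [_ hb] /(eigE l' hb)[].
- apply: Or33; have e0l : lt = l0 by rewrite /lt tz lambda_of0.
  rewrite -e0l; have [h|h] := pselect (eig e lt); [by left | right; exact: rest].
Unshelve. all: by end_near.
Qed.
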